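(* Let $n\ge2$, $\omega_0=(1,\bar\omega_0)\in\mathbb R^n$ with $\bar\omega_0\in[-1,1]^{n-1}$ non-resonant, and assume $\Delta^*=\Delta^*_{\omega_0}$ satisfies $\int_{\Delta(1)}^{+\infty}(x\Delta^*(x))^{-1}dx<\infty$. Let $r,s,h\in(0,1)$, $\varepsilon\ge0$, and let $H$ be bounded and real-analytic on $D_{r,s}\times O_h$ of the form $$H(I,\theta,\omega)=N(I,\omega)+P(I,\theta,\omega),\quad N(I,\omega)=e(\omega)+\omega\cdot I,\quad |P|_{r,s,h}\le\varepsilon.$$ Then there exist constants $0<c_1,c_2,c_3\le1$ and $c_4,c_5\ge1$ depending only on $n$ such that the following holds. If $$\varepsilon r^{-1}\le c_1h\le c_2\,(Q_0\Psi(Q_0))^{-1},$$ where $Q_0\ge1$ is large enough that $$Q_0^{-1}+(\ln 2)^{-1}\int_{\Delta(Q_0)}^{+\infty}\frac{dx}{x\Delta^*(x)}\le c_3 s,$$ then there exist a real-analytic torus embedding $\Phi_{\omega_0}:\mathbb T^n\to B\times\mathbb T^n$ and a vector $\tilde\omega\in\mathbb R^n$ such that $\Phi_{\omega_0}(\mathbb T^n)$ is invariant under the Hamiltonian flow of $H_{\tilde\omega}=H(\cdot,\cdot,\tilde\omega)$ and quasi-periodic with frequency $\omega_0$ (precisely, $X_{H_{\tilde\omega}}\circ\Phi_{\omega_0}=D\Phi_{\omega_0}\cdot\omega_0$). Moreover $\Phi_{\omega_0}$ extends real-analytically to $\mathbb T^n_{s/2}=\{\theta\in\mathbb C^n/\mathbb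 Z^n: |\mathrm{Im}\,\theta|<s/2\}$ and $$|W(\Phi_{\omega_0}-\Phi_0)|_{s/2}\le c_4\,\varepsilon(rh)^{-1},\qquad |\tilde\omega-\omega_0|\le c_5\,\varepsilon r^{-1},$$ where $W=\mathrm{Diag}(r^{-1}\mathrm{Id},Q_0^{-1}\mathrm{Id})$ and $\Phi_0(\theta)=(0,\theta)$.
   Context: $|\cdot|$ denotes the sup norm of vectors in $\mathbb C^n$; for functions, $|\cdot|_{\ldots}$ is the sup norm over the indicated domain (e.g. $|\cdot|_{s/2}$ over $\mathbb T^n_{s/2}$, for vector-valued maps the sup of the vector sup-norm; the angular component of $\Phi_{\omega_0}-\Phi_0$ is computed via lifts). $\mathbb T^n_{\mathbb C}=\mathbb C^n/\mathbb Z^n$, $D_{r,s}=\{I\in\mathbb C^n:|I|<r\}\times\{\theta\in\mathbb T^n_{\mathbb C}:|\mathrm{Im}\,\theta|<s\}$, $O_h=\{\omega\in\mathbb C^n:|\omega-\omega_0|<h\}$, $|P|_{r,s,h}=\sup_{D_{r,s}\times O_h}|P|$, $B=\{I\in\mathbb R^n:|I|<r\}$. Real-analytic means holomorphic and real-valued for real arguments. $X_G$ denotes the Hamiltonian vector field of $G$ (with $\dot I=-\partial_\theta G$, $\dot\theta=\partial_I G$). For $Q\ge1$, $\Psi(Q)=\Psi_{\omega_0}(Q)=\sup\{|k\cdot\omega_0|^{-1}: k\in\mathbb Z^n, 0<|k|_1\le Q\}$ with $|k|_1=\sum|k_i|$; $\Delta(Q)=Q\Psi(Q)$ for $Q\ge1$;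 and $\Delta^*(x)=\sup\{Q\ge1:\Delta(Q)\le x\}$ for $x\ge\Delta(1)$. Non-resonant means $k\cdot\omega_0=0$, $k\in\mathbb Z^n$, implies $k=0$. *)

(* Defs.v *)
From Stdlib Require Import Reals Lra List Arith ZArith ClassicalEpsilon.
Open Scope R_scope.

Definition Idx (n : nat) := {i : nat | (i < n)%nat}.

Definition Cpx := (R * R)%type.
Definition RtoC (x : R) : Cpx := (x, 0).
Definition Re (z : Cpx) : R := fst z.
Definition Im (z : Cpx) : R := snd z.
Definition Cadd (z w : Cpx) : Cpx := (fst z + fst w, snd z + snd w).
Definition Copp (z : Cpx) : Cpx := (- fst z, - snd z).
Definition Csub (z w : Cpx) : Cpx := Cadd z (Copp w).
Definition Cmul (z w : Cpx) : Cpx :=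
  (fst z * fst w - snd z * snd w, fst z * snd w + snd z * fst w).
Definition Cmod (z : Cpx) : R := sqrt (fst z ^ 2 + snd z ^ 2).
Definition Cinv (z : Cpx) : Cpx :=
  (fst z / (fst z ^ 2 + snd z ^ 2), - snd z / (fst z ^ 2 + snd z ^ 2)).
Definition Cdiv (z w : Cpx) : Cpx := Cmul z (Cinv w).

Definition CV (n : nat) := Idx n -> Cpx.
Definition RV (n : nat) := Idx n -> R.
Definition vC {n} (v : RV n) : CV n := fun i => RtoC (v i).
Definition vadd {n} (u v : CV n) : CV n := fun i => Cadd (u i) (v i).
Definition vsub {n} (u v : CV n) : CV n := fun i => Csub (u i) (v i).
Definition vscal {n} (t : Cpx) (v : CV n) : CV n := fun i => Cmul t (v i).
Definition upd {n} (v : CV n) (j : Idx n) (t : Cpx) : CV n :=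
  fun i => if Nat.eq_dec (proj1_sig i) (proj1_sig j) then t else v i.
Definition unitv {n} (j : Idx n) : CV n :=
  fun i => if Nat.eq_dec (proj1_sig i) (proj1_sig j) then RtoC 1 else RtoC 0.
Definition realvec {n} (v : CV n) : Prop := forall i, Im (v i) = 0.

Definition ext {A} {n} (d : A) (v : Idx n -> A) : nat -> A :=
  fun i => match Compare_dec.lt_dec i n with
           | left p => v (exist _ i p)
           | right _ => d
           end.
Definition Rsum_n (n : nat) (f : nat -> R) : R := fold_right Rplus 0 (map f (seq 0 n)).
Definition Csum_n (n : nat) (f : nat -> Cpx) : Cpx := fold_right Cadd (RtoC 0) (map f (seq 0 n)).
Definition cdot {n} (u v : CV n) : Cpx := Csum_n n (ext (RtoC 0) (fun i => Cmul (u i) (v i))).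
Definition rdot {n} (u v : RV n) : R := Rsum_n n (ext 0 (fun i => u i * v i)).
Definition l1Z {n} (k : Idx n -> Z) : R := Rsum_n n (ext 0 (fun i => Rabs (IZR (k i)))).

Definition Rsup (A : R -> Prop) : R := epsilon (inhabits 0) (fun l => is_lub A l).

Definition nonresonant {n} (w : RV n) : Prop :=
  forall k : Idx n -> Z, rdot (fun i => IZR (k i)) w = 0 -> forall i, k i = 0%Z.
Definition PsiQ {n} (w : RV n) (Q : R) : R :=
  Rsup (fun y => exists k : Idx n -> Z,
           0 < l1Z k <= Q /\ y = / Rabs (rdot (fun i => IZR (k i)) w)).
Definition DeltaQ {n} (w : RV n) (Q : R) : R := Q * PsiQ w Q.
Definition DeltaStar {n} (w : RV n) (x : R) : R :=
  Rsup (fun Q => 1 <= Q /\ DeltaQ w Q <= x).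

Definition RInt_val (f : R -> R) (a b v : R) : Prop :=
  exists pr : Riemann_integrable f a b, RiemannInt pr = v.
Definition improper_int (f : R -> R) (a L : R) : Prop :=
  (forall b, a <= b -> exists v, RInt_val f a b v) /\
  (forall eps, 0 < eps -> exists M, forall b v, M <= b -> a <= b ->
       RInt_val f a b v -> Rabs (v - L) < eps).

Definition vnorm_lt {n} (v : CV n) (r : R) : Prop := forall i, Cmod (v i) < r.
Definition strip {n} (s : R) (th : CV n) : Prop := forall i, Rabs (Im (th i)) < s.
Definition Dom {n} (r s h : R) (w0 : RV n) (I th w : CV n) : Prop :=
  vnorm_lt I r /\ strip s th /\ vnorm_lt (vsub w (vC w0)) h.

Definition cdiff (g : Cpx -> Cpx) (z : Cpx) : Prop :=
  exists L, forall eps, 0 < eps -> exists d, 0 < d /\ forall t, 0 < Cmod t < d ->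
    Cmod (Csub (Cdiv (Csub (g (Cadd z t)) (g z)) t) L) < eps.
Definition vclose {n} (u v : CV n) (d : R) : Prop := forall i, Cmod (Csub (u i) (v i)) < d.

(** Holomorphy on an open set (continuous and separately holomorphic, Osgood) *)
Definition holo1 {n} (D : CV n -> Prop) (f : CV n -> Cpx) : Prop :=
  (forall z, D z -> forall eps, 0 < eps -> exists d, 0 < d /\
      forall z', D z' -> vclose z z' d -> Cmod (Csub (f z') (f z)) < eps) /\
  (forall z, D z -> forall j, cdiff (fun t => f (upd z j t)) (z j)).
Definition holo3 {n} (D : CV n -> CV n -> CV n -> Prop)
    (f : CV n -> CV n -> CV n -> Cpx) : Prop :=
  (forall a b c, D a b c -> forall eps, 0 < eps -> exists d, 0 < d /\
      forall a' b' c', D a' b' c' -> vclose a a' d -> vclose b b' d -> vclose c c' d ->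
        Cmod (Csub (f a' b' c') (f a b c)) < eps) /\
  (forall a b c, D a b c -> forall j,
      cdiff (fun t => f (upd a j t) b c) (a j) /\
      cdiff (fun t => f a (upd b j t) c) (b j) /\
      cdiff (fun t => f a b (upd c j t)) (c j)).

Definition has_ddir {n} (f : CV n -> Cpx) (z v : CV n) (L : Cpx) : Prop :=
  forall eps, 0 < eps -> exists d, 0 < d /\ forall t : R, t <> 0 -> Rabs t < d ->
    Cmod (Csub (Cdiv (Csub (f (vadd z (vscal (RtoC t) v))) (f z)) (RtoC t)) L) < eps.

(* Main.v *)
Require Import Defs.
From Stdlib Require Import Reals Lra Lia List ZArith ClassicalEpsilon FunctionalExtensionality FinFun.
From Coquelicot Require Import Coquelicot.
Import ListNotations.
Open Scope R_scope.

(** The torus is found by a parametrized KAM iteration. After rescaling the action by [r],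
    one looks for [theta |-> (U, theta + V)], depending analytically on the frequency as well,
    that makes the energy constant (its oscillation is [a]) and whose frequency defect, modulo
    a theta-independent shift [g], is at most [b]. Each step solves the two cohomological
    equations only approximately, by averaging with the ramp [1 - t/L] along the linear flow
    over a time [L] of order [Psi(Q)]; the error is the difference between a time average and
    a constant, which a Fourier and counting argument bounds by [4 kappa] times the sup norm as
    soon as the strip is reduced by a multiple of [1/Q]. The symplectic correction of [U] is the
    gradient of a function, so that the isotropy identity [M^T U = grad s], [M = Id + DV],
    is preserved; a matrix [W] is carried along as an exact inverse of [M].
    With [a] shrinking like [64^-j] and [b] like [16^-j], the cut-offs
    [Q_j = max (Q_0, Delta^*(2^j Delta(Q_0)) / 2)] keep every step admissible, and the sum of the
    [1/Q_j], i.e. the total loss of the strip, is controlled by the integral condition. In the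
    limit the energy is constant; at a frequency where [g] vanishes, isotropy turns this
    into the invariance of the torus. *)

(** * Continuity, integrals and complex derivatives along paths *)

(** Why approximate solutions are good enough: averaging over a time L = C Psi(Q) yields a solution
    bounded by L times the datum, and the Cauchy estimate on a strip of width C/Q turns this into a
    gradient bound Psi(Q) Q = Delta(Q) times the datum. The large constant C cancels; it enters only
    through the loss of strip, hence only through c_3. The price is an error linear in the datum, so
    a step gains a fixed factor and not a square. That suffices, since Delta(Q_j) is at most 2^j
    Delta(Q_0): with p = 2^-j the products of Delta(Q_j) p with the size mu of the perturbation and
    with the radius h stay small. The frequencies are confined to balls of radius h p^3. The power 3
    lies below the power 4 of the defect, so that the Lipschitz constants of the corrections of g,
    of order p^4 / p^3, have a finite sum; and a zero of g is tracked by moving the centres of the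
    balls, which shrink to a single frequency. *)

Ltac pos := intros; solve [repeat first
 [ lra | easy | apply Cmod_ge_0 | apply pos_INR | apply lt_0_INR; lia | apply PI_RGT_0 | apply exp_pos | apply Rabs_pos | apply Rmin_pos
 | apply Rplus_le_le_0_compat | apply Rmult_lt_0_compat | apply Rdiv_lt_0_compat | apply Rinv_0_lt_compat | apply Rmult_le_pos
 | apply Rdiv_le_0_compat | apply pow_lt | apply pow_le | apply Rgt_not_eq; red | apply sqrt_pos | left; progress pos0 | nra ]]
with pos0 := first [apply Rmult_lt_0_compat | apply Rdiv_lt_0_compat | apply Rinv_0_lt_compat | apply pow_lt | apply exp_pos | apply PI_RGT_0].

Tactic Notation "via" uconstr(t) := eapply Rle_trans; [apply t|].
Tactic Notation "ext" := apply functional_extensionality; intros.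
Tactic Notation "ext" ident(i) := apply functional_extensionality; intros i.
Ltac cmp := repeat match goal with
 | |- context [Nat.ltb ?a ?b] => destruct (Nat.ltb_spec a b)
 | |- context [Nat.leb ?a ?b] => destruct (Nat.leb_spec a b)
 | |- context [Nat.eqb ?a ?b] => destruct (Nat.eqb_spec a b)
 end; simpl; try lia.

Lemma Cmod_sub_sym (a b : C) : Cmod (a - b) = Cmod (b - a).
Proof. rewrite <- Cmod_opp. f_equal. ring. Qed.

Lemma Cmod_sub_tri (a b c : C) : Cmod (a - c) <= Cmod (a - b) + Cmod (b - c).
Proof. replace (a - c)%C with ((a - b) + (b - c))%C by ring. apply Cmod_triangle. Qed.

Lemma Cmod_le_add (a b : C) : Cmod a <= Cmod b + Cmod (a - b).
Proof. replace a with (b + (a - b))%C at 1 by ring. apply Cmod_triangle. Qed.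

Lemma Cmod_sub_le (a b : C) : Cmod (a - b) <= Cmod a + Cmod b.
Proof. rewrite <- (Cmod_opp b). apply Cmod_triangle. Qed.

Lemma Cmod_im_le (z : C) : Rabs (snd z) <= Cmod z.
Proof. eapply Rle_trans; [|apply Rmax_Cmod]. apply Rmax_r. Qed.

Lemma Cmod_re_le (z : C) : Rabs (fst z) <= Cmod z.
Proof. eapply Rle_trans; [|apply Rmax_Cmod]. apply Rmax_l. Qed.

Lemma Cmod_le_abs (z : C) : Cmod z <= Rabs (fst z) + Rabs (snd z).
Proof.
 replace z with (RtoC (fst z) + Ci * RtoC (snd z))%C at 1.
 - via Cmod_triangle. rewrite Cmod_mult, Cmod_Ci, !Cmod_R. lra.
 - destruct z as [x y]; unfold Ci, RtoC, Cplus, Cmult; simpl; f_equal; ring.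
Qed.

Lemma Cmod_small_eq (a b : C) : (forall eps, 0 < eps -> Cmod (a - b) <= eps) -> a = b.
Proof.
 intros H. assert (Cmod (a - b) = 0).
 { apply Rle_antisym; [|apply Cmod_ge_0]. apply le_epsilon. intros e He. rewrite Rplus_0_l. auto. }
 apply Cmod_eq_0 in H0. replace a with ((a - b) + b)%C by ring. rewrite H0. ring.
Qed.

(** Continuity by components, because integrals and derivatives along real paths are taken by
    components too. The general domain serves paths and functions on [C] alike. *)
Definition cc {U : UniformSpace} (f : U -> C) (x : U) : Prop :=
 continuous (fun t => fst (f t)) x /\ continuous (fun t => snd (f t)) x.
Notation path_cont f x := (@cc R_UniformSpace (f : R -> C) (x : R)).
Notation ccont f z := (@cc C_UniformSpace (f : C -> C) (z : C)).

Section Continuity.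
Context {U : UniformSpace}.
Implicit Types (f g : U -> C) (x : U).

Lemma cc_const c x : cc (fun _ => c) x.
Proof. split; apply continuous_const. Qed.
Lemma cc_plus f g x : cc f x -> cc g x -> cc (fun t => f t + g t)%C x.
Proof. intros [? ?] [? ?]. split; simpl; apply (continuous_plus (V := R_NormedModule)); easy. Qed.
Lemma cc_minus f g x : cc f x -> cc g x -> cc (fun t => f t - g t)%C x.
Proof. intros [? ?] [? ?]. split; simpl; apply (continuous_minus (V := R_NormedModule)); easy. Qed.
Lemma cc_mult f g x : cc f x -> cc g x -> cc (fun t => f t * g t)%C x.
Proof.
 intros [? ?] [? ?]. split; simpl; [apply (continuous_minus (V := R_NormedModule))|apply (continuous_plus (V := R_NormedModule))];
  apply (continuous_mult (K := R_AbsRing)); easy.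
Qed.
Lemma cc_ofR (f : U -> R) x : continuous f x -> cc (fun t => RtoC (f t)) x.
Proof. split; [easy|apply continuous_const]. Qed.
Lemma cc_ext f g x : (forall t, f t = g t) -> cc f x -> cc g x.
Proof. intros E H. replace g with f; [easy|]. apply functional_extensionality; easy. Qed.
Lemma cc_comp (F : C -> C) f x : ccont F (f x) -> cc f x -> cc (fun t => F (f t)) x.
Proof.
 intros HF [? ?].
 assert (K : forall p : C -> R, @continuous C_UniformSpace _ (fun z => p (F z)) (f x) -> continuous (fun t => p (F (f t))) x).
 { intros p Hp. apply (continuous_ext (fun t => p (F (fst (f t), snd (f t))))); [intros; rewrite <- surjective_pairing; easy|].
  apply (continuous_comp_2 _ _ (fun a b => p (F (a, b)))); try easy. rewrite <- surjective_pairing.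
  eapply continuous_ext; [|apply Hp]. intros [a b]; easy. }
 split; apply K; apply HF.
Qed.
End Continuity.

Lemma continuous_C_eps (g : C -> R) (z : C) :
 continuous g z <-> forall eps, 0 < eps -> exists d, 0 < d /\ forall t, Cmod t < d -> Rabs (g (z + t)%C - g z) < eps.
Proof.
 unfold continuous. rewrite filterlim_locally. split.
 - intros H eps He. destruct (H (mkposreal eps He)) as [d Hd]. exists d. split; [apply cond_pos|]. intros t Ht. apply Hd.
  split; unfold ball; simpl; unfold AbsRing_ball, abs, minus, plus, opp; simpl.
  + generalize (Cmod_re_le t). replace (fst z + fst t + - fst z) with (fst t) by ring. lra.
  + generalize (Cmod_im_le t). replace (snd z + snd t + - snd z) with (snd t) by ring. lra.
 - intros H eps. destruct (H eps (cond_pos eps)) as (d & Hd & Ht). exists (mkposreal (d/2) ltac:(lra)). intros z' [H1 H2]. change C in z'.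
  change (Rabs (fst z' - fst z) < d/2) in H1. change (Rabs (snd z' - snd z) < d/2) in H2.
  specialize (Ht (z' - z)%C). replace (z + (z' - z))%C with z' in Ht by ring. apply Ht.
  eapply Rle_lt_trans; [apply Cmod_le_abs|]. simpl. unfold Rminus in *. lra.
Qed.

Lemma ccont_eps f z : ccont f z <-> forall eps, 0 < eps -> exists d, 0 < d /\ forall t, Cmod t < d -> Cmod (f (z + t) - f z)%C < eps.
Proof.
 unfold cc. rewrite !(continuous_C_eps (fun t => _ (f t))). split.
 - intros [H H'] eps He. destruct (H (eps/2)) as (d & Hd & H1); [lra|]. destruct (H' (eps/2)) as (d' & Hd' & H2); [lra|].
  exists (Rmin d d'). split; [apply Rmin_pos; easy|]. intros t Ht. eapply Rle_lt_trans; [apply Cmod_le_abs|].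
  specialize (H1 t (Rlt_le_trans _ _ _ Ht (Rmin_l _ _))). specialize (H2 t (Rlt_le_trans _ _ _ Ht (Rmin_r _ _))). simpl. unfold Rminus in *. lra.
 - intros H. split; intros eps He; destruct (H eps He) as (d & Hd & Ht); exists d; split; try easy; intros t h; eapply Rle_lt_trans; [|apply (Ht t h)| |apply (Ht t h)].
  apply (Cmod_re_le (f (z + t) - f z)%C). apply (Cmod_im_le (f (z + t) - f z)%C).
Qed.

Lemma ccont_id z : ccont (fun t => t) z.
Proof. apply ccont_eps. intros eps He. exists eps. split; [easy|]. intros t Ht. replace (z + t - z)%C with t by ring. easy. Qed.
Lemma ccont_shift f (z c : C) : ccont f (z + c)%C <-> ccont (fun t => f (z + t)%C) c.
Proof. rewrite !ccont_eps. split; intros H eps He; destruct (H eps He) as (d & Hd & Ht); exists d; (split; [easy|]); intros t h; specialize (Ht t h); rewrite Cplus_assoc in *; easy. Qed.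

Definition CI (f : R -> C) (a b : R) : C :=
 (RInt (fun t => fst (f t)) a b, RInt (fun t => snd (f t)) a b).
Notation RN := R_CompleteNormedModule.

Lemma ex_RInt_cc f a b : a <= b -> (forall x, a <= x <= b -> path_cont f x) ->
 ex_RInt (fun t => fst (f t)) a b /\ ex_RInt (fun t => snd (f t)) a b.
Proof. intros Hab H. split; apply (ex_RInt_continuous (V := RN)); intros z Hz; rewrite Rmin_left, Rmax_right in Hz by easy; apply H; easy. Qed.

Lemma CI_ext f g a b : a <= b -> (forall x, a <= x <= b -> f x = g x) -> CI f a b = CI g a b.
Proof.
 intros Hab H. unfold CI. f_equal; apply RInt_ext; intros x Hx;
 rewrite Rmin_left, Rmax_right in Hx by easy; rewrite H by lra; easy.
Qed.

Lemma CI_scal f a b c : a <= b -> (forall x, a <= x <= b -> path_cont f x) -> CI (fun t => c * f t)%C a b = (c * CI f a b)%C.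
Proof.
 intros Hab Hf. destruct (ex_RInt_cc f a b Hab Hf) as [E1 E2]. unfold CI, Cmult; simpl.
 assert (S : forall k h, ex_RInt h a b -> RInt (fun t => k * h t) a b = k * RInt h a b) by (intros; apply (RInt_scal (V := RN)); easy).
 assert (X : forall k h, ex_RInt h a b -> ex_RInt (fun t => k * h t) a b) by (intros; apply (ex_RInt_scal (V := RN)); easy).
 rewrite <- !S by easy. f_equal; [apply (RInt_minus (V := RN))|apply (RInt_plus (V := RN))]; apply X; easy.
Qed.

Section Linear.
Variables (f g : R -> C) (a b : R).
Hypothesis Hab : a <= b.
Hypothesis Hf : forall x, a <= x <= b -> path_cont f x.
Hypothesis Hg : forall x, a <= x <= b -> path_cont g x.
Let Ef := ex_RInt_cc f a b Hab Hf.
Let Eg := ex_RInt_cc g a b Hab Hg.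

Lemma CI_plus : CI (fun t => f t + g t)%C a b = (CI f a b + CI g a b)%C.
Proof. unfold CI, Cplus; simpl. f_equal; apply (RInt_plus (V := RN)); easy. Qed.

Lemma CI_minus : CI (fun t => f t - g t)%C a b = (CI f a b - CI g a b)%C.
Proof. unfold CI, Cminus, Cplus, Copp; simpl. f_equal; apply (RInt_minus (V := RN)); easy. Qed.
End Linear.

Lemma CI_chasles f a b c : a <= b -> b <= c -> (forall x, a <= x <= c -> path_cont f x) ->
 CI f a c = (CI f a b + CI f b c)%C.
Proof.
 intros Hab Hbc Hf. destruct (ex_RInt_cc f a b) as [? ?]; [easy|intros; apply Hf; lra|]. destruct (ex_RInt_cc f b c) as [? ?]; [easy|intros; apply Hf; lra|].
 unfold CI, Cplus; simpl. f_equal; symmetry; apply (RInt_Chasles (V := RN)); easy.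
Qed.

Lemma CI_const c a b : CI (fun _ => c) a b = (RtoC (b - a) * c)%C.
Proof. unfold CI. rewrite !(RInt_const (V := RN)). unfold scal; simpl. unfold mult; simpl.
 destruct c; unfold Cmult, RtoC; simpl; f_equal; ring. Qed.

(* Rotating the integral onto the positive axis reduces the bound to one for real parts. *)
Lemma CI_norm f a b B : a <= b -> (forall x, a <= x <= b -> path_cont f x) ->
 (forall x, a <= x <= b -> Cmod (f x) <= B) -> Cmod (CI f a b) <= B * (b - a).
Proof.
 intros Hab Hf HB. set (z := CI f a b). destruct (Ceq_dec z 0) as [E|NE].
 - rewrite E, Cmod_0. apply Rmult_le_pos; [|lra]. eapply Rle_trans; [apply Cmod_ge_0|apply (HB a); lra].
 - assert (Hz : 0 < Cmod z) by (apply Cmod_gt_0; easy).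
  apply (Rmult_le_reg_l (Cmod z)); [easy|].
  assert (Hc : CI (fun t => Cconj z * f t)%C a b = RtoC (Cmod z * Cmod z)).
  { rewrite CI_scal by easy. rewrite Cmult_comm, <- Cmod2_conj. f_equal. ring. }
  apply (f_equal fst) in Hc. cbn [fst RtoC] in Hc. rewrite <- Hc.
  replace (Cmod z * (B * (b - a))) with (RInt (fun _ => Cmod z * B) a b) by (rewrite (RInt_const (V := RN)); unfold scal; simpl; unfold mult; simpl; ring).
  apply RInt_le; try easy.
  + apply (ex_RInt_cc (fun t => Cconj z * f t)%C); [easy|]. intros. apply cc_mult; [apply cc_const|apply Hf; easy].
  + apply (ex_RInt_const (V := RN)).
  + intros x Hx. via Rle_abs. via (Cmod_re_le (Cconj z * f x)).
   rewrite Cmod_mult, Cmod_conj. apply Rmult_le_compat_l; [lra|]. apply HB; lra.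
Qed.

Lemma CI_shift f a b c : a <= b -> (forall x, a + c <= x <= b + c -> path_cont f x) ->
 CI (fun t => f (t + c)) a b = CI f (a + c) (b + c).
Proof.
 intros Hab Hf. destruct (ex_RInt_cc f (a + c) (b + c)) as [? ?]; [lra|easy|]. unfold CI.
 assert (Hl : forall h : R -> R, ex_RInt h (a+c) (b+c) -> RInt (fun t => h (t + c)) a b = RInt h (a + c) (b + c)).
 { intros h Hh. rewrite <- (Rmult_1_l a), <- (Rmult_1_l b) in Hh |- * at 2. rewrite <- (RInt_comp_lin (V := RN)) by easy.
  apply RInt_ext. intros x Hx. rewrite !Rmult_1_l. easy. }
 f_equal; [apply (Hl (fun t => fst (f t)))|apply (Hl (fun t => snd (f t)))]; easy.
Qed.

Definition path_deriv (g : R -> C) (x : R) (d : C) : Prop :=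
 is_derive (fun t => fst (g t)) x (fst d) /\ is_derive (fun t => snd (g t)) x (snd d).

Lemma CI_ftc f g a b : a <= b -> (forall x, a <= x <= b -> path_cont f x) ->
 (forall x, a <= x <= b -> path_deriv g x (f x)) -> CI f a b = (g b - g a)%C.
Proof.
 intros Hab Hf Hg. unfold CI, Cminus, Cplus, Copp; simpl. f_equal; apply is_RInt_unique;
  [apply (is_RInt_derive (V := RN) (fun t => fst (g t)))|apply (is_RInt_derive (V := RN) (fun t => snd (g t)))];
  intros x Hx; rewrite Rmin_left, Rmax_right in Hx by easy; [apply Hg|apply Hf|apply Hg|apply Hf]; easy.
Qed.

(** Multiplied out, so that the zero increment needs no exclusion. *)
Definition is_cd (f : C -> C) (z L : C) : Prop :=
 forall eps, 0 < eps -> exists d, 0 < d /\ forall t, Cmod t < d ->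
  Cmod (f (z + t) - f z - L * t)%C <= eps * Cmod t.

Definition cdf (f : C -> C) (z : C) : Prop := exists L, is_cd f z L.

(* Caratheodory: differentiability as continuity of the slope. *)
Lemma is_cd_slope f z L : is_cd f z L <-> exists p, ccont p 0%C /\ p 0%C = L /\ forall t, (f (z + t) = f z + p t * t)%C.
Proof.
 split.
 - intros H. exists (fun t => if Ceq_dec t 0 then L else ((f (z + t) - f z) / t)%C). split; [|split].
  + apply ccont_eps. intros e He. destruct (H (e/2)) as (d & Hd & Ht); [lra|]. exists d. split; [easy|]. intros t h. rewrite Cplus_0_l.
   destruct (Ceq_dec 0 0) as [_|n]; [|easy]. destruct (Ceq_dec t 0) as [_|n].
   * replace (L - L)%C with (RtoC 0) by ring. rewrite Cmod_0; easy.
   * apply Cmod_gt_0 in n as n'. apply (Rmult_lt_reg_r (Cmod t)); [easy|]. rewrite <- Cmod_mult.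
    replace (((f (z + t) - f z) / t - L) * t)%C with (f (z + t) - f z - L * t)%C by (field; easy). specialize (Ht t h). nra.
  + destruct (Ceq_dec 0 0); easy.
  + intros t. destruct (Ceq_dec t 0) as [->|n]; [rewrite Cplus_0_r; ring|field; easy].
 - intros (p & Hp & <- & E) e He. destruct (proj1 (ccont_eps p 0%C) Hp e He) as (d & Hd & Ht). exists d. split; [easy|]. intros t h.
  rewrite E. replace (f z + p t * t - f z - p 0 * t)%C with ((p t - p 0) * t)%C by ring. rewrite Cmod_mult.
  apply Rmult_le_compat_r; [apply Cmod_ge_0|]. specialize (Ht t h). rewrite Cplus_0_l in Ht. lra.
Qed.

Lemma is_cd_ccont f z L : is_cd f z L -> ccont f z.
Proof.
 intros H. apply is_cd_slope in H. destruct H as (p & Hp & _ & E). rewrite <- (Cplus_0_r z). apply ccont_shift.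
 apply (cc_ext (fun t => f z + p t * t)%C); [easy|]. apply cc_plus; [apply cc_const|]. apply cc_mult; [easy|apply ccont_id].
Qed.

Lemma is_cd_ext f g z L : (forall t, f t = g t) -> is_cd f z L -> is_cd g z L.
Proof. intros E H. replace g with f; [easy|]. apply functional_extensionality; easy. Qed.

Lemma is_cd_unique f z L L' : is_cd f z L -> is_cd f z L' -> L = L'.
Proof.
 intros H H'. apply Cmod_small_eq. intros eps He.
 destruct (H (eps/2)) as (d & Hd & Ht); [lra|]. destruct (H' (eps/2)) as (d' & Hd' & Ht'); [lra|].
 assert (Hm : 0 < Rmin d d') by (apply Rmin_pos; easy). set (t := RtoC (Rmin d d' / 2)).
 assert (E : Cmod t = Rmin d d' / 2) by (unfold t; rewrite Cmod_R, Rabs_right; lra).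
 specialize (Ht t). specialize (Ht' t). generalize (Rmin_l d d') (Rmin_r d d'). intros.
 apply (Rmult_le_reg_r (Cmod t)); [lra|]. rewrite <- Cmod_mult.
 replace ((L - L') * t)%C with ((f (z + t) - f z - L' * t) - (f (z + t) - f z - L * t))%C by ring.
 via Cmod_sub_le. lra.
Qed.

Lemma is_cd_const c z : is_cd (fun _ => c) z 0.
Proof. apply is_cd_slope. exists (fun _ => 0%C). split; [apply cc_const|]. split; [easy|]. intros; ring. Qed.
Lemma is_cd_id z : is_cd (fun t => t) z 1.
Proof. apply is_cd_slope. exists (fun _ => 1%C). split; [apply cc_const|]. split; [easy|]. intros; ring. Qed.
Lemma is_cd_plus f g z L L' : is_cd f z L -> is_cd g z L' -> is_cd (fun t => f t + g t)%C z (L + L').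
Proof.
 rewrite !is_cd_slope. intros (p & Hp & <- & E) (q & Hq & <- & E'). exists (fun t => p t + q t)%C.
 split; [apply cc_plus; easy|]. split; [easy|]. intros. rewrite E, E'. ring.
Qed.
Lemma is_cd_comp f g z L L' : is_cd g z L -> is_cd f (g z) L' -> is_cd (fun t => f (g t)) z (L' * L).
Proof.
 rewrite !is_cd_slope. intros (p & Hp & <- & E) (q & Hq & <- & E'). exists (fun t => q (p t * t) * p t)%C. split; [|split].
 - apply cc_mult; [|easy]. apply (cc_comp q (fun t => p t * t)%C); [rewrite Cmult_0_r; easy|apply cc_mult; [easy|apply ccont_id]].
 - rewrite Cmult_0_r. easy.
 - intros. rewrite E, E'. ring.
Qed.
Lemma is_cd_mult f g z L L' : is_cd f z L -> is_cd g z L' -> is_cd (fun t => f t * g t)%C z (L * g z + f z * L').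
Proof.
 rewrite !is_cd_slope. intros (p & Hp & <- & E) (q & Hq & <- & E'). exists (fun t => p t * (g z + q t * t) + f z * q t)%C. split; [|split].
 - apply cc_plus; apply cc_mult; try easy; try apply cc_const. apply cc_plus; [apply cc_const|apply cc_mult; [easy|apply ccont_id]].
 - ring.
 - intros. rewrite E, E'. ring.
Qed.
Lemma is_cd_scal c f z L : is_cd f z L -> is_cd (fun t => c * f t)%C z (c * L).
Proof. intros H. replace (c * L)%C with (0 * f z + c * L)%C by ring. apply (is_cd_mult (fun _ => c) f); [apply is_cd_const|easy]. Qed.
Lemma is_cd_minus f g z L L' : is_cd f z L -> is_cd g z L' -> is_cd (fun t => f t - g t)%C z (L - L').
Proof.
 intros H H'. replace (L - L')%C with (L + (RtoC (-1)) * L')%C by ring.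
 apply is_cd_ext with (fun t => f t + RtoC (-1) * g t)%C; [intros; ring|]. apply is_cd_plus, is_cd_scal; easy.
Qed.

Lemma is_cd_inv (z : C) : z <> 0%C -> is_cd (fun t => / t)%C z (- / (z * z)).
Proof.
 intros Hz eps He. assert (H0 : 0 < Cmod z) by (apply Cmod_gt_0; easy). set (m := Cmod z) in *.
 assert (P : 0 < m/2*(m*m)) by (repeat apply Rmult_lt_0_compat; lra).
 exists (Rmin (m/2) (eps * (m/2*(m*m)))). split; [apply Rmin_pos; [lra|apply Rmult_lt_0_compat; easy]|].
 intros t Ht. assert (H1 := Rmin_l (m/2) (eps * (m/2*(m*m)))). assert (H2 := Rmin_r (m/2) (eps * (m/2*(m*m)))).
 assert (H3 : m/2 <= Cmod (z + t)). { generalize (Cmod_le_add z (z + t)). replace (z - (z + t))%C with (- t)%C by ring. rewrite Cmod_opp. fold m. lra. }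
 assert (Hzt : (z + t)%C <> 0%C) by (apply Cmod_gt_0; lra).
 replace (/ (z + t) - / z - - / (z * z) * t)%C with (t * t / ((z + t) * (z * z)))%C by (field; easy).
 rewrite Cmod_div, !Cmod_mult by (repeat apply Cmult_neq_0; easy).
 assert (m/2*(m*m) <= Cmod (z + t) * (m * m)) by (apply Rmult_le_compat_r; nra).
 apply (Rmult_le_reg_r (Cmod (z + t) * (m * m))); [lra|]. unfold Rdiv at 1. rewrite Rmult_assoc, Rinv_l by lra.
 assert (h := Cmod_ge_0 t). assert (Cmod t <= eps * (Cmod (z + t) * (m * m))) by nra. nra.
Qed.

(** The function exp(2 pi i z), of period 1; [c2pi] below is the number 2 pi i. *)
Definition ce (z : C) : C := (exp (- (2 * PI * snd z)) * cos (2 * PI * fst z), exp (- (2 * PI * snd z)) * sin (2 * PI * fst z)).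

Lemma ce_plus z w : ce (z + w) = (ce z * ce w)%C.
Proof.
 unfold ce, Cplus, Cmult; simpl. rewrite !Rmult_plus_distr_l, Ropp_plus_distr, exp_plus, cos_plus, sin_plus. f_equal; ring.
Qed.

Lemma ce_0 : ce 0 = 1%C.
Proof. unfold ce; simpl. rewrite Rmult_0_r, Ropp_0, exp_0, cos_0, sin_0. unfold RtoC; f_equal; ring. Qed.

Lemma Cmod_ce z : Cmod (ce z) = exp (- (2 * PI * snd z)).
Proof.
 unfold ce, Cmod; simpl. set (E := exp _). set (x := 2 * PI * fst z).
 replace (E * cos x * (E * cos x * 1) + E * sin x * (E * sin x * 1)) with (E * E * (Rsqr (sin x) + Rsqr (cos x))) by (unfold Rsqr; ring).
 rewrite sin2_cos2, Rmult_1_r. apply sqrt_square. left; apply exp_pos.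
Qed.

Lemma ce_neq0 z : ce z <> 0%C.
Proof. apply Cmod_gt_0. rewrite Cmod_ce. apply exp_pos. Qed.

Lemma ce_opp z : ce (- z) = (/ ce z)%C.
Proof. assert (H : (ce (- z) * ce z)%C = 1%C) by (rewrite <- ce_plus; replace (- z + z)%C with (RtoC 0) by ring; apply ce_0).
 replace (ce (- z)) with (ce (- z) * ce z * / ce z)%C by (field; apply ce_neq0). rewrite H. ring. Qed.

Lemma ce_1 : ce 1 = 1%C.
Proof. unfold ce; simpl. rewrite Rmult_0_r, Ropp_0, exp_0, Rmult_1_r, cos_2PI, sin_2PI. unfold RtoC; f_equal; ring. Qed.

Lemma ce_nat n : ce (RtoC (INR n)) = 1%C.
Proof. induction n. apply ce_0. rewrite S_INR, RtoC_plus, ce_plus, IHn, ce_1. ring. Qed.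

Lemma ce_int (k : Z) : ce (RtoC (IZR k)) = 1%C.
Proof.
 destruct (Z_le_dec 0 k) as [H|H].
 - rewrite <- (Z2Nat.id k H), <- INR_IZR_INZ. apply ce_nat.
 - replace (IZR k) with (- IZR (- k)) by (rewrite opp_IZR; ring). rewrite RtoC_opp, ce_opp.
  rewrite <- (Z2Nat.id (- k)), <- INR_IZR_INZ by lia. rewrite ce_nat. field.
Qed.

Definition c2pi : C := (0, 2 * PI).

Lemma slope_R (f : R -> R) (l : R) : is_derive f 0 l -> exists p : R -> R, continuous p 0 /\ p 0 = l /\ forall y, f y = f 0 + p y * y.
Proof.
 intros H. apply is_derive_Reals in H. exists (fun y => if Req_EM_T y 0 then l else (f y - f 0) / y). split; [|split].
 - apply continuity_pt_filterlim. intros e He. destruct (H e He) as (d & Hd). exists d. split; [apply cond_pos|]. intros y [[_ n] Hy].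
  simpl in *. unfold R_dist in *. destruct (Req_EM_T 0 0) as [_|]; [|easy]. destruct (Req_EM_T y 0) as [e0|n0]; [congruence|].
  rewrite <- (Rplus_0_l y) at 1. apply Hd; [easy|]. rewrite Rminus_0_r in Hy. easy.
 - destruct (Req_EM_T 0 0); easy.
 - intros y. destruct (Req_EM_T y 0) as [->|n]; field; easy.
Qed.

Lemma ce_cd0 : is_cd ce 0 c2pi.
Proof.
 destruct (slope_R (fun y => exp (- (2 * PI * y))) (- (2 * PI))) as (e & He & e0 & Ee). { auto_derive; [easy|]. rewrite Rmult_0_r, Ropp_0, exp_0. ring. }
 destruct (slope_R (fun y => cos (2 * PI * y)) 0) as (c & Hc & c0 & Ec). { auto_derive; [easy|]. rewrite Rmult_0_r, sin_0. ring. }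
 destruct (slope_R (fun y => sin (2 * PI * y)) (2 * PI)) as (s & Hs & s0 & Es). { auto_derive; [easy|]. rewrite Rmult_0_r, cos_0. ring. }
 rewrite Rmult_0_r in Ee, Ec, Es. rewrite Ropp_0, exp_0 in Ee. rewrite cos_0 in Ec. rewrite sin_0 in Es.
 set (E := fun t : C => 1 + e (snd t) * snd t).
 assert (K : forall g : R -> R, continuous g 0 -> continuous (fun t : C => g (fst t)) (RtoC 0) /\ continuous (fun t : C => g (snd t)) (RtoC 0)).
 { split; [apply (continuous_comp fst g); [apply continuous_fst|easy]|apply (continuous_comp snd g); [apply continuous_snd|easy]]. }
 assert (HE : continuous E (RtoC 0)).
 { apply (continuous_plus (V := R_NormedModule)); [apply continuous_const|]. apply (continuous_mult (K := R_AbsRing)); [apply K; easy|apply continuous_snd]. }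
 (* This function vanishes at 0 and bounds the quotient of the remainder by [Cmod t]: its three
    terms are the deviations of the slopes of exp, cos and sin from their values at 0. *)
 assert (G : continuous (fun t : C => Rabs (e (snd t) + 2 * PI) + (Rabs (E t * c (fst t)) + Rabs (E t * s (fst t) - 2 * PI))) (RtoC 0)).
 { pose (P := @continuous_plus C_UniformSpace _ R_NormedModule). pose (M := @continuous_mult C_UniformSpace R_AbsRing).
  pose (B := fun (f : C -> R) H => continuous_comp f Rabs (RtoC 0) H (continuous_Rabs _)).
  apply P; [apply B, P; [apply K; easy|apply continuous_const]|apply P; apply B; [apply M; [easy|apply K; easy]|]].
  apply P; [apply M; [easy|apply K; easy]|apply continuous_const]. }
 intros eps Heps. destruct (proj1 (continuous_C_eps _ _) G eps Heps) as (d & Hd & Ht). exists d. split; [easy|]. intros [x y] h. specialize (Ht _ h).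
 rewrite Cplus_0_l in *. rewrite ce_0. assert (Hx := Cmod_re_le (x, y)). assert (Hy := Cmod_im_le (x, y)).
 apply Rabs_def2 in Ht. revert Ht. unfold ce, E, c2pi. simpl in *. rewrite Ee, Ec, Es, e0, c0, s0. set (m := Cmod (x, y)) in *.
 set (E1 := 1 + e y * y). replace (- (2 * PI) + 2 * PI) with 0 by ring. rewrite !Rmult_0_r, Rplus_0_r, Rmult_1_l, Rminus_diag, !Rabs_R0. intros [Ht _].
 via Cmod_le_abs. simpl.
 replace (E1 * (1 + c x * x) + - (1) + - (0 * x - 2 * PI * y)) with ((e y + 2 * PI) * y + E1 * c x * x) by (unfold E1; ring).
 replace (E1 * (0 + s x * x) + - 0 + - (0 * y + 2 * PI * x)) with ((E1 * s x - 2 * PI) * x) by ring.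
 eapply Rle_trans; [apply Rplus_le_compat_r, Rabs_triang|]. rewrite !(Rabs_mult _ y), !(Rabs_mult _ x).
 assert (0 <= m) by apply Cmod_ge_0. set (u1 := Rabs (e y + _)) in *. set (u2 := Rabs (E1 * c x)) in *. set (u3 := Rabs (E1 * s x - _)) in *.
 assert (0 <= u1) by apply Rabs_pos. assert (0 <= u2) by apply Rabs_pos. assert (0 <= u3) by apply Rabs_pos. nra.
Qed.

Lemma is_cd_ce z : is_cd ce z (c2pi * ce z).
Proof.
 apply is_cd_ext with (fun t => ce z * ce (t - z))%C.
 { intros t. rewrite <- ce_plus. f_equal. ring. }
 replace (c2pi * ce z)%C with (ce z * c2pi)%C by ring. apply is_cd_scal.
 replace c2pi with (c2pi * (1 - 0))%C by ring.
 apply (is_cd_comp ce (fun t => t - z)%C); [apply is_cd_minus; [apply is_cd_id|apply is_cd_const]|].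
 replace (z - z)%C with (RtoC 0) by ring. apply ce_cd0.
Qed.

Lemma ce_period (z : C) (k : Z) : ce (z + RtoC (IZR k)) = ce z.
Proof. rewrite ce_plus, ce_int. ring. Qed.

Lemma cc_fst (f : R -> C) x : path_cont f x -> continuous (fun t => fst (f t)) x.
Proof. intros H; apply H. Qed.
Lemma cc_snd (f : R -> C) x : path_cont f x -> continuous (fun t => snd (f t)) x.
Proof. intros H; apply H. Qed.
Lemma cc_intro (f : R -> C) x : continuous (fun t => fst (f t)) x -> continuous (fun t => snd (f t)) x -> path_cont f x.
Proof. split; easy. Qed.
Global Opaque cc.

(** * Goursat's theorem *)

Definition rect_int (F : C -> C) (x0 x1 y0 y1 : R) : C :=
 (CI (fun x => F (x, y0)) x0 x1 + Ci * CI (fun y => F (x1, y)) y0 y1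
  - CI (fun x => F (x, y1)) x0 x1 - Ci * CI (fun y => F (x0, y)) y0 y1)%C.

Definition rect (x0 x1 y0 y1 : R) (z : C) : Prop := x0 <= fst z <= x1 /\ y0 <= snd z <= y1.

Lemma path_cont_h F x y : ccont F (x, y) -> path_cont (fun t => F (t, y)) x.
Proof. intros H. apply (cc_comp F (fun t => (t, y))); [easy|apply cc_intro; [easy|apply continuous_const]]. Qed.

Lemma path_cont_v F x y : ccont F (x, y) -> path_cont (fun t => F (x, t)) y.
Proof. intros H. apply (cc_comp F (fun t => (x, t))); [easy|apply cc_intro; [apply continuous_const|easy]]. Qed.

Lemma rect_int_split_x F x0 xm x1 y0 y1 : x0 <= xm <= x1 -> y0 <= y1 ->
 (forall x, x0 <= x <= x1 -> ccont F (x, y0) /\ ccont F (x, y1)) ->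
 rect_int F x0 x1 y0 y1 = (rect_int F x0 xm y0 y1 + rect_int F xm x1 y0 y1)%C.
Proof.
 intros Hx Hy Hc. unfold rect_int.
 rewrite (CI_chasles (fun x => F (x, y0)) x0 xm x1), (CI_chasles (fun x => F (x, y1)) x0 xm x1);
  try lra; try (intros; apply path_cont_h, Hc; easy). ring.
Qed.

Lemma rect_int_split_y F x0 x1 y0 ym y1 : y0 <= ym <= y1 -> x0 <= x1 ->
 (forall y, y0 <= y <= y1 -> ccont F (x0, y) /\ ccont F (x1, y)) ->
 rect_int F x0 x1 y0 y1 = (rect_int F x0 x1 y0 ym + rect_int F x0 x1 ym y1)%C.
Proof.
 intros Hx Hy Hc. unfold rect_int.
 rewrite (CI_chasles (fun x => F (x0, x)) y0 ym y1), (CI_chasles (fun x => F (x1, x)) y0 ym y1);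
  try lra; try (intros; apply path_cont_v, Hc; easy). ring.
Qed.

Lemma rect_int_norm F x0 x1 y0 y1 B : x0 <= x1 -> y0 <= y1 ->
 (forall x, x0 <= x <= x1 -> ccont F (x, y0) /\ ccont F (x, y1)) ->
 (forall y, y0 <= y <= y1 -> ccont F (x0, y) /\ ccont F (x1, y)) ->
 (forall x, x0 <= x <= x1 -> Cmod (F (x, y0)) <= B /\ Cmod (F (x, y1)) <= B) ->
 (forall y, y0 <= y <= y1 -> Cmod (F (x0, y)) <= B /\ Cmod (F (x1, y)) <= B) ->
 Cmod (rect_int F x0 x1 y0 y1) <= 2 * B * ((x1 - x0) + (y1 - y0)).
Proof.
 intros Hx Hy Cx Cy Bx By.
 via Cmod_sub_le. rewrite Cmod_mult, Cmod_Ci, Rmult_1_l.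
 eapply Rle_trans; [apply Rplus_le_compat_r, Cmod_sub_le|].
 eapply Rle_trans; [apply Rplus_le_compat_r, Rplus_le_compat_r, Cmod_triangle|].
 rewrite Cmod_mult, Cmod_Ci, Rmult_1_l.
 assert (Cmod (CI (fun x => F (x, y0)) x0 x1) <= B * (x1 - x0)) by (apply CI_norm; intros; [easy|apply path_cont_h, Cx; easy|apply Bx; easy]).
 assert (Cmod (CI (fun x => F (x, y1)) x0 x1) <= B * (x1 - x0)) by (apply CI_norm; intros; [easy|apply path_cont_h, Cx; easy|apply Bx; easy]).
 assert (Cmod (CI (fun x => F (x0, x)) y0 y1) <= B * (y1 - y0)) by (apply CI_norm; intros; [easy|apply path_cont_v, Cy; easy|apply By; easy]).
 assert (Cmod (CI (fun x => F (x1, x)) y0 y1) <= B * (y1 - y0)) by (apply CI_norm; intros; [easy|apply path_cont_v, Cy; easy|apply By; easy]).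
 lra.
Qed.

Lemma rect_int_minus F G x0 x1 y0 y1 : x0 <= x1 -> y0 <= y1 ->
 (forall z, rect x0 x1 y0 y1 z -> ccont F z) -> (forall z, rect x0 x1 y0 y1 z -> ccont G z) ->
 rect_int (fun z => F z - G z)%C x0 x1 y0 y1 = (rect_int F x0 x1 y0 y1 - rect_int G x0 x1 y0 y1)%C.
Proof.
 intros Hx Hy HF HG. unfold rect_int.
 rewrite (CI_minus (fun x => F (x, y0)) (fun x => G (x, y0))), (CI_minus (fun x => F (x, y1)) (fun x => G (x, y1))),
  (CI_minus (fun x => F (x0, x)) (fun x => G (x0, x))), (CI_minus (fun x => F (x1, x)) (fun x => G (x1, x))); try easy; try ring;
 intros; (apply path_cont_h || apply path_cont_v); (apply HF || apply HG); unfold rect; simpl; lra.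
Qed.

Lemma rect_int_affine al be x0 x1 y0 y1 : x0 <= x1 -> y0 <= y1 ->
 rect_int (fun z => al * z + be)%C x0 x1 y0 y1 = 0%C.
Proof.
 intros Hx Hy.
 assert (Cc : forall z, ccont (fun z => al * z + be)%C z).
 { intros z. apply is_cd_ccont with (al * 1 + 0)%C. apply is_cd_plus; [apply is_cd_scal, is_cd_id|apply is_cd_const]. }
 unfold rect_int. destruct al as [a1 a2], be as [b1 b2].
 set (P := fun x y : R => (a1 * (x*x - y*y)/2 - a2 * x * y + b1 * x - b2 * y, a2*(x*x-y*y)/2 + a1*x*y + b2 * x + b1 * y) : C).
 assert (Eh : forall y, CI (fun x => ((a1,a2) * (x, y) + (b1,b2))%C) x0 x1 = (P x1 y - P x0 y)%C).
 { intros y. apply (CI_ftc _ (fun x => P x y)); [easy|intros; apply (path_cont_h (fun z => (a1,a2) * z + (b1,b2))%C); apply Cc|].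
  intros x _. unfold P; split; simpl; auto_derive; try easy; field. }
 assert (Ev : forall x, CI (fun y => ((a1,a2) * (x, y) + (b1,b2))%C) y0 y1 = (- Ci * (P x y1 - P x y0))%C).
 { intros x. rewrite (CI_ftc _ (fun y => - Ci * P x y)%C); [ring|easy|intros; apply (path_cont_v (fun z => (a1,a2) * z + (b1,b2))%C); apply Cc|].
  intros y _. unfold P; split; simpl; auto_derive; try easy; field. }
 rewrite !Eh, !Ev.
 replace (Ci * (- Ci * (P x1 y1 - P x1 y0)))%C with ((P x1 y1 - P x1 y0) * (- (Ci * Ci)))%C by ring.
 replace (Ci * (- Ci * (P x0 y1 - P x0 y0)))%C with ((P x0 y1 - P x0 y0) * (- (Ci * Ci)))%C by ring.
 replace (- (Ci * Ci))%C with (RtoC 1). ring. unfold Ci, Cmult, Copp, RtoC; simpl; f_equal; ring.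
Qed.

Section Goursat.
Variables (F : C -> C) (x0 x1 y0 y1 : R).
Hypothesis Hx : x0 < x1.
Hypothesis Hy : y0 < y1.
Hypothesis HF : forall z, rect x0 x1 y0 y1 z -> cdf F z.
Let A := x1 - x0.
Let B := y1 - y0.

Let HFc z : rect x0 x1 y0 y1 z -> ccont F z.
Proof. intros H. destruct (HF z H) as [L HL]. apply (is_cd_ccont F z L HL). Qed.

(** [d] is the ratio of the sides to those of the original rectangle. Measuring the integral against
    [d * d] makes the property pass to one of the four quarters with the same [eps]. *)
Definition bad_rect (eps : R) (p : R * R * R) : Prop :=
 let '(x, y, d) := p in
 0 < d /\ x0 <= x /\ x + d * A <= x1 /\ y0 <= y /\ y + d * B <= y1 /\
 eps * (d * d) < Cmod (rect_int F x (x + d * A) y (y + d * B)).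

Lemma bad_rect_half eps x y d : bad_rect eps (x, y, d) ->
 exists x' y', bad_rect eps (x', y', d/2) /\ x <= x' /\ x' + d/2 * A <= x + d * A /\ y <= y' /\ y' + d/2*B <= y + d * B.
Proof.
 intros (Hd & H1 & H2 & H3 & H4 & H5).
 assert (HA : 0 < A) by (unfold A; lra). assert (HB : 0 < B) by (unfold B; lra).
 assert (HdA : 0 < d * A) by nra. assert (HdB : 0 < d * B) by nra.
 set (xm := x + d/2*A). set (ym := y + d/2*B).
 assert (E : rect_int F x (x + d * A) y (y + d * B) =
  (rect_int F x xm y ym + rect_int F x xm ym (y + d*B) + rect_int F xm (x + d*A) y ym + rect_int F xm (x+d*A) ym (y + d*B))%C).
 { rewrite (rect_int_split_x F x xm); [|unfold xm; lra|lra|].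
  rewrite (rect_int_split_y F x xm y ym), (rect_int_split_y F xm (x+d*A) y ym).
  ring. all: unfold xm, ym in *; try lra.
  all: intros; split; apply HFc; unfold rect; simpl; lra. }
 destruct (Rlt_dec (eps * (d/2*(d/2))) (Cmod (rect_int F x xm y ym))) as [h|h1].
 { exists x, y. repeat split; simpl; try (unfold xm, ym in *; lra). }
 destruct (Rlt_dec (eps * (d/2*(d/2))) (Cmod (rect_int F x xm ym (y+d*B)))) as [h|h2].
 { exists x, ym. repeat split; simpl; try (unfold xm, ym in *; lra).
  replace (ym + d/2*B) with (y + d*B) by (unfold ym; field). easy. }
 destruct (Rlt_dec (eps * (d/2*(d/2))) (Cmod (rect_int F xm (x+d*A) y ym))) as [h|h3].
 { exists xm, y. repeat split; simpl; try (unfold xm, ym in *; lra).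
  replace (xm + d/2*A) with (x + d*A) by (unfold xm; field). easy. }
 destruct (Rlt_dec (eps * (d/2*(d/2))) (Cmod (rect_int F xm (x+d*A) ym (y+d*B)))) as [h|h4].
 { exists xm, ym. repeat split; simpl; try (unfold xm, ym in *; lra).
  replace (xm + d/2*A) with (x + d*A) by (unfold xm; field). replace (ym + d/2*B) with (y + d*B) by (unfold ym; field). easy. }
  rewrite E in H5.
 assert (H6 := Cmod_triangle (rect_int F x xm y ym + rect_int F x xm ym (y + d*B) + rect_int F xm (x + d*A) y ym) (rect_int F xm (x+d*A) ym (y + d*B))).
 assert (H7 := Cmod_triangle (rect_int F x xm y ym + rect_int F x xm ym (y + d*B)) (rect_int F xm (x + d*A) y ym)).
 assert (H8 := Cmod_triangle (rect_int F x xm y ym) (rect_int F x xm ym (y + d*B))). lra.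
Qed.

Lemma goursat_le eps : 0 < eps -> Cmod (rect_int F x0 x1 y0 y1) <= eps.
Proof.
 intros He. apply Rnot_lt_le. intros Hbad.
 assert (HA : 0 < A) by (unfold A; lra). assert (HB : 0 < B) by (unfold B; lra).
 set (rel := fun p p' : R * R * R => let '(x, y, d) := p in let '(x', y', d') := p' in
   bad_rect eps p' /\ d' = d/2 /\ x <= x' /\ x' + d' * A <= x + d * A /\ y <= y' /\ y' + d'*B <= y + d * B).
 set (nx := fun p => epsilon (inhabits p) (fun p' => rel p p')).
 set (sq := fix sq k := match k with O => (x0, y0, 1) | S k => nx (sq k) end).
 assert (Hs : forall k, bad_rect eps (sq k)).
 { induction k as [|k IH].
  - simpl. replace (x0 + 1 * A) with x1 by (unfold A; ring). replace (y0 + 1 * B) with y1 by (unfold B; ring). lra.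
  - simpl. assert (Hr : rel (sq k) (nx (sq k))).
   { apply epsilon_spec. destruct (sq k) as [[x y] d]. destruct (bad_rect_half eps x y d IH) as (x' & y' & Hb & Hr).
    exists (x', y', d/2). easy. }
   unfold rel in Hr. destruct (sq k) as [[x y] d]. destruct (nx (x, y, d)) as [[x' y'] d']. tauto. }
 assert (Hr : forall k, rel (sq k) (sq (S k))).
 { intros k. simpl. apply epsilon_spec. generalize (Hs k). destruct (sq k) as [[x y] d]. intros Hb.
  destruct (bad_rect_half eps x y d Hb) as (x' & y' & Hb' & Hr). exists (x', y', d/2). easy. }
 set (X := fun k => fst (fst (sq k))). set (Y := fun k => snd (fst (sq k))). set (D := fun k => snd (sq k)).
 assert (HX : forall k, X k <= X (S k) /\ X (S k) + D (S k) * A <= X k + D k * A /\ Y k <= Y (S k) /\ Y (S k) + D (S k) * B <= Y k + D k * B /\ D (S k) = D k / 2).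
 { intros k. generalize (Hr k). unfold X, Y, D, rel. destruct (sq k) as [[x y] d]. destruct (sq (S k)) as [[x' y'] d']. easy. }
 assert (HD : forall k, D k = (/2)^k).
 { induction k. easy. destruct (HX k) as (_ & _ & _ & _ & ->). rewrite IHk. simpl. field. }
 assert (HD0 : forall k, 0 < D k) by (intros; rewrite HD; apply pow_lt; lra).
 assert (Hm : forall k j, X k <= X (k + j)%nat /\ X (k+j)%nat + D (k+j)%nat * A <= X k + D k * A /\ Y k <= Y (k+j)%nat /\ Y (k+j)%nat + D (k+j)%nat * B <= Y k + D k * B).
 { intros k j. induction j. rewrite Nat.add_0_r. lra. rewrite Nat.add_succ_r. destruct (HX (k+j)%nat) as (a1 & a2 & a3 & a4 & _). lra. }
 assert (Hxx : forall k j, X k <= X j + D j * A /\ Y k <= Y j + D j * B).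
 { intros k j. destruct (Hm k j) as (a1 & a2 & a3 & a4). destruct (Hm j k) as (b1 & b2 & b3 & b4). rewrite Nat.add_comm in b1, b2, b3, b4.
  assert (0 < D (k+j)%nat * A) by pos. pos. }
 assert (HL : forall Z W : nat -> R, (forall k j, Z k <= W j) -> exists q, forall k, Z k <= q <= W k).
 { intros Z W HZ. destruct (completeness (fun v => exists k, v = Z k)) as (q & Hq1 & Hq2).
  - exists (W O). intros v (k & ->). easy.
  - exists (Z O), O; easy.
  - exists q. intros k. split; [eauto|]. apply Hq2. intros v (j & ->). easy. }
 destruct (HL X (fun j => X j + D j * A)) as (qx & Hqx); [intros; apply Hxx|].
 destruct (HL Y (fun j => Y j + D j * B)) as (qy & Hqy); [intros; apply Hxx|].
 assert (Hq : rect x0 x1 y0 y1 (qx, qy)).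
 { generalize (Hqx O) (Hqy O). unfold X, Y, D, rect, A, B; simpl. lra. }
 destruct (HF _ Hq) as (L & HLd).
 set (AB := A + B). assert (HAB : 0 < AB) by (unfold AB; lra).
 (* On the boundary of the [k]-th rectangle the remainder is at most [eta * (d * AB)]; the perimeter
    bound then gives exactly [eps * (d * d)], against [bad_rect]. *)
 set (eta := eps / (2 * (AB * AB))). assert (Heta : 0 < eta) by pos.
 destruct (HLd eta Heta) as (dl & Hdl & Hloc).
 destruct (pow_lt_1_zero (/2)) with (y := dl / AB) as (k & Hk). { rewrite Rabs_right; lra. } { pos. }
 specialize (Hk k (le_n k)). rewrite Rabs_right in Hk. 2:{ pos. }
 rewrite <- HD in Hk.
 assert (HkAB : D k * AB < dl). { apply (Rmult_lt_compat_r AB) in Hk; [|easy]. replace (dl / AB * AB) with dl in Hk by (field; lra). easy. }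
 generalize (Hs k) (Hqx k) (Hqy k) (HD0 k). unfold X, Y, D in *. destruct (sq k) as [[x y] d]. cbn [fst snd] in *.
 intros (Hd & H1 & H2 & H3 & H4 & H5) Qx Qy _.
 set (G := (fun z => L * z + (F (qx, qy) - L * (qx, qy)))%C).
 assert (HG : forall z, ccont G z). { intros z. apply is_cd_ccont with (L * 1 + 0)%C. apply is_cd_plus; [apply is_cd_scal, is_cd_id|apply is_cd_const]. }
 assert (HFr : forall z, rect x (x + d * A) y (y + d * B) z -> ccont F z). { intros z [h1 h2]. apply HFc. unfold rect; lra. }
 assert (E : rect_int (fun z => F z - G z)%C x (x + d*A) y (y + d*B) = rect_int F x (x + d*A) y (y + d*B)).
 { rewrite rect_int_minus; [|lra|lra|easy|easy]. unfold G. rewrite rect_int_affine by lra. ring. }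
 assert (Hcc : forall z, rect x (x + d * A) y (y + d * B) z -> ccont (fun z => F z - G z)%C z).
 { intros z Hz. destruct (HF z) as (L1 & HL1). { destruct Hz; unfold rect; lra. }
  apply is_cd_ccont with (L1 - (L * 1 + 0))%C. apply is_cd_minus; [easy|]. apply is_cd_plus; [apply is_cd_scal, is_cd_id|apply is_cd_const]. }
 assert (Hbd : forall z, rect x (x + d * A) y (y + d * B) z -> Cmod (F z - G z)%C <= eta * (d * AB)).
 { intros z [Hz1 Hz2]. set (t := (z - (qx, qy))%C).
  assert (Ht : Cmod t <= d * AB).
  { via Cmod_le_abs. unfold t, Cminus, Cplus, Copp; simpl. unfold AB.
   rewrite Rmult_plus_distr_l. apply Rplus_le_compat; apply Rabs_le; lra. }
  specialize (Hloc t ltac:(lra)). replace ((qx, qy) + t)%C with z in Hloc by (unfold t; ring).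
  replace (F z - G z)%C with (F z - F (qx, qy) - L * t)%C by (unfold G, t; ring).
  pos. }
 assert (HN : Cmod (rect_int (fun z => F z - G z)%C x (x + d*A) y (y + d*B)) <= 2 * (eta * (d * AB)) * ((x + d*A - x) + (y + d*B - y))).
 { apply rect_int_norm; try lra; intros; split; (apply Hcc || apply Hbd); unfold rect; simpl; lra. }
 rewrite E in HN. replace (2 * (eta * (d * AB)) * ((x + d*A - x) + (y + d*B - y))) with (eps * (d * d)) in HN; [lra|].
 unfold eta. replace ((x + d*A - x) + (y + d*B - y)) with (d * AB) by (unfold AB; ring). field. lra.
Qed.

Lemma goursat : rect_int F x0 x1 y0 y1 = 0%C.
Proof. apply Cmod_small_eq. replace (rect_int F x0 x1 y0 y1 - 0)%C with (rect_int F x0 x1 y0 y1) by ring. apply goursat_le; easy. Qed.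
End Goursat.

Lemma goursat_rect F x0 x1 y0 y1 : x0 <= x1 -> y0 <= y1 -> (forall z, rect x0 x1 y0 y1 z -> cdf F z) -> rect_int F x0 x1 y0 y1 = 0%C.
Proof.
 intros Hx Hy H. destruct (Req_dec x0 x1) as [->|hx].
 - unfold rect_int, CI. rewrite !RInt_point. ring.
 - destruct (Req_dec y0 y1) as [->|hy].
  + unfold rect_int, CI. rewrite !RInt_point. ring.
  + apply goursat; try lra; easy.
Qed.

Lemma CI_period (f : R -> C) c : (forall x, f (x + 1) = f x) -> (forall x, path_cont f x) -> CI f c (c + 1) = CI f 0 1.
Proof.
 intros Hp Hc.
 assert (Hk : forall (k : Z) x, f (x + IZR k) = f x).
 { assert (Hn : forall (m : nat) x, f (x + INR m) = f x).
  { induction m; intros. simpl. f_equal; ring. rewrite S_INR, <- Rplus_assoc, Hp. easy. }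
  intros k x. destruct (Z_le_dec 0 k).
  - rewrite <- (Z2Nat.id k), <- INR_IZR_INZ by easy. easy.
  - rewrite <- (Hn (Z.to_nat (-k)) (x + IZR k)). f_equal. rewrite INR_IZR_INZ, Z2Nat.id, opp_IZR by lia. ring. }
 assert (H0 : forall c, 0 <= c <= 1 -> CI f c (c+1) = CI f 0 1).
 { intros c' Hc'. rewrite (CI_chasles f c' 1 (c' + 1)), (CI_chasles f 0 c' 1) by (try lra; intros; apply Hc).
  replace (CI f 1 (c' + 1)) with (CI f 0 c'). ring.
  rewrite <- (Rplus_0_l 1) at 1. rewrite <- CI_shift by easy. apply CI_ext; [lra|]. easy. }
 destruct (archimed c) as [h1 h2]. set (k := (up c - 1)%Z).
 assert (Ek : IZR k = IZR (up c) - 1) by (unfold k; rewrite minus_IZR; ring).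
 rewrite <- (H0 (c - IZR k)) by lra.
 replace c with ((c - IZR k) + IZR k) at 1 2 by ring.
 replace (c - IZR k + IZR k + 1) with ((c - IZR k + 1) + IZR k) by ring.
 rewrite <- CI_shift by (try lra; intros; apply Hc). apply CI_ext; [lra|]. easy.
Qed.

(** Goursat on a rectangle one period wide, whose vertical sides cancel. It makes Fourier
    coefficients independent of the height ([coef_indep]). *)
Lemma mean_const F y0 y1 c : y0 <= y1 -> (forall z, y0 <= snd z <= y1 -> cdf F z) ->
 (forall z, y0 <= snd z <= y1 -> F (z + 1)%C = F z) ->
 CI (fun x => F (x, y0)) c (c + 1) = CI (fun x => F (x, y1)) c (c + 1).
Proof.
 intros Hy HF Hp. assert (E := goursat_rect F c (c + 1) y0 y1 ltac:(lra) Hy).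
 unfold rect_int in E. specialize (E ltac:(intros z [_ h]; apply HF; easy)).
 assert (E2 : CI (fun y => F (c + 1, y)) y0 y1 = CI (fun y => F (c, y)) y0 y1).
 { apply CI_ext; [easy|]. intros y h. rewrite <- (Hp (c, y)) by easy. f_equal. unfold Cplus, RtoC; simpl. f_equal; ring. }
 rewrite E2 in E. match type of E with (?u + ?v - ?w - ?v)%C = _ => replace (u + v - w - v)%C with (u - w)%C in E by ring; set (p := u) in *; set (q := w) in * end.
 replace p with ((p - q) + q)%C by ring. rewrite E. ring.
Qed.

(** * Laurent expansion of periodic holomorphic functions *)

Fixpoint csum (n : nat) (f : nat -> C) : C := match n with O => RtoC 0 | S n => (csum n f + f n)%C end.
Fixpoint rsum (n : nat) (f : nat -> R) : R := match n with O => 0 | S n => rsum n f + f n end.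

Lemma csum_ext n f g : (forall i, (i < n)%nat -> f i = g i) -> csum n f = csum n g.
Proof. induction n; intros H; simpl; [easy|]. f_equal; auto. Qed.
Lemma rsum_ext n f g : (forall i, (i < n)%nat -> f i = g i) -> rsum n f = rsum n g.
Proof. induction n; intros H; simpl; [easy|]. f_equal; auto. Qed.
Lemma csum_plus n f g : csum n (fun i => f i + g i)%C = (csum n f + csum n g)%C.
Proof. induction n; simpl; [|rewrite IHn]; ring. Qed.
Lemma csum_minus n f g : csum n (fun i => f i - g i)%C = (csum n f - csum n g)%C.
Proof. induction n; simpl; [|rewrite IHn]; ring. Qed.
Lemma csum_scal n c f : csum n (fun i => c * f i)%C = (c * csum n f)%C.
Proof. induction n; simpl; [|rewrite IHn]; ring. Qed.
Lemma csum_scal_r n c f : csum n (fun i => f i * c)%C = (csum n f * c)%C.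
Proof. induction n; simpl; [|rewrite IHn]; ring. Qed.
Lemma csum_0 n (f : nat -> C) : (forall i, (i < n)%nat -> f i = 0%C) -> csum n f = 0%C.
Proof. induction n; intros H; simpl; [easy|]. rewrite IHn, H by auto. ring. Qed.
Lemma rsum_plus n f g : rsum n (fun i => f i + g i) = rsum n f + rsum n g.
Proof. induction n; simpl; [|lra]; ring. Qed.
Lemma rsum_scal n c f : rsum n (fun i => c * f i) = c * rsum n f.
Proof. induction n; simpl; [|lra]; ring. Qed.
Lemma rsum_const n c : rsum n (fun _ => c) = INR n * c.
Proof. induction n; [cmp; ring|]. rewrite S_INR. simpl. lra. Qed.
Lemma rsum_le n f g : (forall i, (i < n)%nat -> f i <= g i) -> rsum n f <= rsum n g.
Proof. induction n; intros H; simpl; [lra|]. apply Rplus_le_compat; auto. Qed.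
Lemma rsum_le_const n f c : (forall i, (i < n)%nat -> f i <= c) -> rsum n f <= INR n * c.
Proof. intros. rewrite <- rsum_const. apply rsum_le; easy. Qed.
Lemma rsum_pos n f : (forall i, (i < n)%nat -> 0 <= f i) -> 0 <= rsum n f.
Proof. intros H. replace 0 with (rsum n (fun _ => 0)) by (rewrite rsum_const; ring). apply rsum_le; easy. Qed.
Lemma rsum_term_le n f i : (forall j, (j < n)%nat -> 0 <= f j) -> (i < n)%nat -> f i <= rsum n f.
Proof.
 induction n; intros H Hi; [lia|]. simpl. destruct (Nat.eq_dec i n) as [->|].
 - assert (0 <= rsum n f) by (apply rsum_pos; auto). lra.
 - assert (f i <= rsum n f) by intuition. assert (0 <= f n) by auto. lra.
Qed.
Lemma csum_norm n f : Cmod (csum n f) <= rsum n (fun i => Cmod (f i)).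
Proof. induction n; simpl. rewrite Cmod_0; lra. via Cmod_triangle. lra. Qed.
Lemma csum_norm_le n f c : (forall i, (i < n)%nat -> Cmod (f i) <= c) -> Cmod (csum n f) <= INR n * c.
Proof. intros. via csum_norm. apply rsum_le_const; easy. Qed.
Lemma csum_swap n m f : csum n (fun i => csum m (fun j => f i j)) = csum m (fun j => csum n (fun i => f i j)).
Proof. induction n; simpl. symmetry; apply csum_0; easy. rewrite IHn, <- csum_plus. easy. Qed.
Lemma csum_split n m f : csum (n + m) f = (csum n f + csum m (fun i => f (n + i)%nat))%C.
Proof. induction m; simpl. rewrite Nat.add_0_r; ring. rewrite Nat.add_succ_r; simpl. rewrite IHm; ring. Qed.
Lemma csum_delta n j f : (j < n)%nat -> csum n (fun i => if Nat.eqb i j then f i else 0%C) = f j.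
Proof.
 induction n; intros H; [lia|]. simpl. destruct (Nat.eq_dec j n) as [->|].
 - rewrite Nat.eqb_refl. transitivity (0 + f n)%C; [f_equal|ring]. apply csum_0. intros i Hi. cmp; easy.
 - rewrite IHn by lia. cmp; ring.
Qed.
Lemma csum_shift n f : csum (S n) f = (f O + csum n (fun i => f (S i)))%C.
Proof. induction n. simpl; ring. change (csum (S (S n)) f) with (csum (S n) f + f (S n))%C. rewrite IHn. cmp; ring. Qed.

Lemma CI_csum n (f : nat -> R -> C) a b : a <= b -> (forall i x, (i < n)%nat -> a <= x <= b -> path_cont (f i) x) ->
 CI (fun x => csum n (fun i => f i x)) a b = csum n (fun i => CI (f i) a b) /\
 (forall x, a <= x <= b -> path_cont (fun x => csum n (fun i => f i x)) x).
Proof.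
 intros Hab. induction n; intros H; simpl.
 - split; [rewrite CI_const; ring|intros; apply cc_const].
 - destruct IHn as [E Hc]; [auto|]. split.
  + rewrite CI_plus, E; try easy. auto.
  + intros; apply cc_plus; [auto|auto].
Qed.

Lemma geom_id (u : C) K : u <> 1%C -> (/ (1 - u))%C = (csum K (fun m => u ^ m) + u ^ K / (1 - u))%C.
Proof.
 intros Hu. assert (Hn : (1 - u)%C <> 0%C). { intros E. apply Hu. replace u with (1 - (1 - u))%C by ring. rewrite E. ring. }
 induction K; simpl. field; easy. rewrite IHK at 1. field; pos.
Qed.

Lemma path_cont_inv f x : path_cont f x -> f x <> 0%C -> path_cont (fun t => / f t)%C x.
Proof. intros H Hn. apply (cc_comp (fun z => / z)%C f); [|easy]. eapply is_cd_ccont, is_cd_inv; easy. Qed.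

Lemma path_cont_pow f m x : path_cont f x -> path_cont (fun t => f t ^ m)%C x.
Proof. intros H; induction m; simpl. apply cc_const. apply cc_mult; easy. Qed.

(** Term by term integration of a geometric kernel with an explicit tail, so that no series has to
    be summed. *)
Lemma CI_geom (G u : R -> C) a b M q K : a <= b -> (forall x, path_cont G x) -> (forall x, path_cont u x) ->
 0 <= q < 1 -> (forall x, Cmod (u x) <= q) -> (forall x, Cmod (G x) <= M) ->
 Cmod (CI (fun x => G x / (1 - u x))%C a b - csum K (fun m => CI (fun x => G x * u x ^ m)%C a b)) <= M * (q ^ K / (1 - q)) * (b - a).
Proof.
 intros Hab HG Hu Hq Hub HM.
 assert (Hn : forall x, u x <> 1%C). { intros x E. specialize (Hub x). rewrite E, Cmod_1 in Hub. lra. }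
 assert (Hn0 : forall x, (1 - u x)%C <> 0%C). { intros x E. apply (Hn x). replace (u x) with (1 - (1 - u x))%C by ring. rewrite E. ring. }
 assert (Hpc : forall m x, path_cont (fun x => G x * u x ^ m)%C x) by (intros; apply cc_mult; [easy|apply path_cont_pow; easy]).
 assert (Hpi : forall x, path_cont (fun x => / (1 - u x))%C x) by (intros; apply path_cont_inv; [apply cc_minus; [apply cc_const|easy]|easy]).
 destruct (CI_csum K (fun m x => G x * u x ^ m)%C a b Hab) as [E Hc]; [easy|].
 rewrite <- E, <- CI_minus; try easy.
 2:{ intros; apply cc_mult; easy. }
 rewrite (CI_ext _ (fun x => G x * (u x ^ K * / (1 - u x)))%C); [|easy|].
 - apply CI_norm; [easy| |].
  + intros. repeat apply cc_mult; try easy. apply path_cont_pow; easy.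
  + intros x _. rewrite !Cmod_mult, Cmod_pow, Cmod_inv by easy. apply Rmult_le_compat; [pos| |easy|].
   * apply Rmult_le_pos; [pos|]. left. apply Rinv_0_lt_compat, Cmod_gt_0; easy.
   * apply Rmult_le_compat.
    -- pos.
    -- left. apply Rinv_0_lt_compat, Cmod_gt_0; easy.
    -- apply pow_incr. split; pos.
    -- apply Rinv_le_contravar; [lra|]. generalize (Cmod_le_add 1 (1 - u x)).
      replace (1 - (1 - u x))%C with (u x) by ring. rewrite Cmod_1. specialize (Hub x). lra.
 - intros x _. unfold Cdiv. rewrite csum_scal. rewrite (geom_id (u x) K) at 1 by easy. unfold Cdiv. change (csum K (Cpow (u x))) with (csum K (fun m => u x ^ m))%C. ring.
Qed.

Definition cek (k : Z) (z : C) : C := ce (RtoC (IZR k) * z).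

Lemma cek_add k l z : cek (k + l) z = (cek k z * cek l z)%C.
Proof. unfold cek. rewrite <- ce_plus, plus_IZR, RtoC_plus. f_equal. ring. Qed.
Lemma cek_0 z : cek 0 z = 1%C.
Proof. unfold cek. rewrite Cmult_0_l. apply ce_0. Qed.
Lemma cek_pow z m : (ce z ^ m)%C = cek (Z.of_nat m) z.
Proof.
 induction m. rewrite cek_0; easy.
 rewrite Nat2Z.inj_succ. replace (Z.succ (Z.of_nat m)) with (1 + Z.of_nat m)%Z by lia. rewrite cek_add, <- IHm.
 simpl. f_equal. unfold cek. f_equal. ring.
Qed.
Lemma cek_plus k z w : cek k (z + w) = (cek k z * cek k w)%C.
Proof. unfold cek. rewrite <- ce_plus. f_equal; ring. Qed.
Lemma cek_opp k z : cek (- k) z = cek k (- z).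
Proof. unfold cek. f_equal. rewrite opp_IZR, RtoC_opp. ring. Qed.
Lemma Cmod_cek k z : Cmod (cek k z) = exp (- (2 * PI * (IZR k * snd z))).
Proof. unfold cek. rewrite Cmod_ce. do 3 f_equal. cmp; ring. Qed.
Lemma cek_period k z (j : Z) : cek k (z + RtoC (IZR j)) = cek k z.
Proof. rewrite cek_plus. unfold cek at 2. rewrite <- RtoC_mult, <- mult_IZR, ce_int. ring. Qed.
Lemma is_cd_cek k z : is_cd (cek k) z (c2pi * RtoC (IZR k) * cek k z).
Proof.
 unfold cek. replace (c2pi * RtoC (IZR k) * ce (RtoC (IZR k) * z))%C with ((c2pi * ce (RtoC (IZR k) * z)) * (RtoC (IZR k) * 1))%C by ring.
 apply (is_cd_comp ce (fun t => RtoC (IZR k) * t)%C). apply is_cd_scal, is_cd_id. apply is_cd_ce.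
Qed.

Lemma c2pi_neq0 : c2pi <> 0%C.
Proof. intros E. apply (f_equal snd) in E. simpl in E. generalize PI_RGT_0; lra. Qed.

Lemma is_cd_path F x y L : is_cd F (x, y) L -> path_deriv (fun t => F (t, y)) x L.
Proof.
 intros H.
 assert (K : forall eps, 0 < eps -> exists d, 0 < d /\ forall h, h <> 0 -> Rabs h < d ->
   Cmod ((F ((x + h)%R, y) - F (x, y)) * RtoC (/ h) - L)%C < eps).
 { intros eps He. destruct (H (eps/2)) as (d & Hd & Ht); [lra|]. exists d; split; [easy|]. intros h Hh Hhd.
  specialize (Ht (RtoC h)). rewrite Cmod_R in Ht.
  replace ((x, y) + RtoC h)%C with ((x + h, y) : C) in Ht by (unfold Cplus, RtoC; simpl; f_equal; ring).
  replace ((F ((x + h)%R, y) - F (x, y)) * RtoC (/ h) - L)%C with ((F ((x + h)%R, y) - F (x, y) - L * RtoC h) * RtoC (/ h))%C.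
  - rewrite Cmod_mult, Cmod_R, Rabs_inv. apply Rle_lt_trans with (eps / 2); [|lra].
   assert (0 < Rabs h) by (apply Rabs_pos_lt; easy).
   apply (Rmult_le_reg_r (Rabs h)); [easy|]. rewrite Rmult_assoc, Rinv_l by lra. lra.
  - rewrite RtoC_inv by easy. field. intros E; apply Hh; apply RtoC_inj; easy. }
 split; apply is_derive_Reals; intros eps He; destruct (K eps He) as (d & Hd & Ht); exists (mkposreal d Hd); intros h Hh Hhd;
  specialize (Ht h Hh Hhd); (eapply Rle_lt_trans; [|eauto]).
 - eapply Rle_trans; [|apply Cmod_re_le]. right; f_equal. unfold Cminus, Cplus, Copp, Cmult, RtoC; simpl. lra.
 - eapply Rle_trans; [|apply Cmod_im_le]. right; f_equal. unfold Cminus, Cplus, Copp, Cmult, RtoC; simpl. lra.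
Qed.

Section Laurent.
Variables (F : C -> C) (a b M : R).
Hypothesis HF : forall z : C, a < snd z < b -> cdf F z.
Hypothesis Hp : forall z : C, a < snd z < b -> F (z + 1)%C = F z.
Hypothesis HM : forall z : C, a < snd z < b -> Cmod (F z) <= M.

Let HFc (z : C) : a < snd z < b -> ccont F z.
Proof. intros H. destruct (HF z H) as [L HL]. apply (is_cd_ccont F z L HL). Qed.

(** On the cylinder the Cauchy kernel is 1 / (1 - e^{2 pi i (z - w)}). Subtracting [F z] makes the
    quotient bounded near [z], so that a small square around [z] can be discarded and no residue is
    computed; the vertical sides cancel by periodicity. *)
Lemma cauchy_cyl (z : C) (y0 y1 : R) : a < y0 < snd z -> snd z < y1 < b ->
 let c := fst z - /2 in
 CI (fun x => (F (x, y0) - F z) / (1 - ce (z - (x, y0))))%C c (c + 1) =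
 CI (fun x => (F (x, y1) - F z) / (1 - ce (z - (x, y1))))%C c (c + 1).
Proof.
 intros H0 H1 c. set (Q := fun w => ((F w - F z) / (1 - ce (z - w)))%C).
 (* The rectangle is one period wide and centred at [z]: the denominator then vanishes at [z]
    alone. *)
 assert (Hinj : forall u : C, Rabs (fst u) <= /2 -> ce u = 1%C -> u = 0%C).
 { intros [x y] Hu E. simpl in Hu. assert (E1 := Cmod_ce (x, y)). rewrite E, Cmod_1 in E1. simpl in E1.
  assert (Hpi := PI_RGT_0).
  assert (y = 0). { rewrite <- exp_0 in E1. apply exp_inv in E1. nra. } subst y.
  unfold ce in E; simpl in E. rewrite Rmult_0_r, Ropp_0, exp_0, !Rmult_1_l in E. apply (f_equal fst) in E. simpl in E.
  assert (E2 : cos (2 * PI * Rabs x) = 1). { unfold Rabs. destruct (Rcase_abs x); [|easy]. rewrite <- E, <- cos_neg. f_equal. ring. }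
  destruct (Req_dec x 0) as [->|hx]; [easy|]. assert (0 < Rabs x) by (apply Rabs_pos_lt; easy).
  assert (cos (2 * PI * Rabs x) < cos 0). { apply cos_decreasing_1; try lra; try nra. } rewrite cos_0 in H2. lra. }
 assert (HQ : forall w : C, a < snd w < b -> Rabs (fst w - fst z) <= /2 -> w <> z -> cdf Q w).
 { intros w Hw Hwz Hne. destruct (HF w Hw) as [L HL].
  assert (Hn0 : (1 - ce (z - w))%C <> 0%C).
  { intros E. apply Hne. assert (E1 : ce (z - w) = 1%C). { replace (ce (z - w)) with (1 - (1 - ce (z - w)))%C by ring. rewrite E; ring. }
   apply Hinj in E1. replace z with (w + (z - w))%C by ring. rewrite E1. ring.
   unfold Cminus, Cplus, Copp; simpl. rewrite <- Rabs_Ropp. replace (- (fst z + - fst w)) with (fst w - fst z) by ring. easy. }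
  eexists. apply (is_cd_mult (fun w => F w - F z)%C (fun w => / (1 - ce (z - w)))%C).
  - apply is_cd_minus; [eauto|apply is_cd_const].
  - apply (is_cd_comp (fun u => / u)%C (fun w => 1 - ce (z - w))%C).
   + apply is_cd_minus; [apply is_cd_const|]. apply (is_cd_comp ce (fun w => z - w)%C); [|apply is_cd_ce].
    apply is_cd_minus; [apply is_cd_const|apply is_cd_id].
   + apply is_cd_inv; easy. }
 assert (HB : exists r B, 0 < r /\ forall w, 0 < Cmod (w - z) < r -> Cmod (Q w) <= B).
 { destruct (HF z) as [L HL]; [lra|]. destruct (HL 1 Rlt_0_1) as (r1 & Hr1 & B1). destruct (ce_cd0 1 Rlt_0_1) as (r2 & Hr2 & B2).
  exists (Rmin r1 r2), (1 + Cmod L). split; [pos|]. intros w [Hw0 Hw].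
  set (t := (w - z)%C) in *. specialize (B1 t (Rlt_le_trans _ _ _ Hw (Rmin_l _ _))).
  specialize (B2 (- t)%C). rewrite Cmod_opp in B2. specialize (B2 (Rlt_le_trans _ _ _ Hw (Rmin_r _ _))).
  rewrite ce_0, Cplus_0_l in B2. replace (z + t)%C with w in B1 by (unfold t; ring).
  assert (D : Cmod t <= Cmod (1 - ce (- t))).
  { assert (T : Cmod (c2pi * - t) <= Cmod (1 - ce (-t)) + Cmod (ce (- t) - 1 - c2pi * - t)).
   { eapply Rle_trans; [|apply Cmod_triangle]. rewrite <- Cmod_opp. right; f_equal; ring. }
   rewrite Cmod_mult, Cmod_opp in T. assert (E : Cmod c2pi = 2 * PI).
   { unfold c2pi, Cmod; simpl. replace (0 * (0 * 1) + 2 * PI * (2 * PI * 1)) with ((2*PI)*(2*PI)) by ring. apply sqrt_square. generalize PI_RGT_0; lra. }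
    assert (3 < PI) by (generalize PI2_3_2; lra). nra. }
  assert (Nn : Cmod (F w - F z) <= (1 + Cmod L) * Cmod t).
  { replace (F w - F z)%C with ((F w - F z - L * t) + L * t)%C by ring. via Cmod_triangle. rewrite Cmod_mult. lra. }
  unfold Q. replace (z - w)%C with (- t)%C by (unfold t; ring). rewrite Cmod_div.
  2:{ apply Cmod_gt_0. lra. }
  apply (Rmult_le_reg_r (Cmod (1 - ce (- t)))); [lra|]. unfold Rdiv. rewrite Rmult_assoc, Rinv_l, Rmult_1_r by lra.
  via Nn. apply Rmult_le_compat_l; [pos|easy]. }
 destruct HB as (r & B & Hr & HB).
 assert (HQc : forall w : C, a < snd w < b -> Rabs (fst w - fst z) <= /2 -> w <> z -> ccont Q w).
 { intros w h1 h2 h3. destruct (HQ w h1 h2 h3) as [L HL]. apply (is_cd_ccont Q w L HL). }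
 assert (HR : rect_int Q c (c + 1) y0 y1 = 0%C).
 { apply Cmod_small_eq. intros eps He.
  assert (HB0 : 0 <= Rabs B) by apply Rabs_pos. assert (HB1 : B <= Rabs B) by apply Rle_abs.
  (* Half the side of the square around [z]: it keeps the square inside the rectangle and inside the
     disc of radius [r] where [Q] is bounded, and it makes 8 [Rabs B] [eta], the bound of
     [rect_int_norm], at most [eps]. *)
  set (eta := Rmin (Rmin (/4) (r / 3)) (Rmin (Rmin (snd z - y0) (y1 - snd z)) (eps / (8 * (Rabs B + 1))))).
  assert (Heta : 0 < eta) by pos.
  assert (eta <= /4 /\ eta <= r / 3 /\ eta <= snd z - y0 /\ eta <= y1 - snd z /\ eta <= eps / (8 * (Rabs B + 1))).
  { unfold eta. generalize (Rmin_l (Rmin (/4) (r / 3)) (Rmin (Rmin (snd z - y0) (y1 - snd z)) (eps / (8 * (Rabs B + 1)))))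
    (Rmin_r (Rmin (/4) (r / 3)) (Rmin (Rmin (snd z - y0) (y1 - snd z)) (eps / (8 * (Rabs B + 1)))))
    (Rmin_l (/4) (r/3)) (Rmin_r (/4) (r/3)) (Rmin_l (Rmin (snd z - y0) (y1 - snd z)) (eps / (8 * (Rabs B + 1))))
    (Rmin_r (Rmin (snd z - y0) (y1 - snd z)) (eps / (8 * (Rabs B + 1)))) (Rmin_l (snd z - y0) (y1 - snd z)) (Rmin_r (snd z - y0) (y1 - snd z)). lra. }
  destruct H as (e1 & e2 & e3 & e4 & e5).
  assert (e6 : 8 * (Rabs B + 1) * eta <= eps).
  { apply (Rmult_le_compat_l (8 * (Rabs B + 1))) in e5; [|lra]. replace (8 * (Rabs B + 1) * (eps / (8 * (Rabs B + 1)))) with eps in e5 by (field; lra). easy. }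
  set (zx := fst z) in *. set (zy := snd z) in *.
  assert (Hcc : forall x y, y0 <= y <= y1 -> zx - /2 <= x <= zx + /2 -> (x <> zx \/ y <> zy) -> ccont Q (x, y)).
  { intros x y h1 h2 h3. apply HQc; simpl; try lra. apply Rabs_le; fold zx; lra. intros E. unfold zx, zy in h3. rewrite <- E in h3. intuition. }
  assert (Hcd : forall x0 x1 u v, zx - /2 <= x0 -> x0 <= x1 -> x1 <= zx + /2 -> y0 <= u -> u <= v -> v <= y1 -> (x1 < zx \/ zx < x0 \/ v < zy \/ zy < u) -> rect_int Q x0 x1 u v = 0%C).
  { intros x0 x1 u v h1 h2 h3 h4 h5 h6 h7. apply goursat_rect; try easy. intros w [w1 w2]. apply HQ; try lra. apply Rabs_le; fold zx; lra.
   intros E. rewrite E in w1, w2. fold zx in w1. fold zy in w2. lra. }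
  rewrite (rect_int_split_x Q c (zx - eta) (c + 1)); try (unfold c; lra).
  2:{ intros; split; apply Hcc; unfold c in *; lra. }
  rewrite (rect_int_split_x Q (zx - eta) (zx + eta) (c + 1)); try (unfold c; lra).
  2:{ intros; split; apply Hcc; unfold c in *; lra. }
  rewrite (rect_int_split_y Q (zx - eta) (zx + eta) y0 (zy - eta) y1); try (unfold c; lra).
  2:{ intros; split; apply Hcc; unfold c in *; lra. }
  rewrite (rect_int_split_y Q (zx - eta) (zx + eta) (zy - eta) (zy + eta) y1); try (unfold c; lra).
  2:{ intros; split; apply Hcc; unfold c in *; lra. }
  rewrite (Hcd c (zx - eta)), (Hcd (zx + eta) (c + 1)), (Hcd (zx - eta) (zx + eta) y0), (Hcd (zx - eta) (zx + eta) (zy + eta) y1);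
   try (unfold c; lra).
  match goal with |- Cmod ?e <= _ => replace e with (rect_int Q (zx - eta) (zx + eta) (zy - eta) (zy + eta)) by ring end.
  assert (Hbq : forall x y, Rabs (x - zx) <= eta -> Rabs (y - zy) <= eta -> (x <> zx \/ y <> zy) -> Cmod (Q (x, y)) <= Rabs B).
  { intros x y h1 h2 h3. eapply Rle_trans; [apply HB|easy]. split.
   - apply Cmod_gt_0. intros E. assert (E1 := f_equal fst E). assert (E2 := f_equal snd E). intuition.
   - eapply Rle_lt_trans; [apply Cmod_le_abs|]. unfold Cminus, Cplus, Copp; simpl. fold zx; fold zy.
    replace (x + - zx) with (x - zx) by ring. replace (y + - zy) with (y - zy) by ring. lra. }
  eapply Rle_trans; [apply (rect_int_norm Q _ _ _ _ (Rabs B)); try lra|].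
  1,2: intros; split; apply Hcc; lra.
  1,2: intros; split; apply Hbq; try apply Rabs_le; lra.
  lra. }
 unfold rect_int in HR.
 assert (E2 : CI (fun y => Q (c + 1, y)) y0 y1 = CI (fun y => Q (c, y)) y0 y1).
 { apply CI_ext; [lra|]. intros y h. unfold Q. replace ((c + 1, y) : C) with ((c, y) + 1)%C by (unfold Cplus, RtoC; simpl; f_equal; ring).
  rewrite Hp by (simpl; lra). replace (ce (z - ((c, y) + 1))) with (ce (z - (c, y))); [easy|].
  replace (z - (c, y))%C with ((z - ((c, y) + 1)) + RtoC (IZR 1))%C by ring. apply ce_period. }
 rewrite E2 in HR. match type of HR with (?u + ?v - ?w - ?v)%C = _ => replace (u + v - w - v)%C with (u - w)%C in HR by ring; set (p := u) in *; set (q := w) in * end.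
 change (p = q). replace p with ((p - q) + q)%C by ring. rewrite HR. ring.
Qed.

Definition coef (y : R) (k : Z) : C := CI (fun x => F (x, y) * cek (- k) (x, y))%C 0 1.

Let row_cont y : a < y < b -> forall x, path_cont (fun t => F (t, y)) x.
Proof. intros Hy x. apply path_cont_h, HFc; easy. Qed.

Lemma coef_indep y y' k : a < y < b -> a < y' < b -> coef y k = coef y' k.
Proof.
 assert (G : forall y y', a < y < b -> a < y' < b -> y <= y' -> coef y k = coef y' k).
 { intros u v Hu Hv Huv.
  assert (E := mean_const (fun z => F z * cek (- k) z)%C u v 0 Huv). rewrite Rplus_0_l in E. apply E.
  - intros z Hz. destruct (HF z) as [L HL]; [lra|]. eexists. apply is_cd_mult; [eauto|apply is_cd_cek].
  - intros z Hz. rewrite Hp by lra. f_equal. apply (cek_period (-k) z 1). }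
  destruct (Rle_dec y y'); [auto|symmetry; apply G; lra].
Qed.

Lemma coef_bound y k : a < y < b -> Cmod (coef y k) <= M * exp (2 * PI * (IZR k * y)).
Proof.
 intros Hy. replace (M * exp (2 * PI * (IZR k * y))) with (M * exp (2 * PI * (IZR k * y)) * (1 - 0)) by ring.
 apply CI_norm; [lra| |].
 - intros. apply cc_mult; [auto|]. apply (path_cont_h (cek (-k))). eapply is_cd_ccont, is_cd_cek.
 - intros x _. rewrite Cmod_mult, Cmod_cek. apply Rmult_le_compat; try apply Cmod_ge_0. left; apply exp_pos. apply HM; easy.
  right. f_equal. simpl. rewrite opp_IZR. ring.
Qed.

(** On the line below [z] the kernel expands in powers of e^{2 pi i (z - w)}, on the line above in
    powers of the inverse; the two tails are the two terms of the bound. *)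
Lemma laurent (z : C) (y y0 y1 : R) N : a < y < b -> a < y0 < snd z -> snd z < y1 < b ->
 let q0 := exp (- (2 * PI * (snd z - y0))) in let q1 := exp (- (2 * PI * (y1 - snd z))) in
 Cmod (F z - (csum (S N) (fun m => coef y (Z.of_nat m) * cek (Z.of_nat m) z)
       + csum N (fun m => coef y (- Z.of_nat (S m)) * cek (- Z.of_nat (S m)) z)))%C
  <= M * (q0 ^ S N / (1 - q0)) + M * (q1 ^ S N / (1 - q1)).
Proof.
 intros Hy H0 H1 q0 q1. set (c := fst z - /2).
 assert (Hpi := PI_RGT_0).
 assert (Hq : forall t, 0 < t -> 0 <= exp (- (2 * PI * t)) < 1).
 { split; [pos|]. rewrite <- exp_0. apply exp_increasing. nra. }
 assert (Hq0 : 0 <= q0 < 1) by (apply Hq; lra). assert (Hq1 : 0 <= q1 < 1) by (apply Hq; lra).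
 set (u0 := fun x : R => ce (z - (x, y0))). set (u1 := fun x : R => ce ((x, y1) - z)).
 assert (Hline : forall y x, path_cont (fun t => (t, y) : C) x).
 { intros v x. apply (path_cont_h (fun z => z)). eapply is_cd_ccont, is_cd_id. }
 assert (Hcce : forall z, ccont ce z) by (intros; eapply is_cd_ccont, is_cd_ce).
 assert (Hu0 : forall x, path_cont u0 x). { intros x. apply (cc_comp ce); [easy|]. apply cc_minus; [apply cc_const|easy]. }
 assert (Hu1 : forall x, path_cont u1 x). { intros x. apply (cc_comp ce); [easy|]. apply cc_minus; [easy|apply cc_const]. }
 assert (Bu0 : forall x, Cmod (u0 x) <= q0). { intros x. unfold u0. rewrite Cmod_ce. easy. }
 assert (Bu1 : forall x, Cmod (u1 x) <= q1). { intros x. unfold u1. rewrite Cmod_ce. easy. }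
 assert (N0 : forall x, (1 - u0 x)%C <> 0%C). { intros x E. specialize (Bu0 x). replace (u0 x) with (1 - (1 - u0 x))%C in Bu0 by ring. rewrite E in Bu0.
  replace (1 - 0)%C with (RtoC 1) in Bu0 by ring. rewrite Cmod_1 in Bu0. lra. }
 assert (N1 : forall x, (1 - u1 x)%C <> 0%C). { intros x E. specialize (Bu1 x). replace (u1 x) with (1 - (1 - u1 x))%C in Bu1 by ring. rewrite E in Bu1.
  replace (1 - 0)%C with (RtoC 1) in Bu1 by ring. rewrite Cmod_1 in Bu1. lra. }
 assert (F0 := row_cont y0 ltac:(lra)). assert (F1 := row_cont y1 ltac:(lra)).
 assert (Hint : forall k y, k <> 0%Z -> CI (fun x => cek k (x, y)) c (c + 1) = 0%C).
 { intros k v Hk. assert (Hkr : IZR k <> 0) by (apply not_0_IZR; easy).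
  rewrite (CI_ftc _ (fun x => / (c2pi * RtoC (IZR k)) * cek k (x, v))%C).
  - replace ((c + 1, v) : C) with ((c, v) + RtoC (IZR 1))%C by (unfold Cplus, RtoC; simpl; f_equal; ring). rewrite cek_period. ring.
  - lra.
  - intros. apply (path_cont_h (cek k)). eapply is_cd_ccont, is_cd_cek.
  - intros x _. replace (cek k (x, v)) with (/ (c2pi * RtoC (IZR k)) * (c2pi * RtoC (IZR k) * cek k (x, v)))%C.
   + apply (is_cd_path (fun z => / (c2pi * RtoC (IZR k)) * cek k z)%C). apply is_cd_scal, is_cd_cek.
   + field. split; [intros E; apply Hkr, RtoC_inj; easy|apply c2pi_neq0]. }
 (* [K0] and [K1] are, up to sign, the means of the kernel on the two lines, 1 below and 0 above.
    They take the place of the residue and turn [cauchy_cyl] into the Cauchy formula [EC]. *)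
 assert (K0 : CI (fun x => 1 / (1 - u0 x))%C c (c + 1) = 1%C).
 { apply Cmod_small_eq. intros eps He.
  destruct (pow_lt_1_zero q0) with (y := eps * (1 - q0)) as (n & Hn). rewrite Rabs_right; lra. nra.
  specialize (Hn (S n) ltac:(lia)). rewrite Rabs_right in Hn by pos.
  assert (G := CI_geom (fun _ => 1%C) u0 c (c + 1) 1 q0 (S n) ltac:(lra) (fun x => cc_const _ _) Hu0 Hq0 Bu0 ltac:(intros; rewrite ?Cmod_1; apply Req_le; apply Cmod_1)).
  rewrite csum_shift in G. rewrite csum_0 in G.
  - replace (CI (fun x => 1 * u0 x ^ 0)%C c (c+1)) with (RtoC 1) in G.
   + rewrite Cplus_0_r in G. via G. replace (c + 1 - c) with 1 by ring. rewrite Rmult_1_l, Rmult_1_r.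
    apply (Rmult_le_reg_r (1 - q0)); [lra|]. unfold Rdiv. rewrite Rmult_assoc, Rinv_l by lra. lra.
   + rewrite (CI_ext _ (fun _ => 1%C)); [|lra|intros; ring]. rewrite CI_const. replace (c + 1 - c) with 1 by ring. ring.
  - intros i _. rewrite (CI_ext _ (fun x => cek (Z.of_nat (S i)) z * cek (- Z.of_nat (S i)) (x, y0))%C); [|lra|].
   + rewrite CI_scal. rewrite Hint by lia. ring. lra. intros. apply (path_cont_h (cek _)). eapply is_cd_ccont, is_cd_cek.
   + intros x _. unfold u0. rewrite cek_pow. unfold Cminus. rewrite cek_plus, cek_opp. ring. }
 assert (K1 : CI (fun x => u1 x / (1 - u1 x))%C c (c + 1) = 0%C).
 { apply Cmod_small_eq. intros eps He.
  destruct (pow_lt_1_zero q1) with (y := eps * (1 - q1)) as (n & Hn). rewrite Rabs_right; lra. nra.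
  specialize (Hn (S n) ltac:(lia)). rewrite Rabs_right in Hn by pos.
  assert (G := CI_geom u1 u1 c (c + 1) 1 q1 (S n) ltac:(lra) Hu1 Hu1 Hq1 Bu1 ltac:(intros; eapply Rle_trans; [easy|lra])).
  rewrite csum_0 in G.
  - via G. replace (c + 1 - c) with 1 by ring. rewrite Rmult_1_l, Rmult_1_r.
    apply (Rmult_le_reg_r (1 - q1)); [lra|]. unfold Rdiv. rewrite Rmult_assoc, Rinv_l by lra. lra.
  - intros i _. rewrite (CI_ext _ (fun x => cek (- Z.of_nat (S i)) z * cek (Z.of_nat (S i)) (x, y1))%C); [|lra|].
   + rewrite CI_scal. rewrite Hint by lia. ring. lra. intros. apply (path_cont_h (cek _)). eapply is_cd_ccont, is_cd_cek.
   + intros x _. unfold u1. change (ce ((x, y1) - z) * ce ((x, y1) - z) ^ i)%C with (ce ((x, y1) - z) ^ (S i))%C.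
    rewrite cek_pow. unfold Cminus. rewrite cek_plus, <- cek_opp. ring. }
 assert (Hpi0 : forall x, path_cont (fun x => / (1 - u0 x))%C x) by (intros; apply path_cont_inv; [apply cc_minus; [apply cc_const|easy]|easy]).
 assert (Hpi1 : forall x, path_cont (fun x => / (1 - u1 x))%C x) by (intros; apply path_cont_inv; [apply cc_minus; [apply cc_const|easy]|easy]).
 assert (EC : F z = (CI (fun x => F (x, y0) / (1 - u0 x)) c (c + 1) + CI (fun x => (F (x, y1) * u1 x) / (1 - u1 x)) c (c + 1))%C).
 { assert (E := cauchy_cyl z y0 y1 H0 H1). cbv zeta in E. fold c in E.
  rewrite (CI_ext (fun x => (F (x, y0) - F z) / (1 - ce (z - (x, y0))))%C (fun x => F (x, y0) / (1 - u0 x) - F z * (1 / (1 - u0 x)))%C) in E;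
   [|lra|intros; unfold u0, Cdiv; ring].
  rewrite (CI_ext (fun x => (F (x, y1) - F z) / (1 - ce (z - (x, y1))))%C (fun x => F z * (u1 x / (1 - u1 x)) - (F (x, y1) * u1 x) / (1 - u1 x))%C) in E; [|lra|].
  - rewrite CI_minus, CI_minus, !CI_scal, K0, K1 in E; try lra;
    try (intros; repeat apply cc_mult; try apply cc_const; auto).
   match type of E with (?p - _ = _ - ?q)%C => set (A := p) in *; set (B := q) in * end.
   replace (F z) with (A - (A - F z * 1))%C by ring. rewrite E. ring.
  - intros x _. replace (ce (z - (x, y1))) with (/ u1 x)%C.
   + assert (Hnu : u1 x <> 0%C) by apply ce_neq0. specialize (N1 x). field. repeat split; try easy.
    intros E'. apply N1. replace (1 - u1 x)%C with (- (u1 x - 1))%C by ring. rewrite E'. ring.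
   + unfold u1. rewrite <- ce_opp. f_equal. ring. }
 assert (G0 := CI_geom (fun x => F (x, y0)) u0 c (c + 1) M q0 (S N) ltac:(lra) F0 Hu0 Hq0 Bu0 ltac:(intros; apply HM; simpl; lra)).
 assert (G1 := CI_geom (fun x => F (x, y1) * u1 x)%C u1 c (c + 1) (M * q1) q1 N ltac:(lra) ltac:(intros; apply cc_mult; auto) Hu1 Hq1 Bu1
  ltac:(intros; cbv beta; rewrite Cmod_mult; apply Rmult_le_compat; try apply Cmod_ge_0; [apply HM; simpl; lra|easy])). cbv beta in G0, G1.
 replace (M * q1 * (q1 ^ N / (1 - q1))) with (M * (q1 ^ S N / (1 - q1))) in G1 by (simpl; field; lra).
 assert (Hco : forall v k, a < v < b -> CI (fun x => F (x, v) * cek (- k) (x, v))%C c (c + 1) = coef y k).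
 { intros v k Hv. rewrite (coef_indep y v k) by easy. apply (CI_period (fun x => F (x, v) * cek (- k) (x, v))%C).
  - intros x. replace ((x + 1, v) : C) with ((x, v) + 1)%C by (unfold Cplus, RtoC; simpl; f_equal; ring).
   rewrite Hp by easy. f_equal. apply (cek_period (-k) (x, v) 1).
  - intros x. apply cc_mult; [auto|]. apply (path_cont_h (cek (-k))). eapply is_cd_ccont, is_cd_cek. }
 assert (S0 : csum (S N) (fun m => CI (fun x => F (x, y0) * u0 x ^ m)%C c (c + 1)) = csum (S N) (fun m => coef y (Z.of_nat m) * cek (Z.of_nat m) z)%C).
 { apply csum_ext. intros m _. rewrite (CI_ext _ (fun x => cek (Z.of_nat m) z * (F (x, y0) * cek (- Z.of_nat m) (x, y0)))%C); [|lra|].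
  - rewrite CI_scal, Hco; try lra. ring. intros. apply cc_mult; [easy|]. apply (path_cont_h (cek _)). eapply is_cd_ccont, is_cd_cek.
  - intros x _. unfold u0. rewrite cek_pow. unfold Cminus. rewrite cek_plus, cek_opp. ring. }
 assert (S1 : csum N (fun m => CI (fun x => F (x, y1) * u1 x * u1 x ^ m)%C c (c + 1)) = csum N (fun m => coef y (- Z.of_nat (S m)) * cek (- Z.of_nat (S m)) z)%C).
 { apply csum_ext. intros m _. rewrite (CI_ext _ (fun x => cek (- Z.of_nat (S m)) z * (F (x, y1) * cek (- (- Z.of_nat (S m))) (x, y1)))%C); [|lra|].
  - rewrite CI_scal, Hco; try lra. ring. intros. apply cc_mult; [easy|]. apply (path_cont_h (cek _)). eapply is_cd_ccont, is_cd_cek.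
  - intros x _. rewrite Z.opp_involutive. rewrite <- Cmult_assoc. change (u1 x * u1 x ^ m)%C with (u1 x ^ S m)%C. unfold u1. rewrite cek_pow. unfold Cminus. rewrite cek_plus, <- cek_opp. ring. }
 rewrite S0 in G0. rewrite S1 in G1. rewrite EC.
 match goal with |- Cmod (?A + ?B - (?X + ?Y)) <= _ => replace (A + B - (X + Y))%C with ((A - X) + (B - Y))%C by ring end.
 via Cmod_triangle. lra.
Qed.
End Laurent.

Lemma unit_circle_ce (u : C) : Cmod u = 1 -> exists x, u = ce (RtoC x).
Proof.
 destruct u as [a b]. intros H. unfold Cmod in H; simpl in H.
 assert (H2 : a * a + b * b = 1). { apply (f_equal Rsqr) in H. rewrite Rsqr_sqrt in H by nra. unfold Rsqr in H. lra. }
 assert (Ha : -1 <= a <= 1) by nra.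
 assert (Hpi := PI_RGT_0).
 assert (Hs : sqrt (1 - Rsqr a) = Rabs b). { replace (1 - Rsqr a) with (Rsqr b) by (unfold Rsqr; lra). apply sqrt_Rsqr_abs. }
 destruct (Rle_dec 0 b) as [h|h].
 - exists (acos a / (2 * PI)). unfold ce; simpl. rewrite Rmult_0_r, Ropp_0, exp_0, !Rmult_1_l.
  replace (2 * PI * (acos a / (2 * PI))) with (acos a) by (field; lra).
  rewrite cos_acos, sin_acos, Hs, Rabs_right by lra. easy.
 - exists (- (acos a / (2 * PI))). unfold ce; simpl. rewrite Rmult_0_r, Ropp_0, exp_0, !Rmult_1_l.
  replace (2 * PI * (- (acos a / (2 * PI)))) with (- acos a) by (field; lra).
  rewrite cos_neg, sin_neg, cos_acos, sin_acos, Hs, Rabs_left by lra. f_equal; ring.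
Qed.

Lemma ce_surj (t : C) : t <> 0%C -> exists w : C, t = ce w /\ snd w = - ln (Cmod t) / (2 * PI).
Proof.
 intros Ht. assert (H : 0 < Cmod t) by (apply Cmod_gt_0; easy). assert (Hpi := PI_RGT_0).
 assert (Hn : RtoC (Cmod t) <> 0%C) by (intros E; apply RtoC_inj in E; lra).
 destruct (unit_circle_ce (t / RtoC (Cmod t))%C) as [x Hx].
 { rewrite Cmod_div, Cmod_R, Rabs_right by (easy || lra). field; lra. }
 exists (x, - ln (Cmod t) / (2 * PI)). split; [|easy].
 replace ((x, - ln (Cmod t) / (2 * PI)) : C) with (RtoC x + (0%R, (- ln (Cmod t) / (2 * PI))%R))%C by (unfold RtoC, Cplus; simpl; f_equal; ring).
 rewrite ce_plus, <- Hx. unfold ce; simpl. replace (- (2 * PI * (- ln (Cmod t) / (2 * PI)))) with (ln (Cmod t)) by (field; lra).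
 rewrite exp_ln, Rmult_0_r, cos_0, sin_0 by easy.
 replace ((Cmod t * 1, Cmod t * 0) : C) with (RtoC (Cmod t)) by (unfold RtoC; f_equal; ring). field; easy.
Qed.

Lemma exp_lt_1 t : 0 < t -> 0 < exp (- t) < 1.
Proof. intros; split; [pos|]. rewrite <- exp_0. apply exp_increasing. lra. Qed.

Lemma ccont_zero (g : C -> C) K r : 0 < r -> ccont g 0%C -> (forall t : C, t <> 0%C -> Cmod t <= r -> Cmod (g t) <= K * Cmod t) -> g 0%C = 0%C.
Proof.
 intros Hr Hg HK. apply Cmod_small_eq. intros e He. destruct (proj1 (ccont_eps _ _) Hg (e/2)) as (d & Hd & Ht); [lra|].
 assert (HA := Rabs_pos K). set (q := e / (2 * (Rabs K + 1))). assert (Hq : 0 < q) by pos.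
 set (x := Rmin (d/2) (Rmin r q)). assert (Hx : 0 < x) by (repeat apply Rmin_pos; lra).
 assert (x <= d/2 /\ x <= r /\ x <= q). { unfold x. generalize (Rmin_l (d/2) (Rmin r q)) (Rmin_r (d/2) (Rmin r q)) (Rmin_l r q) (Rmin_r r q). lra. }
 assert (E : Cmod (RtoC x) = x) by (rewrite Cmod_R, Rabs_right; lra).
 specialize (Ht (RtoC x)). specialize (HK (RtoC x)). rewrite E, Cplus_0_l in *.
 specialize (HK ltac:(intros h; apply RtoC_inj in h; lra) ltac:(lra)). replace (g 0 - 0)%C with (g 0) by ring.
 assert (Rabs K * x <= e/2). { replace (e/2) with (q * (Rabs K + 1)) by (unfold q; field; lra). nra. }
 generalize (Cmod_le_add (g 0) (g (RtoC x))) (Rle_abs K). rewrite Cmod_sub_sym. nra.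
Qed.

(** The substitution [z0 + rho * ce w] maps the upper half-plane onto the punctured disc and turns
    the Laurent expansion on a cylinder into a Taylor expansion, so that no circular contour
    occurs. *)
Lemma taylor_disc (f : C -> C) (z0 : C) (rho M : R) : 0 < rho ->
 (forall z, Cmod (z - z0) < rho -> cdf f z) -> (forall z, Cmod (z - z0) < rho -> Cmod (f z) <= M) ->
 exists L, Cmod L <= M / rho /\
  forall t, Cmod t <= rho / 2 -> Cmod (f (z0 + t) - f z0 - L * t)%C <= 4 * M * (Cmod t / rho) ^ 2.
Proof.
 intros Hr Hf HM. assert (Hpi := PI_RGT_0).
 assert (HM0 : 0 <= M). { eapply Rle_trans; [apply Cmod_ge_0|apply (HM z0)]. replace (z0 - z0)%C with (RtoC 0) by ring. rewrite Cmod_0; easy. }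
 set (G := fun w => f (z0 + RtoC rho * ce w)%C).
 assert (Hin : forall w : C, 0 < snd w -> Cmod (z0 + RtoC rho * ce w - z0) < rho).
 { intros w Hw. replace (z0 + RtoC rho * ce w - z0)%C with (RtoC rho * ce w)%C by ring.
  rewrite Cmod_mult, Cmod_R, Cmod_ce, Rabs_right by lra.
  destruct (exp_lt_1 (2 * PI * snd w)) as [e1 e2]; [nra|]. nra. }
 assert (HG : forall b (z : C), 0 < snd z < b -> cdf G z).
 { intros b z Hz. destruct (Hf (z0 + RtoC rho * ce z)%C) as [L HL]; [apply Hin; lra|].
  eexists. apply (is_cd_comp f (fun w => z0 + RtoC rho * ce w)%C); [|eauto].
  apply is_cd_plus; [apply is_cd_const|]. apply is_cd_scal. apply is_cd_ce. }
 assert (Hp : forall b (z : C), 0 < snd z < b -> G (z + 1)%C = G z).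
 { intros. unfold G. rewrite (ce_period z 1). easy. }
 assert (HB : forall b (z : C), 0 < snd z < b -> Cmod (G z) <= M).
 { intros b z Hz. apply HM, Hin. lra. }
 set (c := coef G 1).
 assert (Hc : forall k y, 0 < y -> Cmod (c k) <= M * exp (2 * PI * (IZR k * y))).
 { intros k y Hy. unfold c. rewrite (coef_indep G 0 (Rmax 1 y + 1) (HG _) (Hp _) 1 y k).
  - apply (coef_bound G 0 (y + 1) M (HG _) (HB _)). lra.
  - generalize (Rmax_l 1 y); lra.
  - generalize (Rmax_r 1 y); lra. }
 assert (HM1 : forall e, 0 < e -> exists y, 0 < y /\ M * exp (- y) <= e).
 { intros e He. exists (Rmax 1 (M / e)). generalize (Rmax_l 1 (M/e)) (Rmax_r 1 (M/e)); intros h1 h2. split; [lra|].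
  rewrite exp_Ropp. apply (Rmult_le_reg_r (exp (Rmax 1 (M/e)))); [pos|].
  generalize (exp_ineq1_le (Rmax 1 (M/e))); intros h3. apply Rle_trans with (e * (M / e)); [right; field; lra|]. pos. }
 (* Coefficients do not depend on the height; letting it tend to infinity, that is, shrinking the
    circle, annihilates this one. *)
 assert (Hcm : c (-1)%Z = 0%C).
 { apply Cmod_small_eq. intros e He. replace (c (-1)%Z - 0)%C with (c (-1)%Z) by ring.
  destruct (HM1 e He) as (y & Hy & Hye). eapply Rle_trans; [apply (Hc _ (y / (2 * PI)))|].
  - apply Rdiv_lt_0_compat; lra.
  - replace (2 * PI * (-1 * (y / (2 * PI)))) with (- y) by (field; lra). easy. }
 assert (Hc1 : Cmod (c 1%Z) <= M).
 { apply le_epsilon. intros e He.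
  assert (Cn : continuity_pt (fun y => M * exp (2 * PI * (1 * y))) 0).
  { apply derivable_continuous_pt. eexists. apply is_derive_Reals. auto_derive; [easy|easy]. }
  destruct (Cn e He) as (d & Hd & Hy). simpl in Hy. unfold R_dist in Hy.
  rewrite !Rmult_0_r, exp_0 in Hy. specialize (Hc 1%Z (d/2) ltac:(lra)).
  assert (Rabs (M * exp (2 * PI * (1 * (d/2))) - M * 1) < e).
  { apply Hy. split; [split; [easy|lra]|]. rewrite Rminus_0_r, Rabs_right; lra. }
  apply Rabs_def2 in H. lra. }
 assert (Hmain : forall t : C, t <> 0%C -> Cmod t <= rho / 2 -> Cmod (f (z0 + t) - c 0%Z - c 1%Z / RtoC rho * t)%C <= 4 * M * (Cmod t / rho) ^ 2).
 { intros t Ht0 Ht. assert (Hrn : RtoC rho <> 0%C) by (intros E; apply RtoC_inj in E; lra).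
  assert (HT : 0 < Cmod t) by (apply Cmod_gt_0; easy).
  set (tau := (t / RtoC rho)%C). assert (Etau : Cmod tau = Cmod t / rho) by (unfold tau; rewrite Cmod_div, Cmod_R, Rabs_right by (easy||lra); easy).
  assert (Htau : 0 < Cmod tau <= /2). { rewrite Etau. split; [pos|]. apply (Rmult_le_reg_r rho); [lra|]. unfold Rdiv. rewrite Rmult_assoc, Rinv_l; lra. }
  destruct (ce_surj tau) as (w & Ew & Hw). { apply Cmod_gt_0; lra. }
  set (q := Cmod tau) in *. rewrite <- Etau.
  assert (Hl : ln q <= ln (/2)). { destruct (Rle_lt_or_eq_dec q (/2)) as [h|h]; [lra|left; apply ln_increasing; lra|rewrite h; lra]. }
  assert (Hln98 : 0 < ln (9/8)). { rewrite <- ln_1. apply ln_increasing; lra. }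
  assert (Hln2 : ln (9/8) < - ln (/2)). { rewrite <- ln_Rinv by lra. apply ln_increasing; lra. }
  (* The lower line must lie strictly above the real axis. With the ratio [9/8 * q] here and [q / 2]
     on the line [y1], the tails contribute 3 and 1 to the constant 4 as long as [q <= /2]. *)
  set (y0 := ln (9/8) / (2 * PI)).
  assert (Hy0 : 0 < y0 < snd w). { rewrite Hw. split; [pos|]. apply Rmult_lt_compat_r; [pos|]. lra. }
  set (y1 := snd w + (ln 2 - ln q) / (2 * PI)).
  assert (Hln2' : ln 2 = - ln (/2)) by (rewrite ln_Rinv by lra; ring).
  assert (Hy1 : snd w < y1). { unfold y1. pos. }
  set (b := y1 + 1 + 1).
  assert (Lr := laurent G 0 b M (HG b) (Hp b) (HB b) w 1 y0 y1 1 ltac:(unfold b; lra) Hy0 ltac:(unfold b; lra)).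
  cbv zeta in Lr.
  assert (E0 : exp (- (2 * PI * (snd w - y0))) = 9/8 * q).
  { rewrite Hw. unfold y0. replace (- (2 * PI * (- ln q / (2 * PI) - ln (9 / 8) / (2 * PI)))) with (ln q + ln (9/8)) by (field; lra).
   rewrite exp_plus, !exp_ln by lra. ring. }
  assert (E1 : exp (- (2 * PI * (y1 - snd w))) = q / 2).
  { unfold y1. replace (- (2 * PI * (snd w + (ln 2 - ln q) / (2 * PI) - snd w))) with (ln q + - ln 2) by (field; lra).
   rewrite exp_plus, exp_ln, <- ln_Rinv, exp_ln by lra. field. }
  rewrite E0, E1 in Lr. simpl csum in Lr. fold c in Lr.
  rewrite cek_0 in Lr. replace (cek 1 w) with tau in Lr. 2:{ rewrite Ew. unfold cek. f_equal. ring. }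
  match type of Lr with Cmod ?e <= ?r => replace e with (f (z0 + t) - c 0%Z - c 1%Z / RtoC rho * t)%C in Lr; [via Lr|] end.
  - assert (P1 : (9/8 * q) ^ 2 / (1 - 9/8*q) <= 3 * q ^ 2).
   { apply (Rmult_le_reg_r (1 - 9/8*q)); [lra|]. unfold Rdiv. rewrite Rmult_assoc, Rinv_l by lra. nra. }
   assert (P2 : (q/2) ^ 2 / (1 - q/2) <= q ^ 2).
   { apply (Rmult_le_reg_r (1 - q/2)); [lra|]. unfold Rdiv. rewrite Rmult_assoc, Rinv_l by lra. nra. }
   apply (Rmult_le_compat_l M) in P1; [|easy]. apply (Rmult_le_compat_l M) in P2; [|easy]. lra.
  - assert (EG : G w = f (z0 + t)%C). { unfold G. rewrite <- Ew. f_equal. unfold tau. field; easy. }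
   rewrite EG. rewrite Hcm. unfold tau. field; easy. }
 assert (Hrn : RtoC rho <> 0%C) by (intros E; apply RtoC_inj in E; lra).
 (* The expansion has been obtained off the centre; continuity of [f] identifies the value at the
    centre. *)
 assert (Hc0 : f z0 = c 0%Z).
 { destruct (Hf z0) as [L0 HL0]. { replace (z0 - z0)%C with (RtoC 0) by ring. rewrite Cmod_0; easy. }
  apply is_cd_ccont in HL0. rewrite <- (Cplus_0_r z0), ccont_shift in HL0.
  assert (E := ccont_zero (fun t => f (z0 + t) - c 0%Z)%C (3 * M / rho) (rho / 2)). cbv beta in E. rewrite Cplus_0_r in E.
  replace (f z0) with (f z0 - c 0%Z + c 0%Z)%C by ring. rewrite E; [ring|lra|apply cc_minus; [easy|apply cc_const]|].
  intros t Hn Ht. specialize (Hmain t Hn Ht). set (l := (c 1%Z / RtoC rho * t)%C) in *.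
  via (Cmod_le_add _ l). set (x := Cmod t) in *. assert (Hx : 0 <= x) by apply Cmod_ge_0.
  assert (Hl : Cmod l <= M / rho * x). { unfold l. rewrite Cmod_mult, Cmod_div, Cmod_R, Rabs_right by (easy||lra). apply Rmult_le_compat_r; [easy|]. apply Rmult_le_compat_r; [pos|easy]. }
  assert (4 * (M / rho) * (x * x) / rho <= 2 * (M / rho) * x).
  { apply (Rmult_le_reg_r rho); [lra|]. unfold Rdiv at 1. rewrite Rmult_assoc, Rinv_l by lra. assert (0 <= M / rho * x) by pos. nra. }
  lra. }
 exists (c 1%Z / RtoC rho)%C. split.
 - rewrite Cmod_div, Cmod_R, Rabs_right; try lra. apply Rmult_le_compat_r; [pos|easy]. intros E; apply RtoC_inj in E; lra.
 - intros t Ht. destruct (Ceq_dec t 0) as [->|Hn].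
  + replace (f (z0 + 0) - f z0 - c 1%Z / RtoC rho * 0)%C with (RtoC 0). rewrite Cmod_0. apply Rmult_le_pos; [lra|lra].
   rewrite Cplus_0_r. ring.
  + rewrite Hc0. auto.
Qed.

(** * Analytic functions of several variables *)

(** Only the first [N] entries of a point matter, with [N] passed separately: actions, angles and
    frequencies can then be regrouped without casts between types. *)
Definition vec := nat -> C.
Definition updv (z : vec) (j : nat) (t : C) : vec := fun i => if Nat.eqb i j then t else z i.
Definition near (N : nat) (z z' : vec) (d : R) : Prop := forall i, (i < N)%nat -> Cmod (z' i - z i) < d.
Definition vdist (N : nat) (z z' : vec) : R := rsum N (fun i => Cmod (z' i - z i)).

(** The quadratic remainder is no restriction for holomorphic functions ([osgood_taylor]) and makes
    the chain rule a computation with constants. *)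
Definition is_grad (N : nat) (f : vec -> C) (z : vec) (L : nat -> C) : Prop :=
 exists rho K, 0 < rho /\ 0 <= K /\ forall z', near N z z' rho ->
  Cmod (f z' - f z - csum N (fun i => L i * (z' i - z i)))%C <= K * (vdist N z z' * vdist N z z').

Definition An (N : nat) (D : vec -> Prop) (f : vec -> C) : Prop := forall z, D z -> exists L, is_grad N f z L.
Definition opn (N : nat) (D : vec -> Prop) : Prop :=
 forall z, D z -> exists rho, 0 < rho /\ forall z', near N z z' rho -> D z'.
Definition grad (N : nat) (f : vec -> C) (z : vec) : nat -> C := epsilon (inhabits (fun _ => RtoC 0)) (fun L => is_grad N f z L).
Definition pd (N i : nat) (f : vec -> C) (z : vec) : C := grad N f z i.

Lemma rsum_le_n m n f : (m <= n)%nat -> (forall i, 0 <= f i) -> rsum m f <= rsum n f.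
Proof. intros Hm H. induction Hm as [|n Hm IH]; [lra|]. simpl. specialize (H n). lra. Qed.
Lemma vdist_pos N z z' : 0 <= vdist N z z'.
Proof. apply rsum_pos; intros; apply Cmod_ge_0. Qed.
Lemma near_refl N z d : 0 < d -> near N z z d.
Proof. intros H i _. replace (z i - z i)%C with (RtoC 0) by ring. rewrite Cmod_0; easy. Qed.
Lemma near_le N z z' d d' : d <= d' -> near N z z' d -> near N z z' d'.
Proof. intros H H1 i Hi. eapply Rlt_le_trans; [auto|easy]. Qed.
Lemma near_trans N z z' z'' d d' : near N z z' d -> near N z' z'' d' -> near N z z'' (d + d').
Proof. intros H H' i Hi. eapply Rle_lt_trans; [apply (Cmod_sub_tri _ (z' i))|]. specialize (H i Hi). specialize (H' i Hi). lra. Qed.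
Lemma vdist_term N z z' i : (i < N)%nat -> Cmod (z' i - z i) <= vdist N z z'.
Proof. intros H. apply (rsum_term_le N (fun i => Cmod (z' i - z i))); [pos|easy]. Qed.
Lemma vdist_near N z z' d : 0 < d -> near N z z' d -> vdist N z z' <= INR N * d.
Proof. intros Hd H. apply rsum_le_const. intuition. Qed.
Lemma vdist_lt_near N z z' d : vdist N z z' < d -> near N z z' d.
Proof. intros H i Hi. eapply Rle_lt_trans; [apply vdist_term|]; eauto. Qed.
Lemma vdist_eq0 N z z' : (forall i, (i < N)%nat -> z i = z' i) -> vdist N z z' = 0.
Proof.
 intros H. unfold vdist. rewrite (rsum_ext N _ (fun _ => 0)). rewrite rsum_const; ring. intros i Hi. rewrite H by easy.
 replace (z' i - z' i)%C with (RtoC 0) by ring. apply Cmod_0.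
Qed.
Lemma updv_eq z j t : updv z j t j = t.
Proof. unfold updv. cmp; easy. Qed.
Lemma updv_neq z j t i : i <> j -> updv z j t i = z i.
Proof. unfold updv. cmp; easy. Qed.
Lemma updv_id z j : updv z j (z j) = z.
Proof. ext i. unfold updv. cmp; auto. Qed.
Lemma updv_updv z j t t' : updv (updv z j t) j t' = updv z j t'.
Proof. ext i. unfold updv. cmp; easy. Qed.
Lemma vdist_updv N z j t : (j < N)%nat -> vdist N z (updv z j t) = Cmod (t - z j).
Proof.
 intros H. unfold vdist. assert (E : rsum N (fun i => Cmod (updv z j t i - z i)) = rsum N (fun i => if Nat.eqb i j then Cmod (t - z j) else 0)).
 { apply rsum_ext. intros i _. unfold updv. destruct (Nat.eqb_spec i j); [subst; easy|].
  replace (z i - z i)%C with (RtoC 0) by ring. apply Cmod_0. }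
 rewrite E. clear E. induction N; [lia|]. simpl. destruct (Nat.eq_dec j N) as [->|].
 - rewrite Nat.eqb_refl. rewrite (rsum_ext N _ (fun _ => 0)). rewrite rsum_const; ring.
  intros i Hi. cmp; easy.
 - rewrite IHN by lia. cmp; ring.
Qed.
Lemma csum_updv N (L : nat -> C) z j t : (j < N)%nat -> csum N (fun i => L i * (updv z j t i - z i))%C = (L j * (t - z j))%C.
Proof.
 intros H. rewrite (csum_ext N _ (fun i => if Nat.eqb i j then (L i * (t - z i))%C else 0%C)).
 - apply (csum_delta N j (fun i => L i * (t - z i))%C H).
 - intros i _. unfold updv. cmp; ring.
Qed.
Lemma near_updv N z z' j t d : near N z z' d -> Cmod (t - z j) < d -> near N z (updv z' j t) d.
Proof. intros H Ht i Hi. unfold updv. cmp; subst; auto. Qed.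

Lemma is_grad_dep N f z L z' : is_grad N f z L -> (forall i, (i < N)%nat -> z i = z' i) -> f z' = f z.
Proof.
 intros (rho & K & Hr & HK & H) E. apply Cmod_small_eq. intros e He.
 assert (Hn : near N z z' rho). { intros i Hi. rewrite E by easy. replace (z' i - z' i)%C with (RtoC 0) by ring. rewrite Cmod_0; easy. }
 specialize (H z' Hn). rewrite vdist_eq0 in H by easy. rewrite csum_0 in H.
 - replace (f z' - f z)%C with (f z' - f z - 0)%C by ring. lra.
 - intros i Hi. rewrite E by easy. ring.
Qed.

Lemma is_grad_cd N f z L j : is_grad N f z L -> (j < N)%nat -> is_cd (fun t => f (updv z j t)) (z j) (L j).
Proof.
 intros (rho & K & Hr & HK & H) Hj eps He. exists (Rmin rho (eps / (K + 1))). split.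
 { pos. }
 intros t Ht. rewrite updv_id.
 assert (E : (z j + t - z j)%C = t) by ring.
 specialize (H (updv z j (z j + t))). rewrite vdist_updv, csum_updv, E in H by easy.
 via H.
 - apply near_updv; [apply near_refl; easy|]. rewrite E. eapply Rlt_le_trans; [eauto|apply Rmin_l].
 - assert (Cmod t < eps / (K + 1)) by (eapply Rlt_le_trans; [eauto|apply Rmin_r]).
  assert (Cmod t * (K + 1) <= eps). { apply (Rmult_lt_compat_r (K + 1)) in H0; [|lra]. replace (eps / (K + 1) * (K + 1)) with eps in H0 by (field; lra). lra. }
  assert (H2 := Cmod_ge_0 t). nra.
Qed.

Lemma is_grad_unique N f z L L' i : is_grad N f z L -> is_grad N f z L' -> (i < N)%nat -> L i = L' i.
Proof. intros H H' Hi. eapply is_cd_unique; [apply (is_grad_cd N f z L i H Hi)|apply (is_grad_cd N f z L' i H' Hi)]. Qed.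

Lemma is_grad_ext N f z L L' : is_grad N f z L -> (forall i, (i < N)%nat -> L i = L' i) -> is_grad N f z L'.
Proof.
 intros (rho & K & Hr & HK & H) E. exists rho, K. repeat split; try easy. intros z' Hz.
 rewrite (csum_ext N (fun i => L' i * (z' i - z i))%C (fun i => L i * (z' i - z i))%C). auto. intros i Hi. rewrite E; easy.
Qed.

Lemma is_grad_ext_loc N f g z L rho : 0 < rho -> (forall z', near N z z' rho -> f z' = g z') -> is_grad N f z L -> is_grad N g z L.
Proof.
 intros Hr E (rho' & K & Hr' & HK & H). exists (Rmin rho rho'), K. repeat split; try easy. apply Rmin_pos; easy.
 intros z' Hz. rewrite <- !E. apply H. eapply near_le; [apply Rmin_r|eauto]. apply near_refl; easy. eapply near_le; [apply Rmin_l|eauto].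
Qed.

Lemma grad_spec N f z L : is_grad N f z L -> is_grad N f z (grad N f z).
Proof. intros H. unfold grad. apply epsilon_spec. eauto. Qed.

Lemma pd_eq N f z L i : is_grad N f z L -> (i < N)%nat -> pd N i f z = L i.
Proof. intros H Hi. eapply is_grad_unique; [eapply grad_spec; apply H|easy|easy]. Qed.

Lemma An_grad N D f z : An N D f -> D z -> is_grad N f z (fun i => pd N i f z).
Proof. intros H Hz. destruct (H z Hz) as [L HL]. apply (grad_spec N f z L HL). Qed.

Lemma pd_ext N D f g i z : opn N D -> (forall z, D z -> f z = g z) -> An N D f -> D z -> (i < N)%nat -> pd N i f z = pd N i g z.
Proof.
 intros HD E H Hz Hi. destruct (HD z Hz) as (rho & Hr & Hin). symmetry. apply pd_eq with (L := fun i => pd N i f z); [|easy].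
 apply (is_grad_ext_loc N f g z _ rho); auto. apply (An_grad N D); easy.
Qed.

Lemma An_sub N D D' f : (forall z, D' z -> D z) -> An N D f -> An N D' f.
Proof. intros H Ha z Hz. auto. Qed.

Lemma is_grad_const N c z : is_grad N (fun _ => c) z (fun _ => 0%C).
Proof.
 exists 1, 0. split; [lra|split; [lra|]]. intros z' _. rewrite csum_0 by (intros; ring). replace (c - c - 0)%C with (RtoC 0) by ring. rewrite Cmod_0; lra.
Qed.

Lemma is_grad_coord N j z : (j < N)%nat -> is_grad N (fun z => z j) z (fun i => if Nat.eqb i j then 1%C else 0%C).
Proof.
 intros Hj. exists 1, 0. split; [lra|split; [lra|]]. intros z' _.
 rewrite (csum_ext N _ (fun i => if Nat.eqb i j then (z' i - z i)%C else 0%C)).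
 - rewrite (csum_delta N j (fun i => z' i - z i)%C Hj). replace (z' j - z j - (z' j - z j))%C with (RtoC 0) by ring. rewrite Cmod_0; lra.
 - intros i _. cmp; ring.
Qed.

Lemma is_grad_plus N f g z L M : is_grad N f z L -> is_grad N g z M -> is_grad N (fun z => f z + g z)%C z (fun i => L i + M i)%C.
Proof.
 intros (r1 & K1 & Hr1 & HK1 & H1) (r2 & K2 & Hr2 & HK2 & H2). exists (Rmin r1 r2), (K1 + K2).
 split; [pos|split; [lra|]]. intros z' Hz.
 specialize (H1 z' (near_le _ _ _ _ _ (Rmin_l _ _) Hz)). specialize (H2 z' (near_le _ _ _ _ _ (Rmin_r _ _) Hz)).
 rewrite (csum_ext N _ (fun i => L i * (z' i - z i) + M i * (z' i - z i))%C) by (intros; ring). rewrite csum_plus.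
 match goal with |- Cmod (?a + ?b - (?c + ?d) - (?e + ?g)) <= _ => replace (a + b - (c + d) - (e + g))%C with ((a - c - e) + (b - d - g))%C by ring end.
 via Cmod_triangle. lra.
Qed.

Lemma is_grad_lip N f z L : is_grad N f z L -> exists rho B, 0 < rho /\ 0 <= B /\ forall z', near N z z' rho -> Cmod (f z' - f z) <= B * vdist N z z'.
Proof.
 intros (rho & K & Hr & HK & H). set (S := rsum N (fun i => Cmod (L i))).
 assert (HS : 0 <= S) by (apply rsum_pos; intros; apply Cmod_ge_0).
 exists (Rmin rho 1), (K * INR N + S). assert (HN := pos_INR N). split; [pos|split; [nra|]].
 intros z' Hz. specialize (H z' (near_le _ _ _ _ _ (Rmin_l _ _) Hz)).
 assert (Hd : vdist N z z' <= INR N * 1). { apply vdist_near; [lra|]. eapply near_le; [apply Rmin_r|eauto]. }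
 assert (Hd0 := vdist_pos N z z').
 assert (HL : Cmod (csum N (fun i => L i * (z' i - z i)))%C <= S * vdist N z z').
 { via csum_norm. unfold S. rewrite Rmult_comm, <- rsum_scal. apply rsum_le. intros i Hi. rewrite Cmod_mult, Rmult_comm.
  apply Rmult_le_compat_r; [pos|]. apply vdist_term; easy. }
 replace (f z' - f z)%C with ((f z' - f z - csum N (fun i => L i * (z' i - z i))) + csum N (fun i => L i * (z' i - z i)))%C by ring.
 via Cmod_triangle.
 assert (K * (vdist N z z' * vdist N z z') <= K * INR N * vdist N z z').
 { rewrite Rmult_assoc. apply Rmult_le_compat_l; [easy|]. pos. } lra.
Qed.

Lemma is_grad_comp N N' (f : vec -> C) (g : nat -> vec -> C) z (M : nat -> C) (L : nat -> nat -> C) :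
 (forall i, (i < N)%nat -> is_grad N' (g i) z (L i)) -> is_grad N f (fun i => g i z) M ->
 is_grad N' (fun z => f (fun i => g i z)) z (fun j => csum N (fun i => M i * L i j))%C.
Proof.
 intros Hg Hf.
 assert (Hall : exists rho B K, 0 < rho /\ 0 <= B /\ 0 <= K /\ forall i, (i < N)%nat -> forall z', near N' z z' rho ->
   Cmod (g i z' - g i z) <= B * vdist N' z z' /\
   Cmod (g i z' - g i z - csum N' (fun j => L i j * (z' j - z j)))%C <= K * (vdist N' z z' * vdist N' z z')).
 { clear Hf. induction N as [|N IH].
  - exists 1, 0, 0. split; pos.
  - destruct IH as (r & B & K & Hr & HB & HK & H); [auto|].
   destruct (Hg N ltac:(lia)) as (r2 & K2 & Hr2 & HK2 & H2).
   destruct (is_grad_lip N' (g N) z (L N) (Hg N ltac:(lia))) as (r3 & B3 & Hr3 & HB3 & H3).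
   exists (Rmin r (Rmin r2 r3)), (Rmax B B3), (Rmax K K2).
   assert (m1 := Rmax_l B B3). assert (m2 := Rmax_r B B3). assert (m3 := Rmax_l K K2). assert (m4 := Rmax_r K K2).
   split; [pos|]. split; [lra|]. split; [lra|].
   intros i Hi z' Hz. assert (Hd := vdist_pos N' z z').
   assert (Z1 := near_le _ _ _ _ _ (Rmin_l _ _) Hz). assert (Z2 := near_le _ _ _ _ _ (Rmin_r _ _) Hz).
   assert (Z3 := near_le _ _ _ _ _ (Rmin_l _ _) Z2). assert (Z4 := near_le _ _ _ _ _ (Rmin_r _ _) Z2).
   destruct (Nat.eq_dec i N) as [->|].
   + specialize (H2 z' Z3). specialize (H3 z' Z4). pos.
   + destruct (H i ltac:(lia) z' Z1) as [h1 h2]. pos. }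
 destruct Hall as (r & B & K & Hr & HB & HK & Hall). destruct Hf as (rf & Kf & Hrf & HKf & Hf).
 set (S := rsum N (fun i => Cmod (M i))). assert (HS : 0 <= S) by (apply rsum_pos; intros; apply Cmod_ge_0).
 assert (HN' := pos_INR N').
 set (r' := Rmin r (rf / (B * INR N' + 1))).
 assert (Hq : 0 < rf / (B * INR N' + 1)) by pos.
 exists r', (Kf * ((INR N * B) * (INR N * B)) + S * K).
 split; [pos|]. split. { pos. }
 intros z' Hz. assert (Z1 := near_le _ _ _ _ _ (Rmin_l _ _) Hz). assert (Z2 := near_le _ _ _ _ _ (Rmin_r _ _) Hz).
  set (d := vdist N' z z') in *.
 assert (HdN : B * d < rf).
 { apply Rle_lt_trans with (B * (INR N' * (rf / (B * INR N' + 1)))).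
  - apply Rmult_le_compat_l; [easy|]. apply vdist_near; easy.
  - replace (B * (INR N' * (rf / (B * INR N' + 1)))) with (rf * (B * INR N' / (B * INR N' + 1))) by lra.
   rewrite <- (Rmult_1_r rf) at 2. apply Rmult_lt_compat_l; [easy|]. apply (Rmult_lt_reg_r (B * INR N' + 1)); [nra|].
   unfold Rdiv. rewrite Rmult_assoc, Rinv_l by nra. nra. }
 assert (Hn : near N (fun i => g i z) (fun i => g i z') rf). { intros i Hi. eapply Rle_lt_trans; [apply (Hall i Hi z' Z1)|easy]. }
 specialize (Hf _ Hn).
 assert (HD : vdist N (fun i => g i z) (fun i => g i z') <= INR N * (B * d)).
 { apply rsum_le_const. intros i Hi. apply (Hall i Hi z' Z1). }
 assert (HD0 := vdist_pos N (fun i => g i z) (fun i => g i z')).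
 assert (E : csum N' (fun j => csum N (fun i => M i * L i j) * (z' j - z j))%C = csum N (fun i => M i * csum N' (fun j => L i j * (z' j - z j)))%C).
 { rewrite (csum_ext N' _ (fun j => csum N (fun i => M i * L i j * (z' j - z j)))%C) by (intros; rewrite csum_scal_r; easy).
  rewrite csum_swap. apply csum_ext. intros i _. rewrite <- csum_scal. apply csum_ext. intros; ring. }
 rewrite E.
 match goal with |- Cmod (?a - ?b - ?c) <= _ => replace (a - b - c)%C with ((a - b - csum N (fun i => M i * (g i z' - g i z))) + csum N (fun i => M i * (g i z' - g i z - csum N' (fun j => L i j * (z' j - z j)))))%C end.
 2:{ rewrite (csum_ext N (fun i => M i * (g i z' - g i z - csum N' (fun j => L i j * (z' j - z j))))%C (fun i => M i * (g i z' - g i z) - M i * csum N' (fun j => L i j * (z' j - z j)))%C) by (intros; ring).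
   rewrite csum_minus. ring. }
 via Cmod_triangle. rewrite Rmult_plus_distr_r. apply Rplus_le_compat.
 - via Hf. rewrite Rmult_assoc. apply Rmult_le_compat_l; [easy|].
  pos.
 - via csum_norm. unfold S. rewrite Rmult_assoc, Rmult_comm, <- rsum_scal. apply rsum_le. intros i Hi. rewrite Cmod_mult, Rmult_comm.
  apply Rmult_le_compat_r; [pos|]. apply (Hall i Hi z' Z1).
Qed.

Lemma is_grad_mult N f g z L M : is_grad N f z L -> is_grad N g z M -> is_grad N (fun z => f z * g z)%C z (fun i => L i * g z + f z * M i)%C.
Proof.
 intros Hf Hg.
 assert (H2 : is_grad 2 (fun w => w 0%nat * w 1%nat)%C (fun i => match i with O => f z | _ => g z end) (fun i => match i with O => g z | _ => f z end)).
 { exists 1, 1. split; [lra|split; [lra|]]. intros w _. unfold vdist; simpl.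
  set (a := (w 0%nat - f z)%C). set (b := (w 1%nat - g z)%C).
  replace (w 0%nat * w 1%nat - f z * g z - (0 + g z * a + f z * b))%C with (a * b)%C by (unfold a, b; ring).
  rewrite Cmod_mult. pos. }
 assert (H := is_grad_comp 2 N (fun w => w 0%nat * w 1%nat)%C (fun i => match i with O => f | _ => g end) z (fun i => match i with O => g z | _ => f z end) (fun i => match i with O => L | _ => M end)).
 eapply is_grad_ext; [apply H|].
 - intros [|i] Hi; easy.
 - replace (fun i : nat => match i with 0%nat => f | S _ => g end z) with (fun i : nat => match i with O => f z | _ => g z end); [easy|].
  apply functional_extensionality. intros [|i]; easy.
 - intros i Hi. cmp; ring.
Qed.

Lemma is_grad_scal N c f z L : is_grad N f z L -> is_grad N (fun z => c * f z)%C z (fun i => c * L i)%C.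
Proof. intros H. eapply is_grad_ext; [apply is_grad_mult; [apply is_grad_const|eauto]|]. intros; simpl; ring. Qed.

Lemma is_grad_minus N f g z L M : is_grad N f z L -> is_grad N g z M -> is_grad N (fun z => f z - g z)%C z (fun i => L i - M i)%C.
Proof.
 intros Hf Hg. apply (is_grad_ext_loc N (fun z => f z + RtoC (-1) * g z)%C _ z _ 1); [lra|intros; ring|].
 eapply is_grad_ext; [apply is_grad_plus; [eauto|apply is_grad_scal, Hg]|]. intros; simpl; ring.
Qed.

Lemma is_grad_csum N n (f : nat -> vec -> C) z (L : nat -> nat -> C) : (forall k, (k < n)%nat -> is_grad N (f k) z (L k)) ->
 is_grad N (fun z => csum n (fun k => f k z)) z (fun i => csum n (fun k => L k i)).
Proof.
 induction n; intros H; simpl. apply is_grad_const. apply is_grad_plus; [auto|auto].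
Qed.

Lemma An_const N D c : An N D (fun _ => c).
Proof. intros z _. eexists; apply is_grad_const. Qed.
Lemma An_coord N D j : (j < N)%nat -> An N D (fun z => z j).
Proof. intros H z _. eexists; apply is_grad_coord; easy. Qed.
Lemma An_plus N D f g : An N D f -> An N D g -> An N D (fun z => f z + g z)%C.
Proof. intros H H' z Hz. destruct (H z Hz), (H' z Hz). eexists; apply is_grad_plus; eauto. Qed.
Lemma An_minus N D f g : An N D f -> An N D g -> An N D (fun z => f z - g z)%C.
Proof. intros H H' z Hz. destruct (H z Hz), (H' z Hz). eexists; apply is_grad_minus; eauto. Qed.
Lemma An_mult N D f g : An N D f -> An N D g -> An N D (fun z => f z * g z)%C.
Proof. intros H H' z Hz. destruct (H z Hz), (H' z Hz). eexists; apply is_grad_mult; eauto. Qed.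
Lemma An_csum N D n (f : nat -> vec -> C) : (forall k, (k < n)%nat -> An N D (f k)) -> An N D (fun z => csum n (fun k => f k z)).
Proof. induction n; intros H; simpl. apply An_const. apply An_plus; [auto|auto]. Qed.
Lemma An_comp N N' D D' f (g : nat -> vec -> C) : An N D f -> (forall i, (i < N)%nat -> An N' D' (g i)) ->
 (forall z, D' z -> D (fun i => g i z)) -> An N' D' (fun z => f (fun i => g i z)).
Proof.
 intros Hf Hg HD z Hz. eexists. apply (is_grad_comp N N' f g z (fun i => pd N i f (fun k => g k z)) (fun i j => pd N' j (g i) z)).
 - intros i Hi. apply (An_grad N' D'); auto.
 - apply (An_grad N D f _ Hf (HD z Hz)).
Qed.
Lemma pd_comp N N' D D' f (g : nat -> vec -> C) j z : An N D f -> (forall i, (i < N)%nat -> An N' D' (g i)) ->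
 (forall z, D' z -> D (fun i => g i z)) -> D' z -> (j < N')%nat ->
 pd N' j (fun z => f (fun i => g i z)) z = csum N (fun i => pd N i f (fun i => g i z) * pd N' j (g i) z)%C.
Proof.
 intros Hf Hg HD Hz Hj. apply (pd_eq N' (fun z => f (fun i => g i z)) z (fun j => csum N (fun i => pd N i f (fun i => g i z) * pd N' j (g i) z))%C); [|easy].
 apply (is_grad_comp N N' f g z (fun i => pd N i f (fun i => g i z)) (fun i j => pd N' j (g i) z)).
 - intros i Hi. apply (An_grad N' D'); auto.
 - apply (An_grad N D f _ Hf (HD z Hz)).
Qed.
Lemma pd_plus N D f g j z : An N D f -> An N D g -> D z -> (j < N)%nat -> pd N j (fun z => f z + g z)%C z = (pd N j f z + pd N j g z)%C.
Proof. intros Hf Hg Hz Hj. apply (pd_eq N _ z (fun j => pd N j f z + pd N j g z)%C); [|easy]. apply is_grad_plus; apply (An_grad N D); easy. Qed.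
Lemma pd_minus N D f g j z : An N D f -> An N D g -> D z -> (j < N)%nat -> pd N j (fun z => f z - g z)%C z = (pd N j f z - pd N j g z)%C.
Proof. intros Hf Hg Hz Hj. apply (pd_eq N _ z (fun j => pd N j f z - pd N j g z)%C); [|easy]. apply is_grad_minus; apply (An_grad N D); easy. Qed.
Lemma pd_mult N D f g j z : An N D f -> An N D g -> D z -> (j < N)%nat -> pd N j (fun z => f z * g z)%C z = (pd N j f z * g z + f z * pd N j g z)%C.
Proof. intros Hf Hg Hz Hj. apply (pd_eq N _ z (fun j => pd N j f z * g z + f z * pd N j g z)%C); [|easy]. apply is_grad_mult; apply (An_grad N D); easy. Qed.
Lemma pd_csum N D n (f : nat -> vec -> C) j z : (forall k, (k < n)%nat -> An N D (f k)) -> D z -> (j < N)%nat ->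
 pd N j (fun z => csum n (fun k => f k z)) z = csum n (fun k => pd N j (f k) z).
Proof. intros Hf Hz Hj. apply (pd_eq N _ z (fun j => csum n (fun k => pd N j (f k) z))); [|easy]. apply is_grad_csum; intros; apply (An_grad N D); auto. Qed.
Lemma pd_coord N i j z : (i < N)%nat -> (j < N)%nat -> pd N j (fun z => z i) z = if Nat.eqb j i then 1%C else 0%C.
Proof. intros Hi Hj. apply (pd_eq N _ z (fun j => if Nat.eqb j i then 1%C else 0%C)); [|easy]. apply is_grad_coord; easy. Qed.
Lemma pd_const N j c z : (j < N)%nat -> pd N j (fun _ => c) z = 0%C.
Proof. intros Hj. apply (pd_eq N _ z (fun _ => 0%C)); [apply is_grad_const|easy]. Qed.

(** * Osgood's lemma with explicit Lipschitz and Taylor bounds *)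

Section Osgood.
Variables (N : nat) (f : vec -> C) (z0 : vec) (rho M : R).
Hypothesis Hr : 0 < rho.
Hypothesis HM : forall z, near N z0 z rho -> Cmod (f z) <= M.
Hypothesis Hs : forall z j, near N z0 z rho -> (j < N)%nat -> cdf (fun t => f (updv z j t)) (z j).
Hypothesis Hdep : forall z z', near N z0 z rho -> (forall i, (i < N)%nat -> z i = z' i) -> f z' = f z.

Let HM0 : 0 <= M.
Proof. eapply Rle_trans; [apply Cmod_ge_0|apply (HM z0), near_refl; easy]. Qed.

Lemma slice_taylor w i : near N z0 w rho -> (i < N)%nat -> exists L, Cmod L <= M / rho /\
 forall t, Cmod t <= rho / 2 -> Cmod (f (updv w i (z0 i + t)) - f (updv w i (z0 i)) - L * t)%C <= 4 * M * (Cmod t / rho) ^ 2.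
Proof.
 intros Hw Hi. apply (taylor_disc (fun t => f (updv w i t)) (z0 i) rho M Hr).
 - intros t Ht. destruct (Hs (updv w i t) i) as [L HL]; [apply near_updv; easy|easy|].
  exists L. rewrite updv_eq in HL. apply (is_cd_ext _ _ _ _ (fun s => f_equal f (updv_updv w i t s)) HL).
 - intros t Ht. apply HM, near_updv; easy.
Qed.

Lemma quad_half x : 0 <= x <= rho / 2 -> M / rho * x + 4 * M * (x / rho) ^ 2 <= 3 * M / rho * x.
Proof.
 intros Hx. assert (x / rho <= /2). { apply (Rmult_le_reg_r rho); [lra|]. unfold Rdiv. rewrite Rmult_assoc, Rinv_l; lra. }
 assert (0 <= M * (x / rho)) by pos. nra.
Qed.

Lemma slice_lip w i a : near N z0 w rho -> (i < N)%nat -> Cmod (a - z0 i) <= rho / 2 ->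
 Cmod (f (updv w i a) - f (updv w i (z0 i))) <= 3 * M / rho * Cmod (a - z0 i).
Proof.
 intros Hw Hi Ha. destruct (slice_taylor w i Hw Hi) as (L & HL & Ht). specialize (Ht (a - z0 i)%C Ha).
 replace (z0 i + (a - z0 i))%C with a in Ht by ring. set (t := (a - z0 i)%C) in *.
 replace (f (updv w i a) - f (updv w i (z0 i)))%C with ((f (updv w i a) - f (updv w i (z0 i)) - L * t) + L * t)%C by ring.
 via Cmod_triangle. rewrite Cmod_mult.
 eapply Rle_trans; [|apply quad_half; split; [pos|easy]].
 assert (Cmod L * Cmod t <= M / rho * Cmod t) by (apply Rmult_le_compat_r; [pos|easy]). lra.
Qed.

Definition mixv (k : nat) (z' w : vec) : vec := fun i => if Nat.ltb i k then z' i else w i.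

Lemma mixv_S k z' w : mixv (S k) z' w = updv (mixv k z' w) k (z' k).
Proof.
 ext i. unfold mixv, updv.
 cmp; auto.
Qed.

Lemma near_mixv k z' w d : near N z0 z' d -> near N z0 w d -> near N z0 (mixv k z' w) d.
Proof. intros H H' i Hi. unfold mixv. cmp; auto. Qed.

Lemma mix_lip k z' w : (k <= N)%nat -> near N z0 z' (rho / 2) -> near N z0 w rho -> (forall i, (i < k)%nat -> w i = z0 i) ->
 Cmod (f (mixv k z' w) - f w) <= 3 * M / rho * rsum k (fun i => Cmod (z' i - z0 i)).
Proof.
 intros Hk Hz Hw. assert (Hz' : near N z0 z' rho) by (eapply near_le; [|eauto]; lra).
 induction k; intros Hwz.
 - replace (mixv 0 z' w) with w by easy.
  simpl. replace (f w - f w)%C with (RtoC 0) by ring. rewrite Cmod_0. lra.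
 - rewrite mixv_S. simpl.
  replace (f (updv (mixv k z' w) k (z' k)) - f w)%C with ((f (updv (mixv k z' w) k (z' k)) - f (updv (mixv k z' w) k (z0 k))) + (f (mixv k z' w) - f w))%C.
  + via Cmod_triangle. rewrite Rmult_plus_distr_l, Rplus_comm. apply Rplus_le_compat.
   * intuition.
   * apply slice_lip; [apply near_mixv; easy|lia|]. intuition.
  + replace (updv (mixv k z' w) k (z0 k)) with (mixv k z' w). ring.
   rewrite <- (updv_id (mixv k z' w) k) at 1. f_equal. unfold mixv. cmp; auto.
Qed.

Lemma osgood_lip z' : near N z0 z' (rho / 2) -> Cmod (f z' - f z0) <= 3 * M / rho * vdist N z0 z'.
Proof.
 intros Hz. assert (H := mix_lip N z' z0 (le_n _) Hz (near_refl N z0 rho Hr) (fun _ _ => eq_refl)).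
 rewrite (Hdep (mixv N z' z0) z') ; [easy| |].
 - apply near_mixv; [eapply near_le; [|eauto]; lra|apply near_refl; easy].
 - intros i Hi. unfold mixv. cmp; easy.
Qed.

(** The entries are changed one at a time through [mixv]. Each change costs 4 for the Taylor
    remainder of its slice and 3 for replacing the slope at the mixed point by the slope at [z0].
    The difference of these slopes is small by the Cauchy estimate for the difference of the two
    slices, which [mix_lip] bounds. *)
Lemma osgood_taylor : exists L, (forall i, (i < N)%nat -> Cmod (L i) <= M / rho) /\ forall z', near N z0 z' (rho / 2) ->
 Cmod (f z' - f z0 - csum N (fun i => L i * (z' i - z0 i)))%C <= 7 * M / (rho * rho) * (vdist N z0 z' * vdist N z0 z').
Proof.
 set (P := fun i L => Cmod L <= M / rho /\ forall t, Cmod t <= rho / 2 -> Cmod (f (updv z0 i (z0 i + t)) - f (updv z0 i (z0 i)) - L * t)%C <= 4 * M * (Cmod t / rho) ^ 2).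
 set (L := fun i => epsilon (inhabits (RtoC 0)) (P i)).
 assert (HL : forall i, (i < N)%nat -> P i (L i)). { intros i Hi. apply epsilon_spec. apply slice_taylor; [apply near_refl; easy|easy]. }
 exists L. split; [intros; apply HL; easy|]. intros z' Hz.
 assert (Hz' : near N z0 z' rho) by (eapply near_le; [|eauto]; lra).
 set (d := vdist N z0 z'). assert (Hd0 : 0 <= d) by apply vdist_pos.
 assert (Hrr : 0 < rho * rho) by nra. assert (HMr : 0 <= M / (rho * rho)) by pos.
 assert (Hstep : forall k, (k < N)%nat -> Cmod (f (mixv (S k) z' z0) - f (mixv k z' z0) - L k * (z' k - z0 k))%C <= 7 * M / (rho * rho) * d * Cmod (z' k - z0 k)).
 { intros k Hk. destruct (HL k Hk) as [HL1 HL2]. set (w := mixv k z' z0). assert (Hw : near N z0 w rho) by (apply near_mixv; [easy|apply near_refl; easy]).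
  destruct (slice_taylor w k Hw Hk) as (L' & HL1' & HL2').
  assert (Ewk : w k = z0 k). { unfold w, mixv. cmp; easy. }
  assert (HLL : Cmod (L' - L k) <= 3 * M / rho * d / rho).
  { set (h := fun t => (f (updv w k t) - f (updv z0 k t))%C).
   destruct (taylor_disc h (z0 k) rho (3 * M / rho * d) Hr) as (L2 & HL21 & HL22).
   - intros t Ht. destruct (Hs (updv w k t) k) as [l1 hl1]; [apply near_updv; easy|easy|].
    destruct (Hs (updv z0 k t) k) as [l2 hl2]; [apply near_updv; [apply near_refl; easy|easy]|easy|].
    rewrite updv_eq in hl1, hl2. exists (l1 - l2)%C. apply is_cd_minus.
    + apply (is_cd_ext _ _ _ _ (fun s => f_equal f (updv_updv w k t s)) hl1).
    + apply (is_cd_ext _ _ _ _ (fun s => f_equal f (updv_updv z0 k t s)) hl2).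
   - intros t Ht. unfold h. replace (updv w k t) with (mixv k z' (updv z0 k t)).
    + eapply Rle_trans; [apply mix_lip; [lia|easy|apply near_updv; [apply near_refl; easy|easy]|]|].
     * intros i Hi. apply updv_neq; lia.
     * assert (0 <= 3 * M / rho) by pos.
      apply Rmult_le_compat_l; [easy|]. apply rsum_le_n; [lia|]. pos.
    + ext i. unfold w, mixv, updv. cmp; easy.
   - assert (E : (L' - L k)%C = L2); [|cmp; subst; auto].
    assert (G : forall Z (g : C -> C) B, 0 <= B -> (forall t, Cmod t <= rho / 2 -> Cmod (g (z0 k + t) - g (z0 k) - Z * t)%C <= B * (Cmod t / rho) ^ 2) -> is_cd g (z0 k) Z).
    { intros Z g B HB Hg e He. exists (Rmin (rho/2) (e * (rho * rho) / (B + 1))). split.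
     - pos.
     - intros t Ht. eapply Rle_trans; [apply Hg; left; eapply Rlt_le_trans; [eauto|apply Rmin_l]|].
      assert (Cmod t < e * (rho * rho) / (B + 1)) by (eapply Rlt_le_trans; [eauto|apply Rmin_r]).
      assert (T0 := Cmod_ge_0 t). assert (Cmod t * (B + 1) < e * (rho * rho)).
      { apply (Rmult_lt_compat_r (B + 1)) in H; [|lra]. replace (e * (rho * rho) / (B + 1) * (B + 1)) with (e * (rho * rho)) in H by (field; lra). easy. }
      replace (B * (Cmod t / rho) ^ 2) with (Cmod t * (B * Cmod t / (rho * rho))) by (field; lra). rewrite Rmult_comm. apply Rmult_le_compat_r; [easy|].
      apply (Rmult_le_reg_r (rho * rho)); [easy|]. unfold Rdiv. rewrite Rmult_assoc, Rinv_l by lra. nra. }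
    apply (is_cd_unique h (z0 k)).
    + apply is_cd_minus; [apply (G L' (fun t => f (updv w k t)) (4 * M)); [lra|easy]|apply (G (L k) (fun t => f (updv z0 k t)) (4 * M)); [lra|easy]].
    + apply (G L2 h (4 * (3 * M / rho * d))); [|easy]. pos. }
  rewrite mixv_S. fold w. set (t := (z' k - z0 k)%C) in *.
  assert (Ht : Cmod t <= rho / 2) by (left; apply Hz; easy). specialize (HL2' t Ht).
  replace (z0 k + t)%C with (z' k) in HL2' by (unfold t; ring).
  replace (updv w k (z0 k)) with w in HL2' by (rewrite <- Ewk; symmetry; apply updv_id).
  replace (f (updv w k (z' k)) - f w - L k * t)%C with ((f (updv w k (z' k)) - f w - L' * t) + (L' - L k) * t)%C by ring.
  via Cmod_triangle. rewrite Cmod_mult. assert (T0 := Cmod_ge_0 t).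
  assert (Htd : Cmod t <= d) by (apply vdist_term; easy).
  assert (Cmod (L' - L k) * Cmod t <= 3 * (M / (rho * rho)) * d * Cmod t).
  { apply Rmult_le_compat_r; [easy|]. via HLL. right; field; lra. }
  assert (4 * M * (Cmod t / rho) ^ 2 <= 4 * (M / (rho * rho)) * d * Cmod t).
  { replace (4 * M * (Cmod t / rho) ^ 2) with (4 * (M / (rho * rho)) * Cmod t * Cmod t) by (field; lra).
   apply Rmult_le_compat_r; [easy|]. pos. }
  lra. }
 assert (Htel : forall k, (k <= N)%nat -> Cmod (f (mixv k z' z0) - f z0 - csum k (fun i => L i * (z' i - z0 i)))%C <= 7 * M / (rho * rho) * d * rsum k (fun i => Cmod (z' i - z0 i))).
 { induction k; intros Hk.
  - simpl. replace (mixv 0 z' z0) with z0 by easy.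
   replace (f z0 - f z0 - 0)%C with (RtoC 0) by ring. rewrite Cmod_0. lra.
  - simpl. specialize (IHk ltac:(lia)). specialize (Hstep k ltac:(lia)).
   match goal with |- Cmod (?a - ?b - (?c + ?e)) <= _ => replace (a - b - (c + e))%C with ((f (mixv k z' z0) - b - c) + (a - f (mixv k z' z0) - e))%C by ring end.
   via Cmod_triangle. lra. }
 specialize (Htel N (le_n _)). rewrite (Hdep (mixv N z' z0) z') ; [rewrite <- Rmult_assoc; easy| |].
 - apply near_mixv; [easy|apply near_refl; easy].
 - intros i Hi. unfold mixv. cmp; easy.
Qed.
End Osgood.

Lemma An_of_sep N D f : opn N D ->
 (forall z, D z -> exists rho M, 0 < rho /\ forall z', near N z z' rho -> Cmod (f z') <= M) ->
 (forall z j, D z -> (j < N)%nat -> cdf (fun t => f (updv z j t)) (z j)) ->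
 (forall z z', D z -> (forall i, (i < N)%nat -> z i = z' i) -> f z' = f z) -> An N D f.
Proof.
 intros HD HB Hs Hdep z Hz. destruct (HD z Hz) as (r1 & Hr1 & H1). destruct (HB z Hz) as (r2 & M & Hr2 & H2).
 set (r := Rmin r1 r2). assert (Hr : 0 < r) by pos.
 assert (N1 : forall z', near N z z' r -> D z') by (intros; apply H1; eapply near_le; [apply Rmin_l|eauto]).
 assert (N2 : forall z', near N z z' r -> Cmod (f z') <= M) by (intros; apply H2; eapply near_le; [apply Rmin_r|eauto]).
 assert (HM : 0 <= M) by (eapply Rle_trans; [apply Cmod_ge_0|apply (N2 z), near_refl; easy]).
 destruct (osgood_taylor N f z r M Hr N2) as (L & _ & HL); auto.
 exists L, (r / 2), (7 * M / (r * r)). split; [lra|split; [|easy]]. pos.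
Qed.

Section Quant.
Variables (N : nat) (f : vec -> C) (z0 : vec) (rho M : R).
Hypothesis Hr : 0 < rho.
Hypothesis HM : forall z, near N z0 z rho -> Cmod (f z) <= M.
Hypothesis Hg : forall z, near N z0 z rho -> exists L, is_grad N f z L.

Let Hs z j : near N z0 z rho -> (j < N)%nat -> cdf (fun t => f (updv z j t)) (z j).
Proof. intros Hz Hj. destruct (Hg z Hz) as [L HL]. exists (L j). apply (is_grad_cd N); easy. Qed.
Let Hdep z z' : near N z0 z rho -> (forall i, (i < N)%nat -> z i = z' i) -> f z' = f z.
Proof. intros Hz E. destruct (Hg z Hz) as [L HL]. apply (is_grad_dep N f z L z' HL E). Qed.

Lemma An_lip z' : near N z0 z' (rho / 2) -> Cmod (f z' - f z0) <= 3 * M / rho * vdist N z0 z'.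
Proof. apply (osgood_lip N f z0 rho M); easy. Qed.

Lemma An_taylor : (forall i, (i < N)%nat -> Cmod (pd N i f z0) <= M / rho) /\ forall z', near N z0 z' (rho / 2) ->
 Cmod (f z' - f z0 - csum N (fun i => pd N i f z0 * (z' i - z0 i)))%C <= 7 * M / (rho * rho) * (vdist N z0 z' * vdist N z0 z').
Proof.
 assert (HM0 : 0 <= M) by (eapply Rle_trans; [apply Cmod_ge_0|apply (HM z0), near_refl; easy]).
 destruct (osgood_taylor N f z0 rho M Hr HM Hs Hdep) as (L & HL & HT).
 assert (HG : is_grad N f z0 L).
 { exists (rho / 2), (7 * M / (rho * rho)). split; [lra|split; [|easy]]. pos. }
 split.
 - intros i Hi. rewrite (pd_eq N f z0 L i HG Hi). auto.
 - intros z' Hz'. rewrite (csum_ext N _ (fun i => L i * (z' i - z0 i))%C); [auto|]. intros i Hi. rewrite (pd_eq N f z0 L i HG Hi). easy.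
Qed.
End Quant.

(** * Limits of analytic functions and analyticity of derivatives *)

Definition ccvg (u : nat -> C) (l : C) : Prop := forall eps, 0 < eps -> exists m0, forall m, (m0 <= m)%nat -> Cmod (u m - l) < eps.

Lemma ccvg_lim u l : ccvg u l <-> is_lim_seq (fun m => fst (u m)) (fst l) /\ is_lim_seq (fun m => snd (u m)) (snd l).
Proof.
 rewrite <- !is_lim_seq_spec. split.
 - intros H. split; intros [e He]; destruct (H e He) as (m0 & Hm); exists m0; intros m h; (eapply Rle_lt_trans; [|apply (Hm m h)]);
   [apply (Cmod_re_le (u m - l))|apply (Cmod_im_le (u m - l))].
 - intros [H H'] e He. destruct (H (mkposreal (e/2) ltac:(lra))) as (m1 & H1). destruct (H' (mkposreal (e/2) ltac:(lra))) as (m2 & H2).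
  exists (Nat.max m1 m2). intros m Hm. specialize (H1 m ltac:(lia)). specialize (H2 m ltac:(lia)). eapply Rle_lt_trans; [apply Cmod_le_abs|].
  simpl in *. unfold Rminus in *. lra.
Qed.

Lemma C_complete (u : nat -> C) : (forall eps, 0 < eps -> exists m0, forall m p, (m0 <= m)%nat -> (m0 <= p)%nat -> Cmod (u m - u p) < eps) ->
 exists l, ccvg u l.
Proof.
 intros H.
 assert (K : forall g : C -> R, (forall a b, Rabs (g a - g b) <= Cmod (a - b)) -> exists l : R, is_lim_seq (fun m => g (u m)) l).
 { intros g Hg. destruct (Rcomplete.R_complete (fun m => g (u m))) as (l & Hl).
  - intros e He. destruct (H e He) as (m0 & Hm). exists m0. intros m p h h'. eapply Rle_lt_trans; [apply Hg|auto].
  - exists l. apply is_lim_seq_Reals, Hl. }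
 destruct (K fst) as [a Ha]; [intros a b; apply (Cmod_re_le (a - b))|]. destruct (K snd) as [b Hb]; [intros x y; apply (Cmod_im_le (x - y))|].
 exists (a, b). apply ccvg_lim. easy.
Qed.

Lemma ccvg_unique u l l' : ccvg u l -> ccvg u l' -> l = l'.
Proof.
 rewrite !ccvg_lim. intros [H1 H2] [H3 H4]. apply is_lim_seq_unique in H1, H2, H3, H4. rewrite H1 in H3. rewrite H2 in H4.
 injection H3 as H3. injection H4 as H4. apply injective_projections; easy.
Qed.
Lemma ccvg_const c : ccvg (fun _ => c) c.
Proof. apply ccvg_lim. split; apply is_lim_seq_const. Qed.
Lemma ccvg_ext u v l : (forall m, u m = v m) -> ccvg u l -> ccvg v l.
Proof. intros E H. replace v with u; [easy|]. ext i; cmp; easy. Qed.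
Lemma ccvg_plus u v l l' : ccvg u l -> ccvg v l' -> ccvg (fun m => u m + v m)%C (l + l').
Proof. rewrite !ccvg_lim. split; apply is_lim_seq_plus'; easy. Qed.
Lemma ccvg_minus u v l l' : ccvg u l -> ccvg v l' -> ccvg (fun m => u m - v m)%C (l - l').
Proof. rewrite !ccvg_lim. split; apply is_lim_seq_minus'; easy. Qed.
Lemma ccvg_mult u v l l' : ccvg u l -> ccvg v l' -> ccvg (fun m => u m * v m)%C (l * l').
Proof. rewrite !ccvg_lim. split; [apply is_lim_seq_minus'|apply is_lim_seq_plus']; apply is_lim_seq_mult'; easy. Qed.
Lemma ccvg_le u l B : ccvg u l -> (forall m, Cmod (u m) <= B) -> Cmod l <= B.
Proof.
 intros H HB. apply le_epsilon. intros e He. destruct (H e He) as (m & Hm). specialize (Hm m (le_n _)).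
 via (Cmod_le_add l (u m)). rewrite Cmod_sub_sym. intuition.
Qed.
Lemma ccvg_csum n (u : nat -> nat -> C) l : (forall i, (i < n)%nat -> ccvg (fun m => u m i) (l i)) -> ccvg (fun m => csum n (u m)) (csum n l).
Proof. induction n; intros H; simpl. apply ccvg_const. apply ccvg_plus; [auto|auto]. Qed.

(** The common bound gives all [F m] the same quadratic remainder, so pointwise convergence makes
    the difference quotients at one fixed step, and thereby the gradients, Cauchy sequences. *)
Lemma An_lim N (F : nat -> vec -> C) f z0 rho M : 0 < rho ->
 (forall m z, near N z0 z rho -> (exists L, is_grad N (F m) z L) /\ Cmod (F m z) <= M) ->
 (forall z, near N z0 z rho -> ccvg (fun m => F m z) (f z)) ->
 exists L, is_grad N f z0 L /\ forall i, (i < N)%nat -> ccvg (fun m => pd N i (F m) z0) (L i).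
Proof.
 intros Hr HF Hf.
 assert (HM : 0 <= M) by (eapply Rle_trans; [apply Cmod_ge_0|apply (HF O z0), near_refl; easy]).
 assert (HT : forall m z', near N z0 z' (rho / 2) ->
  Cmod (F m z' - F m z0 - csum N (fun i => pd N i (F m) z0 * (z' i - z0 i)))%C <= 7 * M / (rho * rho) * (vdist N z0 z' * vdist N z0 z')).
 { intros m. apply (An_taylor N (F m) z0 rho M Hr); intros; apply HF; easy. }
 set (K := 7 * M / (rho * rho)) in *. assert (HK : 0 <= K) by (apply Rmult_le_pos; [lra|pos]).
 assert (HL : forall i, (i < N)%nat -> exists l, ccvg (fun m => pd N i (F m) z0) l).
 { intros i Hi. apply C_complete. intros e He.
  (* With this step the two quadratic remainders contribute at most [e * tau / 2], and the four
     pointwise errors of [e * tau / 8] make up the rest. *)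
  set (tau := Rmin (rho / 4) (e / (4 * (K + 1)))).
  assert (Ht : 0 < tau) by (apply Rmin_pos; [lra|pos]).
  assert (Ht1 : tau <= rho / 4) by apply Rmin_l. assert (Ht2 : tau <= e / (4 * (K + 1))) by apply Rmin_r.
  assert (Ht3 : 4 * (K + 1) * tau <= e). { apply (Rmult_le_compat_l (4 * (K + 1))) in Ht2; [|lra]. replace (4 * (K+1) * (e / (4 * (K + 1)))) with e in Ht2 by (field; lra). easy. }
  set (z1 := updv z0 i (z0 i + RtoC tau)). assert (Et : (z0 i + RtoC tau - z0 i)%C = RtoC tau) by ring.
  assert (Ct : Cmod (RtoC tau) = tau) by (rewrite Cmod_R, Rabs_right; lra).
  assert (Hz1 : near N z0 z1 (rho / 2)). { apply near_updv; [apply near_refl; lra|]. rewrite Et, Ct. lra. }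
  assert (Hd : vdist N z0 z1 = tau) by (unfold z1; rewrite vdist_updv, Et by easy; easy).
  destruct (Hf z1) with (eps := e * tau / 8) as (m1 & H1); [eapply near_le; [|eauto]; lra|nra|].
  destruct (Hf z0) with (eps := e * tau / 8) as (m2 & H2); [apply near_refl; lra|nra|].
  exists (Nat.max m1 m2). intros m p Hm Hp.
  assert (A1 := HT m z1 Hz1). assert (A2 := HT p z1 Hz1). rewrite Hd in A1, A2. unfold z1 in A1, A2. rewrite csum_updv, Et in A1, A2 by easy. fold z1 in A1, A2.
  assert (B1 := H1 m ltac:(lia)). assert (B2 := H1 p ltac:(lia)). assert (B3 := H2 m ltac:(lia)). assert (B4 := H2 p ltac:(lia)).
  set (a := pd N i (F m) z0) in *. set (b := pd N i (F p) z0) in *.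
  apply (Rmult_lt_reg_r tau); [easy|]. rewrite <- Ct at 1. rewrite <- Cmod_mult.
  replace ((a - b) * RtoC tau)%C with ((F p z1 - F p z0 - b * RtoC tau) - (F m z1 - F m z0 - a * RtoC tau) + ((F m z1 - f z1) - (F p z1 - f z1)) - ((F m z0 - f z0) - (F p z0 - f z0)))%C by ring.
  eapply Rle_lt_trans; [apply Cmod_sub_le|].
  eapply Rle_lt_trans; [apply Rplus_le_compat; [apply Cmod_triangle|apply Cmod_sub_le]|].
  eapply Rle_lt_trans; [apply Rplus_le_compat_r; apply Rplus_le_compat; apply Cmod_sub_le|].
  pos. }
 set (L := fun i => epsilon (inhabits (RtoC 0)) (fun l => ccvg (fun m => pd N i (F m) z0) l)).
 assert (HLc : forall i, (i < N)%nat -> ccvg (fun m => pd N i (F m) z0) (L i)) by (intros i Hi; apply epsilon_spec, HL; easy).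
 exists L. split; [|easy]. exists (rho / 2), K. split; [lra|split; [easy|]]. intros z' Hz'.
 apply (ccvg_le (fun m => F m z' - F m z0 - csum N (fun i => pd N i (F m) z0 * (z' i - z0 i)))%C); [|auto].
 apply ccvg_minus; [apply ccvg_minus; apply Hf|].
 - eapply near_le; [|eauto]; lra.
 - apply near_refl; lra.
 - apply ccvg_csum. intros i Hi. apply ccvg_mult; [auto|apply ccvg_const].
Qed.

Lemma is_grad_shift N f z i tau L : (i < N)%nat -> is_grad N f (updv z i (z i + tau)) L -> is_grad N (fun z => f (updv z i (z i + tau))) z L.
Proof.
 intros Hi H. eapply is_grad_ext.
 - apply (is_grad_comp N N f (fun k z => if Nat.eqb k i then (z i + tau)%C else z k) z L (fun k j => if Nat.eqb j k then 1%C else 0%C)); [|easy].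
  intros k Hk. destruct (Nat.eqb_spec k i) as [->|].
  + eapply is_grad_ext; [apply is_grad_plus; [apply is_grad_coord; easy|apply is_grad_const]|]. intros j Hj; simpl. ring.
  + apply is_grad_coord; easy.
 - intros j Hj. simpl. rewrite (csum_ext N _ (fun k => if Nat.eqb k j then L k else 0%C)).
  + apply csum_delta; easy.
  + intros k _. cmp; ring.
Qed.

Lemma is_grad_loc_bound N D f z : opn N D -> An N D f -> D z -> exists rho M, 0 < rho /\ forall z', near N z z' rho -> D z' /\ Cmod (f z') <= M.
Proof.
 intros HD Hf Hz. destruct (HD z Hz) as (r1 & Hr1 & H1). destruct (Hf z Hz) as [L HL].
 destruct (is_grad_lip N f z L HL) as (r2 & B & Hr2 & HB & H2).
 exists (Rmin r1 r2), (Cmod (f z) + B * (INR N * r2)). split; [pos|]. split.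
 - apply H1. eapply near_le; [apply Rmin_l|eauto].
 - assert (Hn : near N z z' r2) by (eapply near_le; [apply Rmin_r|eauto]).
  via (Cmod_le_add _ (f z)). apply Rplus_le_compat_l. eapply Rle_trans; [apply H2; easy|].
  apply Rmult_le_compat_l; [easy|]. apply vdist_near; easy.
Qed.

Lemma seq_small d : 0 < d -> exists u : nat -> R, (forall m, 0 < u m <= d) /\ forall e, 0 < e -> exists m0, forall m, (m0 <= m)%nat -> u m < e.
Proof.
 intros Hd. exists (fun m => d / (INR m + 1)). split.
 - intros m. assert (H := pos_INR m). split; [pos|]. apply (Rmult_le_reg_r (INR m + 1)); [lra|]. unfold Rdiv. rewrite Rmult_assoc, Rinv_l by lra. nra.
 - intros e He. destruct (INR_archimed e d He) as (m0 & Hm0). exists m0. intros m Hm. apply le_INR in Hm. assert (H := pos_INR m0).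
  apply (Rmult_lt_reg_r (INR m + 1)); [lra|]. unfold Rdiv. rewrite Rmult_assoc, Rinv_l by lra. nra.
Qed.

(** A partial derivative as a bounded limit of difference quotients: in this form [An_lim] yields
    both its analyticity ([An_pd]) and the symmetry of second derivatives ([pd_swap]). *)
Lemma pd_quot N D f i : opn N D -> An N D f -> (i < N)%nat -> forall z0, D z0 ->
 exists rho M (u : nat -> R), 0 < rho /\ (forall m, 0 < u m) /\ (forall e, 0 < e -> exists m0, forall m, (m0 <= m)%nat -> u m < e) /\ (forall z, near N z0 z rho -> D z) /\
 (forall m z, near N z0 z rho -> D (updv z i (z i + RtoC (u m)))) /\
 let F := fun m z => (RtoC (/ u m) * (f (updv z i (z i + RtoC (u m))) - f z))%C in
 (forall m z, near N z0 z rho -> (exists L, is_grad N (F m) z L) /\ Cmod (F m z) <= M) /\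
 (forall z, near N z0 z rho -> ccvg (fun m => F m z) (pd N i f z)).
Proof.
 intros HD Hf Hi z0 Hz0. destruct (is_grad_loc_bound N D f z0 HD Hf Hz0) as (r & M & Hr & HM).
 destruct (seq_small (r / 8)) as (u & Hu & Hu0); [lra|]. assert (Hup : forall m, 0 < u m) by (intros; apply Hu).
 assert (Cu : forall m, Cmod (RtoC (u m)) = u m) by (intros m; rewrite Cmod_R, Rabs_right; [easy|intuition]).
 assert (HM0 : 0 <= M) by (eapply Rle_trans; [apply Cmod_ge_0|apply (HM z0), near_refl; easy]).
 assert (Hsh : forall m z, near N z (updv z i (z i + RtoC (u m))) (r / 4)).
 { intros m z. apply near_updv; [apply near_refl; lra|]. replace (z i + RtoC (u m) - z i)%C with (RtoC (u m)) by ring. rewrite Cu. generalize (Hu m); lra. }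
 assert (Hn : forall z, near N z0 z (r / 2) -> forall z', near N z z' (r / 2) -> D z' /\ Cmod (f z') <= M).
 { intros z Hz z' Hz'. apply HM. replace r with (r / 2 + r / 2) by field. eapply near_trans; eauto. }
 assert (Hvd : forall m z, vdist N z (updv z i (z i + RtoC (u m))) = u m).
 { intros. rewrite vdist_updv by easy. replace (z i + RtoC (u m) - z i)%C with (RtoC (u m)) by ring. easy. }
 exists (r / 2), (3 * M / (r / 2)), u. split; [lra|]. split; [easy|]. split; [easy|]. split; [|split].
 { intros z Hz. apply (HM z). eapply near_le; [|eauto]; lra. }
 { intros m z Hz. apply (Hn z Hz). eapply near_le; [|easy]; lra. }
  split.
 - intros m z Hz. split.
  + destruct (Hf z) as [L HL]; [apply (HM z); eapply near_le; [|eauto]; lra|].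
   destruct (Hf (updv z i (z i + RtoC (u m)))) as [L' HL']. { apply (Hn z Hz). eapply near_le; [|easy]; lra. }
   eexists. apply is_grad_scal, is_grad_minus; [apply is_grad_shift; eauto|eauto].
  + rewrite Cmod_mult, Cmod_R, Rabs_right by pos.
   assert (HL := An_lip N f z (r / 2) M ltac:(lra) (fun z' h => proj2 (Hn z Hz z' h)) (fun z' h => Hf z' (proj1 (Hn z Hz z' h))) (updv z i (z i + RtoC (u m)))).
   replace (r / 2 / 2) with (r / 4) in HL by field. specialize (HL (Hsh m z)). rewrite Hvd in HL.
   apply (Rmult_le_reg_l (u m)); [easy|]. rewrite <- Rmult_assoc, Rinv_r, Rmult_1_l by pos. lra.
 - intros z Hz e He.
  assert (HT := proj2 (An_taylor N f z (r / 2) M ltac:(lra) (fun z' h => proj2 (Hn z Hz z' h)) (fun z' h => Hf z' (proj1 (Hn z Hz z' h))))).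
  set (K := 7 * M / (r / 2 * (r / 2))) in *. assert (HK : 0 <= K) by (apply Rmult_le_pos; [lra|pos]).
  destruct (Hu0 (e / (K + 1))) as (m0 & Hm0); [pos|]. exists m0. intros m Hm. specialize (Hm0 m Hm).
  specialize (HT (updv z i (z i + RtoC (u m)))). replace (r / 2 / 2) with (r / 4) in HT by field. specialize (HT (Hsh m z)).
  rewrite Hvd, csum_updv in HT by easy. replace (z i + RtoC (u m) - z i)%C with (RtoC (u m)) in HT by ring.
  assert (Hnz : RtoC (u m) <> 0%C). { intros E; apply RtoC_inj in E. generalize (Hup m); lra. }
  replace (RtoC (/ u m) * (f (updv z i (z i + RtoC (u m))) - f z) - pd N i f z)%C with
   (RtoC (/ u m) * (f (updv z i (z i + RtoC (u m))) - f z - pd N i f z * RtoC (u m)))%C.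
  2:{ rewrite RtoC_inv by pos. field; pos. }
  rewrite Cmod_mult, Cmod_R, Rabs_right by pos.
  apply (Rmult_lt_reg_l (u m)); [easy|]. rewrite <- Rmult_assoc, Rinv_r, Rmult_1_l by pos.
  apply (Rmult_lt_compat_l (K + 1)) in Hm0; [|lra]. replace ((K + 1) * (e / (K + 1))) with e in Hm0 by (field; lra). generalize (Hup m); nra.
Qed.

Lemma An_pd N D f i : opn N D -> An N D f -> (i < N)%nat -> An N D (pd N i f).
Proof.
 intros HD Hf Hi z0 Hz0. destruct (pd_quot N D f i HD Hf Hi z0 Hz0) as (rho & M & u & Hr & Hu & _ & _ & _ & HF & Hc).
 destruct (An_lim N _ (pd N i f) z0 rho M Hr HF Hc) as (L & HL & _). eauto.
Qed.

Lemma pd_swap N D f i j z : opn N D -> An N D f -> (i < N)%nat -> (j < N)%nat -> D z -> pd N j (pd N i f) z = pd N i (pd N j f) z.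
Proof.
 intros HD Hf Hi Hj Hz.
 destruct (pd_quot N D f i HD Hf Hi z Hz) as (rho & M & u & Hr & Hu & Hu0 & HDn & HDs & HF & Hc).
 destruct (An_lim N _ (pd N i f) z rho M Hr HF Hc) as (L & HL & HLc). rewrite (pd_eq N _ z L j HL Hj).
 specialize (HLc j Hj).
 assert (E : forall m, pd N j (fun z => (RtoC (/ u m) * (f (updv z i (z i + RtoC (u m))) - f z))%C) z =
  (RtoC (/ u m) * (pd N j f (updv z i (z i + RtoC (u m))) - pd N j f z))%C).
 { intros m. apply (pd_eq N _ z (fun j => RtoC (/ u m) * (pd N j f (updv z i (z i + RtoC (u m))) - pd N j f z))%C); [|easy].
  apply is_grad_scal, is_grad_minus; [apply is_grad_shift; [easy|]|]; apply (An_grad N D); auto.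
  apply HDs, near_refl; easy. }
 apply (ccvg_ext _ _ _ E) in HLc.
 assert (HG := is_grad_cd N (pd N j f) z _ i (An_grad N D (pd N j f) z (An_pd N D f j HD Hf Hj) Hz) Hi).
 apply (ccvg_unique _ _ _ HLc). intros e He.
 destruct (HG (e/2)) as (d & Hd & Ht); [lra|].
 destruct (Hu0 d Hd) as (m0 & Hm0). exists m0. intros m Hm. specialize (Hm0 m Hm).
 assert (Cu : Cmod (RtoC (u m)) = u m) by (rewrite Cmod_R, Rabs_right; [easy|intuition]).
 specialize (Ht (RtoC (u m))). rewrite Cu, updv_id in Ht.
 match goal with |- Cmod (?c * ?a - ?b)%C < _ => replace (c * a - b)%C with (RtoC (/ u m) * (a - b * RtoC (u m)))%C end.
 2:{ rewrite RtoC_inv by pos. field. intros E1; apply RtoC_inj in E1; generalize (Hu m); lra. }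
 rewrite Cmod_mult, Cmod_R, Rabs_right by pos.
 apply (Rmult_lt_reg_l (u m)); [easy|]. rewrite <- Rmult_assoc, Rinv_r, Rmult_1_l by pos.
  generalize (Hu m); nra.
Qed.

Lemma path_unif_cont (g : R -> C) a b : (forall x, a <= x <= b -> path_cont g x) -> forall e, 0 < e ->
 exists d, 0 < d /\ forall x y, a <= x <= b -> a <= y <= b -> Rabs (x - y) < d -> Cmod (g x - g y) <= e.
Proof.
 intros Hg e He. assert (He2 : 0 < e / 2) by lra.
 destruct (@Heine_cor2 (fun x => fst (g x)) a b) with (eps := mkposreal _ He2) as (d1 & H1).
 { intros x Hx. apply continuity_pt_filterlim. apply cc_fst, Hg; easy. }
 destruct (@Heine_cor2 (fun x => snd (g x)) a b) with (eps := mkposreal _ He2) as (d2 & H2).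
 { intros x Hx. apply continuity_pt_filterlim. apply cc_snd, Hg; easy. }
 exists (Rmin d1 d2). split; [apply Rmin_pos; apply cond_pos|]. intros x y Hx Hy Hxy.
 specialize (H1 x y Hx Hy (Rlt_le_trans _ _ _ Hxy (Rmin_l _ _))). specialize (H2 x y Hx Hy (Rlt_le_trans _ _ _ Hxy (Rmin_r _ _))). simpl in H1, H2.
 via Cmod_le_abs. unfold Cminus, Cplus, Copp; simpl. unfold Rminus in *. lra.
Qed.

(** Riemann sums of [f] along the flow are finite sums of translates of [f], so [An_lim] turns this
    convergence into the analyticity of time integrals ([An_intop]). *)
Lemma riemann_cvg (g : R -> C) L : 0 < L -> (forall x, 0 <= x <= L -> path_cont g x) ->
 ccvg (fun m => csum (S m) (fun k => RtoC (L / INR (S m)) * g (INR k * (L / INR (S m)))%R))%C (CI g 0 L).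
Proof.
 intros HL Hg e He.
 destruct (path_unif_cont g 0 L Hg (e / (2 * L))) as (d & Hd & Hu); [pos|].
 destruct (INR_archimed d L Hd) as (m0 & Hm0). exists m0. intros m Hm.
 set (h := L / INR (S m)). assert (HS : 0 < INR (S m)) by pos.
 assert (Hh : 0 < h) by pos.
 assert (Hhd : h < d). { unfold h. apply (Rmult_lt_reg_r (INR (S m))); [easy|]. unfold Rdiv. rewrite Rmult_assoc, Rinv_l by lra.
  rewrite S_INR. apply le_INR in Hm. nra. }
 assert (HhL : INR (S m) * h = L) by (unfold h; field; lra).
 assert (Hk : forall k, (k <= S m)%nat -> INR k * h <= L). { intros k Hk. apply le_INR in Hk. pos. }
 assert (P : forall k, (k <= S m)%nat -> Cmod (csum k (fun k => RtoC h * g (INR k * h)%R) - CI g 0 (INR k * h))%C <= INR k * (e / (2 * L) * h)).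
 { induction k; intros Hkm.
  - rewrite Rmult_0_l. unfold CI. rewrite !RInt_point. unfold zero; simpl. replace (0 - (0,0))%C with (RtoC 0). rewrite Cmod_0; lra. unfold Cminus, Cplus, Copp, RtoC; simpl; f_equal; ring.
  - specialize (IHk ltac:(lia)). assert (Hk1 := Hk (S k) Hkm). assert (Hk0 : 0 <= INR k * h) by (apply Rmult_le_pos; [pos|lra]).
   rewrite S_INR in Hk1 |- *. simpl csum.
   rewrite (CI_chasles g 0 (INR k * h) ((INR k + 1) * h)); [|easy|lra|intros; apply Hg; lra].
   match goal with |- Cmod (?a + ?b - (?c + ?d)) <= _ => replace (a + b - (c + d))%C with ((a - c) + (b - d))%C by ring end.
   via Cmod_triangle.
   replace ((INR k + 1) * (e / (2 * L) * h)) with (INR k * (e / (2 * L) * h) + (e / (2 * L) * h)) by ring. apply Rplus_le_compat; [easy|].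
   replace (RtoC h * g (INR k * h)%R)%C with (CI (fun _ => g (INR k * h)%R) (INR k * h) ((INR k + 1) * h)).
   2:{ rewrite CI_const. f_equal. f_equal. ring. }
   rewrite <- CI_minus; [|lra|intros; apply cc_const|intros; apply Hg; lra].
   eapply Rle_trans; [apply (CI_norm _ _ _ (e / (2 * L))); [lra| |]|lra].
   + intros; apply cc_minus; [apply cc_const|apply Hg; lra].
   + intros x Hx. apply Hu; try lra. rewrite Rabs_minus_sym, Rabs_right; lra. }
 specialize (P (S m) (le_n _)). rewrite HhL in P. eapply Rle_lt_trans; [apply P|].
 replace (INR (S m) * (e / (2 * L) * h)) with (e / (2 * L) * (INR (S m) * h)) by ring. rewrite HhL. replace (e / (2 * L) * L) with (e / 2) by (field; lra). lra.
Qed.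

(** * Time integrals along the linear flow *)

Definition shiftv (v : nat -> R) (z : vec) (t : R) : vec := fun i => (z i + RtoC (t * v i))%C.

Lemma shiftv_shiftv v z t t' : shiftv v (shiftv v z t) t' = shiftv v z (t + t').
Proof. ext i. unfold shiftv. rewrite Rmult_plus_distr_r, RtoC_plus. ring. Qed.
Lemma shiftv_0 v z : shiftv v z 0 = z.
Proof. ext i. unfold shiftv. rewrite Rmult_0_l. ring. Qed.
Lemma is_grad_shiftv N f v z t L : is_grad N f (shiftv v z t) L -> is_grad N (fun z => f (shiftv v z t)) z L.
Proof.
 intros H. eapply is_grad_ext.
 - apply (is_grad_comp N N f (fun k z => z k + RtoC (t * v k))%C z L (fun k j => if Nat.eqb j k then 1%C else 0%C)); [|easy].
  intros k Hk. eapply is_grad_ext; [apply is_grad_plus; [apply is_grad_coord; easy|apply is_grad_const]|]. intros j Hj; simpl. ring.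
 - intros j Hj. simpl. rewrite (csum_ext N _ (fun k => if Nat.eqb k j then L k else 0%C)).
  + apply csum_delta; easy.
  + intros k _. cmp; ring.
Qed.

Lemma is_grad_line N f v z L : is_grad N f z L ->
 is_cd (fun w => f (fun i => z i + w * RtoC (v i))%C) 0 (csum N (fun i => L i * RtoC (v i)))%C.
Proof.
 intros H. set (g := fun (k : nat) (w : vec) => (z k + w O * RtoC (v k))%C).
 assert (HG : is_grad 1 (fun w => f (fun k => g k w)) (fun _ => RtoC 0) (fun j => csum N (fun i => L i * ((if Nat.eqb j 0 then 1%C else 0%C) * RtoC (v i))))%C).
 { apply (is_grad_comp N 1 f g (fun _ => RtoC 0) L (fun i j => (if Nat.eqb j 0 then 1%C else 0%C) * RtoC (v i))%C).
  - intros i _. eapply is_grad_ext.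
   + apply is_grad_plus; [apply is_grad_const|]. apply is_grad_mult; [apply is_grad_coord; lia|apply is_grad_const].
   + intros j Hj. cmp; ring.
  - replace (fun i => g i (fun _ => RtoC 0)) with z; [easy|]. ext. unfold g. ring. }
 apply (is_grad_cd 1) with (j := O) in HG; [|lia]. rewrite (csum_ext N _ (fun i => L i * RtoC (v i))%C) in HG by (intros; simpl; ring).
  easy.
Qed.

Lemma is_grad_path_cont N f v z t L : is_grad N f (shiftv v z t) L -> path_cont (fun t => f (shiftv v z t)) t.
Proof.
 intros H. apply (is_grad_line N f v), is_cd_ccont in H.
 apply (cc_ext (fun t' => f (fun i => shiftv v z t i + RtoC (t' - t) * RtoC (v i))%C)).
 - intros t'. f_equal. ext. unfold shiftv. rewrite <- RtoC_mult, <- Cplus_assoc, <- RtoC_plus.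
  replace (t * v x + (t' - t) * v x) with (t' * v x) by ring. easy.
 - apply (cc_comp (fun w => f (fun i => shiftv v z t i + w * RtoC (v i))%C) (fun t' => RtoC (t' - t)) t); [rewrite Rminus_diag; easy|].
  apply cc_ofR, (continuous_minus (V := R_NormedModule)); [easy|apply continuous_const].
Qed.

Definition intop (v : nat -> R) (w : R -> R) (L : R) (f : vec -> C) (z : vec) : C := CI (fun t => RtoC (w t) * f (shiftv v z t))%C 0 L.

Section IntOp.
Variables (N : nat) (D : vec -> Prop) (v : nat -> R) (w : R -> R) (L M : R) (f : vec -> C).
Hypothesis HD : opn N D.
Hypothesis HDs : forall z t, D z -> D (shiftv v z t).
Hypothesis Hf : An N D f.
Hypothesis HM : forall z, D z -> Cmod (f z) <= M.
Hypothesis HL : 0 < L.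
Hypothesis Hw : forall t, path_cont (fun t => RtoC (w t)) t.
Hypothesis Hw1 : forall t, 0 <= t <= L -> Rabs (w t) <= 1.

Lemma An_path_cont z : D z -> forall t, path_cont (fun t => f (shiftv v z t)) t.
Proof. intros Hz t. destruct (Hf (shiftv v z t)) as [G HG]; [auto|]. apply (is_grad_path_cont N f v z t G HG). Qed.

Lemma intop_bound z : D z -> Cmod (intop v w L f z) <= M * L.
Proof.
 intros Hz. replace (M * L) with (M * (L - 0)) by ring. apply CI_norm; [lra| |].
 - intros; apply cc_mult; [easy|apply An_path_cont; easy].
 - intros x Hx. rewrite Cmod_mult, Cmod_R. rewrite <- (Rmult_1_l M). apply Rmult_le_compat; [pos|pos|auto|auto].
Qed.

Lemma An_intop : An N D (intop v w L f).
Proof.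
 intros z0 Hz0. destruct (HD z0 Hz0) as (rho & Hr & Hn).
 destruct (An_lim N (fun m z => csum (S m) (fun k => RtoC (L / INR (S m)) * (RtoC (w (INR k * (L / INR (S m)))%R) * f (shiftv v z (INR k * (L / INR (S m)))%R))))%C
  (intop v w L f) z0 rho (L * M) Hr) as (G & HG & _); [| |eauto].
 - split.
  + eexists. apply is_grad_csum. intros k _. do 2 apply is_grad_scal. apply is_grad_shiftv. apply (An_grad N D); auto.
  + assert (HS : 0 < INR (S m)) by pos. assert (Hh : 0 < L / INR (S m)) by pos.
   replace (L * M) with (INR (S m) * (L / INR (S m) * M)) by (field; lra). apply csum_norm_le. intros k Hk.
   rewrite !Cmod_mult, !Cmod_R, (Rabs_right (L / INR (S m))) by lra. apply Rmult_le_compat_l; [lra|].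
   rewrite <- (Rmult_1_l M). apply Rmult_le_compat; [pos|pos| |auto].
   apply Hw1. split; [apply Rmult_le_pos; [pos|lra]|].
   replace L with (INR (S m) * (L / INR (S m))) at 2 by (field; lra). intuition.
 - intros z Hz. apply (riemann_cvg (fun t => RtoC (w t) * f (shiftv v z t))%C L HL).
  intros; apply cc_mult; [easy|apply An_path_cont; auto].
Qed.
End IntOp.

Lemma is_grad_path_deriv N f v z L : is_grad N f z L -> path_deriv (fun t => f (shiftv v z t)) 0 (csum N (fun i => L i * RtoC (v i)))%C.
Proof.
 intros H. apply (is_grad_line N f v), is_cd_path in H. replace (fun t => f (shiftv v z t)) with (fun t => f (fun i => z i + RtoC t * RtoC (v i))%C); [easy|].
 ext. f_equal. ext. unfold shiftv. rewrite RtoC_mult. easy.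
Qed.

Definition avg (v : nat -> R) (L : R) (f : vec -> C) (z : vec) : C := (RtoC (/ L) * intop v (fun _ => 1%R) L f z)%C.
Definition sol (v : nat -> R) (L : R) (f : vec -> C) (z : vec) : C := intop v (fun t => 1 - t / L)%R L f z.

(** Integration by parts: the ramp falls from 1 to 0 with slope [- / L]. Expressed by the primitives
    of [h] and of [u * h u], the integral depends on [tau] through end points and coefficients only,
    so that continuity of [h] is enough to differentiate it. *)
Lemma deriv_ramp (h : R -> R) L : 0 < L -> (forall t, continuous h t) ->
 is_derive (fun tau => RInt (fun t => (1 - t / L) * h (t + tau)) 0 L) 0 (/ L * RInt h 0 L - h 0).
Proof.
 intros HL Hh.
 assert (Hc1 : forall t, continuous (fun u => u * h u) t) by (intros; apply (continuous_mult (fun u => u) h); [easy|easy]).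
 assert (E1 : forall a b, ex_RInt h a b) by (intros; apply (ex_RInt_continuous (V := R_CompleteNormedModule)); intros; apply Hh).
 assert (E2 : forall a b, ex_RInt (fun u => u * h u) a b) by (intros; apply (ex_RInt_continuous (V := R_CompleteNormedModule)); intros; apply Hc1).
 set (P := fun x => RInt h 0 x : R). set (Q := fun x => RInt (fun u => u * h u) 0 x : R).
 assert (DP : forall x, is_derive P x (h x)).
 { intros x. apply (is_derive_RInt h P 0 x); [|easy]. exists (mkposreal 1 Rlt_0_1). intros y _. apply (RInt_correct (V := R_CompleteNormedModule)), E1. }
 assert (DQ : forall x, is_derive Q x (x * h x)).
 { intros x. apply (is_derive_RInt (fun u => u * h u) Q 0 x); [|easy]. exists (mkposreal 1 Rlt_0_1). intros y _. apply (RInt_correct (V := R_CompleteNormedModule)), E2. }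
 assert (EJ : forall tau, RInt (fun t => (1 - t / L) * h (t + tau)) 0 L = (1 + tau / L) * (P (L + tau) - P tau) - / L * (Q (L + tau) - Q tau)).
 { intros tau.
  assert (C1 : forall (k : R -> R), (forall a b, ex_RInt k a b) -> RInt (fun t => k (t + tau)) 0 L = RInt k 0 (L + tau) - RInt k 0 tau).
  { intros k Hk. rewrite <- (RInt_Chasles (V := R_CompleteNormedModule) k 0 tau (L + tau)) by auto. unfold plus; simpl.
   replace (RInt k 0 tau + RInt k tau (L + tau) - RInt k 0 tau) with (RInt k (1 * 0 + tau) (1 * L + tau)).
   2:{ rewrite Rmult_0_r, Rmult_1_l, Rplus_0_l. lra. }
   rewrite <- (RInt_comp_lin (V := R_CompleteNormedModule)) by auto. apply RInt_ext. intros x _. rewrite !Rmult_1_l. easy. }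
  unfold P, Q. rewrite <- C1, <- C1 by auto.
  rewrite <- (RInt_scal (V := R_CompleteNormedModule) _ 0 L (1 + tau / L)), <- (RInt_scal (V := R_CompleteNormedModule) _ 0 L (/ L)).
  rewrite <- (RInt_minus (V := R_CompleteNormedModule)).
  - apply RInt_ext. intros x _. unfold minus, plus, opp, scal; simpl. unfold mult; simpl. lra.
  - apply (ex_RInt_scal (V := R_NormedModule)). apply (ex_RInt_continuous (V := R_CompleteNormedModule)). intros. apply (continuous_comp (fun x => x + tau) h); [|easy]. apply (continuous_plus (fun x => x) (fun _ => tau)); [easy|apply continuous_const].
  - apply (ex_RInt_scal (V := R_NormedModule)). apply (ex_RInt_continuous (V := R_CompleteNormedModule)). intros. apply (continuous_comp (fun x => x + tau) (fun u => u * h u)); [|easy]. apply (continuous_plus (fun x => x) (fun _ => tau)); [easy|apply continuous_const].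
  - apply (ex_RInt_continuous (V := R_CompleteNormedModule)). intros. apply (continuous_comp (fun x => x + tau) (fun u => u * h u)); [|easy]. apply (continuous_plus (fun x => x) (fun _ => tau)); [easy|apply continuous_const].
  - apply (ex_RInt_continuous (V := R_CompleteNormedModule)). intros. apply (continuous_comp (fun x => x + tau) h); [|easy]. apply (continuous_plus (fun x => x) (fun _ => tau)); [easy|apply continuous_const]. }
 apply (is_derive_ext (fun tau => (1 + tau / L) * (P (L + tau) - P tau) - / L * (Q (L + tau) - Q tau))); [easy|].
 assert (Ex : forall x, ex_derive P x) by (intros; eexists; apply DP). assert (Ex2 : forall x, ex_derive Q x) by (intros; eexists; apply DQ).
 assert (V1 : forall x, Derive P x = h x) by (intros; apply is_derive_unique, DP).
 assert (V2 : forall x, Derive Q x = x * h x) by (intros; apply is_derive_unique, DQ).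
 auto_derive; [easy|]. rewrite !V1, !V2, !Rplus_0_r. unfold P. rewrite RInt_point. unfold zero; simpl. field. lra.
Qed.

Lemma sol_deriv N D v L M f z : opn N D -> (forall z t, D z -> D (shiftv v z t)) -> An N D f -> (forall z, D z -> Cmod (f z) <= M) -> 0 < L -> D z ->
 An N D (sol v L f) /\ Cmod (sol v L f z) <= M * L /\ An N D (avg v L f) /\ Cmod (avg v L f z) <= M /\
 csum N (fun i => pd N i (sol v L f) z * RtoC (v i))%C = (avg v L f z - f z)%C.
Proof.
 intros HD HDs Hf HM HL Hz.
 assert (W1 : forall t, path_cont (fun t => RtoC (1 - t / L)) t).
 { intros t. apply cc_ofR. apply (ex_derive_continuous (V := R_NormedModule)). auto_derive. easy. }
 assert (W1b : forall t, 0 <= t <= L -> Rabs (1 - t / L) <= 1).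
 { intros t Ht. assert (0 <= t / L <= 1). { split; [apply Rmult_le_pos; [lra|pos]|]. apply (Rmult_le_reg_r L); [lra|]. unfold Rdiv. rewrite Rmult_assoc, Rinv_l; lra. } apply Rabs_le; lra. }
 assert (W2 : forall t, path_cont (fun t => RtoC 1) t) by (intros; apply cc_const).
 assert (W2b : forall t, 0 <= t <= L -> Rabs 1 <= 1) by (intros; rewrite Rabs_R1; lra).
 assert (AS : An N D (sol v L f)) by (apply (An_intop N D v _ L M f); auto).
 assert (AI : An N D (intop v (fun _ => 1%R) L f)) by (apply (An_intop N D v _ L M f); auto).
 split; [easy|]. split; [apply (intop_bound N D v (fun t => 1 - t / L)%R L M f); auto|]. split; [|split].
 - apply An_mult; [apply An_const|easy].
 - unfold avg. rewrite Cmod_mult, Cmod_R, Rabs_right by pos.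
  apply (Rmult_le_reg_l L); [easy|]. rewrite <- Rmult_assoc, Rinv_r, Rmult_1_l by lra. rewrite Rmult_comm. apply (intop_bound N D v (fun _ => 1%R) L M f); auto.
 - assert (HP := is_grad_path_deriv N (sol v L f) v z _ (An_grad N D _ z AS Hz)).
  set (l := csum N (fun i => pd N i (sol v L f) z * RtoC (v i))%C) in *.
  assert (Hpc : forall t, path_cont (fun t => f (shiftv v z t)) t) by (apply (An_path_cont N D v f HDs Hf z Hz)).
  assert (Es : forall tau, sol v L f (shiftv v z tau) = (RInt (fun t => (1 - t / L) * fst (f (shiftv v z (t + tau)))) 0 L, RInt (fun t => (1 - t / L) * snd (f (shiftv v z (t + tau)))) 0 L)).
  { intros tau. unfold sol, intop, CI. f_equal; apply RInt_ext; intros x _; rewrite shiftv_shiftv, (Rplus_comm tau x); unfold RtoC, Cmult; simpl; ring. }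
  assert (Ea : avg v L f z = (/ L * RInt (fun t => fst (f (shiftv v z t))) 0 L, / L * RInt (fun t => snd (f (shiftv v z t))) 0 L)).
  { unfold avg, intop, CI. unfold RtoC at 1, Cmult at 1; simpl. f_equal.
   - rewrite Rmult_0_l, Rminus_0_r. f_equal. apply RInt_ext. pos.
   - rewrite Rmult_0_l, Rplus_0_r. f_equal. apply RInt_ext. pos. }
  destruct HP as [HP1 HP2].
  assert (D1 := deriv_ramp (fun t => fst (f (shiftv v z t))) L HL (fun t => cc_fst _ t (Hpc t))).
  assert (D2 := deriv_ramp (fun t => snd (f (shiftv v z t))) L HL (fun t => cc_snd _ t (Hpc t))).
  apply (is_derive_ext _ (fun t => fst (sol v L f (shiftv v z t)))) in D1; [|intros t; rewrite Es; reflexivity].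
  apply (is_derive_ext _ (fun t => snd (sol v L f (shiftv v z t)))) in D2; [|intros t; rewrite Es; reflexivity].
  apply is_derive_unique in HP1, HP2, D1, D2. rewrite HP1 in D1. rewrite HP2 in D2. rewrite shiftv_0 in D1, D2.
  rewrite (surjective_pairing l), D1, D2, Ea. easy.
Qed.

(** * Trigonometric polynomials: orthogonality and a lattice point count *)

Fixpoint lsum {A} (f : A -> R) (l : list A) : R := match l with [] => 0 | a :: l => f a + lsum f l end.
Fixpoint lsC {A} (f : A -> C) (l : list A) : C := match l with [] => RtoC 0 | a :: l => (f a + lsC f l)%C end.

Section ListSums.
Context {A : Type}.
Implicit Types l : list A.
Lemma lsum_ext (f g : A -> R) l : (forall a, In a l -> f a = g a) -> lsum f l = lsum g l.
Proof. induction l; intros H; simpl; [easy|]. rewrite IHl, H; auto with datatypes. Qed.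
Lemma lsC_ext (f g : A -> C) l : (forall a, In a l -> f a = g a) -> lsC f l = lsC g l.
Proof. induction l; intros H; simpl; [easy|]. rewrite IHl, H; auto with datatypes. Qed.
Lemma lsum_le (f g : A -> R) l : (forall a, In a l -> f a <= g a) -> lsum f l <= lsum g l.
Proof. induction l; intros H; simpl; [lra|]. apply Rplus_le_compat; [intuition|]. intuition. Qed.
Lemma lsum_pos (f : A -> R) l : (forall a, In a l -> 0 <= f a) -> 0 <= lsum f l.
Proof. induction l; intros H; simpl; [lra|]. apply Rplus_le_le_0_compat; [intuition|]. intuition. Qed.
Lemma lsum_plus (f g : A -> R) l : lsum (fun a => f a + g a) l = lsum f l + lsum g l.
Proof. induction l; simpl; [|lra]; ring. Qed.
Lemma lsC_minus (f g : A -> C) l : lsC (fun a => f a - g a)%C l = (lsC f l - lsC g l)%C.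
Proof. induction l; simpl; [|rewrite IHl]; ring. Qed.
Lemma lsum_scal c (f : A -> R) l : lsum (fun a => c * f a) l = c * lsum f l.
Proof. induction l; simpl; [|lra]; ring. Qed.
Lemma lsC_scal c (f : A -> C) l : lsC (fun a => c * f a)%C l = (c * lsC f l)%C.
Proof. induction l; simpl; [|rewrite IHl]; ring. Qed.
Lemma lsC_0 (f : A -> C) l : (forall a, In a l -> f a = RtoC 0) -> lsC f l = RtoC 0.
Proof. induction l; intros H; simpl; [easy|]. rewrite H, IHl by auto with datatypes. ring. Qed.
Lemma lsC_norm (f : A -> C) l : Cmod (lsC f l) <= lsum (fun a => Cmod (f a)) l.
Proof. induction l; simpl; [rewrite Cmod_0; lra|]. via Cmod_triangle. lra. Qed.
Lemma lsum_const c l : lsum (fun _ => c) l = INR (length l) * c.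
Proof. induction l; [cmp; ring|]. simpl lsum. rewrite IHl. simpl length. rewrite S_INR. ring. Qed.
Lemma lsum_app (f : A -> R) l l' : lsum f (l ++ l') = lsum f l + lsum f l'.
Proof. induction l; simpl; [|lra]; ring. Qed.
Lemma lsC_app (f : A -> C) l l' : lsC f (l ++ l') = (lsC f l + lsC f l')%C.
Proof. induction l; simpl; [|rewrite IHl]; ring. Qed.
Lemma lsum_amgm (a b : A -> R) l t : 0 < t -> lsum (fun x => a x * b x) l <= (t * lsum (fun x => a x * a x) l + / t * lsum (fun x => b x * b x) l) / 2.
Proof.
 intros Ht. rewrite <- !lsum_scal, <- lsum_plus. replace (lsum (fun a0 => t * (a a0 * a a0) + / t * (b a0 * b a0)) l / 2) with (/2 * lsum (fun a0 => t * (a a0 * a a0) + / t * (b a0 * b a0)) l) by field.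
 rewrite <- lsum_scal. apply lsum_le. intros x _. set (p := a x). set (q := b x).
 apply Rminus_le. replace (p * q - / 2 * (t * (p * p) + / t * (q * q))) with (- (/ (2 * t)) * ((t * p - q) * (t * p - q))) by (field; lra).
 assert (0 <= (t * p - q) * (t * p - q)) by apply Rle_0_sqr. assert (0 < / (2 * t)) by pos. nra.
Qed.
End ListSums.

Lemma lsum_map {A B} (f : B -> R) (g : A -> B) l : lsum f (map g l) = lsum (fun a => f (g a)) l.
Proof. induction l; simpl; [easy|lra]. Qed.
Lemma lsC_map {A B} (f : B -> C) (g : A -> B) l : lsC f (map g l) = lsC (fun a => f (g a)) l.
Proof. induction l; simpl; [easy|f_equal; auto]. Qed.
Lemma lsum_flat_map {A B} (f : B -> R) (g : A -> list B) l : lsum f (flat_map g l) = lsum (fun a => lsum f (g a)) l.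
Proof. induction l; simpl; [easy|rewrite lsum_app, IHl; easy]. Qed.
Lemma lsC_flat_map {A B} (f : B -> C) (g : A -> list B) l : lsC f (flat_map g l) = lsC (fun a => lsC f (g a)) l.
Proof. induction l; simpl; [easy|rewrite lsC_app, IHl; easy]. Qed.
Lemma lsC_csum {A} n (f : A -> nat -> C) (l : list A) : lsC (fun a => csum n (f a)) l = csum n (fun i => lsC (fun a => f a i) l).
Proof. induction l; simpl. symmetry; apply csum_0; easy. rewrite IHl, <- csum_plus. easy. Qed.
Lemma csum_lsum_swap {A} n (f : A -> nat -> R) (l : list A) : lsum (fun a => rsum n (f a)) l = rsum n (fun i => lsum (fun a => f a i) l).
Proof. induction l; simpl. rewrite rsum_const; ring. rewrite IHl, <- rsum_plus. easy. Qed.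

Lemma lsC_delta (f : Z -> C) (l : list Z) a : NoDup l -> In a l -> lsC (fun x => if Z.eqb x a then f x else RtoC 0) l = f a.
Proof.
 induction 1 as [|b l Hb Hl IH]; intros Ha; [easy|]. simpl. destruct (Z.eqb_spec b a) as [->|Hn].
 - rewrite lsC_0. ring. intros x Hx. destruct (Z.eqb_spec x a); [subst; easy|easy].
 - rewrite IH. ring. destruct Ha; [easy|easy].
Qed.

Lemma lsum_inj {A B} (dec : forall x y : B, {x = y} + {x <> y}) (code : A -> B) (g : B -> R) (l : list A) (lB : list B) :
 NoDup (map code l) -> (forall a, In a l -> In (code a) lB) -> (forall b, 0 <= g b) -> lsum (fun a => g (code a)) l <= lsum g lB.
Proof.
 intros Hn Hi Hg. rewrite <- lsum_map. assert (Hi' : incl (map code l) lB). { intros b Hb. apply in_map_iff in Hb. destruct Hb as (a & <- & Ha). auto. }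
 clear Hi. revert lB Hi'. induction (map code l) as [|b m IH]; intros lB Hi'; simpl; [apply lsum_pos; auto|].
 inversion Hn; subst. destruct (in_split b lB) as (l1 & l2 & ->); [intuition|].
 assert (H := IH H2 (l1 ++ l2)). rewrite lsum_app in *. simpl.
 assert (lsum g m <= lsum g l1 + lsum g l2); [apply H|lra].
 intros c Hc. assert (Hc' := Hi' c (or_intror Hc)). apply in_app_iff in Hc'. apply in_app_iff. destruct Hc' as [|[->|]]; auto. easy.
Qed.

Definition zr (N : nat) : list Z := map (fun i => (Z.of_nat i - Z.of_nat N)%Z) (seq 0 (2 * N + 1)).
Lemma in_zr N m : In m (zr N) <-> (- Z.of_nat N <= m <= Z.of_nat N)%Z.
Proof.
 unfold zr. rewrite in_map_iff. split.
 - intros (i & <- & Hi). apply in_seq in Hi. lia.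
 - intros H. exists (Z.to_nat (m + Z.of_nat N)). split; [lia|]. apply in_seq. lia.
Qed.
Lemma NoDup_zr N : NoDup (zr N).
Proof. unfold zr. apply Injective_map_NoDup; [intros x y; lia|apply seq_NoDup]. Qed.
Lemma length_zr N : length (zr N) = (2 * N + 1)%nat.
Proof. unfold zr. rewrite length_map, length_seq. easy. Qed.

Fixpoint bl (n N : nat) : list (list Z) := match n with O => [[]] | S n => flat_map (fun m => map (cons m) (bl n N)) (zr N) end.
Lemma in_bl n N k : In k (bl n N) <-> length k = n /\ List.Forall (fun m : Z => In m (zr N)) k.
Proof.
 revert k. induction n; intros k; simpl.
 - split; [intros [<-|[]]; split; [easy|easy]|]. destruct k; [auto|easy].
 - rewrite in_flat_map. split.
  + intros (m & Hm & H). apply in_map_iff in H. destruct H as (k' & <- & Hk). apply IHn in Hk. split; [cmp; easy|]. intuition.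
  + intros [H1 H2]. destruct k as [|m k]; [easy|]. inversion H2; subst. exists m. split; [easy|]. apply in_map. apply IHn. auto.
Qed.
Lemma NoDup_bl n N : NoDup (bl n N).
Proof.
 induction n; simpl; [constructor; [easy|pos]|].
 assert (H := NoDup_zr N). induction H as [|m l Hm Hl IH]; simpl; [pos|].
 apply NoDup_app; [apply Injective_map_NoDup; [congruence|easy]|easy|].
 intros k Hk Hk'. apply in_map_iff in Hk. destruct Hk as (k1 & <- & _). apply in_flat_map in Hk'. destruct Hk' as (m' & Hm' & H).
 apply in_map_iff in H. destruct H as (k2 & E & _). congruence.
Qed.

(** The head of a list belongs to the highest variable, since [bl] prepends one entry per variable;
    an induction on [n] thereby splits off the last variable. *)
Fixpoint dotl (k : list Z) (z : vec) : C := match k with [] => RtoC 0 | m :: k => (RtoC (IZR m) * z (length k) + dotl k z)%C end.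
Fixpoint dotr (k : list Z) (x : nat -> R) : R := match k with [] => 0 | m :: k => IZR m * x (length k) + dotr k x end.
Fixpoint l1l (k : list Z) : R := match k with [] => 0 | m :: k => Rabs (IZR m) + l1l k end.

Lemma dotl_ext k z z' : (forall i, (i < length k)%nat -> z i = z' i) -> dotl k z = dotl k z'.
Proof. induction k as [|m k IH]; intros H; simpl; [easy|]. rewrite IH, H; [easy|auto|]. intros; apply H; simpl; lia. Qed.
Lemma dotl_im k z : snd (dotl k z) = dotr k (fun i => snd (z i)).
Proof. induction k as [|m k IH]; simpl; [easy|]. lra. Qed.
Lemma dotl_shiftv k v z t : dotl k (shiftv v z t) = (dotl k z + RtoC (t * dotr k v))%C.
Proof.
 induction k as [|m k IH]; simpl; [rewrite Rmult_0_r; ring|]. rewrite IH. unfold shiftv. rewrite Rmult_plus_distr_l, !RtoC_plus.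
 replace (t * (IZR m * v (length k))) with (IZR m * (t * v (length k))) by ring. rewrite (RtoC_mult (IZR m)). ring.
Qed.
Lemma l1l_pos k : 0 <= l1l k.
Proof. induction k as [|m k IH]; simpl; [lra|]. pos. Qed.

Lemma ce_real_neq1 x : 0 < Rabs x < 1 -> ce (RtoC x) <> 1%C.
Proof.
 intros Hx E. unfold ce in E; simpl in E. rewrite Rmult_0_r, Ropp_0, exp_0, !Rmult_1_l in E. apply (f_equal fst) in E. simpl in E.
 assert (Hpi := PI_RGT_0). replace (2 * PI * x) with (2 * (PI * x)) in E by ring. rewrite cos_2a_sin in E.
 assert (Hs : sin (PI * Rabs x) = 0).
 { assert (sin (PI * x) = 0) by pos. unfold Rabs. destruct (Rcase_abs x); [|easy].
  replace (PI * - x) with (- (PI * x)) by ring. rewrite sin_neg, H. ring. }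
 assert (0 < sin (PI * Rabs x)) by (apply sin_gt_0; nra). lra.
Qed.

Definition node (N l : nat) : R := INR l / INR (2 * N + 1).

(** Differences of two frequencies in [zr N] have absolute value at most 2 N, below the number of
    nodes, so the root of unity [u] differs from 1 unless [j] is 0. *)
Lemma orthog N (j : Z) : (Z.abs j <= 2 * Z.of_nat N)%Z -> csum (2 * N + 1) (fun l => cek j (RtoC (node N l))) = if Z.eqb j 0 then RtoC (INR (2 * N + 1)) else RtoC 0.
Proof.
 intros Hj. set (K := (2 * N + 1)%nat). assert (HK : 0 < INR K) by pos.
 destruct (Z.eqb_spec j 0) as [->|Hn].
 - rewrite (csum_ext K _ (fun _ => 1%C)) by (intros; apply cek_0).
  clear. induction K; [easy|]. simpl csum. rewrite IHK, S_INR, RtoC_plus. easy.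
 - set (u := ce (RtoC (IZR j / INR K))).
  assert (Hu : u <> 1%C).
  { apply ce_real_neq1. assert (Hj0 : 0 < Rabs (IZR j)) by (apply Rabs_pos_lt, not_0_IZR; easy).
   unfold Rdiv. rewrite Rabs_mult, Rabs_inv, (Rabs_right (INR K)) by lra. split; [pos|].
   apply (Rmult_lt_reg_r (INR K)); [easy|]. rewrite Rmult_assoc, Rinv_l, Rmult_1_r, Rmult_1_l by lra.
   rewrite <- abs_IZR, INR_IZR_INZ. apply IZR_lt. lia. }
  assert (Hp : forall l, cek j (RtoC (node N l)) = (u ^ l)%C).
  { intros l. unfold u. rewrite cek_pow. unfold cek. f_equal. rewrite <- !RtoC_mult. f_equal. rewrite <- INR_IZR_INZ. unfold node. fold K. lra. }
  rewrite (csum_ext K _ (fun l => u ^ l)%C) by easy.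
  assert (G : ((1 - u) * csum K (fun l => u ^ l))%C = (1 - u ^ K)%C). { generalize K. intros m. induction m; simpl; [ring|]. rewrite Cmult_plus_distr_l, IHm. ring. }
  assert (E1 : (u ^ K)%C = 1%C). { unfold u. rewrite cek_pow. unfold cek. rewrite <- RtoC_mult. rewrite <- INR_IZR_INZ. replace (INR K * (IZR j / INR K)) with (IZR j) by (field; lra). apply ce_int. }
  rewrite E1 in G. assert (Hn1 : (1 - u)%C <> 0%C). { intros E. apply Hu. replace u with (1 - (1 - u))%C by ring. rewrite E. ring. }
  replace (csum K (fun l => u ^ l)%C) with (/ (1 - u) * ((1 - u) * csum K (fun l => u ^ l)))%C by (field; pos). rewrite G. ring.
Qed.

Lemma Cconj_cek_real j x : Cconj (cek j (RtoC x)) = cek (- j) (RtoC x).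
Proof.
 unfold cek. rewrite <- !RtoC_mult. unfold ce, Cconj; simpl. rewrite Rmult_0_r, Ropp_0, exp_0, !Rmult_1_l, opp_IZR.
 replace (2 * PI * (- IZR j * x)) with (- (2 * PI * (IZR j * x))) by ring. rewrite cos_neg, sin_neg. easy.
Qed.
Lemma Cconj_lsC {A} (f : A -> C) l : Cconj (lsC f l) = lsC (fun a => Cconj (f a)) l.
Proof. induction l; simpl; [unfold Cconj, RtoC; simpl; f_equal; ring|]. rewrite <- IHl. unfold Cconj, Cplus; simpl. f_equal; ring. Qed.
Lemma Cconj_mult a b : Cconj (a * b) = (Cconj a * Cconj b)%C.
Proof. unfold Cconj, Cmult; simpl. f_equal; ring. Qed.
Lemma RtoC_rsum n f : RtoC (rsum n f) = csum n (fun i => RtoC (f i)).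
Proof. induction n; simpl; [easy|]. rewrite RtoC_plus, IHn. easy. Qed.
Lemma RtoC_lsum {A} (f : A -> R) l : RtoC (lsum f l) = lsC (fun i => RtoC (f i)) l.
Proof. induction l; simpl; [easy|]. rewrite RtoC_plus, IHl. easy. Qed.

(** On equidistant nodes the identity is finite and exact for frequencies in [zr N]; neither
    integrals nor convergent series enter. *)
Lemma parseval N (d : Z -> C) : rsum (2 * N + 1) (fun l => Cmod (lsC (fun m => d m * cek m (RtoC (node N l))) (zr N))%C ^ 2) = INR (2 * N + 1) * lsum (fun m => Cmod (d m) ^ 2) (zr N).
Proof.
 apply RtoC_inj. rewrite RtoC_rsum, RtoC_mult, RtoC_lsum. set (K := (2 * N + 1)%nat).
 rewrite (csum_ext K _ (fun l => lsC (fun m => lsC (fun m' => d m * Cconj (d m') * cek (m - m') (RtoC (node N l))) (zr N)) (zr N))%C).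
 2:{ intros l _. rewrite Cmod2_conj, Cconj_lsC. rewrite Cmult_comm, <- lsC_scal. apply lsC_ext. intros m _. rewrite Cmult_comm, <- lsC_scal. apply lsC_ext. intros m' _.
   rewrite Cconj_mult, Cconj_cek_real. unfold Z.sub. rewrite cek_add. ring. }
 rewrite <- lsC_csum. rewrite <- lsC_scal. apply lsC_ext. intros m Hm.
 rewrite <- lsC_csum.
 rewrite (lsC_ext _ (fun m' => if Z.eqb m' m then (RtoC (INR K) * (d m * Cconj (d m')))%C else RtoC 0)).
 - rewrite (lsC_delta (fun m' => RtoC (INR K) * (d m * Cconj (d m')))%C) by (apply NoDup_zr || easy). rewrite <- Cmod2_conj. easy.
 - intros m' Hm'. rewrite csum_scal. unfold K. rewrite orthog by (apply in_zr in Hm, Hm'; lia).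
  destruct (Z.eqb_spec (m - m') 0), (Z.eqb_spec m' m); try lia; ring.
Qed.

(* Parseval on the faces [Im z_i = y_i +- sg], one variable at a time: the weight [exp (4 pi sg |m|)]
  is at most the sum of the weights for the two signs. *)
Lemma bessel N n : forall (A : Type) (la : list A) (c : A -> list Z -> C) (y : nat -> R) (sg Bd : R),
 (forall z : vec, (forall i, (i < n)%nat -> snd (z i) = y i + sg \/ snd (z i) = y i - sg) ->
   lsum (fun a => Cmod (lsC (fun k => c a k * ce (dotl k z)) (bl n N))%C ^ 2) la <= Bd) ->
 lsum (fun a => lsum (fun k => Cmod (c a k) ^ 2 * exp (- (4 * PI * dotr k y) + 4 * PI * sg * l1l k)) (bl n N)) la <= 2 ^ n * Bd.
Proof.
 induction n; intros A la c y sg Bd H.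
 - specialize (H (fun _ => RtoC 0) ltac:(intros; lia)). simpl in *. rewrite Rmult_1_l. eapply Rle_trans; [|apply H]. apply lsum_le. intros a _.
  rewrite !Rmult_0_r, Ropp_0, Rplus_0_l, exp_0. replace (c a [] * ce 0 + 0)%C with (c a []) by (rewrite ce_0; ring). lra.
 - set (K := (2 * N + 1)%nat). assert (HK : 0 < INR K) by pos.
  (* The frequency [m] of the last variable becomes part of the index set, with its weight moved
     into the coefficient. This is why the statement treats a family indexed by [la]. *)
  set (c2 := fun (am : A * Z) k => (c (fst am) (snd am :: k) * RtoC (exp (- (2 * PI * (IZR (snd am) * y n)) + 2 * PI * sg * Rabs (IZR (snd am)))))%C).
  assert (IH := IHn (A * Z)%type (list_prod la (zr N)) c2 y sg (2 * Bd)).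
  assert (Elp : forall (f : A * Z -> R), lsum f (list_prod la (zr N)) = lsum (fun a => lsum (fun m => f (a, m)) (zr N)) la).
  { intros f. induction la as [|a la' IHla]; simpl; [easy|]. rewrite lsum_app, lsum_map. f_equal. clear -la'. induction la' as [|a la' IHla]; simpl; [easy|]. rewrite lsum_app, lsum_map, IHla. easy. }
  rewrite !Elp in IH.
  assert (E1 : lsum (fun a => lsum (fun m => lsum (fun k => Cmod (c2 (a, m) k) ^ 2 * exp (- (4 * PI * dotr k y) + 4 * PI * sg * l1l k)) (bl n N)) (zr N)) la
    = lsum (fun a => lsum (fun k => Cmod (c a k) ^ 2 * exp (- (4 * PI * dotr k y) + 4 * PI * sg * l1l k)) (bl (S n) N)) la).
  { apply lsum_ext. intros a _. simpl bl. rewrite lsum_flat_map. apply lsum_ext. intros m _. rewrite lsum_map. apply lsum_ext. intros k Hk.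
   apply in_bl in Hk. destruct Hk as [Hk _]. unfold c2; simpl fst; simpl snd. rewrite Cmod_mult, Cmod_R, (Rabs_right (exp _)) by pos.
   rewrite Rpow_mult_distr, Rmult_assoc. f_equal. rewrite <- Rsqr_pow2. unfold Rsqr. rewrite <- !exp_plus. f_equal. simpl. rewrite Hk. ring. }
  rewrite <- E1. replace (2 ^ S n * Bd) with (2 ^ n * (2 * Bd)) by (cmp; ring). apply IH.
  intros z Hz. rewrite Elp.
  set (d := fun a m => lsC (fun k => c a (m :: k) * ce (dotl k z))%C (bl n N)).
  (* Parseval in the last variable alone, on one of its two boundary lines. *)
  assert (Hside : forall eta, (eta = sg \/ eta = - sg) -> lsum (fun a => lsum (fun m => Cmod (d a m) ^ 2 * exp (- (4 * PI * (IZR m * (y n + eta))))) (zr N)) la <= Bd).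
  { intros eta Heta. apply (Rmult_le_reg_l (INR K)); [easy|].
   assert (P : INR K * lsum (fun a => lsum (fun m => Cmod (d a m) ^ 2 * exp (- (4 * PI * (IZR m * (y n + eta))))) (zr N)) la =
     rsum K (fun l => lsum (fun a => Cmod (lsC (fun k => c a k * ce (dotl k (updv z n (node N l, (y n + eta)%R)))) (bl (S n) N))%C ^ 2) la)).
   { rewrite <- csum_lsum_swap, <- lsum_scal. apply lsum_ext. intros a _.
    set (d2 := fun m => (d a m * RtoC (exp (- (2 * PI * (IZR m * (y n + eta))))))%C).
    transitivity (INR (2 * N + 1) * lsum (fun m => Cmod (d2 m) ^ 2) (zr N)).
    - f_equal. apply lsum_ext. intros m _. unfold d2. rewrite Cmod_mult, Cmod_R, (Rabs_right (exp _)), Rpow_mult_distr by pos. f_equal.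
     rewrite <- Rsqr_pow2. unfold Rsqr. rewrite <- exp_plus. f_equal. ring.
    - rewrite <- parseval. apply rsum_ext. intros l _. f_equal. f_equal. simpl bl. rewrite lsC_flat_map. apply lsC_ext. intros m _.
     rewrite lsC_map. unfold d2, d. rewrite <- Cmult_assoc, Cmult_comm, <- lsC_scal. apply lsC_ext. intros k Hk. apply in_bl in Hk. destruct Hk as [Hk _].
     simpl dotl. rewrite Hk, updv_eq, ce_plus. rewrite (dotl_ext k (updv z n _) z) by (intros i Hi; apply updv_neq; lia).
     unfold cek, ce, RtoC, Cmult; simpl. rewrite !Rmult_0_l, !Rmult_0_r, !Rplus_0_r, !Rmult_0_r, Ropp_0, exp_0. f_equal; ring. }
   rewrite P. replace (INR K * Bd) with (rsum K (fun _ => Bd)) by (rewrite rsum_const; easy). apply rsum_le. intros l _. apply H.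
   intros i Hi. unfold updv. destruct (Nat.eqb_spec i n) as [->|]; simpl; [lra|]. intuition. }
  assert (S1 := Hside sg (or_introl eq_refl)). assert (S2 := Hside (- sg) (or_intror eq_refl)).
  replace (2 * Bd) with (Bd + Bd) by ring. eapply Rle_trans; [|apply Rplus_le_compat; [apply S1|apply S2]].
  rewrite <- lsum_plus. apply lsum_le. intros a _. rewrite <- lsum_plus. apply lsum_le. intros m _.
  replace (lsC (fun k => c2 (a, m) k * ce (dotl k z))%C (bl n N)) with (d a m * RtoC (exp (- (2 * PI * (IZR m * y n)) + 2 * PI * sg * Rabs (IZR m))))%C.
  + rewrite Cmod_mult, Cmod_R, (Rabs_right (exp _)), Rpow_mult_distr by pos. rewrite <- Rmult_plus_distr_l.
   apply Rmult_le_compat_l; [pos|]. rewrite <- Rsqr_pow2. unfold Rsqr. rewrite <- exp_plus.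
   assert (X1 := exp_pos (- (4 * PI * (IZR m * (y n + sg))))). assert (X2 := exp_pos (- (4 * PI * (IZR m * (y n + - sg))))).
   unfold Rabs. destruct (Rcase_abs (IZR m)).
   * eapply Rle_trans; [|apply Rplus_le_compat_l; left; apply X2]. rewrite Rplus_0_r. right. f_equal. ring.
   * eapply Rle_trans; [|apply Rplus_le_compat_r; left; apply X1]. rewrite Rplus_0_l. right. f_equal. ring.
  + unfold d, c2. rewrite Cmult_comm, <- lsC_scal. apply lsC_ext. intros k _. cmp; ring.
Qed.

Definition zfl (x : R) : Z := (up x - 1)%Z.
Lemma zfl_spec x : IZR (zfl x) <= x < IZR (zfl x) + 1.
Proof. unfold zfl. rewrite minus_IZR. destruct (archimed x). lra. Qed.

(** Majorants on cells with integer index: the factor [exp 1] here and the 4 in [wfl] pay for a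
    rounding by less than one unit ([wcell_bound], [wfl_bound]). *)
Definition wcell (m : Z) : R := exp 1 * exp (- Rabs (IZR m)).
Definition wfl (m : Z) : R := 4 / (1 + IZR m * IZR m).
Definition wtail (k : list Z) : R := fold_right (fun m p => wcell m * p) 1 k.
Definition wcode (k : list Z) : R := match k with [] => 0 | m :: k => wfl m * wtail k end.

Lemma lsum_zr_split (f : Z -> R) N : lsum f (zr N) = f 0%Z + rsum N (fun i => f (Z.of_nat (S i)) + f (- Z.of_nat (S i))%Z).
Proof.
 unfold zr. rewrite lsum_map.
 assert (G : forall a b (g : nat -> R), lsum g (seq a b) = rsum b (fun i => g (a + i)%nat)).
 { intros a b. revert a. induction b; intros a g; simpl; [easy|]. rewrite IHb.
  assert (Q : forall m (h : nat -> R), rsum (S m) h = h O + rsum m (fun i => h (S i))). { induction m; intros h; simpl; [ring|]. simpl in IHm. rewrite IHm. ring. }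
  specialize (Q b (fun i => g (a + i)%nat)). simpl in Q. rewrite Q, Nat.add_0_r. f_equal. apply rsum_ext. intuition. }
 rewrite G. induction N.
 - cmp; ring.
 - replace (2 * S N + 1)%nat with (S (S (2 * N + 1))) by lia.
  assert (Q : forall m (h : nat -> R), rsum (S m) h = h O + rsum m (fun i => h (S i))). { induction m; intros h; simpl; [ring|]. simpl in IHm. rewrite IHm. ring. }
  rewrite Q. change (rsum (S (2*N+1)) ?g) with (rsum (2*N+1) g + g (2*N+1)%nat).
  rewrite (rsum_ext (2 * N + 1) _ (fun i => f (Z.of_nat (0 + i) - Z.of_nat N)%Z)) by (intros; f_equal; lia). rewrite IHN.
  replace (Z.of_nat (0 + S (2 * N + 1)) - Z.of_nat (S N))%Z with (Z.of_nat (S N)) by lia. cmp; ring.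
Qed.

Lemma lsum_wcell N : lsum wcell (zr N) <= 9.
Proof.
 rewrite lsum_zr_split. unfold wcell.
 assert (He : exp 1 <= 3) by apply exp_le_3. assert (He2 : 2 < exp 1) by (generalize (exp_ineq1 1); lra).
 set (q := exp (-1)). assert (Hq : exp 1 * q = 1) by (unfold q; rewrite <- exp_plus; replace (1 + -1) with 0 by ring; apply exp_0).
 rewrite Rabs_R0, Ropp_0, exp_0.
 rewrite (rsum_ext N _ (fun i => 2 * q ^ i)).
 - rewrite rsum_scal. assert (G : rsum N (fun i => q ^ i) * (1 - q) = 1 - q ^ N). { induction N; simpl; [ring|]. lra. }
  assert (0 <= q ^ N) by pos. assert (rsum N (fun i => q ^ i) <= 2) by nra. change (rsum N (pow q)) with (rsum N (fun i => q ^ i)). lra.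
 - intros i _. rewrite opp_IZR, Rabs_Ropp, Rabs_right by intuition. rewrite <- INR_IZR_INZ, S_INR.
  replace (exp 1 * exp (- (INR i + 1))) with (q ^ i). ring.
  rewrite <- exp_plus. replace (1 + - (INR i + 1)) with (INR i * -1) by ring. induction i; [simpl; rewrite Rmult_0_l, exp_0; easy|].
  rewrite S_INR, Rmult_plus_distr_r, exp_plus, <- IHi. simpl. unfold q. rewrite Rmult_1_l. ring.
Qed.

Lemma lsum_wfl N : lsum wfl (zr N) <= 20.
Proof.
 rewrite lsum_zr_split. unfold wfl.
 (* Comparison with a telescoping sum: 1 / (1 + (x + 1)^2) is at most 1 / (x + 1/2) - 1 / (x +
    3/2). *)
 assert (G : rsum N (fun i => 4 / (1 + IZR (Z.of_nat (S i)) * IZR (Z.of_nat (S i))) + 4 / (1 + IZR (- Z.of_nat (S i)) * IZR (- Z.of_nat (S i)))) <= 8 * (2 - / (INR N + /2))).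
 { rewrite (rsum_ext N _ (fun i => 8 / (1 + INR (S i) * INR (S i)))).
  2:{ intros i _. rewrite opp_IZR, <- INR_IZR_INZ. field; pos. }
  induction N; [simpl; lra|]. eapply Rle_trans; [apply Rplus_le_compat_r, IHN|].
   rewrite !S_INR. set (x := INR N). assert (0 <= x) by apply pos_INR.
  assert (A1 : / (1 + (x + 1) * (x + 1)) <= / ((x + /2) * (x + 1 + /2))) by (apply Rinv_le_contravar; nra).
  assert (A2 : / ((x + /2) * (x + 1 + /2)) = / (x + /2) - / (x + 1 + /2)) by (field; lra).
   lra. }
 assert (0 < / (INR N + /2)) by (apply Rinv_0_lt_compat; generalize (pos_INR N); lra). lra.
Qed.

Lemma lsum_wcode n J : lsum wcode (bl (S n) J) <= 20 * 9 ^ n.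
Proof.
 assert (G : forall n, 0 <= lsum wtail (bl n J) <= 9 ^ n).
 { induction n0; [unfold wtail; simpl; lra|]. simpl bl. rewrite lsum_flat_map.
  rewrite (lsum_ext _ (fun m => lsum wtail (bl n0 J) * wcell m)).
  - rewrite lsum_scal. assert (W := lsum_wcell J). assert (W0 : 0 <= lsum wcell (zr J)). { apply lsum_pos. pos. }
    simpl. pos.
  - intros m _. rewrite lsum_map. change (fun a => wtail (m :: a)) with (fun a => wcell m * wtail a). rewrite lsum_scal. ring. }
 simpl bl. rewrite lsum_flat_map.
 rewrite (lsum_ext _ (fun m => lsum wtail (bl n J) * wfl m)).
 - rewrite lsum_scal. assert (W := lsum_wfl J).
   specialize (G n). pos.
 - intros m _. rewrite lsum_map. simpl. rewrite lsum_scal. ring.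
Qed.

Definition celll (q : R) (k : list Z) : list Z := map (fun m => zfl (IZR m / q)) k.

Lemma celll_dist q k k' : 0 < q -> length k = length k' -> celll q k = celll q k' ->
 l1l (map (fun p => (fst p - snd p)%Z) (combine k k')) <= INR (length k) * q.
Proof.
 intros Hq. revert k'. induction k as [|m k IH]; intros [|m' k'] Hl H; simpl in *; try discriminate; try lra.
 injection H; intros H1 H2. injection Hl; intros Hl'. specialize (IH k' Hl' H1).
 assert (Rabs (IZR (m - m')) <= q).
 { destruct (zfl_spec (IZR m / q)) as [a1 a2]. destruct (zfl_spec (IZR m' / q)) as [b1 b2]. rewrite H2 in a1, a2. rewrite minus_IZR.
  replace (IZR m - IZR m') with (q * (IZR m / q - IZR m' / q)) by (field; lra). rewrite Rabs_mult, Rabs_right by lra.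
  apply Rle_trans with (q * 1); [|lra]. apply Rmult_le_compat_l; [lra|]. apply Rabs_le; lra. }
 destruct (length k) eqn:E.
 - simpl in *. lra.
 - lra.
Qed.

Lemma dotr_sub k k' v : length k = length k' -> dotr (map (fun p => (fst p - snd p)%Z) (combine k k')) v = dotr k v - dotr k' v.
Proof.
 revert k'. induction k as [|m k IH]; intros [|m' k'] H; simpl in *; try discriminate; [ring|]. injection H; intros H'.
 rewrite IH by easy. rewrite length_map, length_combine, H', Nat.min_id, minus_IZR. ring.
Qed.

Lemma l1l_0 k : l1l k = 0 -> forall m, In m k -> m = 0%Z.
Proof.
 induction k as [|m k IH]; simpl; intros H a Ha; [easy|]. assert (H0 := Rabs_pos (IZR m)). assert (H1 := l1l_pos k).
 destruct Ha as [<-|Ha]; [|apply IH; [lra|easy]]. apply eq_IZR. destruct (Req_dec (IZR m) 0); [easy|]. assert (0 < Rabs (IZR m)) by (apply Rabs_pos_lt; easy). lra.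
Qed.

Lemma sub_eq k k' : length k = length k' -> (forall m, In m (map (fun p => (fst p - snd p)%Z) (combine k k')) -> m = 0%Z) -> k = k'.
Proof.
 revert k'. induction k as [|m k IH]; intros [|m' k'] H H0; simpl in *; try discriminate; [easy|].
 f_equal; [specialize (H0 (m - m')%Z (or_introl eq_refl)); lia|]. auto.
Qed.

Lemma wcell_bound q sg m : 0 < q -> 1 <= 2 * PI * sg * q -> exp (- (2 * PI * sg * Rabs (IZR m))) <= wcell (zfl (IZR m / q)).
Proof.
 intros Hq Hs. unfold wcell. rewrite <- exp_plus. destruct (zfl_spec (IZR m / q)) as [a1 a2]. set (i := IZR (zfl (IZR m / q))) in *.
 assert (H : Rabs i - 1 <= 2 * PI * sg * Rabs (IZR m)).
 { assert (E : Rabs (IZR m) = q * Rabs (IZR m / q)). { unfold Rdiv. rewrite Rabs_mult, Rabs_inv, (Rabs_right q) by lra. field; lra. }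
   assert (P := Rabs_pos (IZR m / q)). assert (Rabs i - 1 <= Rabs (IZR m / q)).
  { unfold Rabs. destruct (Rcase_abs i), (Rcase_abs (IZR m / q)); lra. } nra. }
 destruct (Rle_lt_or_eq_dec (- (2 * PI * sg * Rabs (IZR m))) (1 + - Rabs i)) as [h|h]; [lra|left; apply exp_increasing; easy|rewrite h; lra].
Qed.

Lemma wfl_bound x : / (1 + x * x) <= wfl (zfl x).
Proof.
 unfold wfl. destruct (zfl_spec x) as [a1 a2]. set (i := zfl x) in *.
 apply (Rmult_le_reg_r (1 + x * x)); [nra|]. rewrite Rinv_l by nra. apply (Rmult_le_reg_r (1 + IZR i * IZR i)); [nra|].
 replace (4 / (1 + IZR i * IZR i) * (1 + x * x) * (1 + IZR i * IZR i)) with (4 * (1 + x * x)) by (field; nra).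
 destruct (Z_le_dec 0 i) as [h|h].
 - apply IZR_le in h. nra.
 - assert (h' : (i <= -1)%Z) by lia. apply IZR_le in h'. assert ((IZR i + 1) * (IZR i + 1) <= x * x) by nra. nra.
Qed.

Lemma wtail_bound q sg k : 0 < q -> 1 <= 2 * PI * sg * q -> exp (- (2 * PI * sg * l1l k)) <= wtail (celll q k).
Proof.
 intros Hq Hs. induction k as [|m k IH]; simpl; [unfold wtail; simpl; rewrite Rmult_0_r, Ropp_0, exp_0; lra|].
 rewrite Rmult_plus_distr_l, Ropp_plus_distr, exp_plus. apply Rmult_le_compat; try (left; apply exp_pos); [|easy]. apply wcell_bound; easy.
Qed.

(* Two indices in a common cell of side [Q / n] differ by a vector of norm at most [Q], so the
  Diophantine condition separates the values [Psi k.v] by at least 1: the pair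
  (integer part of [Psi k.v], cell of [k]) determines [k]. *)
Lemma counting n N v Psi Q sg : (1 <= n)%nat -> 0 < Psi -> 0 < Q -> INR n <= sg * Q ->
 (forall k, length k = n -> 0 < l1l k <= Q -> 1 <= Psi * Rabs (dotr k v)) ->
 lsum (fun k => exp (- (2 * PI * sg * l1l k)) * / (1 + (Psi * dotr k v) * (Psi * dotr k v))) (bl n N) <= 20 * 9 ^ n.
Proof.
 intros Hn HPsi HQ Hsg Hdio. assert (HnR : 1 <= INR n) by (apply (le_INR 1); easy). assert (Hpi : 3 < PI) by (generalize PI2_3_2; lra).
 set (q := Q / INR n). assert (Hq : 0 < q) by pos.
 assert (Hs : 1 <= 2 * PI * sg * q).
 { assert (1 <= sg * q). { unfold q. apply (Rmult_le_reg_r (INR n)); [lra|]. replace (sg * (Q / INR n) * INR n) with (sg * Q) by (field; lra). lra. } nra. }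
 set (code := fun k => zfl (Psi * dotr k v) :: celll q k).
 apply Rle_trans with (lsum (fun k => wcode (code k)) (bl n N)).
 { apply lsum_le. intros k _. rewrite Rmult_comm. apply Rmult_le_compat.
  - pos.
  - pos.
  - apply wfl_bound.
  - apply wtail_bound; easy. }
 (* Some box contains the codes of the finitely many [k]; any size will do, because the bound of
    [lsum_wcode] is uniform in the box. *)
 assert (HJ : forall l : list (list Z), exists J, forall k, In k l -> List.Forall (fun m : Z => In m (zr J)) (code k)).
 { assert (H1 : forall c : list Z, exists J, List.Forall (fun m : Z => In m (zr J)) c).
  { induction c as [|m c (J & HJ)]; [exists O; constructor|]. exists (Nat.max J (Z.to_nat (Z.abs m))). constructor; [apply in_zr; lia|].
   eapply Forall_impl; [|eauto]. intros a Ha. apply in_zr in Ha. apply in_zr. lia. }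
  induction l as [|k l (J & HJ)]; [exists O; easy|]. destruct (H1 (code k)) as (J' & HJ'). exists (Nat.max J J').
  intros k' [<-|Hk']; [eapply Forall_impl; [|eauto]|eapply Forall_impl; [|auto]]; intros a Ha; simpl in Ha; apply in_zr in Ha; apply in_zr; lia. }
 destruct (HJ (bl n N)) as (J & HJ'). eapply Rle_trans; [|apply (lsum_wcode n J)].
 apply (lsum_inj (list_eq_dec Z.eq_dec) code wcode).
 - assert (Inj : forall k k', In k (bl n N) -> In k' (bl n N) -> code k = code k' -> k = k').
  { intros k k' Hk Hk' E. apply in_bl in Hk, Hk'. destruct Hk as [Hk _]. destruct Hk' as [Hk' _]. injection E; intros E1 E2.
   assert (Hl : length k = length k') by congruence.
   set (d := map (fun p => (fst p - snd p)%Z) (combine k k')).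
   assert (Ld : length d = n) by (unfold d; rewrite length_map, length_combine, Hk, Hk'; apply Nat.min_id).
   assert (D1 := celll_dist q k k' Hq Hl E1). rewrite Hk in D1. replace (INR n * q) with Q in D1 by (unfold q; field; lra).
   apply sub_eq; [easy|]. apply l1l_0. apply Rle_antisym; [|apply l1l_pos]. apply Rnot_lt_le. intros Hpos.
   specialize (Hdio d Ld (conj Hpos D1)). unfold d in Hdio. rewrite dotr_sub in Hdio by easy.
   destruct (zfl_spec (Psi * dotr k v)) as [a1 a2]. destruct (zfl_spec (Psi * dotr k' v)) as [b1 b2]. rewrite E2 in a1, a2.
   rewrite <- (Rabs_right Psi), <- Rabs_mult in Hdio by lra. rewrite Rmult_minus_distr_l in Hdio.
   assert (Rabs (Psi * dotr k v - Psi * dotr k' v) < 1) by (apply Rabs_def1; lra). lra. }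
  assert (Nd := NoDup_bl n N). revert Inj. induction Nd as [|k l Hk Hl IH]; intros Inj; simpl; [pos|]. constructor.
  + intros Hin. apply in_map_iff in Hin. destruct Hin as (k' & E & Hk'). apply Inj in E; [subst; easy|cmp; auto|cmp; auto].
  + intuition.
 - intros k Hk. apply in_bl. split; [|auto]. apply in_bl in Hk. unfold code, celll. simpl. rewrite length_map. lia.
 - intros b. destruct b as [|m b]; simpl; [lra|]. apply Rmult_le_pos.
  + pos.
  + induction b; simpl; [lra|]. pos.
Qed.

(** * Interpolation and the ergodization estimate *)

Lemma pow_lin_small q e : 0 < q < 1 -> 0 < e -> exists N, INR (2 * N + 1) * q ^ N < e.
Proof.
 intros Hq He. set (p := sqrt q). assert (Hp : p * p = q) by (apply sqrt_sqrt; lra).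
 assert (Hp0 : 0 < p) by (apply sqrt_lt_R0; lra). assert (Hp1 : p < 1) by nra.
 set (x := / p - 1). assert (Hx : 0 < x). { unfold x. assert (1 < / p) by (rewrite <- Rinv_1; apply Rinv_lt_contravar; lra). lra. }
 assert (HB : forall N, INR N * p ^ N * x <= 1).
 { intros N. assert (H : 1 + INR N * x <= (1 + x) ^ N) by (apply poly; lra). replace (1 + x) with (/ p) in H by (unfold x; ring). rewrite pow_inv in H.
  assert (0 < p ^ N) by pos. apply (Rmult_le_compat_r (p ^ N)) in H; [|lra]. rewrite Rinv_l in H by lra. nra. }
 destruct (pow_lt_1_zero p) with (y := e / (2 / x + 1)) as (N & HN). { rewrite Rabs_right; lra. } { apply Rdiv_lt_0_compat; [easy|]. assert (0 < 2 / x) by pos. lra. }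
 exists N. specialize (HN N (le_n _)). rewrite Rabs_right in HN by pos.
 assert (Hq2 : q ^ N = p ^ N * p ^ N) by (rewrite <- Hp, Rpow_mult_distr; easy). assert (Hpn : 0 < p ^ N) by pos.
 assert (H1 : p ^ N <= 1). { rewrite <- (pow1 N). apply pow_incr; lra. }
 assert (0 < 2 / x) by pos.
 assert (H2 : INR (2 * N + 1) * p ^ N <= 2 / x + 1).
 { rewrite plus_INR, mult_INR. simpl (INR 2). simpl (INR 1). assert (INR N * p ^ N <= / x). { apply (Rmult_le_reg_r x); [easy|]. rewrite Rinv_l by lra. easy. } lra. }
  apply (Rmult_lt_compat_r (2 / x + 1)) in HN; [|lra]. replace (e / (2 / x + 1) * (2 / x + 1)) with e in HN by (field; lra). nra.
Qed.

Lemma lsC_zr_split (f : Z -> C) N : lsC f (zr N) = (csum (S N) (fun m => f (Z.of_nat m)) + csum N (fun m => f (- Z.of_nat (S m))%Z))%C.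
Proof.
 assert (H1 := lsum_zr_split (fun m => fst (f m)) N). assert (H2 := lsum_zr_split (fun m => snd (f m)) N).
 assert (E : forall l, lsC f l = (lsum (fun m => fst (f m)) l, lsum (fun m => snd (f m)) l)). { induction l; simpl; [easy|]. rewrite IHl. easy. }
 assert (E2 : forall n (g : nat -> C), csum n g = (rsum n (fun i => fst (g i)), rsum n (fun i => snd (g i)))). { induction n; intros g; simpl; [easy|]. rewrite IHn. easy. }
 rewrite E, H1, H2, csum_shift, !E2, !rsum_plus. unfold Cplus; cbn [fst snd]. f_equal; simpl; ring.
Qed.

(** Trigonometric interpolation rather than a truncated Fourier series: its coefficients are finite
    sums of values of [F], so interpolating in one variable keeps holomorphy in the others without
    any differentiation under an integral. *)
Definition interp (N : nat) (F : C -> C) (z : C) : C :=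
 lsC (fun m => RtoC (/ INR (2 * N + 1)) * csum (2 * N + 1) (fun l => F (RtoC (node N l)) * cek (- m) (RtoC (node N l))) * cek m z)%C (zr N).

Lemma exp_le a b : a <= b -> exp a <= exp b.
Proof. intros [H| ->]; [left; apply exp_increasing; easy|easy]. Qed.

Lemma interp_trig N (c : Z -> C) z : interp N (fun w => lsC (fun m => c m * cek m w)%C (zr N)) z = lsC (fun m => c m * cek m z)%C (zr N).
Proof.
  set (K := (2 * N + 1)%nat). assert (HK : INR K <> 0) by pos. apply lsC_ext. intros m Hm.
 rewrite (csum_ext K _ (fun l => lsC (fun m' => c m' * cek (m' - m) (RtoC (node N l)))%C (zr N))).
 2:{ intros l _. rewrite Cmult_comm, <- lsC_scal. apply lsC_ext. intros m' _. unfold Z.sub. rewrite cek_add. ring. }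
 rewrite <- lsC_csum. rewrite (lsC_ext _ (fun m' => if Z.eqb m' m then (RtoC (INR K) * c m')%C else RtoC 0)).
 - rewrite (lsC_delta (fun m' => RtoC (INR K) * c m')%C) by (apply NoDup_zr || easy). rewrite Cmult_assoc, <- RtoC_mult, Rinv_l by easy. ring.
 - intros m' Hm'. rewrite csum_scal. unfold K. rewrite orthog by (apply in_zr in Hm, Hm'; lia).
  destruct (Z.eqb_spec (m' - m) 0), (Z.eqb_spec m' m); try lia; ring.
Qed.

Lemma interp_minus N F G z : interp N (fun w => F w - G w)%C z = (interp N F z - interp N G z)%C.
Proof.
 unfold interp. rewrite <- lsC_minus. apply lsC_ext. intros m _.
 rewrite (csum_ext _ _ (fun l => F (RtoC (node N l)) * cek (- m) (RtoC (node N l)) - G (RtoC (node N l)) * cek (- m) (RtoC (node N l)))%C) by (intros; ring).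
 rewrite csum_minus. ring.
Qed.

Lemma interp_norm N F B s z : 0 <= B -> (forall x, Cmod (F (RtoC x)) <= B) -> Rabs (snd z) <= s ->
 Cmod (interp N F z) <= INR (2 * N + 1) * (B * exp (2 * PI * (INR N * s))).
Proof.
 intros HB HF Hz. unfold interp. set (K := (2 * N + 1)%nat). assert (HK : 0 < INR K) by pos.
 via lsC_norm. replace (INR K * (B * exp (2 * PI * (INR N * s)))) with (INR (length (zr N)) * (B * exp (2 * PI * (INR N * s)))) by (rewrite length_zr; easy). rewrite <- lsum_const. apply lsum_le.
 intros m Hm. rewrite !Cmod_mult. apply Rmult_le_compat; [pos|pos| |].
 - rewrite Cmod_R, Rabs_right by pos. apply (Rmult_le_reg_l (INR K)); [easy|]. rewrite <- Rmult_assoc, Rinv_r, Rmult_1_l by lra.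
  apply csum_norm_le. intros l _. rewrite Cmod_mult, Cmod_cek. rewrite !Rmult_0_r, Ropp_0, exp_0, Rmult_1_r. easy.
 - rewrite Cmod_cek. apply exp_le. apply in_zr in Hm. assert (Rabs (IZR m) <= INR N). { rewrite <- abs_IZR, INR_IZR_INZ. apply IZR_le. lia. }
  assert (Hpi := PI_RGT_0). assert (Rabs (IZR m * snd z) <= INR N * s). { rewrite Rabs_mult. apply Rmult_le_compat; try apply Rabs_pos; easy. }
  assert (- (IZR m * snd z) <= INR N * s). { via Rle_abs. rewrite Rabs_Ropp. easy. } nra.
Qed.

Lemma trig1 s S eta : 0 <= s < S -> 0 < eta -> exists N, forall (F : C -> C) M,
 (forall z : C, Rabs (snd z) < S -> cdf F z /\ F (z + 1)%C = F z /\ Cmod (F z) <= M) ->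
 forall z : C, Rabs (snd z) <= s -> Cmod (interp N F z - F z) <= eta * M.
Proof.
 intros HsS Heta. assert (Hpi := PI_RGT_0). set (s1 := (s + S) / 2). set (q := exp (- (2 * PI * (s1 - s)))).
 assert (Hq : 0 < q < 1) by (apply exp_lt_1; unfold s1; nra).
 destruct (pow_lin_small q (eta * (1 - q) / 4) Hq) as (N & HN); [nra|]. exists N. intros F M HF z Hz.
 assert (HFs : forall z : C, - S < snd z < S -> cdf F z) by (intros; apply HF; apply Rabs_def1; lra).
 assert (HFp : forall z : C, - S < snd z < S -> F (z + 1)%C = F z) by (intros; apply HF; apply Rabs_def1; lra).
 assert (HFM : forall z : C, - S < snd z < S -> Cmod (F z) <= M) by (intros; apply HF; apply Rabs_def1; lra).
 assert (HM : 0 <= M) by (eapply Rle_trans; [apply Cmod_ge_0|apply (HFM (RtoC 0)); simpl; lra]).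
 set (c := coef F 0). set (T := fun w => lsC (fun m => c m * cek m w)%C (zr N)).
 assert (HR : forall w : C, forall sw, 0 <= sw <= s -> Rabs (snd w) <= sw -> Cmod (F w - T w) <= 2 * M * (exp (- (2 * PI * (s1 - sw))) ^ (Datatypes.S N) / (1 - q))).
 { intros w sw Hsw Hw. apply Rabs_le_between in Hw. unfold T. rewrite lsC_zr_split.
  assert (L := laurent F (- S) S M HFs HFp HFM w 0 (- s1) s1 N ltac:(lra) ltac:(unfold s1; lra) ltac:(unfold s1; lra)).
  via L. set (r := exp (- (2 * PI * (s1 - sw)))).
  assert (Hrq : r <= q) by (apply exp_le; nra).
  assert (G : forall t, s1 - sw <= t -> exp (- (2 * PI * t)) ^ Datatypes.S N / (1 - exp (- (2 * PI * t))) <= r ^ Datatypes.S N / (1 - q)).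
  { intros t Ht. assert (exp (- (2 * PI * t)) <= r) by (apply exp_le; nra). assert (0 < exp (- (2 * PI * t))) by apply exp_pos.
   apply Rmult_le_compat; [pos|pos|apply pow_incr; lra|apply Rinv_le_contravar; lra]. }
  assert (G1 := G (snd w - - s1) ltac:(lra)). assert (G2 := G (s1 - snd w) ltac:(lra)).
  pos. }
 replace (interp N F z - F z)%C with (interp N (fun w => F w - T w) z - (F z - T z))%C.
 2:{ rewrite interp_minus. unfold T. rewrite interp_trig. ring. }
 via Cmod_sub_le.
 set (r0 := exp (- (2 * PI * (s1 - 0)))).
 assert (B0 : 0 <= 2 * M * (r0 ^ Datatypes.S N / (1 - q))). { pos. }
 assert (I1 := interp_norm N (fun w => F w - T w)%C _ s z B0 (fun x => HR (RtoC x) 0 ltac:(lra) ltac:(simpl; rewrite Rabs_R0; lra)) Hz).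
 assert (I2 := HR z s ltac:(lra) Hz). fold q in I2.
 assert (E1 : r0 ^ N * exp (2 * PI * (INR N * s)) = q ^ N).
 { unfold r0, q. assert (P : forall a m, exp a ^ m = exp (INR m * a)). { intros a m. induction m; [simpl; rewrite Rmult_0_l, exp_0; easy|]. rewrite S_INR, Rmult_plus_distr_r, exp_plus, <- IHm. simpl. rewrite Rmult_1_l. ring. }
  rewrite !P, <- exp_plus. f_equal. ring. }
  assert (Hr01 : r0 <= 1) by (rewrite <- exp_0; apply exp_le; unfold s1; nra).
 assert (Hqn : 0 < q ^ N) by pos.
 set (K := INR (2 * N + 1)) in *. assert (HK : 1 <= K) by (apply (le_INR 1); lia).
 assert (X1 : K * (2 * M * (r0 ^ Datatypes.S N / (1 - q)) * exp (2 * PI * (INR N * s))) <= 2 * M * (K * q ^ N) / (1 - q)).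
 { rewrite <- E1. simpl. apply (Rmult_le_reg_r (1 - q)); [lra|].
  replace (K * (2 * M * (r0 * r0 ^ N / (1 - q)) * exp (2 * PI * (INR N * s))) * (1 - q)) with (r0 * (2 * M * (K * (r0 ^ N * exp (2 * PI * (INR N * s)))))) by (field; lra).
  replace (2 * M * (K * (r0 ^ N * exp (2 * PI * (INR N * s)))) / (1 - q) * (1 - q)) with (1 * (2 * M * (K * (r0 ^ N * exp (2 * PI * (INR N * s)))))) by (field; lra).
  apply Rmult_le_compat_r; [|easy]. pos. }
 assert (X2 : 2 * M * (q ^ Datatypes.S N / (1 - q)) <= 2 * M * (K * q ^ N) / (1 - q)).
 { unfold Rdiv. rewrite <- !Rmult_assoc. apply Rmult_le_compat_r; [pos|]. rewrite !Rmult_assoc. do 2 (apply Rmult_le_compat_l; [lra|]). simpl.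
  pos. }
 assert (X3 : 2 * M * (K * q ^ N) / (1 - q) <= eta / 2 * M).
 { apply (Rmult_le_reg_r (1 - q)); [lra|]. unfold Rdiv. rewrite Rmult_assoc, Rinv_l by lra. nra. }
 lra.
Qed.

Lemma cdf_ext f g z : (forall t, f t = g t) -> cdf f z -> cdf g z.
Proof. intros E [L HL]. exists L. eapply is_cd_ext; eauto. Qed.
Lemma cdf_csum n (f : nat -> C -> C) z : (forall i, (i < n)%nat -> cdf (f i) z) -> cdf (fun t => csum n (fun i => f i t)) z.
Proof.
 induction n; intros H; simpl; [exists 0%C; apply is_cd_const|]. destruct IHn as [L HL]; [auto|]. destruct (H n) as [L' HL']; [lia|].
 exists (L + L')%C. apply is_cd_plus; easy.
Qed.
Lemma cdf_lsC {A} (f : A -> C -> C) l z : (forall i, In i l -> cdf (f i) z) -> cdf (fun t => lsC (fun i => f i t) l) z.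
Proof.
 induction l; intros H; simpl; [exists 0%C; apply is_cd_const|]. destruct IHl as [L HL]; [intuition|]. destruct (H a) as [L' HL']; [cmp; auto|].
 exists (L' + L)%C. apply is_cd_plus; easy.
Qed.
Lemma cdf_scal_r f c z : cdf f z -> cdf (fun t => f t * c)%C z.
Proof. intros [L HL]. exists (c * L)%C. apply (is_cd_ext (fun t => c * f t)%C); [intros; ring|]. apply is_cd_scal; easy. Qed.
Lemma cdf_scal f c z : cdf f z -> cdf (fun t => c * f t)%C z.
Proof. intros [L HL]. exists (c * L)%C. apply is_cd_scal; easy. Qed.

Lemma updv_comm z i j t x : i <> j -> updv (updv z i t) j x = updv (updv z j x) i t.
Proof. intros H. ext k. unfold updv. cmp; easy. Qed.

Section MultiInterp.
Variables (n : nat) (s S : R) (zb : vec).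
Hypothesis HsS : 0 <= s < S.

(** In the first [j] variables, those already interpolated, only the narrower closed strip is kept.
    The entries from [n] on are pinned to those of [zb]; in the applications they are the
    frequencies. *)
Definition reg (j : nat) (z : vec) : Prop :=
 (forall i, (i < j)%nat -> Rabs (snd (z i)) <= s) /\ (forall i, (j <= i < n)%nat -> Rabs (snd (z i)) < S) /\ (forall i, (n <= i)%nat -> z i = zb i).
Definition sepf (j : nat) (g : vec -> C) (M : R) : Prop := forall z, reg j z ->
 Cmod (g z) <= M /\ forall i, (j <= i < n)%nat -> cdf (fun t => g (updv z i t)) (z i) /\ g (updv z i (z i + 1)%C) = g z.
Definition IT (N j : nat) (g : vec -> C) (z : vec) : C := interp N (fun t => g (updv z j t)) (z j).

Lemma reg_S j z : (j < n)%nat -> reg (Datatypes.S j) z -> reg j z.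
Proof.
 intros Hj (H1 & H2 & H3). split; [|split]; auto.
 - intros i Hi. destruct (Nat.eq_dec i j) as [->|]; [|intuition]. assert (H := H1 j (Nat.lt_succ_diag_r j)). lra.
Qed.
Lemma reg_updv j z t : (j < n)%nat -> reg (Datatypes.S j) z -> Rabs (snd t) < S -> reg j (updv z j t).
Proof.
 intros Hj (H1 & H2 & H3) Ht. split; [|split]; intros i Hi; unfold updv; destruct (Nat.eqb_spec i j); subst; auto; try lia.
 intuition.
Qed.

Lemma IT_step N eta j g M : (forall (F : C -> C) M, (forall z : C, Rabs (snd z) < S -> cdf F z /\ F (z + 1)%C = F z /\ Cmod (F z) <= M) ->
   forall z : C, Rabs (snd z) <= s -> Cmod (interp N F z - F z) <= eta * M) ->
 (j < n)%nat -> sepf j g M -> (forall z, reg (Datatypes.S j) z -> Cmod (IT N j g z - g z) <= eta * M) /\ sepf (Datatypes.S j) (IT N j g) ((1 + eta) * M).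
Proof.
 intros HN Hj Hg.
 assert (A1 : forall z, reg (Datatypes.S j) z -> Cmod (IT N j g z - g z) <= eta * M).
 { intros z Hz. replace (g z) with (g (updv z j (z j))) by (rewrite updv_id; easy). apply (HN (fun t => g (updv z j t))).
  - intros t Ht. destruct (Hg (updv z j t) (reg_updv j z t Hj Hz Ht)) as [B H]. destruct (H j ltac:(lia)) as [H1 H2]. rewrite updv_eq in H1, H2. split; [|split]; [| |easy].
   + apply (cdf_ext (fun x => g (updv (updv z j t) j x))); [intros; rewrite updv_updv; easy|easy].
   + rewrite updv_updv in H2. easy.
  - apply Hz. lia. }
 split; [easy|]. intros z Hz. split.
 - via (Cmod_le_add _ (g z)). specialize (A1 z Hz). destruct (Hg z (reg_S j z Hj Hz)) as [B _]. lra.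
 - intros i Hi.
  assert (Hn : forall l, reg j (updv z j (RtoC (node N l)))) by (intros l; apply reg_updv; [easy|easy|simpl; rewrite Rabs_R0; lra]).
  assert (Hzi : forall t, updv z i t j = z j) by (intros; apply updv_neq; lia).
  split.
  + apply cdf_lsC. intros m _.
   apply (cdf_ext (fun t => RtoC (/ INR (2 * N + 1)) * csum (2 * N + 1) (fun l => g (updv (updv z j (RtoC (node N l))) i t) * cek (- m) (RtoC (node N l))) * cek m (z j))%C).
   { intros t. rewrite Hzi. do 2 f_equal. apply csum_ext. intros l _. rewrite updv_comm by lia. easy. }
   apply cdf_scal_r, cdf_scal, cdf_csum. intros l _. apply cdf_scal_r. destruct (Hg _ (Hn l)) as [_ H]. destruct (H i ltac:(lia)) as [H1 _].
   rewrite updv_neq in H1 by lia. easy.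
  + unfold IT, interp. rewrite Hzi. apply lsC_ext. intros m _. do 2 f_equal. apply csum_ext. intros l _. f_equal. rewrite updv_comm by lia.
   destruct (Hg _ (Hn l)) as [_ H]. destruct (H i ltac:(lia)) as [_ H2]. rewrite updv_neq in H2 by lia. easy.
Qed.

Fixpoint ITs (N j : nat) (f : vec -> C) : vec -> C := match j with O => f | Datatypes.S j => IT N j (ITs N j f) end.

Lemma ITs_approx N eta f M : 0 < eta -> (forall (F : C -> C) M, (forall z : C, Rabs (snd z) < S -> cdf F z /\ F (z + 1)%C = F z /\ Cmod (F z) <= M) ->
   forall z : C, Rabs (snd z) <= s -> Cmod (interp N F z - F z) <= eta * M) -> sepf 0 f M ->
 forall j, (j <= n)%nat -> sepf j (ITs N j f) ((1 + eta) ^ j * M) /\ forall z, reg j z -> Cmod (ITs N j f z - f z) <= ((1 + eta) ^ j - 1) * M.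
Proof.
 intros Heta HN Hf. induction j; intros Hj.
 - simpl. rewrite Rmult_1_l. split; [easy|]. intros z Hz. replace (f z - f z)%C with (RtoC 0) by ring. rewrite Cmod_0. lra.
 - destruct (IHj ltac:(lia)) as [I1 I2]. destruct (IT_step N eta j _ _ HN ltac:(lia) I1) as [J1 J2]. split.
  + simpl. rewrite Rmult_assoc. easy.
  + intros z Hz. simpl. via (Cmod_sub_tri _ (ITs N j f z)). specialize (J1 z Hz). specialize (I2 z (reg_S j z ltac:(lia) Hz)). lra.
Qed.

(** The coefficients may depend on the variables not yet interpolated. For [j = n] they depend on
    the tail only and become constants over a fixed [zb]. *)
Lemma ITs_trig N f : forall j, exists c : list Z -> vec -> C,
 (forall z, ITs N j f z = lsC (fun k => c k z * ce (dotl k z))%C (bl j N)) /\ (forall k z z', (forall i, (j <= i)%nat -> z i = z' i) -> c k z = c k z').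
Proof.
 induction j.
 - exists (fun _ => f). split.
  + intros z. simpl. rewrite ce_0. ring.
  + intros k z z' E. f_equal. ext i. apply E; lia.
 - destruct IHj as (c & Hc1 & Hc2).
  exists (fun k z => match k with [] => RtoC 0 | m :: k => (RtoC (/ INR (2 * N + 1)) * csum (2 * N + 1) (fun l => c k (updv z j (RtoC (node N l))) * cek (- m) (RtoC (node N l))))%C end).
  split.
  + intros z. simpl bl. rewrite lsC_flat_map. apply lsC_ext. intros m _. rewrite lsC_map.
   rewrite (csum_ext (2 * N + 1) _ (fun l => lsC (fun k => c k (updv z j (RtoC (node N l))) * cek (- m) (RtoC (node N l)) * ce (dotl k z)) (bl j N))%C).
   * rewrite <- lsC_csum. rewrite <- Cmult_assoc, (Cmult_comm _ (cek m (z j))), Cmult_assoc. rewrite <- lsC_scal. apply lsC_ext. intros k Hk.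
    apply in_bl in Hk. destruct Hk as [Hk _]. rewrite csum_scal_r. simpl dotl. rewrite Hk, ce_plus. unfold cek. ring.
   * intros l _. rewrite Hc1. rewrite Cmult_comm, <- lsC_scal. apply lsC_ext. intros k Hk. apply in_bl in Hk.
    rewrite (dotl_ext k _ z); [ring|]. intros i Hi. apply updv_neq; lia.
  + intros [|m k] z z' E; [easy|]. f_equal. apply csum_ext. intros l _. f_equal. apply Hc2. intros i Hi. unfold updv. destruct (Nat.eqb_spec i j); [easy|]. apply E; lia.
Qed.
End MultiInterp.

Lemma pow_1p_small n e : 0 < e -> exists eta, 0 < eta /\ (1 + eta) ^ n <= 1 + e.
Proof.
 intros He. assert (H : continuity_pt (fun x => (1 + x) ^ n) 0).
 { apply derivable_continuous_pt. eexists. apply is_derive_Reals. auto_derive; [easy|easy]. }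
 destruct (H e He) as (d & Hd & Hx). exists (d / 2). simpl in Hx. unfold R_dist in Hx. rewrite Rplus_0_r, pow1 in Hx.
 assert (Rabs ((1 + d/2) ^ n - 1) < e). { apply Hx. split; [split; pos|]. rewrite Rminus_0_r, Rabs_right; lra. } apply Rabs_def2 in H0. lra.
Qed.

Lemma dotr_0 k v : l1l k = 0 -> dotr k v = 0.
Proof.
 induction k as [|m k IH]; simpl; intros H; [easy|]. assert (H0 := Rabs_pos (IZR m)). assert (H1 := l1l_pos k).
 assert (E : Rabs (IZR m) = 0) by lra. rewrite IH by lra. destruct (Req_dec (IZR m) 0) as [->|Hn]; [ring|]. apply Rabs_no_R0 in Hn. easy.
Qed.

Lemma dotl_0 k z : l1l k = 0 -> dotl k z = RtoC 0.
Proof.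
 induction k as [|m k IH]; simpl; intros H; [easy|]. assert (H0 := Rabs_pos (IZR m)). assert (H1 := l1l_pos k).
 assert (E : Rabs (IZR m) = 0) by lra. rewrite IH by lra. destruct (Req_dec (IZR m) 0) as [->|Hn]; [ring|]. apply Rabs_no_R0 in Hn. easy.
Qed.

(** The factor by which the time average over length [L] multiplies a mode that oscillates at rate
    [th] along the flow. *)
Definition rho (L th : R) : C := (RtoC (/ L) * CI (fun t => ce (RtoC (t * th))) 0 L)%C.

Lemma ce_line_cont th x : path_cont (fun t => ce (RtoC (t * th))) x.
Proof.
 apply (cc_comp ce (fun t => RtoC (t * th))); [eapply is_cd_ccont, is_cd_ce|]. apply cc_ofR.
 apply (ex_derive_continuous (V := R_NormedModule)). auto_derive. easy.
Qed.

Lemma rho_le_1 L th : 0 < L -> Cmod (rho L th) <= 1.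
Proof.
 intros HL. unfold rho. rewrite Cmod_mult, Cmod_R, Rabs_right by pos.
 apply (Rmult_le_reg_l L); [easy|]. rewrite <- Rmult_assoc, Rinv_r, Rmult_1_l by lra. replace (L * 1) with (1 * (L - 0)) by ring.
 apply CI_norm; [lra|intros; apply ce_line_cont|]. intros x _. rewrite Cmod_ce. rewrite Rmult_0_r, Ropp_0, exp_0. lra.
Qed.

Lemma rho_le L th : 0 < L -> th <> 0 -> Cmod (rho L th) * (L * Rabs th) <= 1.
Proof.
 intros HL Hth. unfold rho. assert (Hnc : (c2pi * RtoC th)%C <> 0%C). { apply Cmult_neq_0; [apply c2pi_neq0|]. intros E; apply RtoC_inj in E; easy. }
 assert (Hpi : 3 < PI) by (generalize PI2_3_2; lra).
 assert (Cc : Cmod (c2pi * RtoC th) = 2 * PI * Rabs th).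
 { rewrite Cmod_mult, Cmod_R. f_equal. unfold c2pi, Cmod; simpl. replace (0 * (0 * 1) + 2 * PI * (2 * PI * 1)) with ((2*PI)*(2*PI)) by ring. apply sqrt_square; lra. }
 assert (Ht : 0 < Rabs th) by (apply Rabs_pos_lt; easy).
 rewrite (CI_ftc _ (fun t => / (c2pi * RtoC th) * ce (RtoC th * (t, 0)))%C); [|lra|intros; apply ce_line_cont|].
 - rewrite Cmod_mult, Cmod_R, Rabs_right by pos.
  match goal with |- / L * Cmod ?e * _ <= _ => assert (HX : Cmod e <= / (2 * PI * Rabs th) * 2) end.
  { match goal with |- Cmod (?a * ?b - ?a * ?c)%C <= _ => replace (a * b - a * c)%C with (a * (b - c))%C by ring end. rewrite Cmod_mult, Cmod_inv, Cc by easy. apply Rmult_le_compat_l; [pos|].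
   via Cmod_sub_le. rewrite !Cmod_ce. simpl. rewrite !Rmult_0_l, !Rmult_0_r, !Rplus_0_r, !Rmult_0_r, Ropp_0, exp_0. lra. }
  apply Rle_trans with (/ L * (/ (2 * PI * Rabs th) * 2) * (L * Rabs th)).
  + apply Rmult_le_compat_r; [nra|]. intuition.
  + replace (/ L * (/ (2 * PI * Rabs th) * 2) * (L * Rabs th)) with (/ PI) by (field; lra). rewrite <- Rinv_1. apply Rinv_le_contravar; lra.
 - intros x _.
  assert (H := is_cd_path (fun z => / (c2pi * RtoC th) * ce (RtoC th * z))%C x 0 (/ (c2pi * RtoC th) * (c2pi * ce (RtoC th * (x, 0)) * (RtoC th * 1)))%C).
  replace (ce (RtoC (x * th))) with (/ (c2pi * RtoC th) * (c2pi * ce (RtoC th * (x, 0)) * (RtoC th * 1)))%C.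
  + apply H. apply is_cd_scal. apply (is_cd_comp ce (fun z => RtoC th * z)%C); [apply is_cd_scal, is_cd_id|apply is_cd_ce].
  + replace (RtoC th * (x, 0))%C with (RtoC (x * th)) by (unfold RtoC, Cmult; simpl; f_equal; ring). field.
   split; [intros E; apply RtoC_inj in E; easy|apply c2pi_neq0].
Qed.

(** * Time averages are almost constant on the torus *)

Section Ergod.
Variables (n : nat) (kappa : R).
Hypothesis Hn : (1 <= n)%nat.
Hypothesis Hk : 0 < kappa.

(** The first entry of the maximum provides the hypothesis [INR n <= sg * Q] of [counting] for
    [sg = dl / 4]. The second makes the product of the two quadratic sums in [ergod_pos], bounded by
    2^n 4 M^2 and 160 9^n / [Cerg], at most (kappa M)^2. *)
Definition Cerg : R := Rmax (4 * INR n) (640 * 18 ^ n / (kappa * kappa)) + 4.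

Variables (v : nat -> R) (Psi Q L dl : R).
Hypothesis HPsi : 0 < Psi.
Hypothesis HQ : 0 < Q.
Hypothesis Hdio : forall k, length k = n -> 0 < l1l k <= Q -> 1 <= Psi * Rabs (dotr k v).
Hypothesis HL : Cerg * Psi <= L.
Hypothesis Hdl : Cerg <= dl * Q.

Let HC4 : 4 <= Cerg.
Proof. unfold Cerg. assert (0 <= 4 * INR n) by pos. generalize (Rmax_l (4 * INR n) (640 * 18 ^ n / (kappa * kappa))). lra. Qed.
Let HL0 : 0 < L.
Proof. nra. Qed.
Let Hdl0 : 0 < dl.
Proof. nra. Qed.

(** For 0 < |k| <= Q the average gains 1 / (L |k.v|), and Psi |k.v| is at least 1; for |k| > Q one
    of the two exponentials is at most 4 / [Cerg]. In both cases one exponential and the factor 1 /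
    (1 + (Psi k.v)^2) are left over for [counting]. *)
Lemma weight_bound k sg : sg = dl / 4 -> length k = n ->
 let d := (rho L (dotr k v) - (if Req_EM_T (l1l k) 0 then 1 else 0))%C in
 (Cmod d * exp (- (2 * PI * sg * l1l k))) * (Cmod d * exp (- (2 * PI * sg * l1l k))) <=
 8 / Cerg * (exp (- (2 * PI * sg * l1l k)) * / (1 + (Psi * dotr k v) * (Psi * dotr k v))).
Proof.
 intros Hsg Hkn d. set (E := exp (- (2 * PI * sg * l1l k))). assert (HE : 0 < E) by apply exp_pos.
 set (x := Psi * dotr k v). assert (Hpi : 3 < PI) by (generalize PI2_3_2; lra). assert (Hl := l1l_pos k).
 assert (HE1 : E <= 1) by (unfold E; rewrite <- exp_0; apply exp_le; assert (0 <= sg * l1l k) by pos; nra).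
 assert (HCi : 0 < / Cerg) by pos.
 unfold d. destruct (Req_EM_T (l1l k) 0) as [H0|H0].
 - rewrite (dotr_0 k v H0). unfold rho. rewrite (CI_ext _ (fun _ => 1%C)); [|lra|].
  + rewrite CI_const. rewrite Cmult_assoc, <- RtoC_mult. replace (/ L * (L - 0)) with 1 by (field; lra).
   replace (1 * 1 - 1)%C with (RtoC 0) by ring. rewrite Cmod_0, Rmult_0_l, Rmult_0_l. pos.
  + intros t _. rewrite Rmult_0_r. apply ce_0.
 - replace (rho L (dotr k v) - 0)%C with (rho L (dotr k v)) by ring. set (r := Cmod (rho L (dotr k v))).
  assert (Hr0 : 0 <= r) by apply Cmod_ge_0. assert (Hr1 : r <= 1) by (apply rho_le_1; easy).
  replace (r * E * (r * E)) with (r * r * (E * E)) by ring.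
  assert (Hrx : r * Rabs x <= / Cerg).
  { unfold x. rewrite Rabs_mult, (Rabs_right Psi) by lra. destruct (Req_dec (dotr k v) 0) as [->|Hd]; [rewrite Rabs_R0; lra|].
   assert (H := rho_le L (dotr k v) HL0 Hd). fold r in H. assert (Hd0 : 0 < Rabs (dotr k v)) by (apply Rabs_pos_lt; easy).
   apply (Rmult_le_reg_l Cerg); [lra|]. rewrite Rinv_r by lra. assert (r * (Cerg * Psi * Rabs (dotr k v)) <= r * (L * Rabs (dotr k v))); [|lra].
   intuition. }
  assert (Hxx : x * x = Rabs x * Rabs x) by (rewrite <- Rabs_mult, Rabs_right; [easy|nra]).
  assert (Ha := Rabs_pos x).
  destruct (Rle_dec (l1l k) Q) as [hQ|hQ].
  + assert (Hx1 : 1 <= Rabs x). { unfold x. rewrite Rabs_mult, (Rabs_right Psi) by lra. apply Hdio; [easy|lra]. }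
   assert (R2 : r * r * (1 + x * x) <= 2 / Cerg).
   { apply Rle_trans with (2 * ((r * Rabs x) * (r * Rabs x))); [rewrite Hxx; assert (1 <= Rabs x * Rabs x) by nra; assert (0 <= r * r) by nra; replace (2 * (r * Rabs x * (r * Rabs x))) with (r * r * (2 * (Rabs x * Rabs x))) by ring; apply Rmult_le_compat_l; lra|].
    assert ((r * Rabs x) * (r * Rabs x) <= / Cerg * 1); [|lra]. apply Rmult_le_compat; try nra. assert (/ Cerg <= / 4) by (apply Rinv_le_contravar; lra). lra. }
   assert (R3 : r * r <= 2 / Cerg * / (1 + x * x)). { apply (Rmult_le_reg_r (1 + x * x)); [nra|]. rewrite (Rmult_assoc (2 / Cerg)), Rinv_l by nra. lra. }
   pos.
  + assert (EQ : E <= 4 / Cerg).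
   { apply Rle_trans with (exp (- (sg * Q))).
    - apply exp_le. assert (0 <= sg * l1l k) by nra. nra.
    - rewrite exp_Ropp. assert (H := exp_ineq1_le (sg * Q)). replace (4 / Cerg) with (/ (Cerg / 4)) by (field; lra). apply Rinv_le_contravar; [lra|]. pos. }
   assert (R2 : r * r <= 2 * / (1 + x * x)).
   { apply (Rmult_le_reg_r (1 + x * x)); [nra|]. rewrite (Rmult_assoc 2), Rinv_l by nra.
    assert ((r * Rabs x) * (r * Rabs x) <= 1). { assert (/ Cerg <= / 4) by (apply Rinv_le_contravar; lra). assert (0 <= r * Rabs x) by nra. nra. } nra. }
   replace (8 / Cerg * (E * / (1 + x * x))) with ((2 * / (1 + x * x)) * (E * (4 / Cerg))) by lra.
   apply Rmult_le_compat; nra.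
Qed.

Variables (S M : R) (f : vec -> C) (zb : vec).
Hypothesis Hv : forall i, (n <= i)%nat -> v i = 0.
Hypothesis HM : 0 < M.
Hypothesis HS : dl < S.
Definition ereg (s : R) (z : vec) : Prop := (forall i, (i < n)%nat -> Rabs (snd (z i)) < s) /\ (forall i, (n <= i)%nat -> z i = zb i).
Hypothesis Hf : forall z, ereg S z -> Cmod (f z) <= M /\ forall i, (i < n)%nat -> cdf (fun t => f (updv z i t)) (z i) /\ f (updv z i (z i + 1)%C) = f z.
Hypothesis Hfc : forall z, ereg S z -> forall t, path_cont (fun t => f (shiftv v z t)) t.

Lemma ereg_shiftv s z t : ereg s z -> ereg s (shiftv v z t).
Proof.
 intros [H1 H2]. split; intros i Hi; unfold shiftv.
 - replace (snd (z i + RtoC (t * v i))%C) with (snd (z i)) by (cmp; ring). auto.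
 - rewrite Hv, Rmult_0_r, H2 by easy. ring.
Qed.

(** A trigonometric polynomial replaces [f]; averaging multiplies its modes by [rho]. The
    arithmetic-geometric inequality separates the coefficients, controlled by [bessel], from the
    multipliers, controlled by [counting]. Each of the two averages is thus compared with the
    constant mode [Z0], at the price of 2 kappa M. *)
Lemma ergod_pos z z' : ereg (S - dl) z -> ereg (S - dl) z' -> Cmod (avg v L f z - avg v L f z') <= 4 * kappa * M.
Proof.
 intros Hz Hz'.
 (* Half of the strip loss is spent on the interpolation. A further quarter, [sg = dl / 4], is the
    room for [bessel]: its faces around a point of the strip [S - dl] stay inside the strip [s]. *)
 set (s := S - dl / 2). assert (HsS : 0 <= s < S) by (unfold s; lra).
 (* The 1 gives the bound [2 * M] for the polynomial [p], and [kappa] the approximation error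
    [kappa * M]. *)
 destruct (pow_1p_small n (Rmin 1 kappa)) as (eta & Heta & Hpow); [pos|].
 assert (Hm1 := Rmin_l 1 kappa). assert (Hm2 := Rmin_r 1 kappa).
 destruct (trig1 s S eta HsS Heta) as (N & HN).
 assert (Hsep : sepf n s S zb 0 f M).
 { intros w (w1 & w2 & w3). destruct (Hf w) as [h1 h2]; [split; [intuition|easy]|]. split; [easy|]. intros i Hi. apply h2; lia. }
 destruct (ITs_approx n s S zb HsS N eta f M Heta HN Hsep n (le_n _)) as [P1 P2].
 destruct (ITs_trig N f n) as (c & Hc1 & Hc2). set (p := ITs N n f) in *. set (ck := fun k => c k zb).
 assert (Hp : forall w, (forall i, (n <= i)%nat -> w i = zb i) -> p w = lsC (fun k => ck k * ce (dotl k w))%C (bl n N)).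
 { intros w Hw. rewrite Hc1. apply lsC_ext. intros k _. f_equal. eauto. }
 assert (Hregs : forall t w, t <= s -> ereg t w -> reg n s S zb n w). { intros t w Ht [h1 h2]. split; [|split]; [intros i Hi; left; eapply Rlt_le_trans; [auto|easy]|lia|easy]. }
 assert (Hpb : forall w, ereg s w -> Cmod (p w) <= 2 * M).
 { intros w Hw. destruct (P1 w (Hregs s w ltac:(lra) Hw)) as [h _]. pos. }
 assert (Hfp : forall w, ereg s w -> Cmod (p w - f w) <= kappa * M).
 { intros w Hw. eapply Rle_trans; [apply (P2 w (Hregs s w ltac:(lra) Hw))|]. pos. }
 set (sg := dl / 4).
 set (Z0 := lsC (fun k => ck k * (if Req_EM_T (l1l k) 0 then 1 else 0))%C (bl n N)).
 assert (Hone : forall w, ereg (S - dl) w -> Cmod (avg v L f w - Z0) <= 2 * kappa * M).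
 { intros w Hw. assert (Hws : ereg s w). { destruct Hw as [h1 h2]; split; [|easy]. intros i Hi. specialize (h1 i Hi). unfold s; lra. }
  assert (HwS : ereg S w). { destruct Hw as [h1 h2]; split; [|easy]. intros i Hi. specialize (h1 i Hi). lra. }
  assert (Hpt : forall t, p (shiftv v w t) = lsC (fun k => (ck k * ce (dotl k w)) * ce (RtoC (t * dotr k v)))%C (bl n N)).
  { intros t. rewrite Hp by (apply (ereg_shiftv s w t Hws)). apply lsC_ext. intros k _. rewrite dotl_shiftv, ce_plus. ring. }
  assert (Hpc : forall x, path_cont (fun t => p (shiftv v w t)) x).
  { intros x. apply (cc_ext (fun t => lsC (fun k => (ck k * ce (dotl k w)) * ce (RtoC (t * dotr k v)))%C (bl n N))); [easy|].
   generalize (bl n N). intros l. induction l; simpl; [apply cc_const|]. apply cc_plus; [|easy]. apply cc_mult; [apply cc_const|apply ce_line_cont]. }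
  assert (Hav : avg v L p w = lsC (fun k => ck k * ce (dotl k w) * rho L (dotr k v))%C (bl n N)).
  { unfold avg, intop, rho. rewrite (CI_ext _ (fun t => lsC (fun k => (ck k * ce (dotl k w)) * ce (RtoC (t * dotr k v)))%C (bl n N))); [|lra|intros; rewrite Hpt; ring].
   generalize (bl n N). intros l.
   assert (G : CI (fun t => lsC (fun k => (ck k * ce (dotl k w)) * ce (RtoC (t * dotr k v)))%C l) 0 L = lsC (fun k => (ck k * ce (dotl k w)) * CI (fun t => ce (RtoC (t * dotr k v))) 0 L)%C l
     /\ forall x, path_cont (fun t => lsC (fun k => (ck k * ce (dotl k w)) * ce (RtoC (t * dotr k v)))%C l) x).
   { induction l as [|k l [IH1 IH2]]; simpl; [split; [rewrite CI_const; ring|intros; apply cc_const]|].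
    assert (Hx : forall x, path_cont (fun t => ck k * ce (dotl k w) * ce (RtoC (t * dotr k v)))%C x) by (intros; apply cc_mult; [apply cc_const|apply ce_line_cont]).
    split; [|intros; apply cc_plus; easy]. rewrite CI_plus, IH1 by (easy || lra). f_equal. apply CI_scal; [lra|intros; apply ce_line_cont]. }
   destruct G as [-> _]. rewrite <- lsC_scal. apply lsC_ext. intros; ring. }
  assert (HA1 : Cmod (avg v L f w - avg v L p w) <= kappa * M).
  { unfold avg, intop. match goal with |- Cmod (?a * ?b - ?a * ?c)%C <= _ => replace (a * b - a * c)%C with (a * (b - c))%C by ring end.
   assert (Q1 : forall x, 0 <= x <= L -> path_cont (fun t => RtoC 1 * f (shiftv v w t))%C x) by (intros; apply cc_mult; [apply cc_const|auto]).
   assert (Q2 : forall x, 0 <= x <= L -> path_cont (fun t => RtoC 1 * p (shiftv v w t))%C x) by (intros; apply cc_mult; [apply cc_const|easy]).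
   rewrite <- CI_minus by (easy || lra).
   rewrite Cmod_mult, Cmod_R, Rabs_right by pos.
   apply (Rmult_le_reg_l L); [easy|]. rewrite <- Rmult_assoc, Rinv_r, Rmult_1_l by lra. replace (L * (kappa * M)) with (kappa * M * (L - 0)) by ring.
   apply CI_norm; [lra|intros; apply cc_minus; auto|]. intros x _.
   replace (RtoC 1 * f (shiftv v w x) - RtoC 1 * p (shiftv v w x))%C with (f (shiftv v w x) - p (shiftv v w x))%C by ring.
   rewrite Cmod_sub_sym. apply Hfp. apply ereg_shiftv; easy. }
  assert (HA2 : Cmod (avg v L p w - Z0) <= kappa * M).
  { rewrite Hav. unfold Z0.
   rewrite <- lsC_minus. set (y := fun i => snd (w i)).
   set (d := fun k => (rho L (dotr k v) - (if Req_EM_T (l1l k) 0 then 1 else 0))%C).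
   rewrite (lsC_ext _ (fun k => ck k * ce (dotl k w) * d k)%C).
   2:{ intros k _. unfold d. destruct (Req_EM_T (l1l k) 0) as [h|h]; [rewrite (dotl_0 k w h), ce_0|]; ring. }
   via lsC_norm.
   rewrite (lsum_ext _ (fun k => (Cmod (ck k) * exp (- (2 * PI * dotr k y) + 2 * PI * sg * l1l k)) * (Cmod (d k) * exp (- (2 * PI * sg * l1l k))))).
   2:{ intros k _. rewrite !Cmod_mult, Cmod_ce, dotl_im. fold y. rewrite (exp_plus (- _)), (exp_Ropp (2 * PI * sg * l1l k)). field; pos. }
   set (X := 2 ^ n * (4 * (M * M))). assert (H2n : 0 < 2 ^ n) by pos.
   assert (HX : lsum (fun k => (Cmod (ck k) * exp (- (2 * PI * dotr k y) + 2 * PI * sg * l1l k)) * (Cmod (ck k) * exp (- (2 * PI * dotr k y) + 2 * PI * sg * l1l k))) (bl n N) <= X).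
   { assert (B := bessel N n unit [tt] (fun _ => ck) y sg (4 * (M * M))).
    simpl lsum in B. rewrite !Rplus_0_r in B.
    rewrite (lsum_ext _ (fun k => Cmod (ck k) ^ 2 * exp (- (4 * PI * dotr k y) + 4 * PI * sg * l1l k))).
    - apply B. intros zz Hzz. set (z2 := fun i => if Nat.ltb i n then zz i else zb i).
     assert (Hz2 : ereg s z2).
     { split; intros i Hi; unfold z2; destruct (Nat.ltb_spec i n); try lia; [|easy]. destruct Hw as [h1 _]. specialize (h1 i Hi). apply Rabs_def2 in h1. unfold y in Hzz. specialize (Hzz i Hi). unfold sg in *. apply Rabs_def1; unfold s; destruct Hzz; lra. }
     replace (lsC (fun k => ck k * ce (dotl k zz))%C (bl n N)) with (p z2).
     + assert (h := Hpb z2 Hz2). assert (h0 := Cmod_ge_0 (p z2)). pos.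
     + rewrite Hp by apply Hz2. apply lsC_ext. intros k Hkb. apply in_bl in Hkb. f_equal. f_equal. apply dotl_ext. intros i Hi. unfold z2. cmp; easy.
    - intros k _.
     replace (- (4 * PI * dotr k y) + 4 * PI * sg * l1l k) with ((- (2 * PI * dotr k y) + 2 * PI * sg * l1l k) + (- (2 * PI * dotr k y) + 2 * PI * sg * l1l k)) by ring. rewrite (exp_plus (_ + _) (_ + _)). ring. }
   set (Y := 160 * 9 ^ n / Cerg).
   assert (HY : lsum (fun k => (Cmod (d k) * exp (- (2 * PI * sg * l1l k))) * (Cmod (d k) * exp (- (2 * PI * sg * l1l k)))) (bl n N) <= Y).
   { eapply Rle_trans; [apply lsum_le; intros k Hkb; apply in_bl in Hkb; apply (weight_bound k sg eq_refl (proj1 Hkb))|].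
    rewrite lsum_scal. assert (Cn := counting n N v Psi Q sg Hn HPsi HQ).
    replace Y with (8 / Cerg * (20 * 9 ^ n)) by (unfold Y; field; lra). apply Rmult_le_compat_l; [pos|].
    apply Cn; [|easy]. unfold sg. assert (4 * INR n <= Cerg) by (unfold Cerg; generalize (Rmax_l (4 * INR n) (640 * 18 ^ n / (kappa * kappa))); lra). lra. }
   (* The weight that makes the coefficient term equal to [kappa * M]; the definition of [Cerg]
      gives the same bound for the other term. *)
   set (t := kappa / (2 ^ n * 4 * M)). assert (Ht : 0 < t) by pos.
   via (lsum_amgm _ _ _ t Ht).
   assert (T1 : t * X = kappa * M) by (unfold t, X; field; lra).
   assert (T2 : / t * Y <= kappa * M).
   { assert (HCe : 640 * 18 ^ n / (kappa * kappa) <= Cerg) by (unfold Cerg; generalize (Rmax_r (4 * INR n) (640 * 18 ^ n / (kappa * kappa))); lra).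
    assert (E18 : 18 ^ n = 2 ^ n * 9 ^ n) by (rewrite <- Rpow_mult_distr; f_equal; lra).
    unfold t, Y. apply (Rmult_le_reg_r (Cerg * kappa)); [nra|].
    replace (/ (kappa / (2 ^ n * 4 * M)) * (160 * 9 ^ n / Cerg) * (Cerg * kappa)) with (M * (640 * (2 ^ n * 9 ^ n))) by (field; lra).
    rewrite <- E18. replace (kappa * M * (Cerg * kappa)) with (M * (Cerg * (kappa * kappa))) by ring. apply Rmult_le_compat_l; [lra|].
    apply (Rmult_le_compat_r (kappa * kappa)) in HCe; [|nra]. replace (640 * 18 ^ n / (kappa * kappa) * (kappa * kappa)) with (640 * 18 ^ n) in HCe by (field; lra). easy. }
   apply (Rmult_le_compat_l t) in HX; [|lra]. apply (Rmult_le_compat_l (/ t)) in HY; [|pos]. lra. }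
  via (Cmod_sub_tri _ (avg v L p w)). lra. }
 via (Cmod_sub_tri _ Z0). rewrite (Cmod_sub_sym Z0). assert (h1 := Hone z Hz). assert (h2 := Hone z' Hz'). lra.
Qed.
End Ergod.

(** * Real-analytic functions on the KAM domains *)

Definition kd (i j : nat) : C := if Nat.eqb i j then RtoC 1 else RtoC 0.

Lemma kd_sym i j : kd i j = kd j i.
Proof. unfold kd. cmp; easy. Qed.
Lemma csum_kd_l n i (f : nat -> C) : (i < n)%nat -> csum n (fun k => kd i k * f k)%C = f i.
Proof.
 intros H. rewrite (csum_ext n _ (fun k => if Nat.eqb k i then f k else 0%C)); [apply csum_delta; easy|].
 intros k _. unfold kd. cmp; ring.
Qed.
Lemma csum_kd_r n i (f : nat -> C) : (i < n)%nat -> csum n (fun k => f k * kd k i)%C = f i.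
Proof. intros H. rewrite <- (csum_kd_l n i f H). apply csum_ext. intros k _. rewrite kd_sym. ring. Qed.
Lemma Cmod_kd i j : Cmod (kd i j) <= 1.
Proof. unfold kd. destruct (Nat.eqb i j); [rewrite Cmod_1|rewrite Cmod_0]; lra. Qed.

Definition blockv (o n : nat) (z w : vec) : vec := fun i => if andb (Nat.leb o i) (Nat.ltb i (o + n)) then w (i - o)%nat else z i.

Lemma blockv_id o n z : blockv o n z (fun j => z (o + j)%nat) = z.
Proof.
 ext i. unfold blockv. destruct (Nat.leb_spec o i); simpl; [|easy].
 destruct (Nat.ltb_spec i (o + n)); [|easy]. f_equal. lia.
Qed.

Lemma is_grad_block N o n f z w L : (o + n <= N)%nat -> is_grad N f (blockv o n z w) L -> is_grad n (fun w => f (blockv o n z w)) w (fun j => L (o + j)%nat).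
Proof.
 intros Ho H.
 assert (G := is_grad_comp N n f (fun i w => blockv o n z w i) w L (fun i j => if Nat.eqb i (o + j) then 1%C else 0%C)).
 eapply is_grad_ext; [apply G|].
 - intros i Hi. unfold blockv. destruct (Nat.leb_spec o i); simpl.
  + destruct (Nat.ltb_spec i (o + n)).
   * eapply is_grad_ext; [apply (is_grad_coord n (i - o)); lia|]. intros j Hj. cmp; easy.
   * eapply is_grad_ext; [apply is_grad_const|]. intros j Hj. cmp; easy.
  + eapply is_grad_ext; [apply is_grad_const|]. intros j Hj. cmp; easy.
 - easy.
 - intros j Hj. simpl. rewrite (csum_ext N _ (fun i => if Nat.eqb i (o + j) then L i else 0%C)).
  + apply csum_delta; lia.
  + intros i _. cmp; ring.
Qed.

(** Only one block of variables moves, so the radius is that of its own domain: actions, angles and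
    frequencies live on scales of different size. The three uses are [P_taylor], [KF_lip] and
    [base_lip]. *)
Lemma block_taylor N o n D f z rho M : An N D f -> (o + n <= N)%nat -> 0 < rho -> D z ->
 (forall w, near n (fun j => z (o + j)%nat) w rho -> D (blockv o n z w) /\ Cmod (f (blockv o n z w)) <= M) ->
 forall w, near n (fun j => z (o + j)%nat) w (rho / 2) ->
  Cmod (f (blockv o n z w) - f z) <= 3 * M / rho * rsum n (fun j => Cmod (w j - z (o + j)%nat)) /\
  Cmod (f (blockv o n z w) - f z - csum n (fun j => pd N (o + j) f z * (w j - z (o + j)%nat)))%C <= 7 * M / (rho * rho) * (rsum n (fun j => Cmod (w j - z (o + j)%nat)) * rsum n (fun j => Cmod (w j - z (o + j)%nat))).
Proof.
 intros Hf Ho Hr Hz HD w Hw. set (z1 := fun j => z (o + j)%nat) in *. set (F := fun w => f (blockv o n z w)).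
 assert (HM : forall w, near n z1 w rho -> Cmod (F w) <= M) by (intros; apply HD; easy).
 assert (Hg : forall w, near n z1 w rho -> exists L, is_grad n F w L).
 { intros w' Hw'. destruct (Hf _ (proj1 (HD w' Hw'))) as [L HL]. eexists. apply (is_grad_block N o n f z w' L Ho HL). }
 assert (E0 : F z1 = f z) by (unfold F, z1; rewrite blockv_id; easy).
 assert (Hp : forall j, (j < n)%nat -> pd n j F z1 = pd N (o + j) f z).
 { intros j Hj. apply (pd_eq n F z1 (fun j => pd N (o + j) f z)); [|easy]. apply (is_grad_block N o n f z z1); [easy|]. rewrite blockv_id. apply (An_grad N D); easy. }
 split.
 - rewrite <- E0. apply (An_lip n F z1 rho M Hr HM Hg w Hw).
 - rewrite <- E0. rewrite (csum_ext n _ (fun j => pd n j F z1 * (w j - z1 j))%C) by (intros j Hj; rewrite Hp; easy).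
  apply (proj2 (An_taylor n F z1 rho M Hr HM Hg) w Hw).
Qed.

Lemma slice_cauchy N D f z j rho M : An N D f -> (j < N)%nat -> 0 < rho -> (forall t, Cmod (t - z j) < rho -> D (updv z j t) /\ Cmod (f (updv z j t)) <= M) ->
 Cmod (pd N j f z) <= M / rho.
Proof.
 intros Hf Hj Hr HD.
 assert (HDz : D z). { rewrite <- (updv_id z j). apply HD. replace (z j - z j)%C with (RtoC 0) by ring. rewrite Cmod_0; easy. }
 destruct (taylor_disc (fun t => f (updv z j t)) (z j) rho M Hr) as (L & HL & HT).
 - intros t Ht. destruct (HD t Ht) as [h _]. assert (G := is_grad_cd N f _ _ j (An_grad N D f _ Hf h) Hj). rewrite updv_eq in G.
  eexists. eapply is_cd_ext; [|eauto]. intros; cbv beta; rewrite updv_updv; easy.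
 - apply HD; easy.
 - assert (G := is_grad_cd N f z _ j (An_grad N D f z Hf HDz) Hj).
  assert (E : pd N j f z = L); [|rewrite E; easy]. apply (is_cd_unique _ _ _ _ G).
  assert (HM0 : 0 <= M). { eapply Rle_trans; [apply Cmod_ge_0|apply (HD (z j))]. replace (z j - z j)%C with (RtoC 0) by ring. rewrite Cmod_0; easy. }
  intros e He. exists (Rmin (rho / 2) (e * (rho * rho) / (4 * M + 1))). split.
  { pos. }
  intros t Ht. assert (T0 := Cmod_ge_0 t). eapply Rle_trans; [apply HT; left; eapply Rlt_le_trans; [eauto|apply Rmin_l]|].
  assert (H : Cmod t < e * (rho * rho) / (4 * M + 1)) by (eapply Rlt_le_trans; [eauto|apply Rmin_r]).
  assert (Hrr : 0 < rho * rho) by nra.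
  assert (Cmod t * (4 * M + 1) < e * (rho * rho)).
  { apply (Rmult_lt_compat_r (4 * M + 1)) in H; [|lra]. replace (e * (rho * rho) / (4 * M + 1) * (4 * M + 1)) with (e * (rho * rho)) in H by (field; lra). easy. }
  replace (4 * M * (Cmod t / rho) ^ 2) with (Cmod t * (4 * M * Cmod t / (rho * rho))) by (field; lra). rewrite Rmult_comm. apply Rmult_le_compat_r; [easy|].
  apply (Rmult_le_reg_r (rho * rho)); [easy|]. unfold Rdiv. rewrite Rmult_assoc, Rinv_l by lra. nra.
Qed.

Lemma pd_per N D f i m z : opn N D -> (forall z, D z -> D (updv z m (z m + 1)%C)) -> An N D f -> (forall z, D z -> f (updv z m (z m + 1)%C) = f z) ->
 (i < N)%nat -> (m < N)%nat -> D z -> pd N i f (updv z m (z m + 1)%C) = pd N i f z.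
Proof.
 intros HD Hsh Hf Hp Hi Hm Hz. symmetry. destruct (HD z Hz) as (rho & Hr & Hn).
 apply (pd_eq N f z (fun i => pd N i f (updv z m (z m + 1)%C))); [|easy].
 apply (is_grad_ext_loc N (fun z => f (updv z m (z m + 1)%C)) f z _ rho Hr); [auto|].
 apply is_grad_shift; [easy|]. apply (An_grad N D); auto.
Qed.

Lemma pd_real N D f i z : opn N D -> An N D f -> (forall z, D z -> (forall k, (k < N)%nat -> snd (z k) = 0) -> snd (f z) = 0) -> (i < N)%nat ->
 D z -> (forall k, (k < N)%nat -> snd (z k) = 0) -> snd (pd N i f z) = 0.
Proof.
 intros HD Hf Hre Hi Hz Hr. destruct (HD z Hz) as (rho & Hrho & Hn).
 assert (G := is_grad_cd N f z _ i (An_grad N D f z Hf Hz) Hi). set (L := pd N i f z) in *.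
 assert (H : forall e, 0 < e -> Rabs (snd L) <= e).
 { intros e He. destruct (G e He) as (d & Hd & Ht). set (t := Rmin d rho / 2). assert (Hm : 0 < Rmin d rho) by pos.
  assert (m1 := Rmin_l d rho). assert (m2 := Rmin_r d rho).
  assert (Ct : Cmod (RtoC t) = t) by (rewrite Cmod_R, Rabs_right; unfold t; lra).
  specialize (Ht (RtoC t)). rewrite Ct, updv_id in Ht. specialize (Ht ltac:(unfold t; lra)).
  set (y := f (updv z i (z i + RtoC t))) in *.
  assert (Hy : snd y = 0).
  { apply Hre.
   - apply Hn. apply near_updv; [apply near_refl; easy|]. replace (z i + RtoC t - z i)%C with (RtoC t) by ring. rewrite Ct. unfold t; lra.
   - intros k Hk. unfold updv. destruct (Nat.eqb_spec k i) as [->|]; [simpl; rewrite (Hr i Hi); ring|auto]. }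
  assert (Hfz : snd (f z) = 0) by auto.
  assert (Hs := Rle_trans _ _ _ (Cmod_im_le _) Ht).
  replace (snd (y - f z - L * RtoC t)%C) with (- (snd L * t)) in Hs by (unfold Cminus, Cplus, Copp, Cmult, RtoC; simpl; rewrite Hy, Hfz; ring).
  rewrite Rabs_Ropp, Rabs_mult, (Rabs_right t) in Hs by pos. apply (Rmult_le_reg_r t); [pos|easy]. }
 destruct (Req_dec (snd L) 0) as [E|E]; [easy|]. assert (0 < Rabs (snd L)) by (apply Rabs_pos_lt; easy). specialize (H (Rabs (snd L) / 2)). lra.
Qed.

Lemma csum_2n n (f : nat -> C) : (forall i, (i < n)%nat -> f (n + i)%nat = 0%C) -> csum (2 * n) f = csum n f.
Proof. intros H. replace (2 * n)%nat with (n + n)%nat by lia. rewrite csum_split, (csum_0 n (fun i => f (n + i)%nat)) by easy. ring. Qed.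

Section KF.
Variables (n : nat) (v : nat -> R).
Hypothesis Hv0 : forall i, (n <= i)%nat -> v i = 0.

(** The first [n] entries are the angles, the next [n] the frequencies, which range over a complex
    polydisc around a real centre. *)
Definition Dm (S : R) (c : nat -> R) (hh : R) (z : vec) : Prop :=
 (forall i, (i < n)%nat -> Rabs (snd (z i)) < S) /\ (forall i, (i < n)%nat -> Cmod (z (n + i)%nat - RtoC (c i)) < hh).
Definition realv (z : vec) : Prop := forall i, (i < 2 * n)%nat -> snd (z i) = 0.
Definition KF (S : R) (c : nat -> R) (hh : R) (f : vec -> C) : Prop :=
 An (2 * n) (Dm S c hh) f /\ (forall z, Dm S c hh z -> forall j, (j < n)%nat -> f (updv z j (z j + 1)%C) = f z) /\
 (forall z, Dm S c hh z -> realv z -> snd (f z) = 0).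

Lemma opn_and N D D' : opn N D -> opn N D' -> opn N (fun z => D z /\ D' z).
Proof.
 intros H H' z [Hz Hz']. destruct (H z Hz) as (r & Hr & h). destruct (H' z Hz') as (r' & Hr' & h'). exists (Rmin r r'). split; [pos|].
  split; [apply h; eapply near_le; [apply Rmin_l|eauto]|apply h'; eapply near_le; [apply Rmin_r|eauto]].
Qed.
Lemma opn_all N m (D : nat -> vec -> Prop) : (forall i, (i < m)%nat -> opn N (D i)) -> opn N (fun z => forall i, (i < m)%nat -> D i z).
Proof.
 induction m; intros H; [intros z _; exists 1; split; [lra|easy]|].
 assert (H1 := opn_and N _ _ (IHm ltac:(intros; apply H; lia)) (H m (Nat.lt_succ_diag_r m))).
 intros z Hz. destruct (H1 z) as (r & Hr & h); [cmp; auto|]. exists r. split; [easy|]. intros w Hw i Hi.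
 destruct (h w Hw) as [h1 h2]. destruct (Nat.eq_dec i m) as [->|]; [easy|intuition].
Qed.
Lemma opn_disc N k c r : (k < N)%nat -> opn N (fun z => Cmod (z k - c) < r).
Proof.
 intros Hk z Hz. exists (r - Cmod (z k - c)). split; [lra|]. intros w Hw. specialize (Hw k Hk). generalize (Cmod_sub_tri (w k) (z k) c). lra.
Qed.
Lemma opn_strip N k r : (k < N)%nat -> opn N (fun z => Rabs (snd (z k)) < r).
Proof.
 intros Hk z Hz. exists (r - Rabs (snd (z k))). split; [lra|]. intros w Hw. specialize (Hw k Hk).
 assert (H := Cmod_im_le (w k - z k)%C). simpl in H. assert (H2 := Rabs_triang (snd (z k)) (snd (w k) + - snd (z k))).
 replace (snd (z k) + (snd (w k) + - snd (z k))) with (snd (w k)) in H2 by ring. lra.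
Qed.

Lemma opn_Dm S c hh : opn (2 * n) (Dm S c hh).
Proof.
 unfold Dm. apply opn_and; apply opn_all; intros i Hi; [apply opn_strip; lia|apply opn_disc; lia].
Qed.

Lemma Dm_per S c hh z j : Dm S c hh z -> (j < n)%nat -> Dm S c hh (updv z j (z j + 1)%C).
Proof.
 intros [H1 H2] Hj. split; intros i Hi; unfold updv.
 - destruct (Nat.eqb_spec i j) as [->|]; [|auto]. simpl. rewrite Rplus_0_r. auto.
 - cmp; auto.
Qed.
Lemma Dm_shiftv S c hh z t : Dm S c hh z -> Dm S c hh (shiftv v z t).
Proof.
 intros [H1 H2]. split; intros i Hi; unfold shiftv.
 - simpl. rewrite Rplus_0_r. auto.
 - rewrite Hv0, Rmult_0_r by lia. replace (z (n + i)%nat + 0 - RtoC (c i))%C with (z (n + i)%nat - RtoC (c i))%C by ring. auto.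
Qed.
Lemma Dm_le S S' c hh z : S' <= S -> Dm S' c hh z -> Dm S c hh z.
Proof. intros H [H1 H2]. split; [|easy]. intros i Hi. specialize (H1 i Hi). lra. Qed.
Lemma Dm_updv S c hh z j t del : Dm (S - del) c hh z -> (j < n)%nat -> Cmod (t - z j) < del -> Dm S c hh (updv z j t).
Proof.
 intros [H1 H2] Hj Ht. assert (Hd : 0 < del) by (eapply Rle_lt_trans; [apply Cmod_ge_0|eauto]). split; intros i Hi; unfold updv.
 - destruct (Nat.eqb_spec i j) as [->|]; [|specialize (H1 i Hi); lra].
  specialize (H1 j Hj). assert (H := Cmod_im_le (t - z j)%C). simpl in H. assert (H3 := Rabs_triang (snd (z j)) (snd t + - snd (z j))).
  replace (snd (z j) + (snd t + - snd (z j))) with (snd t) in H3 by ring. lra.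
 - cmp; auto.
Qed.

Lemma KF_sub S c hh S' c' hh' f : (forall z, Dm S' c' hh' z -> Dm S c hh z) -> KF S c hh f -> KF S' c' hh' f.
Proof. intros H (F1 & F2 & F3). split; [|split]; [eapply An_sub; eauto|auto|auto]. Qed.

Section Fixed.
Variables (S : R) (c : nat -> R) (hh : R).

Lemma KF_const x : KF S c hh (fun _ => RtoC x).
Proof. split; [apply An_const|easy]. Qed.
Lemma KF_kd i j : KF S c hh (fun _ => kd i j).
Proof. split; [apply An_const|split; intros; unfold kd; [easy|cmp; easy]]. Qed.
Lemma KF_om i : (i < n)%nat -> KF S c hh (fun z => z (n + i)%nat).
Proof.
 intros Hi. split; [apply An_coord; lia|split]; [intros z Hz j Hj; apply updv_neq; lia|intuition].
Qed.
Lemma KF_plus f g : KF S c hh f -> KF S c hh g -> KF S c hh (fun z => f z + g z)%C.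
Proof.
 intros (F1 & F2 & F3) (G1 & G2 & G3). split; [apply An_plus; easy|split; intros].
 - f_equal; auto.
 - simpl. rewrite F3, G3 by easy. ring.
Qed.
Lemma KF_minus f g : KF S c hh f -> KF S c hh g -> KF S c hh (fun z => f z - g z)%C.
Proof.
 intros (F1 & F2 & F3) (G1 & G2 & G3). split; [apply An_minus; easy|split; intros].
 - f_equal; auto.
 - simpl. rewrite F3, G3 by easy. ring.
Qed.
Lemma KF_mult f g : KF S c hh f -> KF S c hh g -> KF S c hh (fun z => f z * g z)%C.
Proof.
 intros (F1 & F2 & F3) (G1 & G2 & G3). split; [apply An_mult; easy|split; intros].
 - f_equal; auto.
 - simpl. rewrite F3, G3 by easy. ring.
Qed.
Lemma KF_csum m (f : nat -> vec -> C) : (forall i, (i < m)%nat -> KF S c hh (f i)) -> KF S c hh (fun z => csum m (fun i => f i z)).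
Proof. induction m; intros H; simpl. apply (KF_const 0). apply KF_plus; [auto|auto]. Qed.
Lemma KF_pd f j : KF S c hh f -> (j < 2 * n)%nat -> KF S c hh (pd (2 * n) j f).
Proof.
 intros (F1 & F2 & F3) Hj. split; [apply An_pd; [apply opn_Dm|easy|easy]|split].
 - intros z Hz i Hi. apply (pd_per (2 * n) (Dm S c hh)); try easy; try lia; [apply opn_Dm| |].
  + intros; apply Dm_per; easy.
  + auto.
 - intros z Hz Hr. apply (pd_real (2 * n) (Dm S c hh)); try easy. apply opn_Dm.
Qed.
Lemma KF_lim (F : nat -> vec -> C) f M : (forall m, KF S c hh (F m)) -> (forall m z, Dm S c hh z -> Cmod (F m z) <= M) ->
 (forall z, Dm S c hh z -> ccvg (fun m => F m z) (f z)) -> KF S c hh f.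
Proof.
 intros HF HM Hc. split; [|split].
 - intros z Hz. destruct (opn_Dm S c hh z Hz) as (r & Hr & Hn).
  destruct (An_lim (2 * n) F f z r M Hr) as (L & HL & _); [| |eauto].
  + split; [apply (proj1 (HF m)); auto|auto].
  + auto.
 - intros z Hz j Hj. apply (ccvg_unique (fun m => F m z)); [|auto]. apply (ccvg_ext (fun m => F m (updv z j (z j + 1)%C))).
  + intros m. apply (proj1 (proj2 (HF m))); easy.
  + apply Hc. apply Dm_per; easy.
 - intros z Hz Hr. destruct (Req_dec (snd (f z)) 0) as [E|E]; [easy|]. assert (P : 0 < Rabs (snd (f z))) by (apply Rabs_pos_lt; easy).
  destruct (Hc z Hz _ P) as (m0 & Hm). specialize (Hm m0 (le_n _)). assert (E2 := proj2 (proj2 (HF m0)) z Hz Hr).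
  assert (H := Rle_lt_trans _ _ _ (Cmod_im_le _) Hm). simpl in H. rewrite E2, Rplus_0_l, Rabs_Ropp in H. lra.
Qed.
(** Evaluation at angle zero stands in for the mean over the torus: up to the ergodization error, a
    time average has the same value at every angle. The result is a function of the frequencies
    alone. *)
Definition base (z : vec) : vec := fun i => if Nat.ltb i n then RtoC 0 else z i.

Lemma Dm_base z : 0 < S -> Dm S c hh z -> Dm S c hh (base z).
Proof.
 intros HS [H1 H2]. split; intros i Hi; unfold base.
 - destruct (Nat.ltb_spec i n); [simpl; rewrite Rabs_R0; easy|lia].
 - cmp; auto.
Qed.
Lemma KF_base f : 0 < S -> KF S c hh f -> KF S c hh (fun z => f (base z)).
Proof.
 intros HS (F1 & F2 & F3). split; [|split].
 - apply (An_comp (2 * n) (2 * n) (Dm S c hh) (Dm S c hh) f (fun i z => base z i)); [easy| |intros; apply (Dm_base z); easy].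
  intros i Hi. unfold base. destruct (Nat.ltb_spec i n); [apply An_const|apply An_coord; easy].
 - intros z Hz j Hj. f_equal. ext i. unfold base. unfold updv; cmp; auto.
 - intros z Hz Hr. apply F3; [apply Dm_base; easy|]. intros i Hi. unfold base. cmp; auto.
Qed.

Lemma KF_intop f w L M : KF S c hh f -> (forall z, Dm S c hh z -> Cmod (f z) <= M) -> 0 < L -> (forall t, path_cont (fun t => RtoC (w t)) t) ->
 (forall t, 0 <= t <= L -> Rabs (w t) <= 1) -> KF S c hh (intop v w L f).
Proof.
 intros (F1 & F2 & F3) HM HL Hw Hw1. split; [|split].
 - apply (An_intop (2 * n) (Dm S c hh) v w L M f); try easy; [apply opn_Dm|intros; apply Dm_shiftv; easy].
 - intros z Hz j Hj. apply CI_ext; [lra|]. intros t _. f_equal. rewrite <- (F2 (shiftv v z t)) with (j := j) by (try apply Dm_shiftv; easy). f_equal.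
  ext i. unfold shiftv, updv. destruct (Nat.eqb_spec i j); subst; ring.
 - intros z Hz Hr. unfold intop, CI. cbn [snd]. rewrite (RInt_ext _ (fun _ => 0)).
  + rewrite (RInt_const (V := R_CompleteNormedModule)). intuition.
  + intros t _. simpl. rewrite (F3 (shiftv v z t)); [ring|apply Dm_shiftv; easy|]. intros i Hi. simpl. rewrite (Hr i Hi). ring.
Qed.
Lemma KF_sol f L M : KF S c hh f -> (forall z, Dm S c hh z -> Cmod (f z) <= M) -> 0 < L ->
 KF S c hh (sol v L f) /\ KF S c hh (avg v L f) /\ (forall z, Dm S c hh z -> Cmod (sol v L f z) <= M * L) /\ (forall z, Dm S c hh z -> Cmod (avg v L f z) <= M) /\
 (forall z, Dm S c hh z -> csum n (fun i => pd (2 * n) i (sol v L f) z * RtoC (v i))%C = (avg v L f z - f z)%C).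
Proof.
 intros HF HM HL.
 assert (SD : forall z, Dm S c hh z -> An (2 * n) (Dm S c hh) (sol v L f) /\ Cmod (sol v L f z) <= M * L /\ An (2 * n) (Dm S c hh) (avg v L f) /\ Cmod (avg v L f z) <= M /\
   csum (2 * n) (fun i => pd (2 * n) i (sol v L f) z * RtoC (v i))%C = (avg v L f z - f z)%C).
 { intros z Hz. apply (sol_deriv (2 * n) (Dm S c hh) v L M f z); try easy; [apply opn_Dm|intros; apply Dm_shiftv; easy|apply HF]. }
 split; [|split; [|split; [|split]]].
 - apply (KF_intop f _ L M); try easy.
  + intros t. apply cc_ofR. apply (ex_derive_continuous (V := R_NormedModule)). auto_derive. easy.
  + intros t Ht. assert (0 <= t / L <= 1). { split; [apply Rmult_le_pos; [lra|pos]|]. apply (Rmult_le_reg_r L); [lra|]. unfold Rdiv. rewrite Rmult_assoc, Rinv_l; lra. } apply Rabs_le; lra.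
 - apply KF_mult; [apply KF_const|]. apply (KF_intop f _ L M); try easy.
  + intros; apply cc_const.
  + intros; rewrite Rabs_R1; lra.
 - intros z Hz. apply (SD z Hz).
 - intros z Hz. apply (SD z Hz).
 - intros z Hz. destruct (SD z Hz) as (_ & _ & _ & _ & E). rewrite <- E. symmetry. apply csum_2n. intros i Hi. rewrite Hv0 by lia. ring.
Qed.

Lemma KF_cauchy f M del z j : KF S c hh f -> (forall z, Dm S c hh z -> Cmod (f z) <= M) -> 0 < del -> (j < n)%nat -> Dm (S - del) c hh z ->
 Cmod (pd (2 * n) j f z) <= M / del.
Proof.
 intros HF HM Hd Hj Hz. apply (slice_cauchy (2 * n) (Dm S c hh)); try easy; [apply HF|lia|].
 intros t Ht. assert (H := Dm_updv S c hh z j t del Hz Hj Ht). auto.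
Qed.

Definition thadd (xi : nat -> vec -> C) (z : vec) : vec := fun i => if Nat.ltb i n then (z i + xi i z)%C else z i.

Lemma KF_lip f M del eta z (xi : nat -> vec -> C) : KF S c hh f -> (forall z, Dm S c hh z -> Cmod (f z) <= M) -> 0 < del -> Dm (S - del) c hh z ->
 (forall i, (i < n)%nat -> Cmod (xi i z) <= eta * del) -> eta < / 2 -> Cmod (f (thadd xi z) - f z) <= 3 * M * INR n * eta.
Proof.
 intros HF HM Hd Hz Hxi Heta.
 assert (HM0 : 0 <= M). { eapply Rle_trans; [apply Cmod_ge_0|apply (HM z)]. eapply Dm_le; [|eauto]; lra. }
 set (w := fun j => (z j + xi j z)%C).
 destruct (block_taylor (2 * n) 0 n (Dm S c hh) f z del M) with (w := w) as [H _]; try easy; try lia.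
 - apply HF.
 - eapply Dm_le; [|eauto]; lra.
 - intros w' Hw'. assert (HD : Dm S c hh (blockv 0 n z w')).
  { destruct Hz as [Z1 Z2]. split; intros i Hi; unfold blockv; simpl.
   - destruct (Nat.ltb_spec i n); [|lia]. rewrite Nat.sub_0_r. specialize (Hw' i Hi). simpl in Hw'. specialize (Z1 i Hi).
    assert (H1 := Cmod_im_le (w' i - z i)%C). simpl in H1. assert (H3 := Rabs_triang (snd (z i)) (snd (w' i) + - snd (z i))).
    replace (snd (z i) + (snd (w' i) + - snd (z i))) with (snd (w' i)) in H3 by ring. lra.
   - cmp; auto. }
  auto.
 - intros i Hi. unfold w. simpl. replace (z i + xi i z - z i)%C with (xi i z) by ring. eapply Rle_lt_trans; [apply Hxi; easy|]. nra.
 - replace (thadd xi z) with (blockv 0 n z w).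
  2:{ ext i. unfold blockv, thadd, w. rewrite Nat.sub_0_r. easy. }
  via H. apply Rle_trans with (3 * M / del * (INR n * (eta * del))).
  + apply Rmult_le_compat_l; [apply Rmult_le_pos; [lra|pos]|]. apply rsum_le_const. intros i Hi. unfold w. simpl. replace (z i + xi i z - z i)%C with (xi i z) by ring. auto.
  + right. field. lra.
Qed.
End Fixed.

Lemma KF_thadd S S' c hh f (xi : nat -> vec -> C) : KF S c hh f -> (forall i, (i < n)%nat -> KF S' c hh (xi i)) -> (forall z, Dm S' c hh z -> Dm S c hh (thadd xi z)) ->
 KF S' c hh (fun z => f (thadd xi z)) /\
 forall z j, Dm S' c hh z -> (j < n)%nat -> pd (2 * n) j (fun z => f (thadd xi z)) z = csum n (fun k => pd (2 * n) k f (thadd xi z) * (kd k j + pd (2 * n) j (xi k) z))%C.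
Proof.
 intros (F1 & F2 & F3) Hxi Hm.
 assert (Hg : forall i, (i < 2 * n)%nat -> An (2 * n) (Dm S' c hh) (fun z => thadd xi z i)).
 { intros i Hi. unfold thadd. destruct (Nat.ltb_spec i n); [apply An_plus; [apply An_coord; easy|apply Hxi; easy]|apply An_coord; easy]. }
 split; [split; [|split]|].
 - apply (An_comp (2 * n) (2 * n) (Dm S c hh) (Dm S' c hh) f (fun i z => thadd xi z i)); easy.
 - intros z Hz j Hj. rewrite <- (F2 (thadd xi z)) with (j := j) by auto. f_equal. ext i. unfold thadd at 1 2.
  destruct (Nat.ltb_spec i n) as [Hi|Hi].
  + rewrite (proj1 (proj2 (Hxi i Hi))) by easy. unfold updv. destruct (Nat.eqb_spec i j) as [->|]; [unfold thadd; destruct (Nat.ltb_spec j n); [ring|lia]|].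
    cmp; easy.
  + unfold updv; cmp; auto.
 - intros z Hz Hr. apply F3; [auto|]. intros i Hi. unfold thadd. destruct (Nat.ltb_spec i n) as [Hin|Hin]; [|auto].
  simpl. rewrite (Hr i Hi), (proj2 (proj2 (Hxi i Hin)) z Hz Hr). ring.
 - intros z j Hz Hj.
  assert (E := pd_comp (2 * n) (2 * n) (Dm S c hh) (Dm S' c hh) f (fun i z => thadd xi z i) j z F1 Hg Hm Hz ltac:(lia)).
  etransitivity; [exact E|]. rewrite csum_2n.
  + apply csum_ext. intros k Hk. unfold thadd. destruct (Nat.ltb_spec k n); [|lia].
   rewrite (pd_plus (2 * n) (Dm S' c hh)); [|apply An_coord; lia|apply Hxi; easy|easy|lia]. rewrite pd_coord by lia. rewrite Nat.eqb_sym. easy.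
  + intros i Hi. unfold thadd. destruct (Nat.ltb_spec (n + i) n); [lia|]. rewrite pd_coord by lia. cmp; ring.
Qed.

Lemma geom_cvg (u : nat -> C) K q : 0 <= q < 1 -> (forall m, Cmod (u (S m) - u m) <= K * q ^ m) -> 0 <= K ->
 exists l, ccvg u l /\ forall m, Cmod (l - u m) <= K * q ^ m / (1 - q).
Proof.
 intros Hq H HK.
 assert (P : forall m p, Cmod (u (m + p)%nat - u m) <= K * q ^ m / (1 - q) * (1 - q ^ p)).
 { intros m p. induction p. - rewrite Nat.add_0_r. replace (u m - u m)%C with (RtoC 0) by ring. rewrite Cmod_0. lra.
  - rewrite Nat.add_succ_r. eapply Rle_trans; [apply (Cmod_sub_tri _ (u (m + p)%nat))|]. specialize (H (m + p)%nat). rewrite pow_add in H.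
   replace (K * q ^ m / (1 - q) * (1 - q ^ S p)) with (K * (q ^ m * q ^ p) + K * q ^ m / (1 - q) * (1 - q ^ p)) by (simpl; field; lra). lra. }
 assert (P2 : forall m p, (m <= p)%nat -> Cmod (u p - u m) <= K * q ^ m / (1 - q)).
 { intros m p Hm. replace p with (m + (p - m))%nat by lia. eapply Rle_trans; [easy|].
  assert (0 <= K * q ^ m / (1 - q)) by (apply Rmult_le_pos; [apply Rmult_le_pos; [easy|pos]|pos]).
  assert (0 <= q ^ (p - m)) by pos. nra. }
 destruct (C_complete u) as [l Hl].
 - intros e He. destruct (pow_lt_1_zero q) with (y := e * (1 - q) / (2 * (K + 1))) as (m0 & Hm0). { rewrite Rabs_right; lra. } { pos. }
  specialize (Hm0 m0 (le_n _)). rewrite Rabs_right in Hm0 by (apply Rle_ge, pow_le; lra). exists m0. intros m p Hm Hp.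
  eapply Rle_lt_trans; [apply (Cmod_sub_tri _ (u m0))|]. rewrite (Cmod_sub_sym (u m0)). assert (h1 := P2 m0 m Hm). assert (h2 := P2 m0 p Hp).
  assert (K * q ^ m0 / (1 - q) < e / 2); [|lra].
  apply (Rmult_lt_reg_r (1 - q)); [lra|]. unfold Rdiv. rewrite Rmult_assoc, Rinv_l, Rmult_1_r by lra.
  apply (Rmult_lt_compat_r (2 * (K + 1))) in Hm0; [|lra]. replace (e * (1 - q) / (2 * (K + 1)) * (2 * (K + 1))) with (e * (1 - q)) in Hm0 by (field; lra).
  pos.
 - exists l. split; [easy|]. intros m. apply (ccvg_le (fun p => u (m + p)%nat - u m)%C).
  + apply ccvg_minus; [|apply ccvg_const]. intros e He. destruct (Hl e He) as (m0 & Hm0). exists m0. intuition.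
  + intuition.
Qed.

(** The Neumann series as an iteration: its iterates are analytic with a uniform bound, so [KF_lim]
    applies to them. Since every [T m] commutes with [A] ([TC]), the limit is a two-sided
    inverse. *)
Lemma KF_matinv S c hh (A : nat -> nat -> vec -> C) eta : (forall i j, (i < n)%nat -> (j < n)%nat -> KF S c hh (A i j)) ->
 (forall i j z, (i < n)%nat -> (j < n)%nat -> Dm S c hh z -> Cmod (A i j z) <= eta) -> 0 <= eta -> INR n * eta <= / 2 ->
 exists B : nat -> nat -> vec -> C, (forall i j, (i < n)%nat -> (j < n)%nat -> KF S c hh (B i j)) /\
  (forall i j z, (i < n)%nat -> (j < n)%nat -> Dm S c hh z -> Cmod (B i j z - kd i j) <= 2 * eta) /\
  (forall i j z, (i < n)%nat -> (j < n)%nat -> Dm S c hh z -> csum n (fun k => (kd i k + A i k z) * B k j z)%C = kd i j) /\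
  (forall i j z, (i < n)%nat -> (j < n)%nat -> Dm S c hh z -> csum n (fun k => B i k z * (kd k j + A k j z))%C = kd i j).
Proof.
 intros HA HE He Hn.
 set (T := fix T m i j z := match m with O => kd i j | Datatypes.S m => (kd i j - csum n (fun k => A i k z * T m k j z))%C end : C).
 assert (TK : forall m i j, (i < n)%nat -> (j < n)%nat -> KF S c hh (T m i j)).
 { induction m; intros i j Hi Hj; simpl; [apply KF_kd|]. apply KF_minus; [apply KF_kd|]. apply (KF_csum S c hh n (fun k z => A i k z * T m k j z)%C). intros k Hk. apply KF_mult; auto. }
 assert (TB : forall m i j z, (i < n)%nat -> (j < n)%nat -> Dm S c hh z -> Cmod (T m i j z) <= 2).
 { induction m; intros i j z Hi Hj Hz; simpl; [generalize (Cmod_kd i j); lra|]. via Cmod_sub_le.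
  assert (Cmod (csum n (fun k => A i k z * T m k j z))%C <= INR n * (eta * 2)).
  { apply csum_norm_le. intros k Hk. rewrite Cmod_mult. apply Rmult_le_compat; try apply Cmod_ge_0; auto. } generalize (Cmod_kd i j); lra. }
 assert (TD : forall m i j z, (i < n)%nat -> (j < n)%nat -> Dm S c hh z -> Cmod (T (Datatypes.S m) i j z - T m i j z) <= 2 * eta * INR n * (/ 2) ^ m + eta * (/2) ^ m).
 { induction m; intros i j z Hi Hj Hz.
  - simpl. replace (kd i j - csum n (fun k => A i k z * kd k j) - kd i j)%C with (- csum n (fun k => A i k z * kd k j))%C by ring. rewrite Cmod_opp, csum_kd_r by easy.
   assert (h := HE i j z Hi Hj Hz). assert (0 <= eta * INR n) by (apply Rmult_le_pos; [easy|pos]). lra.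
  - change (T (Datatypes.S (Datatypes.S m)) i j z) with (kd i j - csum n (fun k => A i k z * T (Datatypes.S m) k j z))%C.
   change (T (Datatypes.S m) i j z) with (kd i j - csum n (fun k => A i k z * T m k j z))%C.
   replace (kd i j - csum n (fun k => A i k z * T (Datatypes.S m) k j z) - (kd i j - csum n (fun k => A i k z * T m k j z)))%C with (- csum n (fun k => A i k z * (T (Datatypes.S m) k j z - T m k j z)))%C.
   2:{ rewrite (csum_ext n (fun k => A i k z * (T (Datatypes.S m) k j z - T m k j z))%C (fun k => A i k z * T (Datatypes.S m) k j z - A i k z * T m k j z)%C) by (intros; ring). rewrite csum_minus. ring. }
   rewrite Cmod_opp. eapply Rle_trans; [apply csum_norm_le; intros k Hk; rewrite Cmod_mult; apply Rmult_le_compat; [pos|pos|auto|auto]|].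
   set (X := 2 * eta * INR n * (/ 2) ^ m + eta * (/ 2) ^ m). assert (HX : 0 <= X). { pos. }
    replace (2 * eta * INR n * (/ 2) ^ Datatypes.S m + eta * (/ 2) ^ Datatypes.S m) with (/ 2 * X) by (unfold X; simpl; ring).
   pos. }
 set (K := 2 * eta * INR n + eta).
 assert (HK : 0 <= K). { pos. }
 set (B := fun i j z => epsilon (inhabits (RtoC 0)) (fun l => ccvg (fun m => T m i j z) l)).
 assert (HB : forall i j z, (i < n)%nat -> (j < n)%nat -> Dm S c hh z -> ccvg (fun m => T m i j z) (B i j z)).
 { intros i j z Hi Hj Hz. apply epsilon_spec. destruct (geom_cvg (fun m => T m i j z) K (/2)) as (l & Hl & _); [lra| |easy|eauto].
  intros m. eapply Rle_trans; [apply TD; easy|]. unfold K. lra. }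
 assert (Hsh : forall u l, ccvg u l -> ccvg (fun m => u (Datatypes.S m)) l). { intros u l H e He'. destruct (H e He') as (m0 & Hm). eauto. }
 assert (TC : forall m i j z, (i < n)%nat -> (j < n)%nat -> csum n (fun k => T m i k z * A k j z)%C = csum n (fun k => A i k z * T m k j z)%C).
 { induction m; intros i j z Hi Hj; simpl.
  - rewrite csum_kd_l, csum_kd_r by easy. easy.
  - rewrite (csum_ext n _ (fun k => kd i k * A k j z - csum n (fun l => A i l z * (T m l k z * A k j z)))%C).
   2:{ intros k _. rewrite (csum_ext n (fun l => A i l z * (T m l k z * A k j z))%C (fun l => A i l z * T m l k z * A k j z)%C) by (intros; ring). rewrite csum_scal_r. ring. }
   rewrite csum_minus, csum_kd_l, csum_swap by easy.
   rewrite (csum_ext n (fun k => A i k z * (kd k j - csum n (fun k0 => A k k0 z * T m k0 j z)))%C (fun k => A i k z * kd k j - A i k z * csum n (fun l => T m k l z * A l j z))%C).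
   2:{ intros k Hk. rewrite (IHm k j z Hk Hj). ring. }
   rewrite csum_minus, csum_kd_r by easy. f_equal. apply csum_ext. intros k _. rewrite csum_scal. easy. }
 assert (B1 : forall i j z, (i < n)%nat -> (j < n)%nat -> Dm S c hh z -> B i j z = (kd i j - csum n (fun k => A i k z * B k j z))%C).
 { intros i j z Hi Hj Hz. apply (ccvg_unique (fun m => T (Datatypes.S m) i j z)); [apply (Hsh (fun m => T m i j z)), HB; easy|].
   apply ccvg_minus; [apply ccvg_const|]. apply (ccvg_csum n (fun m k => A i k z * T m k j z)%C (fun k => A i k z * B k j z)%C). intros k Hk. apply ccvg_mult; [apply ccvg_const|auto]. }
 assert (B2 : forall i j z, (i < n)%nat -> (j < n)%nat -> Dm S c hh z -> B i j z = (kd i j - csum n (fun k => B i k z * A k j z))%C).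
 { intros i j z Hi Hj Hz. apply (ccvg_unique (fun m => T (Datatypes.S m) i j z)); [apply (Hsh (fun m => T m i j z)), HB; easy|].
  apply (ccvg_ext (fun m => kd i j - csum n (fun k => T m i k z * A k j z))%C); [intros m; rewrite TC by easy; easy|].
  apply ccvg_minus; [apply ccvg_const|]. apply (ccvg_csum n (fun m k => T m i k z * A k j z)%C (fun k => B i k z * A k j z)%C). intros k Hk. apply ccvg_mult; [auto|apply ccvg_const]. }
 exists B. split; [|split; [|split]].
 - intros i j Hi Hj. apply (KF_lim S c hh (fun m => T m i j) (B i j) 2); auto.
 - intros i j z Hi Hj Hz.
  assert (Q : forall m, Cmod (T m i j z - kd i j) <= 2 * eta).
  { assert (Q1 : forall m i, (i < n)%nat -> Cmod (T m i j z - kd i j) <= 2 * eta); [|auto]. induction m; intros i' Hi'.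
   - simpl. replace (kd i' j - kd i' j)%C with (RtoC 0) by ring. rewrite Cmod_0. lra.
   - simpl. replace (kd i' j - csum n (fun k => A i' k z * T m k j z) - kd i' j)%C with (- (csum n (fun k => A i' k z * kd k j) + csum n (fun k => A i' k z * (T m k j z - kd k j))))%C.
    2:{ rewrite <- csum_plus. rewrite (csum_ext n (fun i0 => A i' i0 z * kd i0 j + A i' i0 z * (T m i0 j z - kd i0 j))%C (fun k => A i' k z * T m k j z)%C) by (intros; ring). ring. }
    rewrite Cmod_opp, csum_kd_r by easy. via Cmod_triangle.
    assert (Cmod (csum n (fun k => A i' k z * (T m k j z - kd k j)))%C <= INR n * (eta * (2 * eta))).
    { apply csum_norm_le. intros k Hk. rewrite Cmod_mult. apply Rmult_le_compat; try apply Cmod_ge_0; auto. }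
    assert (h := HE i' j z Hi' Hj Hz). nra. }
  apply (ccvg_le (fun m => T m i j z - kd i j)%C); [apply ccvg_minus; [auto|apply ccvg_const]|easy].
 - intros i j z Hi Hj Hz. rewrite (csum_ext n _ (fun k => kd i k * B k j z + A i k z * B k j z)%C) by (intros; ring). rewrite csum_plus, csum_kd_l by easy.
  rewrite (B1 i j z) at 1 by easy. ring.
 - intros i j z Hi Hj Hz. rewrite (csum_ext n _ (fun k => B i k z * kd k j + B i k z * A k j z)%C) by (intros; ring). rewrite csum_plus, csum_kd_r by easy.
  rewrite (B2 i j z) at 1 by easy. ring.
Qed.
End KF.

(** * The perturbation along a parametrized torus *)

Section Pert.
Variables (n : nat) (v : nat -> R) (h sP : R).

(** The three blocks of [n] entries are actions, angles and frequencies. Actions are already divided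
    by the radius r of the theorem, hence the 1. *)
Definition DP (z : vec) : Prop :=
 (forall i, (i < n)%nat -> Cmod (z i) < 1) /\ (forall i, (i < n)%nat -> Rabs (snd (z (n + i)%nat)) < sP) /\
 (forall i, (i < n)%nat -> Cmod (z (2 * n + i)%nat - RtoC (v i)) < h).
Definition PF (f : vec -> C) : Prop :=
 An (3 * n) DP f /\ (forall z, DP z -> forall j, (j < n)%nat -> f (updv z (n + j) (z (n + j)%nat + 1)%C) = f z) /\
 (forall z, DP z -> (forall k, (k < 3 * n)%nat -> snd (z k) = 0) -> snd (f z) = 0).

Lemma opn_DP : opn (3 * n) DP.
Proof.
  apply opn_and; [|apply opn_and]; apply opn_all; intros i Hi.
 - intros z Hz. destruct (opn_disc (3 * n) i 0 1 ltac:(lia) z) as (r & Hr & H).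
  + replace (z i - 0)%C with (z i) by ring. easy.
  + exists r. split; [easy|]. intros w Hw. specialize (H w Hw). replace (w i - 0)%C with (w i) in H by ring. easy.
 - apply opn_strip; lia.
 - apply opn_disc; lia.
Qed.
Lemma DP_per z j : DP z -> (j < n)%nat -> DP (updv z (n + j) (z (n + j)%nat + 1)%C).
Proof.
 intros (H1 & H2 & H3) Hj. split; [|split]; intros i Hi; unfold updv.
 - cmp; auto.
 - destruct (Nat.eqb_spec (n + i) (n + j)) as [E|]; [|auto]. simpl. rewrite Rplus_0_r. auto.
 - cmp; auto.
Qed.
Lemma PF_pd f k : PF f -> (k < 3 * n)%nat -> PF (pd (3 * n) k f).
Proof.
 intros (F1 & F2 & F3) Hk. split; [|split].
 - apply An_pd; [apply opn_DP|easy|easy].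
 - intros z Hz j Hj. apply (pd_per (3 * n) DP); try easy; try lia; [apply opn_DP| |]; intros; [apply DP_per; easy|auto].
 - intros z Hz Hr. apply (pd_real (3 * n) DP); try easy. apply opn_DP.
Qed.

(** The point (U, theta + V, omega) of the torus over angle theta and frequency omega, laid out as
    in [DP]. *)
Definition Th (U V : nat -> vec -> C) (z : vec) : vec := fun i =>
 if Nat.ltb i n then U i z else if Nat.ltb i (2 * n) then (z (i - n)%nat + V (i - n)%nat z)%C else z (i - n)%nat.

Lemma Th_I U V z i : (i < n)%nat -> Th U V z i = U i z.
Proof. intros H. unfold Th. cmp; easy. Qed.
Lemma Th_th U V z i : (i < n)%nat -> Th U V z (n + i)%nat = (z i + V i z)%C.
Proof. intros H. unfold Th. destruct (Nat.ltb_spec (n + i) n); [lia|]. destruct (Nat.ltb_spec (n + i) (2 * n)); [|lia]. replace (n + i - n)%nat with i by lia. easy. Qed.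
Lemma Th_om U V z i : Th U V z (2 * n + i)%nat = z (n + i)%nat.
Proof. unfold Th. destruct (Nat.ltb_spec (2 * n + i) n); [lia|]. destruct (Nat.ltb_spec (2 * n + i) (2 * n)); [lia|]. f_equal; lia. Qed.

Section Dom.
Variables (S : R) (c : nat -> R) (hh v0 : R).
Hypothesis Hsv : S + v0 <= sP.
Hypothesis Hom : forall z, Dm n S c hh z -> forall i, (i < n)%nat -> Cmod (z (n + i)%nat - RtoC (v i)) < h.

Lemma Th_DP U V z : (forall i, (i < n)%nat -> Cmod (U i z) < 1) -> (forall i, (i < n)%nat -> Cmod (V i z) <= v0) -> Dm n S c hh z -> DP (Th U V z).
Proof.
 intros HU HV Hz. split; [|split]; intros i Hi.
 - rewrite Th_I by easy. auto.
 - rewrite Th_th by easy. simpl. assert (H := proj1 Hz i Hi). assert (H2 := Cmod_im_le (V i z)). specialize (HV i Hi). generalize (Rabs_triang (snd (z i)) (snd (V i z))). lra.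
 - rewrite Th_om. auto.
Qed.

Lemma KF_Th f U V : PF f -> (forall i, (i < n)%nat -> KF n S c hh (U i)) -> (forall i, (i < n)%nat -> KF n S c hh (V i)) ->
 (forall z, Dm n S c hh z -> DP (Th U V z)) ->
 KF n S c hh (fun z => f (Th U V z)) /\
 forall z j, Dm n S c hh z -> (j < n)%nat -> pd (2 * n) j (fun z => f (Th U V z)) z =
  (csum n (fun k => pd (3 * n) k f (Th U V z) * pd (2 * n) j (U k) z) + csum n (fun k => pd (3 * n) (n + k) f (Th U V z) * (kd k j + pd (2 * n) j (V k) z)))%C.
Proof.
 intros (F1 & F2 & F3) HU HV HD.
 assert (Hg : forall i, (i < 3 * n)%nat -> An (2 * n) (Dm n S c hh) (fun z => Th U V z i)).
 { intros i Hi. unfold Th. destruct (Nat.ltb_spec i n); [apply HU; easy|]. destruct (Nat.ltb_spec i (2 * n)); [apply An_plus; [apply An_coord; lia|apply HV; lia]|apply An_coord; lia]. }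
 split; [split; [|split]|].
 - apply (An_comp (3 * n) (2 * n) DP (Dm n S c hh) f (fun i z => Th U V z i)); easy.
 - intros z Hz j Hj. rewrite <- (F2 (Th U V z)) with (j := j) by auto. f_equal. ext i. unfold Th at 1 2.
  destruct (Nat.ltb_spec i n) as [Hi|Hi].
  + rewrite (proj1 (proj2 (HU i Hi))) by easy. unfold updv; cmp; auto.
  + destruct (Nat.ltb_spec i (2 * n)) as [Hi2|Hi2].
   * rewrite (proj1 (proj2 (HV (i - n)%nat ltac:(lia)))) by easy. unfold updv. destruct (Nat.eqb_spec (i - n) j) as [E|E].
    -- destruct (Nat.eqb_spec i (n + j)); [|lia]. rewrite E. unfold Th. destruct (Nat.ltb_spec (n + j) n); [lia|]. destruct (Nat.ltb_spec (n + j) (2 * n)); [|lia].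
      replace (n + j - n)%nat with j by lia. ring.
    -- cmp; easy.
   * unfold updv; cmp; auto.
 - intros z Hz Hr. apply F3; [auto|]. intros i Hi. unfold Th. destruct (Nat.ltb_spec i n) as [Hi1|Hi1].
  + apply HU; easy.
  + destruct (Nat.ltb_spec i (2 * n)) as [Hi2|Hi2]; [|intuition].
   simpl. rewrite (proj2 (proj2 (HV (i - n)%nat ltac:(lia))) z Hz Hr), Hr by lia. ring.
 - intros z j Hz Hj.
  assert (E := pd_comp (3 * n) (2 * n) DP (Dm n S c hh) f (fun i z => Th U V z i) j z F1 Hg HD Hz ltac:(lia)).
  etransitivity; [exact E|]. replace (3 * n)%nat with (n + (n + n))%nat at 1 by lia. rewrite csum_split. f_equal.
  + apply csum_ext. intros k Hk. unfold Th. cmp; easy.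
  + rewrite csum_split. rewrite (csum_0 n (fun i => _ * pd (2 * n) j (fun z => Th U V z (n + (n + i))%nat) z)%C).
   * rewrite Cplus_0_r. apply csum_ext. intros k Hk. unfold Th. destruct (Nat.ltb_spec (n + k) n); [lia|]. destruct (Nat.ltb_spec (n + k) (2 * n)); [|lia].
    replace (n + k - n)%nat with k by lia. rewrite (pd_plus (2 * n) (Dm n S c hh)); [|apply An_coord; lia|apply HV; easy|easy|lia].
    rewrite pd_coord by lia. rewrite Nat.eqb_sym. easy.
   * intros i Hi. unfold Th. destruct (Nat.ltb_spec (n + (n + i)) n); [lia|]. destruct (Nat.ltb_spec (n + (n + i)) (2 * n)); [lia|].
    rewrite pd_coord by lia. cmp; ring.
Qed.
End Dom.

Section Ineq.
Variables (mu : R) (P : vec -> C).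
Hypothesis HP : PF P.
Hypothesis HPb : forall z, DP z -> Cmod (P z) <= mu.

(** From here on [PI] is a derivative of [P], taken in an action for [k < n], and no longer the
    number pi. *)
Definition PI k := pd (3 * n) k P.

Lemma DP_block z w : DP z -> (forall i, (i < n)%nat -> Cmod (w i) < 1) -> DP (blockv 0 n z w).
Proof.
 intros (H1 & H2 & H3) Hw. split; [|split]; intros i Hi; unfold blockv; rewrite Nat.add_0_l; cbn [Nat.leb andb].
 - destruct (Nat.ltb_spec i n); [|lia]. intuition.
 - cmp; auto.
 - cmp; auto.
Qed.
Lemma PI_bound z rho k : DP z -> 0 < rho -> (forall i, (i < n)%nat -> Cmod (z i) <= 1 - rho) -> (k < n)%nat -> Cmod (PI k z) <= mu / rho.
Proof.
 intros Hz Hr Hi Hk. apply (slice_cauchy (3 * n) DP); try easy; [apply HP|lia|].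
 intros t Ht. assert (D : DP (updv z k t)).
 { destruct Hz as (H1 & H2 & H3). split; [|split]; intros i Hi'; unfold updv.
  - destruct (Nat.eqb_spec i k) as [->|]; [|auto]. specialize (Hi k Hk). generalize (Cmod_le_add t (z k)). lra.
  - cmp; auto.
  - cmp; auto. }
 auto.
Qed.

(** Actions below 1/4 leave a radius 1/2 for [P], whence 28 = 7 / (1/2)^2. The derivatives [PI k]
    are at most [2 * mu] for actions below 1/2, and the radius 1/4 gives 24 = 3 . 2 / (1/4). *)
Lemma P_taylor U U1 V z d : DP (Th U V z) -> (forall i, (i < n)%nat -> Cmod (U i z) <= / 4) -> (forall i, (i < n)%nat -> Cmod (U1 i z - U i z) <= d) -> d < / 8 ->
 Cmod (P (Th U1 V z) - P (Th U V z) - csum n (fun k => PI k (Th U V z) * (U1 k z - U k z)))%C <= 28 * mu * ((INR n * d) * (INR n * d)) /\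
 forall k, (k < n)%nat -> Cmod (PI k (Th U1 V z) - PI k (Th U V z)) <= 24 * mu * (INR n * d).
Proof.
 intros HD HU Hd Hd8.
 assert (Hmu : 0 <= mu) by (eapply Rle_trans; [apply Cmod_ge_0|eauto]).
 assert (E : Th U1 V z = blockv 0 n (Th U V z) (fun i => U1 i z)).
 { ext i. unfold blockv, Th. simpl. destruct (Nat.ltb_spec i n); [f_equal; lia|easy]. }
 assert (HUw : forall rho, rho <= / 2 -> forall w, near n (fun j => Th U V z (0 + j)%nat) w rho -> forall i, (i < n)%nat -> Cmod (w i) < / 4 + rho).
 { intros rho Hrho w Hw i Hi. specialize (Hw i Hi). rewrite Th_I in Hw by easy. specialize (HU i Hi). generalize (Cmod_le_add (w i) (U i z)). lra. }
 assert (Hnr : forall rho, d < rho -> near n (fun j => Th U V z (0 + j)%nat) (fun i => U1 i z) rho).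
 { intros rho Hrho i Hi. simpl. rewrite Th_I by easy. specialize (Hd i Hi). lra. }
 assert (Hsum : 0 <= rsum n (fun j => Cmod (U1 j z - Th U V z (0 + j)%nat)) <= INR n * d).
 { split; [apply rsum_pos; intros; apply Cmod_ge_0|]. apply rsum_le_const. intros i Hi. rewrite Th_I by easy. auto. }
 set (sm := rsum n (fun j => Cmod (U1 j z - Th U V z (0 + j)%nat))) in *.
 split.
 - destruct (block_taylor (3 * n) 0 n DP P (Th U V z) (/ 2) mu) with (w := fun i => U1 i z) as [_ H]; try easy; try lia; try lra.
  + apply HP.
  + intros w Hw. assert (H := HUw (/ 2) ltac:(lra) w Hw). assert (DP (blockv 0 n (Th U V z) w)); [|auto]. apply DP_block; [easy|]. intros i Hi. specialize (H i Hi). lra.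
  + apply Hnr. lra.
  + rewrite E. rewrite (csum_ext n (fun k => PI k (Th U V z) * (U1 k z - U k z))%C (fun j => pd (3 * n) (0 + j) P (Th U V z) * (U1 j z - Th U V z (0 + j)%nat))%C).
   2:{ intros k Hk. rewrite Th_I by easy. easy. }
   via H. fold sm. replace (7 * mu / (/ 2 * / 2)) with (28 * mu) by field. apply Rmult_le_compat_l; [lra|]. pos.
 - intros k Hk. destruct (block_taylor (3 * n) 0 n DP (PI k) (Th U V z) (/ 4) (2 * mu)) with (w := fun i => U1 i z) as [H _]; try easy; try lia; try lra.
  + apply An_pd; [apply opn_DP|apply HP|lia].
  + intros w Hw. assert (H := HUw (/ 4) ltac:(lra) w Hw). assert (HDb : DP (blockv 0 n (Th U V z) w)). { apply DP_block; [easy|]. intros i Hi. specialize (H i Hi). lra. }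
   split; [easy|]. replace (2 * mu) with (mu / / 2) by field. apply PI_bound; [easy|lra| |easy]. intros i Hi. unfold blockv. simpl. destruct (Nat.ltb_spec i n); [|lia]. rewrite Nat.sub_0_r. specialize (H i Hi). lra.
  + apply Hnr. lra.
  + rewrite E. via H. fold sm. pos.
Qed.
End Ineq.
End Pert.

(** * The iteration step *)

Lemma base_base n z : base n (base n z) = base n z.
Proof. ext i. unfold base. cmp; easy. Qed.
Lemma base_tail n z i : (n <= i)%nat -> base n z i = z i.
Proof. intros H. unfold base. cmp; easy. Qed.

Section Erg.
Variables (n : nat) (v : nat -> R) (kap : R).
Hypothesis Hn : (1 <= n)%nat.
Hypothesis Hv0 : forall i, (n <= i)%nat -> v i = 0.
Hypothesis Hkap : 0 < kap.

Definition dioph (Psi Q : R) : Prop := 0 < Psi /\ 0 < Q /\ forall k : list Z, length k = n -> 0 < l1l k <= Q -> 1 <= Psi * Rabs (dotr k v).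

Lemma Cerg_pos : 4 <= Cerg n kap.
Proof. unfold Cerg. assert (0 <= 4 * INR n) by pos. generalize (Rmax_l (4 * INR n) (640 * 18 ^ n / (kap * kap))). lra. Qed.

Lemma KF_ergod Psi Q S c hh f M z z' : dioph Psi Q -> KF n S c hh f -> (forall z, Dm n S c hh z -> Cmod (f z) <= M) -> 0 <= M -> Cerg n kap / Q < S ->
 Dm n (S - Cerg n kap / Q) c hh z -> Dm n (S - Cerg n kap / Q) c hh z' -> (forall i, (n <= i)%nat -> z i = z' i) ->
 Cmod (avg v (Cerg n kap * Psi) f z - avg v (Cerg n kap * Psi) f z') <= 4 * kap * M.
Proof.
 intros (HPsi & HQ & Hd) HF HM HM0 HS Hz Hz' Ht.
 (* [ergod_pos] asks for a strictly positive bound, whereas [M] may be 0. *)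
 apply le_epsilon. intros e He. set (dl := Cerg n kap / Q) in *.
 replace (4 * kap * M + e) with (4 * kap * (M + e / (4 * kap))) by (field; lra).
 assert (HDm : forall s zz, ereg n z s zz -> s <= S -> Dm n S c hh zz).
 { intros s zz [E1 E2] Hs. split; intros i Hi; [specialize (E1 i Hi); lra|]. rewrite E2 by lia. apply Hz; easy. }
 apply (ergod_pos n kap Hn Hkap v Psi Q (Cerg n kap * Psi) dl HPsi HQ Hd) with (S := S) (zb := z).
 - lra.
 - unfold dl. right. field. lra.
 - easy.
 - assert (0 < e / (4 * kap)) by pos. lra.
 - easy.
 - intros zz Hzz. assert (D := HDm S zz Hzz (Rle_refl _)). split.
  + assert (0 < e / (4 * kap)) by pos. specialize (HM zz D). lra.
  + destruct HF as (F1 & F2 & F3). split; [|auto].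
   eexists. apply (is_grad_cd (2 * n) f zz _ i (An_grad _ _ _ _ F1 D)). lia.
 - intros zz Hzz t. apply (An_path_cont (2 * n) (Dm n S c hh)); [intros; apply Dm_shiftv; easy|apply HF|apply (HDm S); [easy|lra]].
 - split; [apply Hz|easy].
 - split; [apply Hz'|]. symmetry; auto.
Qed.
End Erg.

(** [sS] is a primitive: its angular gradient is the pull-back of I d theta to the torus ([giso]).
    [sW] is the inverse of the Jacobian of theta + V, and [sg] the shift of the frequency. *)
Record st := mkst { sS : vec -> C; sU : nat -> vec -> C; sV : nat -> vec -> C; sW : nat -> nat -> vec -> C; sg : nat -> vec -> C }.

Section Step.
Variables (n : nat) (v : nat -> R) (h sP mu kap : R) (P : vec -> C).
Hypothesis Hn : (1 <= n)%nat.
Hypothesis Hv0 : forall i, (n <= i)%nat -> v i = 0.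
Hypothesis Hkap : 0 < kap.
Hypothesis Hmu : 0 <= mu.
Hypothesis HP : PF n v h sP P.
Hypothesis HPb : forall z, DP n v h sP z -> Cmod (P z) <= mu.

Definition MM (V : nat -> vec -> C) i j z := (kd i j + pd (2 * n) j (V i) z)%C.
(** The energy along the torus. *)
Definition EE (U V : nat -> vec -> C) z := (csum n (fun i => z (n + i)%nat * U i z) + P (Th n U V z))%C.
(** The angular component of the Hamiltonian vector field along the torus. *)
Definition XX (U V : nat -> vec -> C) k z := (z (n + k)%nat + PI n P k (Th n U V z))%C.
(** When [W] inverts [MM], this vanishes exactly if [MM] v = [XX], that is, if the angular velocity
    is the image of the constant field v. Applying [W] expresses the defect in the intrinsic angle,
    where reparametrization acts simply. *)
Definition GG (U V : nat -> vec -> C) (W : nat -> nat -> vec -> C) i z := (RtoC (v i) - csum n (fun k => W i k z * XX U V k z))%C.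

Record good (S : R) (c : nat -> R) (hh a b gam u vb w : R) (x : st) : Prop := mkgood {
 gS : KF n S c hh (sS x);
 gU : forall i, (i < n)%nat -> KF n S c hh (sU x i);
 gV : forall i, (i < n)%nat -> KF n S c hh (sV x i);
 gW : forall i j, (i < n)%nat -> (j < n)%nat -> KF n S c hh (sW x i j);
 gg : forall i, (i < n)%nat -> KF n S c hh (sg x i);
 gbase : forall i z, (i < n)%nat -> sg x i (base n z) = sg x i z;
 giso : forall z j, Dm n S c hh z -> (j < n)%nat -> (sU x j z + csum n (fun i => pd (2 * n) j (sV x i) z * sU x i z))%C = pd (2 * n) j (sS x) z;
 gWM : forall z i j, Dm n S c hh z -> (i < n)%nat -> (j < n)%nat -> csum n (fun k => sW x i k z * MM (sV x) k j z)%C = kd i j;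
 gMW : forall z i j, Dm n S c hh z -> (i < n)%nat -> (j < n)%nat -> csum n (fun k => MM (sV x) i k z * sW x k j z)%C = kd i j;
 gUb : forall z i, Dm n S c hh z -> (i < n)%nat -> Cmod (sU x i z) <= u;
 gVb : forall z i, Dm n S c hh z -> (i < n)%nat -> Cmod (sV x i z) <= vb;
 gWb : forall z i j, Dm n S c hh z -> (i < n)%nat -> (j < n)%nat -> Cmod (sW x i j z - kd i j) <= w;
 gosc : forall z z', Dm n S c hh z -> Dm n S c hh z' -> (forall i, (n <= i)%nat -> z i = z' i) -> Cmod (EE (sU x) (sV x) z - EE (sU x) (sV x) z') <= a;
 gGb : forall z i, Dm n S c hh z -> (i < n)%nat -> Cmod (GG (sU x) (sV x) (sW x) i z - sg x i z) <= b;
 ggb : forall z i, Dm n S c hh z -> (i < n)%nat -> Cmod (sg x i z) <= gam }.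

Lemma KF_EE S c hh U V : (forall i, (i < n)%nat -> KF n S c hh (U i)) -> (forall i, (i < n)%nat -> KF n S c hh (V i)) -> (forall z, Dm n S c hh z -> DP n v h sP (Th n U V z)) -> KF n S c hh (EE U V).
Proof.
 intros HU HV HD. apply KF_plus.
 - apply (KF_csum n S c hh n (fun i z => z (n + i)%nat * U i z)%C). intros i Hi. apply KF_mult; [apply KF_om; easy|auto].
 - apply (KF_Th n v h sP S c hh P U V HP HU HV HD).
Qed.
Lemma KF_XX S c hh U V k : (forall i, (i < n)%nat -> KF n S c hh (U i)) -> (forall i, (i < n)%nat -> KF n S c hh (V i)) -> (forall z, Dm n S c hh z -> DP n v h sP (Th n U V z)) ->
 (k < n)%nat -> KF n S c hh (XX U V k).
Proof.
 intros HU HV HD Hk. apply KF_plus; [apply KF_om; easy|].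
 apply (KF_Th n v h sP S c hh (PI n P k) U V); try easy. apply PF_pd; [easy|lia].
Qed.
Lemma KF_GG S c hh U V W i : (forall i, (i < n)%nat -> KF n S c hh (U i)) -> (forall i, (i < n)%nat -> KF n S c hh (V i)) -> (forall z, Dm n S c hh z -> DP n v h sP (Th n U V z)) ->
 (forall i j, (i < n)%nat -> (j < n)%nat -> KF n S c hh (W i j)) -> (i < n)%nat -> KF n S c hh (GG U V W i).
Proof.
 intros HU HV HD HW Hi. apply KF_minus; [apply KF_const|].
 apply (KF_csum n S c hh n (fun k z => W i k z * XX U V k z)%C). intros k Hk. apply KF_mult; [auto|apply KF_XX; easy].
Qed.

Variables (S : R) (c : nat -> R) (hh a b gam u vb w : R) (x : st).
Hypothesis HG : good S c hh a b gam u vb w x.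
Variables (Psi Q : R).
Hypothesis Hdio : dioph n v Psi Q.
Hypothesis Hu : u <= / 8.
Hypothesis Hw : w <= 1.
Hypothesis Hsv : S + vb <= sP.
Hypothesis Hom : forall z, Dm n S c hh z -> forall i, (i < n)%nat -> Cmod (z (n + i)%nat - RtoC (v i)) < h.
Hypothesis Ha : 0 <= a.
Hypothesis Hb : 0 <= b.

Let N := INR n.
Let D := Psi * Q.
Let dl := Cerg n kap / Q.
Let L := Cerg n kap * Psi.
Let d := 2 * N * a * D.
Let b1 := b + 96 * (N * N * N) * mu * a * D.
Hypothesis Hd8 : d < / 8.
Hypothesis HS : 3 * dl < S.

Let HN : 1 <= N.
Proof. apply (le_INR 1). easy. Qed.
Let HD0 : 0 < D.
Proof. destruct Hdio as (? & ? & _). pos. Qed.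
Let HC4 : 4 <= Cerg n kap.
Proof. apply Cerg_pos. Qed.
Let Hdl0 : 0 < dl.
Proof. destruct Hdio as (? & ? & _). pos. Qed.
Let HL0 : 0 < L.
Proof. destruct Hdio as (? & ? & _). pos. Qed.
Let HLD : L = D * dl.
Proof. destruct Hdio as (? & ? & _). unfold L, D, dl. field. lra. Qed.
Let Hd0 : 0 <= d.
Proof. pos. Qed.

Let U := sU x. Let V := sV x. Let W := sW x.

Let HDP z : Dm n S c hh z -> DP n v h sP (Th n U V z).
Proof.
 intros Hz. apply (Th_DP n v h sP S c hh vb Hsv Hom); [| |easy].
 - intros i Hi. assert (H := gUb _ _ _ _ _ _ _ _ _ _ HG z i Hz Hi). fold U in H. lra.
 - intros i Hi. apply (gVb _ _ _ _ _ _ _ _ _ _ HG z i Hz Hi).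
Qed.
Let HE : KF n S c hh (EE U V).
Proof. apply KF_EE; [apply HG|apply HG|easy]. Qed.

(** The energy need not be small, but its oscillation is; subtracting the value at angle zero bounds
    the datum by [a]. *)
Let f1 z := (EE U V z - EE U V (base n z))%C.
Let Hf1 : KF n S c hh f1.
Proof. apply KF_minus; [easy|]. apply KF_base; [lra|easy]. Qed.
Let Hf1b z : Dm n S c hh z -> Cmod (f1 z) <= a.
Proof. intros Hz. apply (gosc _ _ _ _ _ _ _ _ _ _ HG); [easy|apply Dm_base; [lra|easy]|]. intros i Hi. rewrite base_tail; easy. Qed.

Let sig := sol v L f1.
Let Hsig : KF n S c hh sig. Proof. apply (KF_sol n v Hv0 S c hh f1 L a Hf1 Hf1b HL0). Qed.
Let Hsigb j z : (j < n)%nat -> Dm n (S - dl) c hh z -> Cmod (pd (2 * n) j sig z) <= a * D.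
Proof.
  replace (a * D) with (a * L / dl) by (rewrite HLD; field; lra). apply (KF_cauchy n S c hh sig); try easy.
 apply (KF_sol n v Hv0 S c hh f1 L a Hf1 Hf1b HL0).
Qed.

(** The correction W^T grad sig adds grad sig to MM^T U, which keeps the torus isotropic. It changes
    the energy, to first order, by XX . W^T grad sig = (v - GG) . grad sig. *)
Definition step_U1 i z := (U i z + csum n (fun k => W k i z * pd (2 * n) k sig z))%C.
Let U1 := step_U1.
Let HU1 i : (i < n)%nat -> KF n S c hh (U1 i).
Proof.
 intros Hi. apply KF_plus; [apply HG; easy|]. apply (KF_csum n S c hh n (fun k z => W k i z * pd (2 * n) k sig z)%C). intros k Hk.
 apply KF_mult; [apply HG; easy|apply KF_pd; [easy|lia]].
Qed.
Let HWb z i j : Dm n S c hh z -> (i < n)%nat -> (j < n)%nat -> Cmod (W i j z) <= 2.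
Proof.
 intros Hz Hi Hj. assert (H := gWb _ _ _ _ _ _ _ _ _ _ HG z i j Hz Hi Hj). fold W in H.
 generalize (Cmod_le_add (W i j z) (kd i j)). generalize (Cmod_kd i j). lra.
Qed.
Let HDle1 z : Dm n (S - dl) c hh z -> Dm n S c hh z.
Proof. apply Dm_le. lra. Qed.

Lemma step_dU i z : (i < n)%nat -> Dm n (S - dl) c hh z -> Cmod (U1 i z - U i z) <= d.
Proof.
 intros Hi Hz. unfold U1, step_U1. replace (U i z + csum n (fun k => W k i z * pd (2 * n) k sig z) - U i z)%C with (csum n (fun k => W k i z * pd (2 * n) k sig z))%C by ring.
 replace d with (N * (2 * (a * D))) by (unfold d; ring). apply csum_norm_le. intros k Hk. rewrite Cmod_mult.
 apply Rmult_le_compat; try apply Cmod_ge_0; [auto|auto].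
Qed.
Let HU1b i z : (i < n)%nat -> Dm n (S - dl) c hh z -> Cmod (U1 i z) <= / 4.
Proof.
 intros Hi Hz. assert (H := step_dU i z Hi Hz). assert (H2 := gUb _ _ _ _ _ _ _ _ _ _ HG z i (HDle1 z Hz) Hi). fold U in H2.
 generalize (Cmod_le_add (U1 i z) (U i z)). lra.
Qed.
Let HDP1 z : Dm n (S - dl) c hh z -> DP n v h sP (Th n U1 V z).
Proof.
 intros Hz. apply (Th_DP n v h sP S c hh vb Hsv Hom); [| |auto].
 - intros i Hi. generalize (HU1b i z Hi Hz). lra.
 - intros i Hi. apply (gVb _ _ _ _ _ _ _ _ _ _ HG z i (HDle1 z Hz) Hi).
Qed.
Let HPT z : Dm n (S - dl) c hh z ->
 Cmod (P (Th n U1 V z) - P (Th n U V z) - csum n (fun k => PI n P k (Th n U V z) * (U1 k z - U k z)))%C <= 28 * mu * ((N * d) * (N * d)) /\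
 forall k, (k < n)%nat -> Cmod (PI n P k (Th n U1 V z) - PI n P k (Th n U V z)) <= 24 * mu * (N * d).
Proof.
 intros Hz. apply (P_taylor n v h sP mu P HP HPb U U1 V z d); auto.
 - intros i Hi. assert (H2 := gUb _ _ _ _ _ _ _ _ _ _ HG z i (HDle1 z Hz) Hi). fold U in H2. lra.
 - intros i Hi. apply step_dU; easy.
Qed.

(** Since v . grad sig = avg f1 - f1, the first-order change replaces [f1] by its time average. What
    remains is the product of [GG] with grad sig and, because omega . U is linear, the Taylor
    remainder of [P] in the actions. *)
Lemma step_E z : Dm n (S - dl) c hh z ->
 Cmod (EE U1 V z - (EE U V (base n z) + avg v L f1 z - csum n (fun k => GG U V W k z * pd (2 * n) k sig z)))%C <= 28 * mu * ((N * d) * (N * d)).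
Proof.
 intros Hz. assert (Hz0 := HDle1 z Hz).
 replace (EE U1 V z - (EE U V (base n z) + avg v L f1 z - csum n (fun k => GG U V W k z * pd (2 * n) k sig z)))%C with
   (P (Th n U1 V z) - P (Th n U V z) - csum n (fun k => PI n P k (Th n U V z) * (U1 k z - U k z)))%C; [apply (HPT z Hz)|].
 assert (HA : avg v L f1 z = (csum n (fun i => pd (2 * n) i sig z * RtoC (v i)) + f1 z)%C).
 { unfold sig. rewrite (proj2 (proj2 (proj2 (proj2 (KF_sol n v Hv0 S c hh f1 L a Hf1 Hf1b HL0)))) z Hz0). ring. }
 rewrite HA.
 assert (HX : csum n (fun k => XX U V k z * (U1 k z - U k z))%C = (csum n (fun i => pd (2 * n) i sig z * RtoC (v i)) - csum n (fun k => GG U V W k z * pd (2 * n) k sig z))%C).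
 { rewrite <- csum_minus. rewrite (csum_ext n (fun k => XX U V k z * (U1 k z - U k z))%C (fun k => csum n (fun m => XX U V k z * (W m k z * pd (2 * n) m sig z)))%C).
  2:{ intros k Hk. unfold U1, step_U1. rewrite csum_scal. ring. }
  rewrite csum_swap. apply csum_ext. intros m Hm. unfold GG.
  rewrite (csum_ext n (fun i => XX U V i z * (W m i z * pd (2 * n) m sig z))%C (fun i => W m i z * XX U V i z * pd (2 * n) m sig z)%C) by (intros; ring).
  rewrite csum_scal_r. ring. }
 assert (HX2 : csum n (fun k => XX U V k z * (U1 k z - U k z))%C = (csum n (fun k => z (n + k)%nat * U1 k z) - csum n (fun k => z (n + k)%nat * U k z) + csum n (fun k => PI n P k (Th n U V z) * (U1 k z - U k z)))%C).
 { rewrite <- csum_minus, <- csum_plus. apply csum_ext. intros k Hk. unfold XX. ring. }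
 rewrite HX2 in HX. unfold f1, EE at 1 3.
 set (A1 := csum n (fun k => z (n + k)%nat * U1 k z)%C) in *. set (A2 := csum n (fun k => z (n + k)%nat * U k z)%C) in *.
 set (A3 := csum n (fun k => PI n P k (Th n U V z) * (U1 k z - U k z))%C) in *. set (A4 := csum n (fun i => pd (2 * n) i sig z * RtoC (v i))%C) in *.
 set (A5 := csum n (fun k => GG U V W k z * pd (2 * n) k sig z)%C) in *.
 replace A1 with (A4 - A5 + A2 - A3)%C by (rewrite <- HX; ring). ring.
Qed.

Lemma step_osc z z' : Dm n (S - dl) c hh z -> Dm n (S - dl) c hh z' -> (forall i, (n <= i)%nat -> z i = z' i) ->
 Cmod (EE U1 V z - EE U1 V z') <= 4 * kap * a + 2 * (N * ((gam + b) * (a * D)) + 28 * mu * ((N * d) * (N * d))).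
Proof.
 intros Hz Hz' Ht.
 assert (Eb : base n z = base n z'). { ext i. unfold base. cmp; auto. }
 assert (He := KF_ergod n v kap Hn Hv0 Hkap Psi Q S c hh f1 a z z' Hdio Hf1 Hf1b Ha ltac:(fold dl; lra) Hz Hz' Ht). fold L in He.
 assert (HGs : forall z, Dm n (S - dl) c hh z -> Cmod (csum n (fun k => GG U V W k z * pd (2 * n) k sig z)%C) <= N * ((gam + b) * (a * D))).
 { intros y Hy. apply csum_norm_le. intros k Hk. rewrite Cmod_mult. apply Rmult_le_compat; try apply Cmod_ge_0; [|auto].
  assert (h1 := gGb _ _ _ _ _ _ _ _ _ _ HG y k (HDle1 y Hy) Hk). assert (h2 := ggb _ _ _ _ _ _ _ _ _ _ HG y k (HDle1 y Hy) Hk).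
  generalize (Cmod_le_add (GG U V W k y) (sg x k y)). fold U V W in h1. lra. }
 assert (g1 := HGs z Hz). assert (g2 := HGs z' Hz'). assert (e1 := step_E z Hz). assert (e2 := step_E z' Hz'). rewrite <- Eb in e2.
 set (A1 := csum n (fun k => GG U V W k z * pd (2 * n) k sig z)%C) in *. set (A2 := csum n (fun k => GG U V W k z' * pd (2 * n) k sig z')%C) in *.
 set (F := EE U1 V z) in *. set (F' := EE U1 V z') in *. set (B0 := EE U V (base n z)) in *. set (a1 := avg v L f1 z) in *. set (a2 := avg v L f1 z') in *.
 replace (F - F')%C with ((F - (B0 + a1 - A1)) - (F' - (B0 + a2 - A2)) + (a1 - a2) - (A1 - A2))%C by ring.
 via Cmod_sub_le. assert (t1 := Cmod_sub_le A1 A2).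
 assert (t2 := Cmod_triangle ((F - (B0 + a1 - A1)) - (F' - (B0 + a2 - A2)))%C (a1 - a2)%C). assert (t3 := Cmod_sub_le (F - (B0 + a1 - A1))%C (F' - (B0 + a2 - A2))%C). lra.
Qed.

Let Gt i z := (GG U1 V W i z - sg x i z)%C.
Let HGt i : (i < n)%nat -> KF n (S - dl) c hh (Gt i).
Proof.
 intros Hi. apply KF_minus; [apply KF_GG|]; try easy; intros; (eapply KF_sub; [auto|]).
 - auto.
 - apply HG; easy.
 - apply HG; easy.
 - apply HG; easy.
Qed.
Let HGtb i z : (i < n)%nat -> Dm n (S - dl) c hh z -> Cmod (Gt i z) <= b1.
Proof.
 intros Hi Hz. assert (H := gGb _ _ _ _ _ _ _ _ _ _ HG z i (HDle1 z Hz) Hi).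
 unfold Gt. replace (GG U1 V W i z - sg x i z)%C with ((GG U V W i z - sg x i z) - csum n (fun k => W i k z * (PI n P k (Th n U1 V z) - PI n P k (Th n U V z))))%C.
 2:{ unfold GG. rewrite (csum_ext n (fun k => W i k z * XX U1 V k z)%C (fun k => W i k z * XX U V k z + W i k z * (PI n P k (Th n U1 V z) - PI n P k (Th n U V z)))%C) by (intros; unfold XX; ring).
   rewrite csum_plus. ring. }
 via Cmod_sub_le. apply Rplus_le_compat; [easy|].
 (* [N] entries of [W], each at most 2, times the variation [24 * mu * (N * d)] of the derivatives
    of [P], with [d = 2 * N * a * D]. *)
 replace (96 * (N * N * N) * mu * a * D) with (N * (2 * (24 * mu * (N * d)))) by (unfold d; ring). apply csum_norm_le. intros k Hk. rewrite Cmod_mult.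
 apply Rmult_le_compat; try apply Cmod_ge_0; [auto|]. apply (HPT z Hz); easy.
Qed.
Let Hb1 : 0 <= b1.
Proof. pos. Qed.

Hypothesis Hbd : N * (b1 * D) <= / 4.
Let Hbd1 : 0 <= b1 * D <= / 4.
Proof. pos. Qed.

Let Hbd1' : b1 * D <= 1.
Proof. lra. Qed.
Let xi i := sol v L (Gt i).
Let Hxs i (Hi : (i < n)%nat) := KF_sol n v Hv0 (S - dl) c hh (Gt i) L b1 (HGt i Hi) (fun z => HGtb i z Hi) HL0.
Let Hxi i : (i < n)%nat -> KF n (S - dl) c hh (xi i).
Proof. intros Hi. apply (Hxs i Hi). Qed.
Let Hxib i z : (i < n)%nat -> Dm n (S - dl) c hh z -> Cmod (xi i z) <= b1 * D * dl.
Proof. intros Hi Hz. rewrite Rmult_assoc, <- HLD. apply (Hxs i Hi); easy. Qed.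
Let Hxid i j z : (i < n)%nat -> (j < n)%nat -> Dm n (S - 2 * dl) c hh z -> Cmod (pd (2 * n) j (xi i) z) <= b1 * D.
Proof.
 intros Hi Hj Hz. replace (b1 * D) with (b1 * D * dl / dl) by (field; lra). apply (KF_cauchy n (S - dl) c hh); auto.
 replace (S - dl - dl) with (S - 2 * dl) by ring. easy.
Qed.

Let S3 := S - 3 * dl.
Let HD31 z : Dm n S3 c hh z -> Dm n (S - dl) c hh z.
Proof. apply Dm_le. unfold S3; lra. Qed.
Let HD3 z : Dm n S3 c hh z -> Dm n S c hh z.
Proof. auto. Qed.
(** The change of angle theta + xi(theta) by which the torus is reparametrized. It does not touch
    the frequencies and moves along one torus only, so the oscillation of the energy is not
    increased. *)
Let gx := thadd n xi.
Let Hgx z : Dm n S3 c hh z -> Dm n (S - 2 * dl) c hh (gx z).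
Proof.
 intros Hz. split; intros i Hi; unfold gx, thadd.
 - destruct (Nat.ltb_spec i n); [|lia]. assert (h1 := Hxib i z Hi (HD31 z Hz)). assert (h0 := proj1 Hz i Hi). unfold S3 in h0. change (snd (z i + xi i z)%C) with (snd (z i) + snd (xi i z)).
  assert (h2 := Cmod_im_le (xi i z)). assert (b1 * D * dl <= dl) by pos. generalize (Rabs_triang (snd (z i)) (snd (xi i z))). lra.
 - destruct (Nat.ltb_spec (n + i) n); [lia|]. apply Hz; easy.
Qed.
Let Hgx1 z : Dm n S3 c hh z -> Dm n (S - dl) c hh (gx z).
Proof. intros Hz. apply (Dm_le n _ (S - 2 * dl)); [lra|auto]. Qed.
Let Hgx0 z : Dm n S3 c hh z -> Dm n S c hh (gx z).
Proof. auto. Qed.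
Let gx_om z i : (n <= i)%nat -> gx z i = z i.
Proof. intros Hi. unfold gx, thadd. cmp; easy. Qed.
Let gx_base z : base n (gx z) = base n z.
Proof. ext i. unfold base. cmp; auto. Qed.
Let Hcomp f : KF n S c hh f -> KF n S3 c hh (fun z => f (gx z)) /\
 forall z j, Dm n S3 c hh z -> (j < n)%nat -> pd (2 * n) j (fun z => f (gx z)) z = csum n (fun k => pd (2 * n) k f (gx z) * (kd k j + pd (2 * n) j (xi k) z))%C.
Proof.
 intros Hf. apply (KF_thadd n S S3 c hh f xi); [easy| |easy]. intros i Hi. apply (KF_sub n (S - dl) c hh); auto.
Qed.
Let Hlip f M z : KF n (S - dl) c hh f -> (forall z, Dm n (S - dl) c hh z -> Cmod (f z) <= M) -> Dm n S3 c hh z -> Cmod (f (gx z) - f z) <= 3 * M * N * (b1 * D).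
Proof.
 intros Hf HM Hz. apply (KF_lip n (S - dl) c hh f M dl (b1 * D) z xi); auto; [|lra].
 apply (Dm_le n _ S3); [unfold S3; lra|easy].
Qed.

Lemma step_B : exists B : nat -> nat -> vec -> C, (forall i j, (i < n)%nat -> (j < n)%nat -> KF n S3 c hh (B i j)) /\
  (forall i j z, (i < n)%nat -> (j < n)%nat -> Dm n S3 c hh z -> Cmod (B i j z - kd i j) <= 2 * (b1 * D)) /\
  (forall i j z, (i < n)%nat -> (j < n)%nat -> Dm n S3 c hh z -> csum n (fun k => (kd i k + pd (2 * n) k (xi i) z) * B k j z)%C = kd i j) /\
  (forall i j z, (i < n)%nat -> (j < n)%nat -> Dm n S3 c hh z -> csum n (fun k => B i k z * (kd k j + pd (2 * n) j (xi k) z))%C = kd i j).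
Proof.
 apply (KF_matinv n S3 c hh (fun i j => pd (2 * n) j (xi i)) (b1 * D)).
 - intros i j Hi Hj. apply KF_pd; [|lia]. apply (KF_sub n (S - dl) c hh); auto.
 - intros i j z Hi Hj Hz. apply Hxid; try easy. apply (Dm_le n _ S3); [unfold S3; lra|easy].
 - lra.
 - fold N. lra.
Qed.

(** In [a'] and [b'] the term with [kap] is the ergodization error, linear in the datum; all others
    are products of two small quantities. *)
Let a' := 4 * kap * a + 2 * (N * ((gam + b) * (a * D)) + 28 * mu * ((N * d) * (N * d))).
Let b' := b1 * (2 * N * D * (gam + b1) + 4 * kap + 6 * (N * N) * (b1 * D)).

Lemma csum_assoc (f g : nat -> C) (M : nat -> nat -> C) : csum n (fun i => f i * csum n (fun k => M i k * g k))%C = csum n (fun k => csum n (fun i => f i * M i k) * g k)%C.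
Proof.
 rewrite (csum_ext n _ (fun i => csum n (fun k => f i * M i k * g k))%C). rewrite csum_swap.
 - apply csum_ext. intros k _. rewrite csum_scal_r. easy.
 - intros i _. rewrite <- csum_scal. apply csum_ext. intros; ring.
Qed.
Lemma csum_assoc_r (f g : nat -> C) (M : nat -> nat -> C) : csum n (fun k => csum n (fun i => f i * M i k) * g k)%C = csum n (fun i => f i * csum n (fun k => M i k * g k))%C.
Proof. symmetry. apply csum_assoc. Qed.

(** With the new Jacobian MM(gx) (Id + D xi) and its inverse, the new defect is B applied to (Id + D
    xi) v - v + Gt(gx) + g, where (Id + D xi) v - v = avg Gt - Gt. Hence [Gt] cancels up to a
    displacement by [xi], and the average of [Gt], taken at angle zero, is added to the shift g. *)
Lemma step : exists x' : st, good S3 c hh a' b' (gam + b1) (u + d + N * (b1 * D)) (vb + (b1 * D * dl + 3 * vb * N * (b1 * D))) (w + 10 * (N * (b1 * D))) x' /\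
 (forall z i, Dm n S3 c hh z -> (i < n)%nat -> Cmod (sU x' i z - U i z) <= d + N * (b1 * D) /\ Cmod (sV x' i z - V i z) <= b1 * D * dl + 3 * vb * N * (b1 * D) /\ Cmod (sg x' i z - sg x i z) <= b1).
Proof.
 destruct step_B as (B & HB & HBb & HB1 & HB2).
 set (V' := fun i z => (xi i z + V i (gx z))%C).
 set (W' := fun i j z => csum n (fun k => B i k z * W k j (gx z))%C).
 set (U' := fun i z => U1 i (gx z)).
 set (s' := fun z => (sS x (gx z) + sig (gx z))%C).
 set (g' := fun i z => (sg x i z + avg v L (Gt i) (base n z))%C).
 assert (HS3 : 0 < S3) by (unfold S3; lra).
 assert (KV : forall i, (i < n)%nat -> KF n S c hh (V i)) by apply HG.
 assert (KV' : forall i, (i < n)%nat -> KF n S3 c hh (V' i)).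
 { intros i Hi. apply KF_plus; [apply (KF_sub n (S - dl) c hh); auto|apply Hcomp; auto]. }
 assert (KU' : forall i, (i < n)%nat -> KF n S3 c hh (U' i)) by (intros i Hi; apply (Hcomp (U1 i)); auto).
 assert (KW' : forall i j, (i < n)%nat -> (j < n)%nat -> KF n S3 c hh (W' i j)).
 { intros i j Hi Hj. apply (KF_csum n S3 c hh n (fun k z => B i k z * W k j (gx z))%C). intros k Hk. apply KF_mult; [auto|apply (Hcomp (W k j)); apply HG; easy]. }
 assert (EM : forall z i j, Dm n S3 c hh z -> (i < n)%nat -> (j < n)%nat -> MM V' i j z = csum n (fun k => MM V i k (gx z) * (kd k j + pd (2 * n) j (xi k) z))%C).
 { intros z i j Hz Hi Hj. unfold MM at 1, V'.
  rewrite (pd_plus (2 * n) (Dm n S3 c hh)); [| |apply (Hcomp (V i)); auto|easy|lia]. 2:{ apply (An_sub _ (Dm n (S - dl) c hh)); [auto|apply Hxi; easy]. }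
  rewrite (proj2 (Hcomp (V i) (KV i Hi)) z j Hz Hj). unfold MM.
  rewrite (csum_ext n (fun k => (kd i k + pd (2 * n) k (V i) (gx z)) * (kd k j + pd (2 * n) j (xi k) z))%C (fun k => kd i k * (kd k j + pd (2 * n) j (xi k) z) + pd (2 * n) k (V i) (gx z) * (kd k j + pd (2 * n) j (xi k) z))%C) by (intros; ring).
  rewrite csum_plus, csum_kd_l by easy. ring. }
 assert (ETh : forall z, Th n U' V' z = Th n U1 V (gx z)).
 { intros z. ext i. unfold Th. destruct (Nat.ltb_spec i n); [easy|]. destruct (Nat.ltb_spec i (2 * n)).
  - unfold V', gx, thadd. cmp; ring.
  - rewrite gx_om by lia. easy. }
 assert (EEE : forall z, EE U' V' z = EE U1 V (gx z)).
 { intros z. unfold EE. rewrite ETh. f_equal. apply csum_ext. intros i Hi. rewrite gx_om by lia. easy. }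
 assert (EX : forall z k, XX U' V' k z = XX U1 V k (gx z)).
 { intros z k. unfold XX. rewrite ETh. rewrite gx_om by lia. easy. }
 assert (dUb : forall z i, Dm n S3 c hh z -> (i < n)%nat -> Cmod (U' i z - U i z) <= d + N * (b1 * D)).
 { intros z i Hz Hi. via (Cmod_sub_tri _ (U1 i z)). rewrite Rplus_comm. apply Rplus_le_compat; [apply step_dU; auto|].
  assert (H := Hlip (U1 i) (/ 4) z ltac:(apply (KF_sub n S c hh); auto) ltac:(intros; apply HU1b; easy) Hz). fold (U' i z) in H. nra. }
 assert (dVb : forall z i, Dm n S3 c hh z -> (i < n)%nat -> Cmod (V' i z - V i z) <= b1 * D * dl + 3 * vb * N * (b1 * D)).
 { intros z i Hz Hi. unfold V'. replace (xi i z + V i (gx z) - V i z)%C with (xi i z + (V i (gx z) - V i z))%C by ring. via Cmod_triangle.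
  apply Rplus_le_compat; [auto|]. apply Hlip; [apply (KF_sub n S c hh); auto| |easy]. intros; apply (gVb _ _ _ _ _ _ _ _ _ _ HG); auto. }
 assert (dgb : forall z i, Dm n S3 c hh z -> (i < n)%nat -> Cmod (g' i z - sg x i z) <= b1).
 { intros z i Hz Hi. unfold g'. replace (sg x i z + avg v L (Gt i) (base n z) - sg x i z)%C with (avg v L (Gt i) (base n z)) by ring. apply (Hxs i Hi). apply HD31, Dm_base; easy. }
 assert (Havb : forall i z, (i < n)%nat -> Dm n (S - dl) c hh z -> Cmod (avg v L (Gt i) z) <= b1) by (intros i z Hi Hz; apply (Hxs i Hi); easy).
 assert (BWb : forall z i j, Dm n S3 c hh z -> (i < n)%nat -> (j < n)%nat -> Cmod (B i j z) <= 2).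
 { intros z i j Hz Hi Hj. assert (H := HBb i j z Hi Hj Hz). generalize (Cmod_le_add (B i j z) (kd i j)) (Cmod_kd i j). lra. }
 exists (mkst s' U' V' W' g'). split.
 { constructor; cbn [sS sU sV sW sg].
  - apply KF_plus; [apply (Hcomp (sS x)), HG|apply (Hcomp sig), Hsig].
  - easy.
  - easy.
  - easy.
  - intros i Hi. apply KF_plus; [apply (KF_sub n S c hh); [auto|apply HG; easy]|]. apply (KF_base n S3 c hh (avg v L (Gt i)) HS3). apply (KF_sub n (S - dl) c hh); [auto|apply (Hxs i Hi)].
  - intros i z Hi. unfold g'. rewrite base_base, (gbase _ _ _ _ _ _ _ _ _ _ HG) by easy. easy.
  - intros z j Hz Hj.
   change (pd (2 * n) j s' z) with (pd (2 * n) j (fun z => sS x (gx z) + sig (gx z))%C z).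
   rewrite (pd_plus (2 * n) (Dm n S3 c hh)); [|apply (Hcomp (sS x)), HG|apply (Hcomp sig), Hsig|easy|lia].
   rewrite (proj2 (Hcomp (sS x) (gS _ _ _ _ _ _ _ _ _ _ HG)) z j Hz Hj), (proj2 (Hcomp sig Hsig) z j Hz Hj). rewrite <- csum_plus.
   (* Both sides are pull-backs by [gx] of one identity, MM^T U1 = MM^T U + grad sig, which holds
      because [sW] is inverse to [MM]. *)
   transitivity (csum n (fun i => MM V' i j z * U' i z)%C).
   { unfold MM. rewrite (csum_ext n (fun i => (kd i j + pd (2 * n) j (V' i) z) * U' i z)%C (fun i => kd j i * U' i z + pd (2 * n) j (V' i) z * U' i z)%C) by (intros; rewrite (kd_sym j); ring).
    rewrite csum_plus, csum_kd_l by easy. easy. }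
   rewrite (csum_ext n _ (fun i => U1 i (gx z) * csum n (fun k => MM V i k (gx z) * (kd k j + pd (2 * n) j (xi k) z)))%C) by (intros i Hi; rewrite EM by easy; unfold U'; ring).
   rewrite csum_assoc. apply csum_ext. intros k Hk.
   rewrite <- (giso _ _ _ _ _ _ _ _ _ _ HG (gx z) k (Hgx0 z Hz) Hk). fold U V.
   replace (csum n (fun i => U1 i (gx z) * MM V i k (gx z)))%C with (U k (gx z) + csum n (fun i => pd (2 * n) k (V i) (gx z) * U i (gx z)) + pd (2 * n) k sig (gx z))%C; [ring|].
   unfold U1, step_U1. rewrite (csum_ext n (fun i => (U i (gx z) + csum n (fun k0 => W k0 i (gx z) * pd (2 * n) k0 sig (gx z))) * MM V i k (gx z))%C
     (fun i => (kd k i * U i (gx z) + pd (2 * n) k (V i) (gx z) * U i (gx z)) + csum n (fun m => pd (2 * n) m sig (gx z) * W m i (gx z)) * MM V i k (gx z))%C).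
   2:{ intros i Hi. rewrite (csum_ext n (fun k0 => W k0 i (gx z) * pd (2 * n) k0 sig (gx z))%C (fun m => pd (2 * n) m sig (gx z) * W m i (gx z))%C) by (intros; ring). unfold MM. rewrite (kd_sym k). ring. }
   rewrite !csum_plus, csum_kd_l by easy. f_equal. rewrite csum_assoc_r.
   rewrite (csum_ext n _ (fun m => pd (2 * n) m sig (gx z) * kd m k)%C). rewrite csum_kd_r by easy. easy.
   intros m Hm. rewrite <- (gWM _ _ _ _ _ _ _ _ _ _ HG (gx z) m k (Hgx0 z Hz) Hm Hk). easy.
  - intros z i j Hz Hi Hj. unfold W'. rewrite csum_assoc_r.
   rewrite (csum_ext n _ (fun m => B i m z * (kd m j + pd (2 * n) j (xi m) z))%C); [auto|]. intros m Hm. f_equal.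
   rewrite (csum_ext n _ (fun k => W m k (gx z) * csum n (fun l => MM V k l (gx z) * (kd l j + pd (2 * n) j (xi l) z)))%C) by (intros k Hk; rewrite EM by easy; easy).
   rewrite csum_assoc. rewrite (csum_ext n _ (fun l => kd m l * (kd l j + pd (2 * n) j (xi l) z))%C); [apply csum_kd_l; easy|].
   intros l Hl. f_equal. apply (gWM _ _ _ _ _ _ _ _ _ _ HG (gx z) m l (Hgx0 z Hz) Hm Hl).
  - intros z i j Hz Hi Hj.
   rewrite (csum_ext n _ (fun k => csum n (fun l => MM V i l (gx z) * (kd l k + pd (2 * n) k (xi l) z)) * csum n (fun m => B k m z * W m j (gx z)))%C) by (intros k Hk; rewrite EM by easy; easy).
   rewrite csum_assoc_r. rewrite (csum_ext n _ (fun l => MM V i l (gx z) * W l j (gx z))%C); [apply (gMW _ _ _ _ _ _ _ _ _ _ HG (gx z)); auto|].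
   intros l Hl. f_equal. rewrite csum_assoc. rewrite (csum_ext n _ (fun m => kd l m * W m j (gx z))%C); [apply csum_kd_l; easy|]. intros m Hm. f_equal; auto.
  - intros z i Hz Hi. assert (H := dUb z i Hz Hi). assert (H2 := gUb _ _ _ _ _ _ _ _ _ _ HG z i (HD3 z Hz) Hi). fold U in H2. generalize (Cmod_le_add (U' i z) (U i z)). lra.
  - intros z i Hz Hi. assert (H := dVb z i Hz Hi). assert (H2 := gVb _ _ _ _ _ _ _ _ _ _ HG z i (HD3 z Hz) Hi). fold V in H2. generalize (Cmod_le_add (V' i z) (V i z)). lra.
  - intros z i j Hz Hi Hj. unfold W'.
   replace (csum n (fun k => B i k z * W k j (gx z)) - kd i j)%C with (csum n (fun k => (B i k z - kd i k) * W k j (gx z)) + (W i j (gx z) - W i j z) + (W i j z - kd i j))%C.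
   2:{ rewrite (csum_ext n (fun k => (B i k z - kd i k) * W k j (gx z))%C (fun k => B i k z * W k j (gx z) - kd i k * W k j (gx z))%C) by (intros; ring). rewrite csum_minus, csum_kd_l by easy. ring. }
   assert (t1 : Cmod (csum n (fun k => (B i k z - kd i k) * W k j (gx z)))%C <= N * (2 * (b1 * D) * 2)).
   { apply csum_norm_le. intros k Hk. rewrite Cmod_mult. apply Rmult_le_compat; try apply Cmod_ge_0; [auto|auto]. }
   assert (t2 : Cmod (W i j (gx z) - W i j z) <= 3 * 2 * N * (b1 * D)).
   { apply Hlip; [apply (KF_sub n S c hh); [auto|apply HG; easy]|auto|easy]. }
   assert (t3 := gWb _ _ _ _ _ _ _ _ _ _ HG z i j (HD3 z Hz) Hi Hj). fold W in t3.
   via Cmod_triangle. assert (t4 := Cmod_triangle (csum n (fun k => (B i k z - kd i k) * W k j (gx z)))%C (W i j (gx z) - W i j z)). lra.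
  - intros z z' Hz Hz' Ht. rewrite !EEE. apply step_osc; auto. intros i Hi. rewrite !gx_om by easy. auto.
  - intros z i Hz Hi.
   (* The cohomological equation for [xi] in matrix form. Here [Gt m z] carries a minus sign and
      meets [Gt m (gx z)] in [Eg]. *)
   assert (Hsol : forall m, (m < n)%nat -> csum n (fun l => (kd m l + pd (2 * n) l (xi m) z) * RtoC (v l))%C = (RtoC (v m) + avg v L (Gt m) z - Gt m z)%C).
   { intros m Hm. rewrite (csum_ext n _ (fun l => kd m l * RtoC (v l) + pd (2 * n) l (xi m) z * RtoC (v l))%C) by (intros; ring). rewrite csum_plus, (csum_kd_l n m (fun l => RtoC (v l))) by easy.
    unfold xi. rewrite (proj2 (proj2 (proj2 (proj2 (Hxs m Hm)))) z (HD31 z Hz)). ring. }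
   assert (Eg : GG U' V' W' i z = csum n (fun m => B i m z * ((avg v L (Gt m) z - Gt m z) + sg x m z + Gt m (gx z)))%C).
   { unfold GG, W'. rewrite csum_assoc_r.
    rewrite (csum_ext n (fun m => B i m z * csum n (fun k => W m k (gx z) * XX U' V' k z))%C (fun m => B i m z * (RtoC (v m) - (Gt m (gx z) + sg x m z)))%C).
    2:{ intros m Hm. unfold Gt, GG. rewrite <- (gbase _ _ _ _ _ _ _ _ _ _ HG m (gx z)), gx_base, (gbase _ _ _ _ _ _ _ _ _ _ HG m z) by easy.
      rewrite (csum_ext n (fun k => W m k (gx z) * XX U' V' k z)%C (fun k => W m k (gx z) * XX U1 V k (gx z))%C) by congruence. ring. }
    replace (RtoC (v i)) with (csum n (fun m => B i m z * csum n (fun l => (kd m l + pd (2 * n) l (xi m) z) * RtoC (v l)))%C).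
    2:{ rewrite csum_assoc. rewrite (csum_ext n _ (fun l => kd i l * RtoC (v l))%C); [apply (csum_kd_l n i (fun l => RtoC (v l))); easy|]. intros l Hl. f_equal; auto. }
    rewrite <- csum_minus. apply csum_ext. intros m Hm. rewrite Hsol by easy. ring. }
   (* The three groups are a product of D xi with the remaining shift, an ergodization error, and
      the displacement of [Gt] by [xi]; in this order they give the three terms of [b']. *)
   replace (GG U' V' W' i z - g' i z)%C with (csum n (fun m => (B i m z - kd i m) * (avg v L (Gt m) z + sg x m z)) + (avg v L (Gt i) z - avg v L (Gt i) (base n z)) + csum n (fun m => B i m z * (Gt m (gx z) - Gt m z)))%C.
   2:{ rewrite Eg. unfold g'.
     rewrite (csum_ext n (fun m => B i m z * ((avg v L (Gt m) z - Gt m z) + sg x m z + Gt m (gx z)))%C (fun m => (B i m z * (Gt m (gx z) - Gt m z) + (B i m z - kd i m) * (avg v L (Gt m) z + sg x m z)) + kd i m * (avg v L (Gt m) z + sg x m z))%C) by (intros; ring).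
     rewrite !csum_plus, (csum_kd_l n i (fun m => (avg v L (Gt m) z + sg x m z)%C)) by easy. ring. }
   assert (t1 : Cmod (csum n (fun m => (B i m z - kd i m) * (avg v L (Gt m) z + sg x m z)))%C <= N * (2 * (b1 * D) * (gam + b1))).
   { apply csum_norm_le. intros m Hm. rewrite Cmod_mult. apply Rmult_le_compat; try apply Cmod_ge_0; [auto|]. via Cmod_triangle.
    assert (h1 := Havb m z Hm (HD31 z Hz)). assert (h2 := ggb _ _ _ _ _ _ _ _ _ _ HG z m (HD3 z Hz) Hm). lra. }
   assert (t2 : Cmod (avg v L (Gt i) z - avg v L (Gt i) (base n z)) <= 4 * kap * b1).
   { apply (KF_ergod n v kap Hn Hv0 Hkap Psi Q (S - dl) c hh (Gt i) b1); auto.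
    - fold dl. lra.
    - fold dl. apply (Dm_le n _ S3); [unfold S3; lra|easy].
    - fold dl. apply (Dm_le n _ S3); [unfold S3; lra|apply Dm_base; easy].
    - intros k Hk. rewrite base_tail; easy. }
   assert (t3 : Cmod (csum n (fun m => B i m z * (Gt m (gx z) - Gt m z)))%C <= N * (2 * (3 * b1 * N * (b1 * D)))).
   { apply csum_norm_le. intros m Hm. rewrite Cmod_mult. apply Rmult_le_compat; try apply Cmod_ge_0; [auto|]. auto. }
   via Cmod_triangle. eapply Rle_trans; [apply Rplus_le_compat_r, Cmod_triangle|]. unfold b'.
    lra.
  - intros z i Hz Hi. assert (H := dgb z i Hz Hi). assert (H2 := ggb _ _ _ _ _ _ _ _ _ _ HG z i (HD3 z Hz) Hi). generalize (Cmod_le_add (g' i z) (sg x i z)). lra. }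
 auto.
Qed.
End Step.

(** * Convergence of the iteration *)

Lemma good_weak n v P S c hh a b gam u vb w x S' c' hh' a' b' gam' u' vb' w' : good n v P S c hh a b gam u vb w x ->
 (forall z, Dm n S' c' hh' z -> Dm n S c hh z) -> a <= a' -> b <= b' -> u <= u' -> vb <= vb' -> w <= w' ->
 (forall z i, Dm n S' c' hh' z -> (i < n)%nat -> Cmod (sg x i z) <= gam') -> good n v P S' c' hh' a' b' gam' u' vb' w' x.
Proof.
 intros G HD Ha Hb Hu Hv Hw Hg. destruct G. constructor; try easy; intros; try (eapply KF_sub; [auto|auto]); try (eapply Rle_trans; [eauto|easy]); eauto.
Qed.

Definition cv (n : nat) (c : nat -> R) : vec := fun i => if Nat.ltb i n then RtoC 0 else RtoC (c (i - n)%nat).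
Lemma cv_om n c i : cv n c (n + i)%nat = RtoC (c i).
Proof. unfold cv. destruct (Nat.ltb_spec (n + i) n); [lia|]. intuition. Qed.
Lemma cv_real n c : realv n (cv n c).
Proof. intros i _. unfold cv. cmp; easy. Qed.
Lemma cv_Dm n S c c' hh : 0 < S -> (forall i, (i < n)%nat -> Rabs (c i - c' i) < hh) -> Dm n S c' hh (cv n c).
Proof.
  split; intros i Hi.
 - unfold cv. destruct (Nat.ltb_spec i n); [simpl; rewrite Rabs_R0; easy|lia].
 - rewrite cv_om, <- RtoC_minus, Cmod_R. auto.
Qed.

(** A Cauchy estimate in the frequencies. Points of the new ball lie within 3/8 of the old radius
    from the old centre, which leaves a radius [hh / 2] around each of them; two of them are less
    than [hh / 4] apart. *)
Lemma base_lip n S c hh c' f M : KF n S c hh f -> (forall z, f (base n z) = f z) -> (forall z, Dm n S c hh z -> Cmod (f z) <= M) -> 0 < S -> 0 < hh ->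
 (forall i, (i < n)%nat -> Rabs (c' i - c i) <= hh / 4) -> forall z z', Dm n S c' (hh / 8) z -> Dm n S c' (hh / 8) z' ->
 Cmod (f z' - f z) <= 6 * M / hh * rsum n (fun k => Cmod (z' (n + k)%nat - z (n + k)%nat)).
Proof.
 intros HF Hb HM HS Hh Hc z z' Hz Hz'.
 assert (Hcc : forall y, Dm n S c' (hh / 8) y -> forall i, (i < n)%nat -> Cmod (y (n + i)%nat - RtoC (c i)) < hh / 2).
 { intros y Hy i Hi. generalize (proj2 Hy i Hi) (Hc i Hi) (Cmod_sub_tri (y (n + i)%nat) (RtoC (c' i)) (RtoC (c i))). rewrite <- (RtoC_minus (c' i)), Cmod_R. lra. }
 assert (HDz : Dm n S c hh (base n z)).
 { apply Dm_base; [easy|]. split; [apply Hz|]. intros i Hi. generalize (Hcc z Hz i Hi). lra. }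
 destruct (block_taylor (2 * n) n n (Dm n S c hh) f (base n z) (hh / 2) M) with (w := fun k => z' (n + k)%nat) as [H _]; try easy; try lia; try lra.
 - apply HF.
 - intros w Hw. assert (D : Dm n S c hh (blockv n n (base n z) w)).
  { split; intros i Hi; unfold blockv.
   - destruct (Nat.leb_spec n i); [lia|]. apply HDz; easy.
   - destruct (Nat.leb_spec n (n + i)); [|lia]. destruct (Nat.ltb_spec (n + i) (n + n)); [|lia]. simpl. replace (n + i - n)%nat with i by lia.
    specialize (Hw i Hi). cbv beta in Hw. rewrite base_tail in Hw by lia. generalize (Hcc z Hz i Hi) (Cmod_sub_tri (w i) (z (n + i)%nat) (RtoC (c i))). lra. }
  auto.
 - intros i Hi. rewrite base_tail by lia. generalize (proj2 Hz i Hi) (proj2 Hz' i Hi) (Cmod_sub_tri (z' (n + i)%nat) (RtoC (c' i)) (z (n + i)%nat)).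
  rewrite (Cmod_sub_sym (RtoC (c' i))). lra.
 - rewrite (rsum_ext n _ (fun k => Cmod (z' (n + k)%nat - z (n + k)%nat))) in H by (intros; rewrite base_tail by lia; easy).
  replace (f (blockv n n (base n z) (fun k => z' (n + k)%nat))) with (f z') in H.
  + rewrite Hb in H. replace (6 * M / hh) with (3 * M / (hh / 2)) by (field; lra). easy.
  + rewrite <- (Hb z'). symmetry. assert (D' : Dm n S c hh (base n z')).
   { apply Dm_base; [easy|]. split; [apply Hz'|]. intros i Hi. generalize (Hcc z' Hz' i Hi). lra. }
   destruct (proj1 HF _ D') as [L0 HL0]. apply (is_grad_dep _ _ _ _ _ HL0). intros i Hi. unfold blockv, base.
   destruct (Nat.ltb_spec i n); destruct (Nat.leb_spec n i); try lia; simpl; [easy|]. destruct (Nat.ltb_spec i (n + n)); [|lia]. f_equal; lia.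
Qed.

(** * Numerical estimates for one iteration step *)

Section Arith.
Variables (N mu h D p X Y : R).
Hypothesis HN : 1 <= N.
Hypothesis Hmu : 0 <= mu.
Hypothesis Hh : 0 < h.
Hypothesis HD : 0 < D.
Hypothesis Hp : 0 < p <= 1.
Hypothesis EX : X = mu * D * p.
Hypothesis EY : Y = h * D * p.
Hypothesis HX : N * N * N * X <= / 4096.
Hypothesis HY : N * Y <= / 4096.
Let a := 2 * mu * p ^ 6.
Let b := mu * p ^ 4.
Let b1 := b + 96 * (N * N * N) * mu * a * D.

Lemma ar_X : 0 <= X.
Proof. subst X. pos. Qed.
Lemma ar_Y : 0 <= Y.
Proof. subst Y. pos. Qed.
Lemma ar_NX : N * X <= / 4096 /\ N * N * X <= / 4096 /\ X <= / 4096.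
Proof.
 assert (H := ar_X). assert (h1 : X <= N * X) by nra. pos.
Qed.
Lemma ar_pow k : 0 < p ^ k <= 1.
Proof. split; [pos|]. rewrite <- (pow1 k). apply pow_incr. lra. Qed.
Lemma ar_b1 : 0 <= b1 <= 2 * mu * p ^ 4.
Proof.
 assert (HX0 := ar_X). assert (p4 := ar_pow 4). assert (E : b1 = mu * p ^ 4 * (1 + 192 * (N * N * N * X) * p)) by (unfold b1, a, b; rewrite EX; ring).
 rewrite E. assert (h0 : 0 <= mu * p ^ 4) by pos. assert (h1 : 0 <= N * N * N * X) by pos.
 assert (h2 : 0 <= N * N * N * X * p <= / 4096) by nra. pos.
Qed.
Lemma ar_b1D : 0 <= b1 * D <= 2 * X * p ^ 3.
Proof.
 assert (H := ar_b1). pos.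
Qed.
Lemma ar_Nb1D : N * (b1 * D) <= 2 * (N * X) * p ^ 3 /\ N * (b1 * D) <= / 4.
Proof.
 assert (H := ar_b1D). assert (p3 := ar_pow 3). assert (HX0 := ar_X). destruct ar_NX as (g1 & _). pos.
Qed.
Lemma ar_d : 0 <= 2 * N * a * D <= 4 * (N * X) * p ^ 3 /\ 2 * N * a * D < / 8.
Proof.
 assert (p3 := ar_pow 3). assert (p2 := ar_pow 2). assert (HX0 := ar_X). destruct ar_NX as (g1 & _). assert (h0 : 0 <= N * X) by pos.
 replace (2 * N * a * D) with (4 * (N * X) * p ^ 3 * p ^ 2) by (unfold a; rewrite EX; ring). assert (0 <= 4 * (N * X) * p ^ 3 <= 4 / 4096) by nra. pos.
Qed.
Lemma ar_a' : 4 * / 1024 * a + 2 * (N * ((2 * h * p ^ 3 + b) * (a * D)) + 28 * mu * ((N * (2 * N * a * D)) * (N * (2 * N * a * D)))) <= 2 * mu * (p / 2) ^ 6.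
Proof.
 assert (HX0 := ar_X). assert (HY0 := ar_Y). destruct ar_NX as (g1 & g2 & g3). assert (h0 : 0 <= N * X) by pos. assert (h1 : 0 <= N * N * X) by pos. assert (h2 : 0 <= N * Y) by pos.
 assert (p2 := ar_pow 2). assert (p3 := ar_pow 3). assert (p4 := ar_pow 4). assert (p6 := ar_pow 6).
 assert (ha : 0 <= a) by pos.
 replace (4 * / 1024 * a + 2 * (N * ((2 * h * p ^ 3 + b) * (a * D)) + 28 * mu * ((N * (2 * N * a * D)) * (N * (2 * N * a * D)))))
  with (a * (/ 256 + 4 * (N * Y) * p ^ 2 + 2 * (N * X) * p ^ 3 + 448 * ((N * N * X) * (N * N * X)) * p ^ 4)).
 2:{ rewrite EX, EY. unfold a, b. field. }
 replace (2 * mu * (p / 2) ^ 6) with (a * / 64) by (unfold a; field). apply Rmult_le_compat_l; [easy|].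
 assert (k1 : (N * Y) * p ^ 2 <= / 4096) by nra. assert (k2 : (N * X) * p ^ 3 <= / 4096) by nra.
 assert (k3 : 0 <= (N * N * X) * (N * N * X) <= / 4096 * / 4096) by pos. pos.
Qed.
(** As [b1] is at most twice [b], the bracket has to stay below 1/32 in order to gain 1/16 =
    (1/2)^4; ergodization takes 1/256 of this. *)
Lemma ar_b' : b1 * (2 * N * D * (2 * h * p ^ 3 + b1) + 4 * / 1024 + 6 * (N * N) * (b1 * D)) <= mu * (p / 2) ^ 4.
Proof.
 assert (HX0 := ar_X). assert (HY0 := ar_Y). destruct ar_NX as (g1 & g2 & g3). assert (h0 : 0 <= N * X) by pos. assert (h1 : 0 <= N * N * X) by pos. assert (h2 : 0 <= N * Y) by pos.
 assert (p2 := ar_pow 2). assert (p3 := ar_pow 3). assert (B1 := ar_b1). assert (B2 := ar_b1D). destruct ar_Nb1D as (B3 & _).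
 assert (B4 : N * N * (b1 * D) <= 2 * (N * N * X) * p ^ 3) by pos.
 assert (E : 2 * N * D * (2 * h * p ^ 3 + b1) = 4 * (N * Y) * p ^ 2 + 2 * (N * (b1 * D))) by pos. rewrite E.
 assert (k1 : (N * Y) * p ^ 2 <= / 4096) by nra. assert (k2 : (N * X) * p ^ 3 <= / 4096) by nra. assert (k3 : (N * N * X) * p ^ 3 <= / 4096) by nra.
 pos.
Qed.
End Arith.

Section Iter.
Variables (n : nat) (v : nat -> R) (h sP mu : R) (P : vec -> C).
Hypothesis Hn : (1 <= n)%nat.
Hypothesis Hv0 : forall i, (n <= i)%nat -> v i = 0.
Hypothesis Hmu : 0 <= mu.
Hypothesis Hh : 0 < h.
Hypothesis HP : PF n v h sP P.
Hypothesis HPb : forall z, DP n v h sP z -> Cmod (P z) <= mu.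
Variables (D0 e : R).
Hypothesis He : 0 < e.
Hypothesis HD0 : 0 < D0.
Let N := INR n.
Let t := mu * D0.
Hypothesis Ht : N * N * N * t <= / 4096.
Hypothesis Hq : N * (h * D0) <= / 4096.
Hypothesis Hmuh : 384 * N * mu <= h.

Let HN : 1 <= N.
Proof. apply (le_INR 1). easy. Qed.
Let Ht0 : 0 <= t.
Proof. pos. Qed.
Let HNt : 0 <= N * t <= / 4096.
Proof.
 revert HN Ht Ht0. generalize N t. intros N0 t0 h1 h2 h3. assert (1 <= N0 * N0) by nra. pos.
Qed.

(** Here p = 2^-j. A bound K (1 - p^3) grows by (7/8) K p^3 when p is halved, which for K = 7, 12,
    24, 5 covers the increments 6, 8, 20, 4 of U, V, W and of the centre. The Lipschitz constant
    grows by a multiple of p. It concerns g(omega) + omega because g starts as v - omega, so that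
    this sum is nearly constant. *)
Record Inv (p S : R) (c : nat -> R) (x : st) : Prop := mkInv {
 i_good : good n v P S c (h * p ^ 3) (2 * mu * p ^ 6) (mu * p ^ 4) (2 * h * p ^ 3) (7 * (N * t) * (1 - p ^ 3)) (12 * (N * t) * e * (1 - p ^ 3)) (24 * (N * t) * (1 - p ^ 3)) x;
 i_lip : forall z z' i, Dm n S c (h * p ^ 3) z -> Dm n S c (h * p ^ 3) z' -> (i < n)%nat ->
  Cmod ((sg x i z' + z' (n + i)%nat) - (sg x i z + z (n + i)%nat)) <= 24 * (mu / h) * (1 - p) * rsum n (fun k => Cmod (z' (n + k)%nat - z (n + k)%nat));
 i_c0 : forall i, (i < n)%nat -> Cmod (sg x i (cv n c)) <= 2 * mu * p ^ 3;
 i_cv : forall i, (i < n)%nat -> Rabs (c i - v i) <= 5 * mu * (1 - p ^ 3) }.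

Lemma Inv_om p S c x : 0 < p <= 1 -> Inv p S c x -> forall z, Dm n S c (h * p ^ 3) z -> forall i, (i < n)%nat -> Cmod (z (n + i)%nat - RtoC (v i)) < h.
Proof.
 intros Hp HI z Hz i Hi. generalize (proj2 Hz i Hi) (i_cv _ _ _ _ HI i Hi) (Cmod_sub_tri (z (n + i)%nat) (RtoC (c i)) (RtoC (v i))). rewrite <- (RtoC_minus (c i)), Cmod_R.
 assert (p3 := ar_pow p Hp 3). assert (5 * mu <= h). { pos. } nra.
Qed.

Lemma Inv_step p S c x Psi Q : 0 < p <= 1 -> Inv p S c x -> dioph n v Psi Q -> Psi * Q * p <= D0 -> S + e <= sP -> 3 * (Cerg n (/ 1024) / Q) < S -> Cerg n (/ 1024) / Q <= e ->
 exists c' x', Inv (p / 2) (S - 3 * (Cerg n (/ 1024) / Q)) c' x' /\ (forall i, (i < n)%nat -> Rabs (c' i - c i) <= 4 * mu * p ^ 3) /\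
  (forall z i, Dm n (S - 3 * (Cerg n (/ 1024) / Q)) c (h * p ^ 3) z -> (i < n)%nat -> Cmod (sU x' i z - sU x i z) <= 6 * (N * t) * p ^ 3 /\ Cmod (sV x' i z - sV x i z) <= 8 * (N * t) * e * p ^ 3).
Proof.
 intros Hp HI Hd HD HSe HdS Hde. set (dl := Cerg n (/ 1024) / Q) in *. set (D := Psi * Q) in *.
 assert (HDp : 0 < D) by (destruct Hd as (? & ? & _); unfold D; apply Rmult_lt_0_compat; easy).
 set (X := mu * D * p). set (Y := h * D * p).
 assert (HXt : X <= t). { unfold X, t. pos. }
 assert (HX : N * N * N * X <= / 4096). { eapply Rle_trans; [|apply Ht]. apply Rmult_le_compat_l; [|easy]. pos. }
 assert (HY : N * Y <= / 4096). { eapply Rle_trans; [|apply Hq]. apply Rmult_le_compat_l; [lra|]. unfold Y. pos. }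
 assert (X0 := ar_X N mu D p X Hmu HDp Hp eq_refl HX).
 assert (A1 := ar_b1 N mu D p X HN Hmu HDp Hp eq_refl HX). assert (A2 := ar_b1D N mu D p X HN Hmu HDp Hp eq_refl HX). assert (A3 := ar_Nb1D N mu D p X HN Hmu HDp Hp eq_refl HX).
 assert (A4 := ar_d N mu D p X HN Hmu HDp Hp eq_refl HX). assert (A5 := ar_a' N mu h D p X Y HN Hmu Hh HDp Hp eq_refl eq_refl HX HY). assert (A6 := ar_b' N mu h D p X Y HN Hmu Hh HDp Hp eq_refl eq_refl HX HY).
 assert (p3 := ar_pow p Hp 3). assert (p4 := ar_pow p Hp 4). assert (p6 := ar_pow p Hp 6).
 assert (HNX : N * X <= N * t) by pos.
 assert (G := i_good _ _ _ _ HI).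
 destruct (step n v h sP mu (/ 1024) P Hn Hv0 ltac:(lra) Hmu HP HPb S c _ _ _ _ _ _ _ x G Psi Q Hd) as (x' & G' & Hdif).
 { nra. } { nra. }
 { assert (0 <= 12 * (N * t) * (1 - p ^ 3) <= 1) by nra. nra. }
 { apply (Inv_om p S c x Hp HI). }
 { pos. } { lra. }
 { easy. } { easy. } { easy. }
 fold dl D N in G', Hdif. assert (Hdl0 : 0 < dl) by (unfold dl; destruct Hd as (_ & q0 & _); assert (C4 := Cerg_pos n (/1024)); apply Rdiv_lt_0_compat; lra).
 set (S3 := S - 3 * dl) in *. assert (HS3S : S3 <= S) by (unfold S3; lra).
 set (b1 := mu * p ^ 4 + 96 * (N * N * N) * mu * (2 * mu * p ^ 6) * D) in *.
 set (d := 2 * N * (2 * mu * p ^ 6) * D) in *.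
 assert (HS3 : 0 < S3) by (unfold S3; lra).
 assert (Hhp : 0 < h * p ^ 3) by pos.
 assert (Hb1' : b1 <= 2 * mu * p ^ 3). { nra. }
 assert (Hm4 : 384 * mu <= h). { assert (mu <= N * mu) by nra. lra. }
 assert (HcvD : Dm n S3 c (h * p ^ 3) (cv n c)) by (apply cv_Dm; [easy|intros; rewrite Rminus_diag, Rabs_R0; easy]).
 (* One fixed-point step for omega = omega + g(omega). The right-hand side has a Lipschitz constant
    which, summed over the entries, is at most 1/16 ([Hl16]), so the bound 4 mu p^3 at the old
    centre becomes 2 mu (p / 2)^3 at the new one. *)
 set (c' := fun i => c i + fst (sg x' i (cv n c))).
 assert (Ec' : forall i, (i < n)%nat -> RtoC (c' i) = (RtoC (c i) + sg x' i (cv n c))%C).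
 { intros i Hi. unfold c'. rewrite RtoC_plus. assert (R0 := proj2 (proj2 (gg _ _ _ _ _ _ _ _ _ _ _ _ _ G' i Hi)) (cv n c) HcvD (cv_real n c)).
  destruct (sg x' i (cv n c)) as [q0 q1]. simpl in R0. rewrite R0. easy. }
 assert (Hsc : forall i, (i < n)%nat -> Cmod (sg x' i (cv n c)) <= 4 * mu * p ^ 3).
 { intros i Hi. destruct (Hdif (cv n c) i HcvD Hi) as (_ & _ & H). assert (H2 := i_c0 _ _ _ _ HI i Hi). generalize (Cmod_le_add (sg x' i (cv n c)) (sg x i (cv n c))). lra. }
 assert (Hcc : forall i, (i < n)%nat -> Rabs (c' i - c i) <= 4 * mu * p ^ 3).
 { intros i Hi. rewrite <- Cmod_R, RtoC_minus, Ec' by easy. replace (RtoC (c i) + sg x' i (cv n c) - RtoC (c i))%C with (sg x' i (cv n c)) by ring. auto. }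
 assert (Eh : h * (p / 2) ^ 3 = h * p ^ 3 / 8) by field.
 assert (Hcch : forall i, (i < n)%nat -> Rabs (c' i - c i) < h * p ^ 3 / 8).
 { intros i Hi. eapply Rle_lt_trans; [apply Hcc; easy|]. nra. }
 assert (HD' : forall z, Dm n S3 c' (h * (p / 2) ^ 3) z -> Dm n S3 c (h * p ^ 3) z).
 { intros z Hz. split; [apply Hz|]. intros i Hi. generalize (proj2 Hz i Hi) (Hcch i Hi) (Cmod_sub_tri (z (n + i)%nat) (RtoC (c' i)) (RtoC (c i))). rewrite <- (RtoC_minus (c' i)), Cmod_R. lra. }
 assert (Hlip : forall z z' i, Dm n S3 c' (h * (p / 2) ^ 3) z -> Dm n S3 c' (h * (p / 2) ^ 3) z' -> (i < n)%nat ->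
  Cmod ((sg x' i z' + z' (n + i)%nat) - (sg x' i z + z (n + i)%nat)) <= 24 * (mu / h) * (1 - p / 2) * rsum n (fun k => Cmod (z' (n + k)%nat - z (n + k)%nat))).
 { intros z z' i Hz Hz' Hi.
  assert (L1 := i_lip _ _ _ _ HI z z' i (Dm_le n S S3 c _ z HS3S (HD' z Hz)) (Dm_le n S S3 c _ z' HS3S (HD' z' Hz')) Hi).
  assert (L2 := base_lip n S3 c (h * p ^ 3) c' (fun z => sg x' i z - sg x i z)%C b1).
  assert (L3 : Cmod ((sg x' i z' - sg x i z') - (sg x' i z - sg x i z)) <= 6 * b1 / (h * p ^ 3) * rsum n (fun k => Cmod (z' (n + k)%nat - z (n + k)%nat))).
  { apply L2; try easy.
   - apply KF_minus; [apply G'; easy|]. apply (KF_sub n S c (h * p ^ 3)); [intros y Hy; apply (Dm_le n S S3); easy|]. apply G; easy.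
   - intros y. rewrite (gbase _ _ _ _ _ _ _ _ _ _ _ _ _ G'), (gbase _ _ _ _ _ _ _ _ _ _ _ _ _ G) by easy. easy.
   - intros y Hy. apply (Hdif y i Hy Hi).
   - intros k Hk. specialize (Hcch k Hk). lra.
   - congruence.
   - congruence. }
  set (sm := rsum n (fun k => Cmod (z' (n + k)%nat - z (n + k)%nat))) in *. assert (Hsm : 0 <= sm) by (apply rsum_pos; intros; apply Cmod_ge_0).
  replace (sg x' i z' + z' (n + i)%nat - (sg x' i z + z (n + i)%nat))%C with ((sg x i z' + z' (n + i)%nat - (sg x i z + z (n + i)%nat)) + (sg x' i z' - sg x i z' - (sg x' i z - sg x i z)))%C by ring.
  via Cmod_triangle. eapply Rle_trans; [apply Rplus_le_compat; [apply L1|apply L3]|]. rewrite <- Rmult_plus_distr_r. apply Rmult_le_compat_r; [easy|].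
  replace (24 * (mu / h) * (1 - p / 2)) with (24 * (mu / h) * (1 - p) + 6 * (2 * mu * p ^ 4) / (h * p ^ 3)) by (field; lra). apply Rplus_le_compat_l.
   apply Rmult_le_compat_r; [pos|]. lra. }
 assert (Hl16 : N * (24 * (mu / h) * (1 - p / 2)) <= / 16).
 { assert (N * (mu / h) <= / 384). { apply (Rmult_le_reg_r h); [easy|]. unfold Rdiv. rewrite <- Rmult_assoc, Rmult_assoc, Rinv_l by lra. lra. }
  nra. }
 assert (Hl0 : 0 <= 24 * (mu / h) * (1 - p / 2)) by pos.
 set (l := 24 * (mu / h) * (1 - p / 2)) in *.
 assert (HcvD' : Dm n S3 c' (h * (p / 2) ^ 3) (cv n c')) by (apply cv_Dm; [easy|intros; rewrite Rminus_diag, Rabs_R0, Eh; lra]).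
 assert (HcvD'' : Dm n S3 c' (h * (p / 2) ^ 3) (cv n c)) by (apply cv_Dm; [easy|intros; rewrite Rabs_minus_sym, Eh; auto]).
 assert (Hc0 : forall i, (i < n)%nat -> Cmod (sg x' i (cv n c')) <= 2 * mu * (p / 2) ^ 3).
 { intros i Hi. assert (H := Hlip (cv n c) (cv n c') i HcvD'' HcvD' Hi). rewrite !cv_om, Ec' in H by easy.
  replace (sg x' i (cv n c') + (RtoC (c i) + sg x' i (cv n c)) - (sg x' i (cv n c) + RtoC (c i)))%C with (sg x' i (cv n c')) in H by ring.
  via H. assert (Hs : rsum n (fun k => Cmod (cv n c' (n + k)%nat - cv n c (n + k)%nat)) <= N * (4 * mu * p ^ 3)).
  { apply rsum_le_const. intros k Hk. rewrite !cv_om, <- RtoC_minus, Cmod_R. auto. }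
  eapply Rle_trans; [apply Rmult_le_compat_l; [easy|apply Hs]|]. replace (l * (N * (4 * mu * p ^ 3))) with (N * l * (4 * mu * p ^ 3)) by ring.
  replace (2 * mu * (p / 2) ^ 3) with (/ 16 * (4 * mu * p ^ 3)) by field. apply Rmult_le_compat_r; [|easy]. lra. }
 exists c', x'. split; [|split; [easy|]].
 - constructor.
  + apply (good_weak _ _ _ _ _ _ _ _ _ _ _ _ _ _ _ _ _ _ _ _ _ _ G'); [easy| | | | | |].
   * easy.
   * easy.
   * assert ((N * X) * p ^ 3 <= (N * t) * p ^ 3) by pos. lra.
   * destruct A3 as [A3 _].
    set (vb := 12 * (N * t) * e * (1 - p ^ 3)). assert (Hvb : 0 <= vb <= e). { assert (0 <= 12 * (N * t) * (1 - p ^ 3) <= 1) by nra. unfold vb. nra. }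
    assert (k1 : b1 * D * dl <= 2 * (N * t) * p ^ 3 * e). { apply Rmult_le_compat; try lra. via A2. apply Rmult_le_compat_r; [lra|]. assert (X <= N * t) by nra. lra. }
    assert (k2 : vb * (N * (b1 * D)) <= e * (2 * (N * t) * p ^ 3)). { apply Rmult_le_compat; try lra. apply Rmult_le_pos; lra. via A3. intuition. }
     unfold vb at 1. assert (0 <= (N * t) * e * p ^ 3) by pos. lra.
   * pos.
   (* On the new ball the shift is its value at the centre, plus the distance of omega from the
      centre, plus the Lipschitz part: at most 1/2, 1 and 1/16 of the radius, below the 2 that is
      allowed. *)
   * intros z i Hz Hi. assert (H := Hlip (cv n c') z i HcvD' Hz Hi). rewrite cv_om in H.
    assert (Hs : rsum n (fun k => Cmod (z (n + k)%nat - cv n c' (n + k)%nat)) <= N * (h * (p / 2) ^ 3)).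
    { apply rsum_le_const. intros k Hk. rewrite cv_om. left. apply Hz; easy. }
    assert (Hs2 : l * rsum n (fun k => Cmod (z (n + k)%nat - cv n c' (n + k)%nat)) <= / 16 * (h * (p / 2) ^ 3)).
    { eapply Rle_trans; [apply Rmult_le_compat_l; [easy|apply Hs]|]. rewrite <- Rmult_assoc, (Rmult_comm l). apply Rmult_le_compat_r; [lra|easy]. }
    assert (H3 := proj2 Hz i Hi). assert (H4 := Hc0 i Hi).
    replace (sg x' i z) with ((sg x' i z + z (n + i)%nat - (sg x' i (cv n c') + RtoC (c' i))) - (z (n + i)%nat - RtoC (c' i)) + sg x' i (cv n c'))%C by ring.
    via Cmod_triangle. eapply Rle_trans; [apply Rplus_le_compat_r, Cmod_sub_le|].
    assert (2 * mu * (p / 2) ^ 3 <= / 2 * (h * (p / 2) ^ 3)). { nra. }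
    lra.
  + easy.
  + easy.
  + intros i Hi. replace (c' i - v i) with ((c' i - c i) + (c i - v i)) by ring. via Rabs_triang. assert (h1 := Hcc i Hi). assert (h2 := i_cv _ _ _ _ HI i Hi).
    lra.
 - intros z i Hz Hi. destruct (Hdif z i Hz Hi) as (h1 & h2 & _). destruct A3 as [A3 _]. destruct A4 as [A4 _].
  assert (k0 : (N * X) * p ^ 3 <= (N * t) * p ^ 3) by intuition.
  set (vb := 12 * (N * t) * e * (1 - p ^ 3)) in *. assert (Hvb : 0 <= vb <= e). { assert (0 <= 12 * (N * t) * (1 - p ^ 3) <= 1) by nra. unfold vb. replace (12 * (N * t) * e * (1 - p ^ 3)) with (12 * (N * t) * (1 - p ^ 3) * e) by ring. nra. }
  assert (k1 : b1 * D * dl <= 2 * (N * t) * p ^ 3 * e). { apply Rmult_le_compat; try lra. via A2. apply Rmult_le_compat_r; [lra|]. assert (X <= N * t) by nra. lra. }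
  assert (k2 : vb * (N * (b1 * D)) <= e * (2 * (N * t) * p ^ 3)). { pos. }
  lra.
Qed.

Definition st0 : st := mkst (fun _ => RtoC 0) (fun _ _ => RtoC 0) (fun _ _ => RtoC 0) (fun i j _ => kd i j) (fun i z => RtoC (v i) - z (n + i)%nat)%C.

(** The iteration starts from the unperturbed torus, on which the energy oscillates by at most 2 mu.
    The shift v - omega absorbs the whole detuning, so the defect left over is a derivative of [P],
    at most mu by Cauchy on the unit ball of actions. *)
Lemma Inv_0 S : 0 < S -> S <= sP -> Inv 1 S v st0.
Proof.
 intros HS HSP.
 assert (HD : forall z, Dm n S v h z -> DP n v h sP (Th n (fun _ _ => RtoC 0) (fun _ _ => RtoC 0) z)).
 { intros z Hz. apply (Th_DP n v h sP S v h 0); try easy; [lra|intros y Hy; apply Hy| |]; intros; rewrite Cmod_0; lra. }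
 constructor.
 - rewrite !pow1, !Rmult_1_r. constructor; cbn [sS sU sV sW sg st0]; try (intros; apply (KF_const n S v h 0)); try (intros; apply KF_kd).
  + intros i Hi. apply KF_minus; [apply KF_const|apply KF_om; easy].
  + intros i z Hi. rewrite base_tail by lia. easy.
  + intros z j Hz Hj. rewrite pd_const by lia. rewrite csum_0; [ring|]. intros; ring.
  + intros z i j Hz Hi Hj. rewrite csum_kd_l by easy. unfold MM. rewrite pd_const by lia. ring.
  + intros z i j Hz Hi Hj. rewrite (csum_kd_r n j (fun k => MM n (fun _ _ => RtoC 0) i k z)) by easy. unfold MM. rewrite pd_const by lia. ring.
  + intros; rewrite Cmod_0; lra.
  + intros; rewrite Cmod_0; lra.
  + intros z i j _ _ _. replace (kd i j - kd i j)%C with (RtoC 0) by ring. rewrite Cmod_0; lra.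
  + intros z z' Hz Hz' Ht'. unfold EE. rewrite !(csum_0 n (fun i => _ * RtoC 0)%C) by (intros; ring).
   rewrite !Cplus_0_l. via Cmod_sub_le. assert (h1 := HPb _ (HD z Hz)). assert (h2 := HPb _ (HD z' Hz')). lra.
  + intros z i Hz Hi. unfold GG. rewrite csum_kd_l by easy. unfold XX.
   match goal with |- Cmod ?x <= _ => replace x with (- PI n P i (Th n (fun _ _ => RtoC 0) (fun _ _ => RtoC 0) z))%C by ring end.
   rewrite Cmod_opp. replace mu with (mu / 1) by field. apply (PI_bound n v h sP mu P HP HPb); [auto|lra| |easy]. intros k Hk. rewrite Th_I, Cmod_0 by easy. lra.
  + intros z i Hz Hi. rewrite Cmod_sub_sym. left. eapply Rlt_trans; [apply Hz; easy|lra].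
 - intros z z' i Hz Hz' Hi. cbn [sg st0]. match goal with |- Cmod ?x <= _ => replace x with (RtoC 0) by ring end. rewrite Cmod_0, Rminus_diag, Rmult_0_r, Rmult_0_l. lra.
 - intros i Hi. cbn [sg st0]. rewrite cv_om. replace (RtoC (v i) - RtoC (v i))%C with (RtoC 0) by ring. rewrite Cmod_0, pow1. lra.
 - intros i Hi. rewrite !Rminus_diag, Rabs_R0, pow1. lra.
Qed.
End Iter.

Lemma An_ccvg N D f (u : nat -> vec) z : An N D f -> D z -> (forall i, (i < N)%nat -> ccvg (fun m => u m i) (z i)) -> ccvg (fun m => f (u m)) (f z).
Proof.
 intros Hf Hz Hu. destruct (Hf z Hz) as [L HL]. destruct (is_grad_lip N f z L HL) as (rho & B & Hr & HB & Hl).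
 intros e He. set (d := Rmin rho (e / (INR N * B + 1))).
 assert (HNB : 0 <= INR N * B) by pos.
 assert (Hd : 0 < d) by pos.
 assert (Hm : exists m0, forall m, (m0 <= m)%nat -> near N z (u m) d).
 { unfold near. induction N as [|N IH]; [exists O; intros; lia|].
  destruct (Hu N (Nat.lt_succ_diag_r N) d Hd) as [m1 H1].
  assert (IH' : exists m0, forall m, (m0 <= m)%nat -> forall i, (i < N)%nat -> Cmod (u m i - z i) < d).
  { clear -Hu Hd. revert Hd. generalize d. clear d. intros d Hd. assert (Hu' : forall i, (i < N)%nat -> ccvg (fun m => u m i) (z i)) by auto. clear Hu. induction N as [|N IH]; [exists O; intros; lia|].
   destruct IH as [m0 H0]; [auto|]. destruct (Hu' N (Nat.lt_succ_diag_r N) d Hd) as [m1 H1]. exists (max m0 m1). intros m Hm i Hi.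
   destruct (Nat.eq_dec i N) as [->|]; [intuition|intuition]. }
  destruct IH' as [m0 H0]. exists (max m0 m1). intros m Hm i Hi. destruct (Nat.eq_dec i N) as [->|]; [intuition|intuition]. }
 destruct Hm as [m0 Hm]. exists m0. intros m Hm'. specialize (Hm m Hm').
 eapply Rle_lt_trans; [apply Hl; eapply near_le; [apply Rmin_l|eauto]|].
 assert (HV := vdist_near N z (u m) d Hd Hm).
 assert (d <= e / (INR N * B + 1)) by apply Rmin_r. apply Rle_lt_trans with ((INR N * B) * (e / (INR N * B + 1))).
 - pos.
 - apply (Rmult_lt_reg_r (INR N * B + 1)); [lra|]. unfold Rdiv. rewrite <- Rmult_assoc, Rmult_assoc, Rinv_l by lra. nra.
Qed.

Lemma ccvg_0 u K q : 0 <= q < 1 -> (forall m, Cmod (u m) <= K * q ^ m) -> ccvg u 0%C.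
Proof.
 intros Hq H e He. assert (HK : 0 <= K) by (specialize (H O); simpl in H; generalize (Cmod_ge_0 (u O)); lra).
 destruct (pow_lt_1_zero q) with (y := e / (K + 1)) as (m0 & Hm0). { rewrite Rabs_right; lra. } { pos. }
 exists m0. intros m Hm. replace (u m - 0)%C with (u m) by ring. specialize (Hm0 m Hm). rewrite Rabs_right in Hm0 by (apply Rle_ge, pow_le; lra).
 eapply Rle_lt_trans; [easy|]. apply (Rmult_lt_compat_r (K + 1)) in Hm0; [|lra].
 replace (e / (K + 1) * (K + 1)) with e in Hm0 by (field; lra). nra.
Qed.

Lemma ccvg_minus0 u l : ccvg u 0%C -> ccvg (fun m => l - u m)%C l.
Proof. intros H. assert (H1 := ccvg_minus _ _ _ _ (ccvg_const l) H). replace (l - 0)%C with l in H1 by ring. easy. Qed.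

Section Frz.
Variables (n : nat) (wt : nat -> R).
(** The balls of frequencies shrink to [wt], so the iterates converge at this frequency only.
    Freezing it keeps the limit in [KF], as a function constant in the frequency, and the calculus
    of [KF] remains available. *)
Definition frz (z : vec) : vec := fun i => if Nat.ltb i n then z i else RtoC (wt (i - n)%nat).
Lemma frz_frz z : frz (frz z) = frz z.
Proof. ext i. unfold frz. cmp; easy. Qed.
Lemma frz_om z i : frz z (n + i)%nat = RtoC (wt i).
Proof. unfold frz. destruct (Nat.ltb_spec (n + i) n); [lia|]. intuition. Qed.
Lemma frz_th z i : (i < n)%nat -> frz z i = z i.
Proof. intros H. unfold frz. cmp; easy. Qed.

Lemma KF_frz S c hh S' c' hh' f : KF n S c hh f -> (forall z, Dm n S' c' hh' z -> Dm n S c hh (frz z)) ->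
 KF n S' c' hh' (fun z => f (frz z)) /\ forall z j, Dm n S' c' hh' z -> (j < n)%nat -> pd (2 * n) j (fun z => f (frz z)) z = pd (2 * n) j f (frz z).
Proof.
 intros (F1 & F2 & F3) HD.
 assert (Hg : forall i, (i < 2 * n)%nat -> An (2 * n) (Dm n S' c' hh') (fun z => frz z i)).
 { intros i Hi. unfold frz. destruct (Nat.ltb_spec i n); [apply An_coord; lia|apply An_const]. }
 split; [split; [|split]|].
 - apply (An_comp (2 * n) (2 * n) (Dm n S c hh) (Dm n S' c' hh') f (fun i z => frz z i)); easy.
 - intros z Hz j Hj. rewrite <- (F2 (frz z)) with (j := j) by auto. f_equal. ext i. unfold frz, updv.
  cmp; easy.
 - intros z Hz Hr. apply F3; [auto|]. intros i Hi. unfold frz. cmp; auto.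
 - intros z j Hz Hj. assert (E := pd_comp (2 * n) (2 * n) (Dm n S c hh) (Dm n S' c' hh') f (fun i z => frz z i) j z F1 Hg HD Hz ltac:(lia)).
  etransitivity; [exact E|]. rewrite (csum_ext (2 * n) _ (fun i => if Nat.eqb i j then pd (2 * n) i f (frz z) else 0%C)); [apply csum_delta; lia|].
  intros i Hi. unfold frz at 2. destruct (Nat.ltb_spec i n).
  + rewrite pd_coord by lia. change (fun i0 => frz z i0) with (frz z). cmp; ring.
  + rewrite pd_const by lia. cmp; ring.
Qed.
End Frz.

(** The factor 1/8 is p^3 for p = 1/2. Geometric convergence is uniform, so the Cauchy estimate on a
    narrower strip carries it over to the angular derivatives. *)
Lemma KF_seq_lim n S c hh (F : nat -> vec -> C) K M : 0 <= K -> (forall m, KF n S c hh (F m)) -> (forall m z, Dm n S c hh z -> Cmod (F m z) <= M) ->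
 (forall m z, Dm n S c hh z -> Cmod (F (Datatypes.S m) z - F m z) <= K * (/ 8) ^ m) ->
 let f z := epsilon (inhabits (RtoC 0)) (fun l => ccvg (fun m => F m z) l) in
 KF n S c hh f /\ (forall z, Dm n S c hh z -> ccvg (fun m => F m z) (f z)) /\ (forall z, Dm n S c hh z -> Cmod (f z) <= M) /\
 (forall del z k, 0 < del -> Dm n (S - del) c hh z -> (k < n)%nat -> ccvg (fun m => pd (2 * n) k (F m) z) (pd (2 * n) k f z)).
Proof.
 intros HK HF HM HD f.
 assert (Hc : forall z, Dm n S c hh z -> ccvg (fun m => F m z) (f z) /\ forall m, Cmod (f z - F m z) <= K * (/ 8) ^ m / (1 - / 8)).
 { intros z Hz. destruct (geom_cvg (fun m => F m z) K (/ 8)) as (l & Hl & Hl2); [lra|auto|easy|].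
  assert (ccvg (fun m => F m z) (f z)) by (unfold f; apply epsilon_spec; exists l; easy).
  assert (E : f z = l) by (apply (ccvg_unique (fun m => F m z)); easy). rewrite E. easy. }
 assert (Hf : KF n S c hh f) by (apply (KF_lim n S c hh F f M); [easy|easy|intros; apply Hc; easy]).
 split; [easy|]. split; [intros; apply Hc; easy|]. split.
 - intros z Hz. apply (ccvg_le (fun m => F m z)); [apply Hc; easy|auto].
 - intros del z k Hdel Hz Hk. assert (Hz0 : Dm n S c hh z) by (apply (Dm_le n _ (S - del)); [lra|easy]).
  apply (ccvg_ext (fun m => (pd (2 * n) k f z - (pd (2 * n) k f z - pd (2 * n) k (F m) z))%C)); [intros; ring|].
  apply ccvg_minus0.
  apply (ccvg_0 _ (K / (1 - / 8) / del) (/ 8)); [lra|]. intros m. rewrite <- (pd_minus (2 * n) (Dm n S c hh)) by first [lia | apply Hf | apply HF | easy].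
  replace (K / (1 - / 8) / del * (/ 8) ^ m) with (K * (/ 8) ^ m / (1 - / 8) / del) by lra.
  apply (KF_cauchy n S c hh (fun z => f z - F m z)%C); [apply KF_minus; auto| |easy|easy|easy]. intros y Hy. apply Hc; easy.
Qed.

(** The form dI ^ d theta vanishes on the torus, because I d theta pulls back to the exact form ds:
    the second derivatives of [s] are symmetric, and those of [V], symmetric as well, drop out. *)
Lemma kf_isotropy n S c hh U V s z j k : KF n S c hh s -> (forall i, (i < n)%nat -> KF n S c hh (U i)) -> (forall i, (i < n)%nat -> KF n S c hh (V i)) ->
 (forall z j, Dm n S c hh z -> (j < n)%nat -> (U j z + csum n (fun i => pd (2 * n) j (V i) z * U i z))%C = pd (2 * n) j s z) ->
 Dm n S c hh z -> (j < n)%nat -> (k < n)%nat ->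
 csum n (fun l => MM n V l j z * pd (2 * n) k (U l) z)%C = csum n (fun l => MM n V l k z * pd (2 * n) j (U l) z)%C.
Proof.
 intros Hs HU HV Hi Hz Hj Hk.
 assert (HpV : forall i j, (i < n)%nat -> (j < n)%nat -> An (2 * n) (Dm n S c hh) (pd (2 * n) j (V i))) by (intros i j' Hi' Hj'; apply KF_pd; [auto|lia]).
 assert (D : forall j k, (j < n)%nat -> (k < n)%nat -> pd (2 * n) k (pd (2 * n) j s) z = (csum n (fun l => MM n V l j z * pd (2 * n) k (U l) z) + csum n (fun l => pd (2 * n) k (pd (2 * n) j (V l)) z * U l z))%C).
 { clear j k Hj Hk. intros j k Hj Hk. rewrite <- (pd_ext (2 * n) (Dm n S c hh) (fun z => (U j z + csum n (fun i => pd (2 * n) j (V i) z * U i z))%C)).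
  - rewrite (pd_plus (2 * n) (Dm n S c hh)); [|apply HU; easy| |easy|lia].
   2:{ apply (An_csum (2 * n) _ n (fun i z => pd (2 * n) j (V i) z * U i z)%C). intros i Hi'. apply An_mult; [auto|apply HU; easy]. }
   rewrite (pd_csum (2 * n) (Dm n S c hh) n (fun i z => pd (2 * n) j (V i) z * U i z)%C); [|intros i Hi'; apply An_mult; [auto|apply HU; easy]|easy|lia].
   rewrite (csum_ext n (fun i => pd (2 * n) k (fun z => pd (2 * n) j (V i) z * U i z)%C z) (fun i => pd (2 * n) k (pd (2 * n) j (V i)) z * U i z + pd (2 * n) j (V i) z * pd (2 * n) k (U i) z)%C).
   2:{ intros i Hi'. apply (pd_mult (2 * n) (Dm n S c hh)); [auto|apply HU; easy|easy|lia]. }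
   rewrite csum_plus. unfold MM. rewrite (csum_ext n (fun l => (kd l j + pd (2 * n) j (V l) z) * pd (2 * n) k (U l) z)%C (fun l => kd j l * pd (2 * n) k (U l) z + pd (2 * n) j (V l) z * pd (2 * n) k (U l) z)%C) by (intros l _; rewrite (kd_sym j); ring).
   rewrite csum_plus, (csum_kd_l n j (fun l => pd (2 * n) k (U l) z)) by easy. ring.
  - apply opn_Dm.
  - auto.
  - apply An_plus; [apply HU; easy|]. apply (An_csum (2 * n) _ n (fun i z => pd (2 * n) j (V i) z * U i z)%C). intros i Hi'. apply An_mult; [auto|apply HU; easy].
  - easy.
  - lia. }
 assert (E := pd_swap (2 * n) (Dm n S c hh) s j k z (opn_Dm n S c hh) (proj1 Hs) ltac:(lia) ltac:(lia) Hz).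
 rewrite (D j k), (D k j) in E by easy.
 rewrite (csum_ext n (fun l => pd (2 * n) k (pd (2 * n) j (V l)) z * U l z)%C (fun l => pd (2 * n) j (pd (2 * n) k (V l)) z * U l z)%C) in E.
 2:{ intros l Hl. f_equal. apply (pd_swap (2 * n) (Dm n S c hh)); [apply opn_Dm|apply HV; easy|lia|lia|easy]. }
 set (A1 := csum n (fun l => pd (2 * n) j (pd (2 * n) k (V l)) z * U l z)%C) in E. set (A2 := csum n (fun l => MM n V l j z * pd (2 * n) k (U l) z)%C) in *.
 replace A2 with (A2 + A1 - A1)%C by ring. rewrite E. ring.
Qed.

Lemma near_id_inj n (A : nat -> nat -> C) (y : nat -> C) eta : (forall l k, (l < n)%nat -> (k < n)%nat -> Cmod (A l k) <= eta) -> INR n * eta <= / 2 ->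
 (forall k, (k < n)%nat -> csum n (fun l => (kd l k + A l k) * y l)%C = 0%C) -> forall k, (k < n)%nat -> y k = 0%C.
Proof.
 intros HA He Hy.
 assert (H1 : forall k, (k < n)%nat -> Cmod (y k) <= eta * rsum n (fun l => Cmod (y l))).
 { intros k Hk. specialize (Hy k Hk). rewrite (csum_ext n _ (fun l => kd k l * y l + A l k * y l)%C) in Hy by (intros l _; rewrite (kd_sym k); ring).
  rewrite csum_plus, csum_kd_l in Hy by easy. replace (y k) with (- csum n (fun l => A l k * y l))%C.
  2:{ replace (y k) with (y k + csum n (fun l => A l k * y l) - csum n (fun l => A l k * y l))%C by ring. rewrite Hy. ring. }
  rewrite Cmod_opp. via csum_norm. rewrite <- rsum_scal. apply rsum_le. intros l Hl. rewrite Cmod_mult. apply Rmult_le_compat_r; [pos|auto]. }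
 set (s := rsum n (fun l => Cmod (y l))) in *. assert (Hs : 0 <= s) by (apply rsum_pos; intros; apply Cmod_ge_0).
 assert (H2 : s <= INR n * (eta * s)) by (apply rsum_le_const; easy). assert (s = 0) by nra.
 intros k Hk. apply Cmod_eq_0. assert (H3 := rsum_term_le n (fun l => Cmod (y l)) k ltac:(intros; apply Cmod_ge_0) Hk). fold s in H3. generalize (Cmod_ge_0 (y k)). lra.
Qed.

(** * The limit torus and its invariance *)

Section Lim.
Variables (n : nat) (v : nat -> R) (h sP mu : R) (P : vec -> C).
Hypothesis Hn : (1 <= n)%nat.
Hypothesis Hv0 : forall i, (n <= i)%nat -> v i = 0.
Hypothesis Hmu : 0 <= mu.
Hypothesis Hh : 0 < h.
Hypothesis HP : PF n v h sP P.
Hypothesis HPb : forall z, DP n v h sP z -> Cmod (P z) <= mu.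
Variables (D0 e : R).
Hypothesis He : 0 < e.
Hypothesis HD0 : 0 < D0.
Hypothesis Ht : INR n * INR n * INR n * (mu * D0) <= / 4096.
Hypothesis Hq : INR n * (h * D0) <= / 4096.
Hypothesis Hmuh : 384 * INR n * mu <= h.
Variables (Qs Ps : nat -> R) (S0 Sm : R).
Hypothesis Hdio : forall j, dioph n v (Ps j) (Qs j).
Hypothesis HDj : forall j, Ps j * Qs j * (/ 2) ^ j <= D0.
Let dl j := Cerg n (/ 1024) / Qs j.
Hypothesis Hdl : forall j, dl j <= e.
Hypothesis HSP : S0 + e <= sP.
Hypothesis HSm : forall J, Sm <= S0 - 3 * rsum J dl.
Hypothesis HSm0 : e < Sm.

Let N := INR n.
Let t := mu * D0.
Let pj (j : nat) := (/ 2) ^ j.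
Let Sj J := S0 - 3 * rsum J dl.
Let HN : 1 <= N.
Proof. apply (le_INR 1). easy. Qed.
Let Hpj j : 0 < pj j <= 1.
Proof. split; [pos|]. rewrite <- (pow1 j). apply pow_incr. lra. Qed.
Let Hpj8 j : pj j ^ 3 = (/ 8) ^ j.
Proof. unfold pj. rewrite <- pow_mult, Nat.mul_comm, pow_mult. f_equal. field. Qed.
Let Hdl0 j : 0 < dl j.
Proof. destruct (Hdio j) as (_ & q0 & _). assert (C4 := Cerg_pos n (/ 1024)). pos. Qed.
Let HSj J : Sm <= Sj J /\ Sj J <= S0.
Proof. split; [eauto|]. unfold Sj. assert (0 <= rsum J dl) by (apply rsum_pos; intros; left; auto). lra. Qed.
Let HmuN : 384 * mu <= h.
Proof. assert (mu <= N * mu) by nra. fold N in Hmuh. lra. Qed.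
Let Ht0 : 0 <= t.
Proof. pos. Qed.
Let HNNt : 0 <= N * t /\ 0 <= N * (N * t) <= / 4096 /\ N * t <= / 4096.
Proof.
 assert (H := Ht). fold N t in H. revert HN Ht0 H. generalize N t. intros N0 t0 h1 h2 h3. assert (a2 : 0 <= N0 * (N0 * t0)) by pos.
 pos.
Qed.

Let rel (j : nat) (y y' : (nat -> R) * st) :=
 Inv n v h mu P D0 e (pj (Datatypes.S j)) (Sj (Datatypes.S j)) (fst y') (snd y') /\ (forall i, (i < n)%nat -> Rabs (fst y' i - fst y i) <= 4 * mu * pj j ^ 3) /\
  (forall z i, Dm n (Sj (Datatypes.S j)) (fst y) (h * pj j ^ 3) z -> (i < n)%nat -> Cmod (sU (snd y') i z - sU (snd y) i z) <= 6 * (N * t) * pj j ^ 3 /\ Cmod (sV (snd y') i z - sV (snd y) i z) <= 8 * (N * t) * e * pj j ^ 3).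

Lemma kam_seq : exists y : nat -> (nat -> R) * st, fst (y O) = v /\ (forall j, Inv n v h mu P D0 e (pj j) (Sj j) (fst (y j)) (snd (y j))) /\ forall j, rel j (y j) (y (Datatypes.S j)).
Proof.
 set (y := fix y j := match j with O => (v, st0 n v) | Datatypes.S j => epsilon (inhabits (v, st0 n v)) (rel j (y j)) end).
 assert (HI : forall j, Inv n v h mu P D0 e (pj j) (Sj j) (fst (y j)) (snd (y j)) -> rel j (y j) (y (Datatypes.S j))).
 { intros j HI. apply epsilon_spec.
  destruct (Inv_step n v h sP mu P Hn Hv0 Hmu Hh HP HPb D0 e He HD0 Ht Hq Hmuh (pj j) (Sj j) _ _ (Ps j) (Qs j) (Hpj j) HI (Hdio j) (HDj j)) as (c' & x' & H1 & H2 & H3).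
  - generalize (HSj j). lra.
  - fold (dl j). assert (H := HSj (Datatypes.S j)). unfold Sj in *. simpl rsum in *. lra.
  - eauto.
  - exists (c', x'). fold (dl j) in H1, H3. assert (E1 : pj j / 2 = pj (Datatypes.S j)) by (unfold pj; simpl; field).
   assert (E2 : Sj j - 3 * dl j = Sj (Datatypes.S j)) by (unfold Sj; simpl; ring). rewrite E1, E2 in H1. rewrite E2 in H3. easy. }
 assert (HI0 : forall j, Inv n v h mu P D0 e (pj j) (Sj j) (fst (y j)) (snd (y j))).
 { induction j; [|apply HI; easy]. assert (H := HSj O). apply Inv_0 with (sP := sP); try easy; lra. }
 exists y. auto.
Qed.

(** In the limit MM v = XX, and differentiating the constant energy gives XX . d_k U + sum_l
    (d_{theta_l} P) MM_lk = 0 for every k. By isotropy the first term is sum_l MM_lk (v . grad U_l).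
    So MM^T annihilates v . grad U + d_theta P, and MM is close to the identity: the action equation
    follows from the angular one. *)
Theorem kam_limit : exists (UU VV : nat -> vec -> C) (wt : nat -> R),
 (forall i, (i < n)%nat -> KF n Sm wt (h / 2) (UU i) /\ KF n Sm wt (h / 2) (VV i)) /\
 (forall i z, UU i (frz n wt z) = UU i z /\ VV i (frz n wt z) = VV i z) /\
 (forall i z, (i < n)%nat -> Dm n Sm wt (h / 2) z -> Cmod (UU i z) <= 7 * (N * t) /\ Cmod (VV i z) <= 12 * (N * t) * e) /\
 (forall i, (i < n)%nat -> Rabs (wt i - v i) <= 5 * mu) /\
 (forall z, Dm n Sm wt (h / 2) z -> DP n v h sP (Th n UU VV z)) /\
 (forall z l, Dm n (Sm - e) wt (h / 2) z -> frz n wt z = z -> (l < n)%nat ->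
   csum n (fun i => pd (2 * n) i (UU l) z * RtoC (v i))%C = (- pd (3 * n) (n + l) P (Th n UU VV z))%C /\
   (RtoC (v l) + csum n (fun i => pd (2 * n) i (VV l) z * RtoC (v i)))%C = (RtoC (wt l) + pd (3 * n) l P (Th n UU VV z))%C).
Proof.
 destruct kam_seq as (y & Hy0 & HI & Hrel).
 set (c j := fst (y j)). set (x j := snd (y j)).
 assert (HG : forall j, good n v P (Sj j) (c j) (h * pj j ^ 3) (2 * mu * pj j ^ 6) (mu * pj j ^ 4) (2 * h * pj j ^ 3) (7 * (N * t) * (1 - pj j ^ 3)) (12 * (N * t) * e * (1 - pj j ^ 3)) (24 * (N * t) * (1 - pj j ^ 3)) (x j)) by (intros j; apply (i_good _ _ _ _ _ _ _ _ _ _ _ (HI j))).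
 (* The centres move by at most 4 mu 8^-j; the 5 bounds 4 / (1 - 1/8). *)
 assert (Hcc : forall i, (i < n)%nat -> exists l : R, forall j, Rabs (l - c j i) <= 5 * mu * (/ 8) ^ j).
 { intros i Hi. destruct (geom_cvg (fun j => RtoC (c j i)) (4 * mu) (/ 8)) as (l & _ & Hl).
  - lra.
  - intros m. rewrite <- RtoC_minus, Cmod_R, <- Hpj8. destruct (Hrel m) as (_ & H & _). eauto.
  - lra.
  - exists (fst l). intros j. eapply Rle_trans; [|via (Hl j)].
   + assert (H := Cmod_re_le (l - RtoC (c j i))%C). easy.
   + assert (0 < (/ 8) ^ j) by pos. pos. }
 set (wt := fun i => epsilon (inhabits 0) (fun l => forall j, Rabs (l - c j i) <= 5 * mu * (/ 8) ^ j)).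
 assert (Hwt : forall i j, (i < n)%nat -> Rabs (wt i - c j i) <= 5 * mu * (/ 8) ^ j).
 { intros i j Hi. revert j. apply epsilon_spec. auto. }
 assert (Hwv : forall i, (i < n)%nat -> Rabs (wt i - v i) <= 5 * mu).
 { intros i Hi. assert (H := Hwt i O Hi). unfold c in H. rewrite Hy0 in H. lra. }
 (* The limit frequency lies in every ball because [384 * mu <= h]. The index [J] may exceed [j] by
    one, since the increments of a step are bounded on the strip that is left after it. *)
 assert (Hfr : forall j J z, (J <= Datatypes.S j)%nat -> Dm n Sm wt (h / 2) z -> Dm n (Sj J) (c j) (h * pj j ^ 3) (frz n wt z)).
 { intros j J z HJ Hz. split; intros i Hi.
  - rewrite frz_th by easy. assert (H := proj1 Hz i Hi). generalize (HSj J). lra.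
  - rewrite frz_om, <- RtoC_minus, Cmod_R. eapply Rle_lt_trans; [apply Hwt; easy|]. rewrite Hpj8. assert (0 < (/ 8) ^ j) by pos. pos. }
 set (Uj := fun i j z => sU (x j) i (frz n wt z)). set (Vj := fun i j z => sV (x j) i (frz n wt z)).
 set (UU := fun i z => epsilon (inhabits (RtoC 0)) (fun l => ccvg (fun m => Uj i m z) l)).
 set (VV := fun i z => epsilon (inhabits (RtoC 0)) (fun l => ccvg (fun m => Vj i m z) l)).
 assert (HUK : forall i j, (i < n)%nat -> KF n Sm wt (h / 2) (Uj i j) /\ forall z k, Dm n Sm wt (h / 2) z -> (k < n)%nat -> pd (2 * n) k (Uj i j) z = pd (2 * n) k (sU (x j) i) (frz n wt z)).
 { intros i j Hi. apply (KF_frz n wt (Sj j) (c j) (h * pj j ^ 3)); [apply (HG j); easy|auto]. }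
 assert (HVK : forall i j, (i < n)%nat -> KF n Sm wt (h / 2) (Vj i j) /\ forall z k, Dm n Sm wt (h / 2) z -> (k < n)%nat -> pd (2 * n) k (Vj i j) z = pd (2 * n) k (sV (x j) i) (frz n wt z)).
 { intros i j Hi. apply (KF_frz n wt (Sj j) (c j) (h * pj j ^ 3)); [apply (HG j); easy|auto]. }
 assert (Hp1 : forall j, 0 <= 1 - pj j ^ 3 <= 1) by (intros j; generalize (ar_pow _ (Hpj j) 3); lra).
 assert (LU : forall i, (i < n)%nat -> KF n Sm wt (h / 2) (UU i) /\ (forall z, Dm n Sm wt (h / 2) z -> ccvg (fun m => Uj i m z) (UU i z)) /\ (forall z, Dm n Sm wt (h / 2) z -> Cmod (UU i z) <= 7 * (N * t)) /\
   (forall del z k, 0 < del -> Dm n (Sm - del) wt (h / 2) z -> (k < n)%nat -> ccvg (fun m => pd (2 * n) k (Uj i m) z) (pd (2 * n) k (UU i) z))).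
 { intros i Hi. apply (KF_seq_lim n Sm wt (h / 2) (Uj i) (6 * (N * t)) (7 * (N * t))).
  - lra.
  - intros m. apply (HUK i m Hi).
  - intros m z Hz. eapply Rle_trans; [apply (gUb _ _ _ _ _ _ _ _ _ _ _ _ _ (HG m)); auto|]. generalize (Hp1 m). nra.
  - intros m z Hz. destruct (Hrel m) as (_ & _ & H). rewrite <- Hpj8. apply (H (frz n wt z) i); [eauto|easy]. }
 assert (LV : forall i, (i < n)%nat -> KF n Sm wt (h / 2) (VV i) /\ (forall z, Dm n Sm wt (h / 2) z -> ccvg (fun m => Vj i m z) (VV i z)) /\ (forall z, Dm n Sm wt (h / 2) z -> Cmod (VV i z) <= 12 * (N * t) * e) /\
   (forall del z k, 0 < del -> Dm n (Sm - del) wt (h / 2) z -> (k < n)%nat -> ccvg (fun m => pd (2 * n) k (Vj i m) z) (pd (2 * n) k (VV i) z))).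
 { intros i Hi. apply (KF_seq_lim n Sm wt (h / 2) (Vj i) (8 * (N * t) * e) (12 * (N * t) * e)).
  - pos.
  - intros m. apply (HVK i m Hi).
  - intros m z Hz. eapply Rle_trans; [apply (gVb _ _ _ _ _ _ _ _ _ _ _ _ _ (HG m)); auto|]. assert (0 <= 12 * (N * t) * e) by pos. generalize (Hp1 m). nra.
  - intros m z Hz. destruct (Hrel m) as (_ & _ & H). rewrite <- Hpj8. apply (H (frz n wt z) i); [eauto|easy]. }
 assert (Hom : forall z, Dm n Sm wt (h / 2) z -> forall i, (i < n)%nat -> Cmod (z (n + i)%nat - RtoC (v i)) < h).
 { intros z Hz i Hi. generalize (proj2 Hz i Hi) (Hwv i Hi) (Cmod_sub_tri (z (n + i)%nat) (RtoC (wt i)) (RtoC (v i))). rewrite <- (RtoC_minus (wt i)), Cmod_R. lra. }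
 assert (HDPU : forall z, Dm n Sm wt (h / 2) z -> DP n v h sP (Th n UU VV z)).
 { intros z Hz. apply (Th_DP n v h sP Sm wt (h / 2) e); [generalize (HSj O); lra|easy| | |easy].
  - intros i Hi. assert (H := proj1 (proj2 (proj2 (LU i Hi))) z Hz). lra.
  - intros i Hi. eapply Rle_trans; [apply (LV i Hi); easy|]. nra. }
 assert (Hfz : forall i z, UU i (frz n wt z) = UU i z /\ VV i (frz n wt z) = VV i z).
 { intros i z. split; [unfold UU, Uj|unfold VV, Vj]; rewrite frz_frz; easy. }
 exists UU, VV, wt. split; [intros i Hi; split; [apply (LU i Hi)|apply (LV i Hi)]|]. split; [easy|].
 split; [intros i z Hi Hz; split; [apply (LU i Hi); easy|apply (LV i Hi); easy]|]. split; [easy|]. split; [easy|].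
 assert (HTh : forall z, Dm n Sm wt (h / 2) z -> frz n wt z = z -> forall i, (i < 3 * n)%nat -> ccvg (fun m => Th n (sU (x m)) (sV (x m)) z i) (Th n UU VV z i)).
 { intros z Hz Ez i Hi. unfold Th. destruct (Nat.ltb_spec i n).
  - apply (ccvg_ext (fun m => Uj i m z)); [intros m; unfold Uj; rewrite Ez; easy|]. apply LU; easy.
  - destruct (Nat.ltb_spec i (2 * n)); [|apply ccvg_const]. apply ccvg_plus; [apply ccvg_const|].
   apply (ccvg_ext (fun m => Vj (i - n)%nat m z)); [intros m; unfold Vj; rewrite Ez; easy|]. apply LV; [lia|easy]. }
 (* The oscillation of the energy at stage m is at most 2 mu 8^-m. *)
 assert (HEc : forall z z', Dm n Sm wt (h / 2) z -> Dm n Sm wt (h / 2) z' -> EE n P UU VV (frz n wt z) = EE n P UU VV (frz n wt z')).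
 { assert (Hfd : forall z, Dm n Sm wt (h / 2) z -> Dm n Sm wt (h / 2) (frz n wt z)).
  { intros z Hz. split; intros i Hi; [rewrite frz_th by easy; apply Hz; easy|]. rewrite frz_om. replace (RtoC (wt i) - RtoC (wt i))%C with (RtoC 0) by ring. rewrite Cmod_0; lra. }
  assert (HEcv : forall z, Dm n Sm wt (h / 2) z -> ccvg (fun m => EE n P (sU (x m)) (sV (x m)) (frz n wt z)) (EE n P UU VV (frz n wt z))).
  { intros z Hz. apply ccvg_plus.
   - apply (ccvg_csum n (fun m i => frz n wt z (n + i)%nat * sU (x m) i (frz n wt z))%C (fun i => frz n wt z (n + i)%nat * UU i (frz n wt z))%C). intros i Hi. apply ccvg_mult; [apply ccvg_const|]. rewrite (proj1 (Hfz i z)). apply (LU i Hi); easy.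
   - apply (An_ccvg (3 * n) (DP n v h sP) P (fun m => Th n (sU (x m)) (sV (x m)) (frz n wt z)) (Th n UU VV (frz n wt z))); [apply HP|auto|].
    apply HTh; [auto|apply frz_frz]. }
  intros z z' Hz Hz'. assert (HH := ccvg_minus _ _ _ _ (HEcv z Hz) (HEcv z' Hz')).
  assert (H0 : ccvg (fun m => EE n P (sU (x m)) (sV (x m)) (frz n wt z) - EE n P (sU (x m)) (sV (x m)) (frz n wt z'))%C 0%C).
  { apply (ccvg_0 _ (2 * mu) (/ 8)); [lra|]. intros m. eapply Rle_trans; [apply (gosc _ _ _ _ _ _ _ _ _ _ _ _ _ (HG m)); [auto|auto|]|].
   - intros i Hi. unfold frz. cmp; easy.
   - rewrite <- Hpj8. apply Rmult_le_compat_l; [lra|]. generalize (ar_pow _ (Hpj m) 3). nra. }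
  assert (H1 := ccvg_unique _ _ _ HH H0).
  replace (EE n P UU VV (frz n wt z)) with (EE n P UU VV (frz n wt z) - EE n P UU VV (frz n wt z') + EE n P UU VV (frz n wt z'))%C by ring. rewrite H1. ring. }
 intros z l Hze Ez Hl.
 assert (Hz : Dm n Sm wt (h / 2) z) by (apply (Dm_le n _ (Sm - e)); [lra|easy]).
 assert (HpU : forall i k, (i < n)%nat -> (k < n)%nat -> ccvg (fun m => pd (2 * n) k (sU (x m) i) z) (pd (2 * n) k (UU i) z)).
 { intros i k Hi Hk. apply (ccvg_ext (fun m => pd (2 * n) k (Uj i m) z)); [intros m; rewrite (proj2 (HUK i m Hi)) by easy; rewrite Ez; easy|]. apply (LU i Hi) with (del := e); easy. }
 assert (HpV : forall i k, (i < n)%nat -> (k < n)%nat -> ccvg (fun m => pd (2 * n) k (sV (x m) i) z) (pd (2 * n) k (VV i) z)).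
 { intros i k Hi Hk. apply (ccvg_ext (fun m => pd (2 * n) k (Vj i m) z)); [intros m; rewrite (proj2 (HVK i m Hi)) by easy; rewrite Ez; easy|]. apply (LV i Hi) with (del := e); easy. }
 assert (HMc : forall i k, (i < n)%nat -> (k < n)%nat -> ccvg (fun m => MM n (sV (x m)) i k z) (MM n VV i k z)).
 { intros i k Hi Hk. apply ccvg_plus; [apply ccvg_const|auto]. }
 assert (Hzj : forall m, Dm n (Sj m) (c m) (h * pj m ^ 3) z) by (intros m; rewrite <- Ez; auto).
 assert (Hiso : forall j k, (j < n)%nat -> (k < n)%nat -> csum n (fun l => MM n VV l j z * pd (2 * n) k (UU l) z)%C = csum n (fun l => MM n VV l k z * pd (2 * n) j (UU l) z)%C).
 { intros j k Hj Hk. apply (ccvg_unique (fun m => csum n (fun l => MM n (sV (x m)) l j z * pd (2 * n) k (sU (x m) l) z)%C)).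
  - apply (ccvg_csum n (fun m l => MM n (sV (x m)) l j z * pd (2 * n) k (sU (x m) l) z)%C (fun l => MM n VV l j z * pd (2 * n) k (UU l) z)%C). intros i Hi. apply ccvg_mult; auto.
  - apply (ccvg_ext (fun m => csum n (fun l => MM n (sV (x m)) l k z * pd (2 * n) j (sU (x m) l) z)%C)).
   + intros m. symmetry. assert (G := HG m). apply (kf_isotropy n (Sj m) (c m) (h * pj m ^ 3) (sU (x m)) (sV (x m)) (sS (x m)) z j k); try apply G; auto.
   + apply (ccvg_csum n (fun m l => MM n (sV (x m)) l k z * pd (2 * n) j (sU (x m) l) z)%C (fun l => MM n VV l k z * pd (2 * n) j (UU l) z)%C). intros i Hi. apply ccvg_mult; auto. }
 (* At each stage MM (v - GG) = XX, by the inverse [sW]. At the limit frequency [GG] tends to 0,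
    since the defect does and the shift is at most 2 h 8^-m on the m-th ball. *)
 assert (HX : forall l, (l < n)%nat -> csum n (fun i => MM n VV l i z * RtoC (v i))%C = XX n P UU VV l z).
 { intros k Hk. apply (ccvg_unique (fun m => csum n (fun i => MM n (sV (x m)) k i z * (RtoC (v i) - GG n v P (sU (x m)) (sV (x m)) (sW (x m)) i z))%C)).
  - apply (ccvg_csum n (fun m i => MM n (sV (x m)) k i z * (RtoC (v i) - GG n v P (sU (x m)) (sV (x m)) (sW (x m)) i z))%C (fun i => MM n VV k i z * RtoC (v i))%C). intros i Hi.
   apply ccvg_mult; [auto|]. apply ccvg_minus0.
   apply (ccvg_0 _ (mu + 2 * h) (/ 8)); [lra|]. intros m. rewrite <- Hpj8.
   assert (g1 := gGb _ _ _ _ _ _ _ _ _ _ _ _ _ (HG m) z i (Hzj m) Hi). assert (g2 := ggb _ _ _ _ _ _ _ _ _ _ _ _ _ (HG m) z i (Hzj m) Hi).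
   assert (g3 := Cmod_le_add (GG n v P (sU (x m)) (sV (x m)) (sW (x m)) i z) (sg (x m) i z)).
   assert (mu * pj m ^ 4 <= mu * pj m ^ 3). { apply Rmult_le_compat_l; [easy|]. generalize (ar_pow _ (Hpj m) 3) (Hpj m). nra. } lra.
  - apply (ccvg_ext (fun m => XX n P (sU (x m)) (sV (x m)) k z)).
   + intros m. symmetry. rewrite (csum_ext n _ (fun i => MM n (sV (x m)) k i z * csum n (fun a => sW (x m) i a z * XX n P (sU (x m)) (sV (x m)) a z))%C) by (intros i Hi; unfold GG; ring).
    rewrite csum_assoc. rewrite (csum_ext n _ (fun a => kd k a * XX n P (sU (x m)) (sV (x m)) a z)%C); [apply csum_kd_l; easy|]. intros a Ha. f_equal.
    apply (gMW _ _ _ _ _ _ _ _ _ _ _ _ _ (HG m)); auto.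
   + apply ccvg_plus; [apply ccvg_const|]. apply (An_ccvg (3 * n) (DP n v h sP) (PI n P k)); [apply An_pd; [apply opn_DP|apply HP|lia]|auto|auto]. }
 assert (HUa : forall i, (i < n)%nat -> KF n Sm wt (h / 2) (UU i)) by (intros; apply LU; easy).
 assert (HVa : forall i, (i < n)%nat -> KF n Sm wt (h / 2) (VV i)) by (intros; apply LV; easy).
 (* The angular derivative of the constant energy. The frequencies are frozen, so differentiating
    omega . U yields omega . d_k U only, which [XX] collects together with the action derivatives of
    [P]. *)
 assert (HEd : forall k, (k < n)%nat -> (csum n (fun l => XX n P UU VV l z * pd (2 * n) k (UU l) z) + csum n (fun l => pd (3 * n) (n + l) P (Th n UU VV z) * MM n VV l k z))%C = 0%C).
 { intros k Hk. assert (KE := KF_EE n v h sP P HP Sm wt (h / 2) UU VV HUa HVa HDPU).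
  destruct (KF_frz n wt Sm wt (h / 2) Sm wt (h / 2) (EE n P UU VV) KE) as [KEf PEf].
  { intros w Hw. split; intros i Hi; [rewrite frz_th by easy; apply Hw; easy|]. rewrite frz_om. replace (RtoC (wt i) - RtoC (wt i))%C with (RtoC 0) by ring. rewrite Cmod_0; lra. }
  assert (E0 := PEf z k Hz Hk). rewrite Ez in E0.
  rewrite (pd_ext (2 * n) (Dm n Sm wt (h / 2)) _ (fun _ => EE n P UU VV (frz n wt z)) k z) in E0; [|apply opn_Dm|auto|apply KEf|easy|lia].
  rewrite pd_const in E0 by lia. rewrite E0. unfold EE.
  rewrite (pd_plus (2 * n) (Dm n Sm wt (h / 2))); [| | |easy|lia].
  2:{ apply (KF_csum n Sm wt (h / 2) n (fun i z => z (n + i)%nat * UU i z)%C). intros i Hi. apply KF_mult; [apply KF_om; easy|auto]. }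
  2:{ apply (KF_Th n v h sP Sm wt (h / 2) P UU VV HP HUa HVa HDPU). }
  rewrite (proj2 (KF_Th n v h sP Sm wt (h / 2) P UU VV HP HUa HVa HDPU) z k Hz Hk).
  rewrite (pd_csum (2 * n) (Dm n Sm wt (h / 2)) n (fun i z => z (n + i)%nat * UU i z)%C); [| |easy|lia].
  2:{ intros i Hi. apply An_mult; [apply An_coord; lia|apply HUa; easy]. }
  rewrite (csum_ext n (fun i => pd (2 * n) k (fun z => z (n + i)%nat * UU i z)%C z) (fun i => z (n + i)%nat * pd (2 * n) k (UU i) z)%C).
  2:{ intros i Hi. rewrite (pd_mult (2 * n) (Dm n Sm wt (h / 2))); [|apply An_coord; lia|apply HUa; easy|easy|lia]. rewrite pd_coord by lia. cmp; ring. }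
  rewrite Cplus_assoc, <- !csum_plus. apply csum_ext; intros i Hi; unfold XX, PI, MM; ring. }
 assert (HpVb : forall i k, (i < n)%nat -> (k < n)%nat -> Cmod (pd (2 * n) k (VV i) z) <= 12 * (N * t)).
 { intros i k Hi Hk. replace (12 * (N * t)) with (12 * (N * t) * e / e) by (field; lra). apply (KF_cauchy n Sm wt (h / 2)); auto. apply (LV i Hi). }
 assert (Ez2 : forall i, z (n + i)%nat = RtoC (wt i)) by (intros i; rewrite <- Ez, frz_om; easy).
 split.
 - assert (Hy : (csum n (fun i => pd (2 * n) i (UU l) z * RtoC (v i)) + pd (3 * n) (n + l) P (Th n UU VV z))%C = 0%C).
  { apply (near_id_inj n (fun l k => pd (2 * n) k (VV l) z) (fun l => csum n (fun i => pd (2 * n) i (UU l) z * RtoC (v i)) + pd (3 * n) (n + l) P (Th n UU VV z))%C (12 * (N * t))); auto.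
   - fold N. lra.
   - intros k Hk. rewrite <- (HEd k Hk).
    rewrite (csum_ext n _ (fun m => MM n VV m k z * csum n (fun i => pd (2 * n) i (UU m) z * RtoC (v i)) + pd (3 * n) (n + m) P (Th n UU VV z) * MM n VV m k z)%C) by (intros m Hm; unfold MM; ring).
    rewrite csum_plus. f_equal. rewrite csum_assoc.
    rewrite (csum_ext n (fun l0 => XX n P UU VV l0 z * pd (2 * n) k (UU l0) z)%C (fun m => csum n (fun i => MM n VV m i z * RtoC (v i)) * pd (2 * n) k (UU m) z)%C) by (intros m Hm; rewrite HX by easy; easy).
    rewrite (csum_ext n (fun m => csum n (fun i => MM n VV m i z * RtoC (v i)) * pd (2 * n) k (UU m) z)%C (fun m => pd (2 * n) k (UU m) z * csum n (fun i => MM n VV m i z * RtoC (v i)))%C) by (intros; ring).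
    rewrite csum_assoc. apply csum_ext. intros i Hi. f_equal. rewrite <- Hiso by easy. apply csum_ext. intros; ring. }
  set (A1 := csum n (fun i => pd (2 * n) i (UU l) z * RtoC (v i))%C) in *. set (A2 := pd (3 * n) (n + l) P (Th n UU VV z)) in *. replace A1 with (A1 + A2 - A2)%C by ring. rewrite Hy. ring.
 - assert (H := HX l Hl). unfold MM in H. rewrite (csum_ext n _ (fun i => kd l i * RtoC (v i) + pd (2 * n) i (VV l) z * RtoC (v i))%C) in H by (intros; ring).
  rewrite csum_plus, (csum_kd_l n l (fun i => RtoC (v i))) in H by easy. rewrite H. unfold XX, PI. f_equal; auto.
Qed.
End Lim.

(** * The sequence of cut-offs *)

Lemma Rsum_n_rsum n f : Defs.Rsum_n n f = rsum n f.
Proof.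
 unfold Defs.Rsum_n. induction n; [easy|]. rewrite seq_S, map_app, fold_right_app. simpl. rewrite <- IHn.
 generalize (seq 0 n). induction l; simpl; [ring|]. lra.
Qed.
Lemma ext_lt {A} n (d : A) (f : Defs.Idx n -> A) i (H : (i < n)%nat) : Defs.ext d f i = f (exist _ i H).
Proof. unfold Defs.ext. destruct (Compare_dec.lt_dec i n) as [p|]; [|lia]. do 2 f_equal. apply Peano_dec.le_unique. Qed.
Lemma ext_idx {A} n (d : A) (f : Defs.Idx n -> A) (i : Defs.Idx n) : Defs.ext d f (proj1_sig i) = f i.
Proof. destruct i as [i H]. apply ext_lt. Qed.
Lemma ext_ge {A} n (d : A) (f : Defs.Idx n -> A) i : (n <= i)%nat -> Defs.ext d f i = d.
Proof. intros H. unfold Defs.ext. destruct (Compare_dec.lt_dec i n); [lia|easy]. Qed.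

Lemma rdot_rsum n (k : Defs.Idx n -> Z) (w : Defs.RV n) : Defs.rdot (fun i => IZR (k i)) w = rsum n (fun i => IZR (Defs.ext 0%Z k i) * Defs.ext 0 w i).
Proof. unfold Defs.rdot. rewrite Rsum_n_rsum. apply rsum_ext. intros i Hi. rewrite !(ext_lt _ _ _ _ Hi). easy. Qed.
Lemma l1Z_rsum n (k : Defs.Idx n -> Z) : Defs.l1Z k = rsum n (fun i => Rabs (IZR (Defs.ext 0%Z k i))).
Proof. unfold Defs.l1Z. rewrite Rsum_n_rsum. apply rsum_ext. intros i Hi. rewrite !(ext_lt _ _ _ _ Hi). easy. Qed.

Lemma dotr_rsum k x : dotr k x = rsum (length k) (fun i => IZR (nth (length k - 1 - i) k 0%Z) * x i).
Proof.
 induction k as [|m k IH]; [easy|]. simpl. rewrite IH, Rplus_comm. f_equal.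
 - apply rsum_ext. intros i Hi. replace (length k - 0 - i)%nat with (S (length k - 1 - i)) by lia. easy.
 - replace (length k - 0 - length k)%nat with O by lia. easy.
Qed.
Lemma l1l_rsum k : l1l k = rsum (length k) (fun i => Rabs (IZR (nth (length k - 1 - i) k 0%Z))).
Proof.
 induction k as [|m k IH]; [easy|]. simpl. rewrite IH, Rplus_comm. f_equal.
 - apply rsum_ext. intros i Hi. replace (length k - 0 - i)%nat with (S (length k - 1 - i)) by lia. easy.
 - replace (length k - 0 - length k)%nat with O by lia. easy.
Qed.
Section NT.
Variables (n : nat) (w : Defs.RV n).
Hypothesis Hn : (1 <= n)%nat.
Hypothesis Hw1 : forall i : Defs.Idx n, proj1_sig i = 0%nat -> w i = 1.
Hypothesis Hnr : Defs.nonresonant w.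
Let vv := Defs.ext 0 w.

(** [dotl] attaches the head of a list to the last coordinate, hence the reversed index. *)
Definition lidx (k : list Z) : Defs.Idx n -> Z := fun i => nth (n - 1 - proj1_sig i) k 0%Z.
Definition idxl (k : Defs.Idx n -> Z) : list Z := rev (map (Defs.ext 0%Z k) (seq 0 n)).

Lemma lidx_dot k : length k = n -> Defs.rdot (fun i => IZR (lidx k i)) w = dotr k vv /\ Defs.l1Z (lidx k) = l1l k.
Proof.
 intros H. rewrite rdot_rsum, l1Z_rsum, dotr_rsum, l1l_rsum, H. split; apply rsum_ext; intros i Hi; rewrite (ext_lt _ _ _ _ Hi); easy.
Qed.
Lemma idxl_length k : length (idxl k) = n.
Proof. unfold idxl. rewrite length_rev, length_map, length_seq. easy. Qed.
Lemma lidx_idxl k : lidx (idxl k) = k.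
Proof.
 apply functional_extensionality; intros [i Hi]. unfold lidx, idxl. simpl proj1_sig. rewrite rev_nth by (rewrite length_map, length_seq; lia).
 rewrite length_map, length_seq. replace (n - S (n - 1 - i))%nat with i by lia.
 rewrite nth_indep with (d' := Defs.ext 0%Z k 0%nat) by (rewrite length_map, length_seq; lia). rewrite map_nth, seq_nth by lia. apply ext_lt.
Qed.

Lemma rdot_pos k : 0 < Defs.l1Z k -> 0 < Rabs (Defs.rdot (fun i => IZR (k i)) w).
Proof.
 intros H. apply Rabs_pos_lt. intros E. assert (E2 := Hnr k E). rewrite l1Z_rsum in H. rewrite (rsum_ext n _ (fun _ => 0)), rsum_const in H; [lra|].
 intros i Hi. rewrite (ext_lt _ _ _ _ Hi), E2, Rabs_R0. easy.
Qed.

Let PA Q (y : R) := exists k : Defs.Idx n -> Z, 0 < Defs.l1Z k <= Q /\ y = / Rabs (Defs.rdot (fun i => IZR (k i)) w).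

(** The first frequency is 1, so the first unit vector shows that Psi is at least 1. Consequently
    Delta(Q) is at least Q, which bounds the set whose supremum is [DeltaStar]. *)
Lemma unit_in Q : 1 <= Q -> PA Q 1.
Proof.
 intros HQ. set (k0 := fun i : Defs.Idx n => if Nat.eqb (proj1_sig i) 0 then 1%Z else 0%Z). exists k0.
 assert (S1 : forall (g : nat -> R), rsum n (fun i => if Nat.eqb i 0 then g i else 0) = g O).
 { intros g. clear -Hn. induction n; [lia|]. simpl. destruct (Nat.eqb_spec n0 0) as [->|]; [simpl; ring|]. rewrite IHn0 by lia. ring. }
 assert (E1 : Defs.l1Z k0 = 1).
 { rewrite l1Z_rsum. rewrite (rsum_ext n _ (fun i => if Nat.eqb i 0 then 1 else 0)); [easy|].
  intros i Hi. rewrite (ext_lt _ _ _ _ Hi). unfold k0. simpl. destruct (Nat.eqb i 0); [apply Rabs_R1|apply Rabs_R0]. }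
  split; [lra|]. rewrite rdot_rsum. rewrite (rsum_ext n _ (fun i => if Nat.eqb i 0 then 1 else 0)).
 - rewrite (S1 (fun _ => 1)), Rabs_R1, Rinv_1. easy.
 - intros i Hi. rewrite !(ext_lt _ _ _ _ Hi). unfold k0. simpl. destruct (Nat.eqb_spec i 0); [rewrite Hw1 by easy; ring|ring].
Qed.

Lemma PsiQ_lub Q : 1 <= Q -> is_lub (PA Q) (Defs.PsiQ w Q).
Proof.
 intros HQ. unfold Defs.PsiQ, Defs.Rsup. apply epsilon_spec.
 destruct (completeness (PA Q)) as [m Hm]; [|exists 1; apply unit_in; easy|eauto].
 (* All admissible [k] lie in a box, so a sum over this box is an upper bound; the filter keeps the
    terms of the sum positive. *)
 set (J := Z.to_nat (up Q)). exists (lsum (fun k => / Rabs (dotr k vv)) (filter (fun k => if Rlt_dec 0 (Rabs (dotr k vv)) then true else false) (bl n J))).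
 intros y (k & Hk & ->). assert (Hp := rdot_pos k (proj1 Hk)).
 rewrite <- (lidx_idxl k) in Hk, Hp |- *. destruct (lidx_dot (idxl k) (idxl_length k)) as [E1 E2]. rewrite E1 in Hp |- *. rewrite E2 in Hk.
 set (l := idxl k) in *.
 assert (Hin : In l (bl n J)).
 { apply in_bl. split; [apply idxl_length|]. assert (HL : l1l l <= Q) by easy. clear -HL.
  induction l as [|m l IH]; [easy|]. simpl in HL.
  assert (P : 0 <= l1l l) by (clear; induction l; simpl; [lra|pos]).
  constructor; [|apply IH; generalize (Rabs_pos (IZR m)); lra]. apply in_zr. destruct (archimed Q) as [A1 _].
  assert (HA : Rabs (IZR m) < IZR (up Q)) by lra. rewrite <- abs_IZR in HA. apply lt_IZR in HA. lia. }
 assert (T : forall l', In l (filter (fun k => if Rlt_dec 0 (Rabs (dotr k vv)) then true else false) l') -> / Rabs (dotr l vv) <= lsum (fun k => / Rabs (dotr k vv)) (filter (fun k => if Rlt_dec 0 (Rabs (dotr k vv)) then true else false) l')).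
 { induction l' as [|b l' IH]; [easy|]. simpl.
  assert (P : 0 <= lsum (fun k => / Rabs (dotr k vv)) (filter (fun k => if Rlt_dec 0 (Rabs (dotr k vv)) then true else false) l')).
  { clear. induction l'; simpl; [lra|]. destruct (Rlt_dec 0 (Rabs (dotr a vv))); simpl; [|easy]. pos. }
  destruct (Rlt_dec 0 (Rabs (dotr b vv))); [|easy]. intros [->|H]; simpl; [lra|]. generalize (IH H) (Rinv_0_lt_compat _ r). lra. }
 apply T. apply filter_In. destruct (Rlt_dec 0 (Rabs (dotr l vv))); easy.
Qed.
Lemma PsiQ_ge1 Q : 1 <= Q -> 1 <= Defs.PsiQ w Q.
Proof. intros HQ. apply (PsiQ_lub Q HQ). apply unit_in; easy. Qed.
Lemma PsiQ_mono Q Q' : 1 <= Q -> Q <= Q' -> Defs.PsiQ w Q <= Defs.PsiQ w Q'.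
Proof.
 intros HQ HQ'. apply (PsiQ_lub Q HQ). intros y (k & Hk & E). apply (PsiQ_lub Q' ltac:(lra)). exists k. lra.
Qed.
Lemma PsiQ_dioph Q : 1 <= Q -> dioph n vv (Defs.PsiQ w Q) Q.
Proof.
 intros HQ. assert (H1 := PsiQ_ge1 Q HQ). split; [lra|]. split; [lra|]. intros k Hk Hl. destruct (lidx_dot k Hk) as [E1 E2].
 assert (Hp := rdot_pos (lidx k)). rewrite E1, E2 in Hp.
 assert (H : / Rabs (dotr k vv) <= Defs.PsiQ w Q). { apply (PsiQ_lub Q HQ). exists (lidx k). rewrite E1, E2. easy. }
 apply (Rmult_le_compat_r (Rabs (dotr k vv))) in H; [|lra]. rewrite Rinv_l in H by lra. easy.
Qed.

Lemma DeltaQ_mono Q Q' : 1 <= Q -> Q <= Q' -> Defs.DeltaQ w Q <= Defs.DeltaQ w Q'.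
Proof.
 intros HQ HQ'. unfold Defs.DeltaQ. assert (H := PsiQ_mono Q Q' HQ HQ'). assert (H1 := PsiQ_ge1 Q HQ). pos.
Qed.
Lemma DeltaQ_ge Q : 1 <= Q -> Q <= Defs.DeltaQ w Q.
Proof. intros HQ. unfold Defs.DeltaQ. assert (H1 := PsiQ_ge1 Q HQ). nra. Qed.

Let DA x Q := 1 <= Q /\ Defs.DeltaQ w Q <= x.
Lemma DS_lub x : Defs.DeltaQ w 1 <= x -> is_lub (DA x) (Defs.DeltaStar w x).
Proof.
 intros Hx. unfold Defs.DeltaStar, Defs.Rsup. apply epsilon_spec.
 destruct (completeness (DA x)) as [m Hm]; [|exists 1; split; [lra|easy]|eauto].
 exists x. intros Q [H1 H2]. generalize (DeltaQ_ge Q H1). lra.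
Qed.
Lemma DS_ge x Q : 1 <= Q -> Defs.DeltaQ w Q <= x -> Q <= Defs.DeltaStar w x.
Proof. intros H1 H2. apply DS_lub; [|easy]. eapply Rle_trans; [apply (DeltaQ_mono 1 Q); lra|easy]. Qed.
Lemma DS_mono x x' : Defs.DeltaQ w 1 <= x -> x <= x' -> Defs.DeltaStar w x <= Defs.DeltaStar w x'.
Proof. intros Hx Hx'. apply (DS_lub x Hx). intros Q [H1 H2]. apply DS_ge; lra. Qed.
Lemma DS_lt x Q : Defs.DeltaQ w 1 <= x -> 1 <= Q -> Q < Defs.DeltaStar w x -> Defs.DeltaQ w Q <= x.
Proof.
 intros Hx HQ H. destruct (Rle_or_lt (Defs.DeltaQ w Q) x) as [|Hc]; [easy|exfalso].
 assert (Defs.DeltaStar w x <= Q); [|lra]. apply (DS_lub x Hx). intros Q' [H1 H2]. destruct (Rle_or_lt Q' Q) as [|Hq]; [easy|].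
 generalize (DeltaQ_mono Q Q' HQ ltac:(lra)). lra.
Qed.

Let f x := / (x * Defs.DeltaStar w x).
Lemma q_seq Q0 L0 : 1 <= Q0 -> Defs.improper_int f (Defs.DeltaQ w Q0) L0 ->
 exists Qs Ps : nat -> R, (forall j, dioph n vv (Ps j) (Qs j)) /\ (forall j, Ps j * Qs j * (/ 2) ^ j <= Defs.DeltaQ w Q0) /\
  (forall j, 0 < Qs j) /\ 0 <= L0 /\ forall J, rsum J (fun j => / Qs j) <= / Q0 + 4 * L0.
Proof.
 (* The half in [Qs] puts the cut-off strictly below the supremum [DeltaStar], so that [DS_lt] gives
    Delta(Q_j) <= x_j = 2^j Delta(Q_0). *)
 intros HQ0 [Hex Hlim]. set (D0 := Defs.DeltaQ w Q0) in *. set (xj j := 2 ^ j * D0). set (Qs j := Rmax Q0 (Defs.DeltaStar w (xj j) / 2)).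
 assert (HD0 : 1 <= D0) by (generalize (DeltaQ_ge Q0 HQ0); fold D0; lra).
 assert (HD1 : Defs.DeltaQ w 1 <= D0) by (apply DeltaQ_mono; lra).
 assert (H2j : forall j, 1 <= 2 ^ j) by (intros; apply pow_R1_Rle; lra).
 assert (Hxj : forall j, D0 <= xj j) by (intros j; unfold xj; specialize (H2j j); nra).
 assert (HxS : forall j, xj (S j) = 2 * xj j) by (intros; unfold xj; simpl; ring).
 assert (HDS : forall x, D0 <= x -> Q0 <= Defs.DeltaStar w x) by (intros x Hx; apply DS_ge; [easy|easy]).
 assert (HQs1 : forall j, Q0 <= Qs j) by (intros; apply Rmax_l).
 assert (HDel : forall j, Defs.DeltaQ w (Qs j) <= xj j).
 { intros j. unfold Qs, Rmax. destruct (Rle_dec Q0 (Defs.DeltaStar w (xj j) / 2)) as [H|H]; [|easy].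
  apply DS_lt; [generalize (Hxj j); lra|lra|]. lra. }
 assert (Hfp : forall x, D0 <= x -> 0 <= f x). { intros x Hx. generalize (HDS x Hx). pos. }
 assert (HexI : forall b, D0 <= b -> ex_RInt f D0 b).
 { intros b Hb. destruct (Hex b Hb) as (v & pr & _). apply ex_RInt_Reals_1. easy. }
 assert (HexJ : forall a b, D0 <= a -> a <= b -> ex_RInt f a b).
 { intros a b Ha Hb. apply (ex_RInt_Chasles_2 (V := R_CompleteNormedModule)) with D0; [lra|apply HexI; lra]. }
 assert (HI : forall b, D0 <= b -> RInt f D0 b <= L0).
 { intros b Hb. apply le_epsilon. intros eps He. destruct (Hlim eps He) as (M & HM). set (b' := Rmax M b).
  assert (Hb' : D0 <= b') by (eapply Rle_trans; [apply Hb|apply Rmax_r]). destruct (Hex b' Hb') as (v & pr & Ev).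
  assert (HH := HM b' v (Rmax_l _ _) Hb' ltac:(exists pr; easy)).
  assert (E : RInt f D0 b' = v) by (rewrite <- Ev; apply RInt_Reals).
  assert (Ec : RInt f D0 b + RInt f b b' = RInt f D0 b'). { apply (RInt_Chasles (V := R_CompleteNormedModule)); [auto|apply HexJ; [easy|apply Rmax_r]]. }
  assert (0 <= RInt f b b'). { apply RInt_ge_0; [apply Rmax_r|apply HexJ; [easy|apply Rmax_r]|]. intros x Hx. apply Hfp; lra. }
  apply Rabs_def2 in HH. lra. }
 (* On the dyadic interval from x_j to x_{j+1} = 2 x_j both factors of the denominator are largest
    at the right end, so the integral over it is at least half of 1 / [DeltaStar] there. *)
 assert (HJ : forall J, rsum J (fun j => / Defs.DeltaStar w (xj (S j))) <= 2 * RInt f D0 (xj J)).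
 { induction J.
  - unfold xj. rewrite Rmult_1_l, RInt_point. pos.
  - simpl rsum.
   assert (Ec : RInt f D0 (xj J) + RInt f (xj J) (xj (S J)) = RInt f D0 (xj (S J))).
   { apply (RInt_Chasles (V := R_CompleteNormedModule)); [auto|apply HexJ; [auto|]]. rewrite HxS. generalize (Hxj J). lra. }
   set (ds := Defs.DeltaStar w (xj (S J))) in *. assert (Hds : 1 <= ds) by (generalize (HDS (xj (S J)) (Hxj (S J))); fold ds; lra).
   assert (Hx := Hxj J).
   assert (Hc : RInt (fun _ => / (xj (S J) * ds)) (xj J) (xj (S J)) <= RInt f (xj J) (xj (S J))).
   { apply RInt_le; [rewrite HxS; lra|apply ex_RInt_const|apply HexJ; [auto|rewrite HxS; lra]|]. intros x Hxx.
    assert (h1 := HDS x ltac:(lra)). assert (h2 : Defs.DeltaStar w x <= ds) by (apply DS_mono; lra).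
    apply Rinv_le_contravar; [pos|]. pos. }
   rewrite (RInt_const (V := R_CompleteNormedModule)) in Hc. unfold scal in Hc; simpl in Hc; unfold mult in Hc; simpl in Hc.
   replace ((xj (S J) - xj J) * / (xj (S J) * ds)) with (/ 2 * / ds) in Hc by (rewrite HxS; field; lra). lra. }
 exists Qs, (fun j => Defs.PsiQ w (Qs j)). split; [intros j; apply PsiQ_dioph; generalize (HQs1 j); lra|]. split; [|split].
 - intros j. specialize (HDel j). unfold xj in HDel. rewrite (Rmult_comm (Defs.PsiQ w (Qs j))).
  assert (Hp : 0 < (/ 2) ^ j) by pos. apply (Rmult_le_compat_r ((/ 2) ^ j)) in HDel; [|lra].
  replace (2 ^ j * D0 * (/ 2) ^ j) with (D0 * (2 * / 2) ^ j) in HDel by (rewrite Rpow_mult_distr; ring). rewrite Rinv_r, pow1, Rmult_1_r in HDel by lra. easy.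
 - intros j. generalize (HQs1 j). lra.
 - assert (HL0 : 0 <= L0). { eapply Rle_trans; [|apply (HI D0); lra]. rewrite RInt_point. easy. }
  split; [easy|].
  (* The cut-off of index 0 has no dyadic interval before it and contributes at most 1 / Q_0; each
     later one is at least half of [DeltaStar]. *)
  assert (G : forall J, rsum (S J) (fun j => / Qs j) <= / Q0 + 2 * rsum J (fun j => / Defs.DeltaStar w (xj (S j)))).
  { induction J.
   - simpl. assert (/ Qs O <= / Q0) by (apply Rinv_le_contravar; [lra|auto]). lra.
   - change (rsum (S (S J)) (fun j => / Qs j)) with (rsum (S J) (fun j => / Qs j) + / Qs (S J)).
    change (rsum (S J) (fun j => / Defs.DeltaStar w (xj (S j)))) with (rsum J (fun j => / Defs.DeltaStar w (xj (S j))) + / Defs.DeltaStar w (xj (S J))).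
    assert (/ Qs (S J) <= 2 * / Defs.DeltaStar w (xj (S J))); [|lra].
    assert (H1 := HDS (xj (S J)) (Hxj (S J))). replace (2 * / Defs.DeltaStar w (xj (S J))) with (/ (Defs.DeltaStar w (xj (S J)) / 2)) by (field; lra).
    apply Rinv_le_contravar; [lra|apply Rmax_r]. }
  intros [|J]; [pos|]. eapply Rle_trans; [easy|]. assert (h1 := HJ J). assert (h2 := HI (xj J) (Hxj J)). lra.
Qed.
End NT.

(** * From the normalized to the original Hamiltonian *)

(** The complex operations of the statement are convertible with those used in the proof; what has
    to be treated is the zero increment. *)
Lemma cdf_of_cdiff (g : C -> C) (z : C) : Defs.cdiff g z -> cdf g z.
Proof.
 intros [L HL]. exists L. intros eps He. destruct (HL eps He) as (d & Hd & H). exists d. split; [easy|]. intros t Ht.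
 destruct (Req_dec (Cmod t) 0) as [E|E].
 - apply Cmod_eq_0 in E. subst t. replace (g (z + 0)%C - g z - L * 0)%C with (RtoC 0); [rewrite Cmod_0; lra|]. replace (z + 0)%C with z by ring. ring.
 - assert (Ht0 : 0 < Cmod t) by (generalize (Cmod_ge_0 t); lra). assert (Hn : t <> RtoC 0) by (intros ->; apply E, Cmod_0).
  assert (H1 : Cmod ((g (z + t)%C - g z) / t - L) < eps) by auto.
  replace (g (z + t)%C - g z - L * t)%C with (((g (z + t)%C - g z) / t - L) * t)%C by (field; pos). rewrite Cmod_mult. pos.
Qed.
Lemma cd_quot g z L : is_cd g z L -> forall eps, 0 < eps -> exists d, 0 < d /\ forall t : C, 0 < Cmod t < d -> Cmod ((g (z + t)%C - g z) / t - L) < eps.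
Proof.
 intros HL eps He. destruct (HL (eps / 2) ltac:(lra)) as (d & Hd & H). exists d. split; [easy|]. intros t Ht.
 assert (Hn : t <> RtoC 0) by (intros ->; rewrite Cmod_0 in Ht; lra). specialize (H t ltac:(lra)).
 replace ((g (z + t)%C - g z) / t - L)%C with ((g (z + t)%C - g z - L * t) / t)%C by (field; pos). rewrite Cmod_div by easy.
 apply Rle_lt_trans with (eps / 2); [|lra]. apply (Rmult_le_reg_r (Cmod t)); [lra|]. unfold Rdiv at 1. rewrite Rmult_assoc, Rinv_l by lra. lra.
Qed.
Lemma cdiff_of_cd g z L : is_cd g z L -> Defs.cdiff g z.
Proof. intros H. exists L. intros eps He. apply (cd_quot g z L H eps He). Qed.

Lemma csum_n_csum n f : Defs.Csum_n n f = csum n f.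
Proof.
 unfold Defs.Csum_n. induction n; [easy|]. rewrite seq_S, map_app, fold_right_app. cbn [fold_right map seq Nat.add]. simpl csum. rewrite <- IHn.
 generalize (seq 0 n). induction l; cbn [fold_right map].
 - change (f n + RtoC 0 = RtoC 0 + f n)%C. ring.
 - rewrite IHl. change (f a + (fold_right Defs.Cadd (Defs.RtoC 0) (map f l) + f n) = f a + fold_right Defs.Cadd (Defs.RtoC 0) (map f l) + f n)%C. ring.
Qed.

Lemma im_mult0 (a b : C) : snd a = 0 -> snd b = 0 -> snd (a * b)%C = 0.
Proof. unfold Cmult. cbn [snd]. pos. Qed.
Lemma im_plus0 (a b : C) : snd a = 0 -> snd b = 0 -> snd (a + b)%C = 0.
Proof. unfold Cplus. cbn [snd]. lra. Qed.
Lemma im_minus0 (a b : C) : snd a = 0 -> snd b = 0 -> snd (a - b)%C = 0.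
Proof. unfold Cminus, Copp, Cplus. cbn [snd]. lra. Qed.
Lemma im_csum0 n (f : nat -> C) : (forall i, (i < n)%nat -> snd (f i) = 0) -> snd (csum n f) = 0.
Proof. induction n; intros H; [easy|]. apply im_plus0; [auto|auto]. Qed.

Section Blk.
Variable n : nat.
Definition blk (o : nat) (z : vec) : Defs.CV n := fun i => z (o + proj1_sig i)%nat.
Lemma blk_upd_in o z (j : Defs.Idx n) t : blk o (updv z (o + proj1_sig j) t) = Defs.upd (blk o z) j t.
Proof.
 ext i. unfold blk, Defs.upd, updv. destruct (Nat.eqb_spec (o + proj1_sig i) (o + proj1_sig j)), (Nat.eq_dec (proj1_sig i) (proj1_sig j)); try lia; easy.
Qed.
Lemma blk_upd_out o z k t : (k < o \/ o + n <= k)%nat -> blk o (updv z k t) = blk o z.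
Proof. intros H. apply functional_extensionality; intros [i Hi]. unfold blk. simpl. apply updv_neq. lia. Qed.
Lemma blk_eq o z z' : (forall i, (i < n)%nat -> z (o + i)%nat = z' (o + i)%nat) -> blk o z = blk o z'.
Proof. intros H. apply functional_extensionality; intros [i Hi]. eauto. Qed.

Lemma holo1_An D f : Defs.holo1 D f -> opn n (fun z => D (blk 0 z)) -> An n (fun z => D (blk 0 z)) (fun z => f (blk 0 z)).
Proof.
 intros [Hc Hd] HD. apply An_of_sep; [easy| | |].
 - intros z Hz. destruct (HD z Hz) as (r1 & Hr1 & H1). destruct (Hc (blk 0 z) Hz 1 Rlt_0_1) as (d & Hd0 & H2). exists (Rmin r1 d), (Cmod (f (blk 0 z)) + 1). split; [pos|].
  intros z' Hz'. assert (H : Cmod (f (blk 0 z') - f (blk 0 z)) < 1).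
  { apply H2; [apply H1; apply (near_le _ _ _ (Rmin r1 d)); [apply Rmin_l|easy]|]. intros [i Hi]. unfold blk. rewrite Cmod_sub_sym. eapply Rlt_le_trans; [auto|apply Rmin_r]. }
  generalize (Cmod_le_add (f (blk 0 z')) (f (blk 0 z))). lra.
 - intros z j Hz Hj. apply cdf_of_cdiff. assert (H := Hd (blk 0 z) Hz (exist _ j Hj)).
  replace (fun t => f (blk 0 (updv z j t))) with (fun t => f (Defs.upd (blk 0 z) (exist _ j Hj) t)); [easy|].
  ext t. rewrite <- blk_upd_in. easy.
 - intros z z' Hz E. f_equal. symmetry. apply blk_eq. easy.
Qed.
End Blk.

Section Ham.
Variables (n : nat) (r s h : R) (w0 : Defs.RV n) (H : Defs.CV n -> Defs.CV n -> Defs.CV n -> Defs.Cpx) (e : Defs.CV n -> Defs.Cpx).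
Hypothesis Hr : 0 < r < 1.
Let v := Defs.ext 0 w0.

Definition DH (z : vec) : Prop := Defs.Dom r s h w0 (blk n 0 z) (blk n n z) (blk n (2 * n) z).
Lemma DH_iff z : DH z <-> (forall i, (i < n)%nat -> Cmod (z i) < r) /\ (forall i, (i < n)%nat -> Rabs (snd (z (n + i)%nat)) < s) /\ (forall i, (i < n)%nat -> Cmod (z (2 * n + i)%nat - RtoC (v i)) < h).
Proof.
  split.
 - intros (H1 & H2 & H3). split; [|split]; intros i Hi; [apply (H1 (exist _ i Hi))|apply (H2 (exist _ i Hi))|].
  assert (G := H3 (exist _ i Hi)). unfold v. rewrite (ext_lt _ _ _ _ Hi). easy.
 - intros (H1 & H2 & H3). split; [|split]; intros [i Hi]; [eauto|eauto|]. assert (G := H3 i Hi). unfold v in G. rewrite (ext_lt _ _ _ _ Hi) in G. easy.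
Qed.
Lemma opn_ext N D D' : (forall z, D z <-> D' z) -> opn N D -> opn N D'.
Proof. intros E HD z Hz. destruct (HD z (proj2 (E z) Hz)) as (rho & Hrho & G). exists rho. split; [easy|]. intros z' Hz'. apply E, G, Hz'. Qed.
Lemma opn_ball N k rr : (k < N)%nat -> opn N (fun z => Cmod (z k) < rr).
Proof.
 intros Hk. apply (opn_ext N (fun z => Cmod (z k - RtoC 0) < rr)); [|apply opn_disc; easy]. intros z. replace (z k - RtoC 0)%C with (z k) by ring. easy.
Qed.
Lemma opn_DH : opn (3 * n) DH.
Proof.
 apply (opn_ext _ (fun z => (forall i, (i < n)%nat -> Cmod (z i) < r) /\ (forall i, (i < n)%nat -> Rabs (snd (z (n + i)%nat)) < s) /\ (forall i, (i < n)%nat -> Cmod (z (2 * n + i)%nat - RtoC (v i)) < h))); [intros z; symmetry; apply DH_iff|].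
 apply opn_and; [|apply opn_and]; apply opn_all; intros i Hi; [apply opn_ball; lia|apply opn_strip; lia|apply opn_disc; lia].
Qed.

Definition HH (z : vec) : C := H (blk n 0 z) (blk n n z) (blk n (2 * n) z).
Hypothesis HHolo : Defs.holo3 (Defs.Dom r s h w0) H.
Lemma An_HH : An (3 * n) DH HH.
Proof.
 destruct HHolo as [Hc Hd]. apply An_of_sep; [apply opn_DH| | |].
 - intros z Hz. destruct (opn_DH z Hz) as (r1 & Hr1 & H1). destruct (Hc _ _ _ Hz 1 Rlt_0_1) as (d & Hd0 & H2). exists (Rmin r1 d), (Cmod (HH z) + 1). split; [pos|].
  intros z' Hz'. assert (G : Cmod (HH z' - HH z) < 1).
  { assert (Hcl : forall o, (o + n <= 3 * n)%nat -> Defs.vclose (blk n o z) (blk n o z') d).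
   { intros o Ho [i Hi]. unfold blk. simpl. rewrite Cmod_sub_sym. eapply Rlt_le_trans; [apply Hz'; lia|apply Rmin_r]. }
   apply H2; [apply H1; apply (near_le _ _ _ (Rmin r1 d)); [apply Rmin_l|easy]| | |]; apply Hcl; lia. }
  generalize (Cmod_le_add (HH z') (HH z)). lra.
 - intros z j Hz Hj. apply cdf_of_cdiff. unfold HH.
  destruct (Nat.lt_ge_cases j n) as [Hj1|Hj1]; [|destruct (Nat.lt_ge_cases j (2 * n)) as [Hj2|Hj2]].
  + replace (fun t => H (blk n 0 (updv z j t)) (blk n n (updv z j t)) (blk n (2 * n) (updv z j t))) with (fun t => H (Defs.upd (blk n 0 z) (exist _ j Hj1) t) (blk n n z) (blk n (2 * n) z)).
   * apply (Hd _ _ _ Hz (exist _ j Hj1)).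
   * ext t. rewrite <- blk_upd_in. rewrite (blk_upd_out n n), (blk_upd_out n (2 * n)) by lia. easy.
  + assert (Hj' : (j - n < n)%nat) by lia. set (j' := exist _ (j - n)%nat Hj' : Defs.Idx n). assert (Ej : j = (n + proj1_sig j')%nat) by (cmp; easy).
   replace (fun t => H (blk n 0 (updv z j t)) (blk n n (updv z j t)) (blk n (2 * n) (updv z j t))) with (fun t => H (blk n 0 z) (Defs.upd (blk n n z) j' t) (blk n (2 * n) z)).
   * rewrite Ej. apply (Hd _ _ _ Hz j').
   * ext t. rewrite (blk_upd_out n 0), (blk_upd_out n (2 * n)) by lia. rewrite <- blk_upd_in, <- Ej. easy.
  + assert (Hj' : (j - 2 * n < n)%nat) by lia. set (j' := exist _ (j - 2 * n)%nat Hj' : Defs.Idx n). assert (Ej : j = (2 * n + proj1_sig j')%nat) by (cmp; easy).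
   replace (fun t => H (blk n 0 (updv z j t)) (blk n n (updv z j t)) (blk n (2 * n) (updv z j t))) with (fun t => H (blk n 0 z) (blk n n z) (Defs.upd (blk n (2 * n) z) j' t)).
   * rewrite Ej. apply (Hd _ _ _ Hz j').
   * ext t. rewrite (blk_upd_out n 0), (blk_upd_out n n) by lia. rewrite <- blk_upd_in, <- Ej. easy.
 - intros z z' Hz E. unfold HH. rewrite (blk_eq n 0 z z'), (blk_eq n n z z'), (blk_eq n (2 * n) z z'); try easy; intros; apply E; lia.
Qed.

Definition scl (z : vec) : vec := fun k => if Nat.ltb k n then (RtoC r * z k)%C else z k.
(** Dividing both the action and the Hamiltonian by r preserves the form of the equations of motion;
    e(omega) is constant on phase space and drops out of them. The perturbation acquires the size
    eps / r. *)
Definition Pz (z : vec) : C := (RtoC (/ r) * (HH (scl z) - e (blk n (2 * n) z)) - csum n (fun i => z (2 * n + i)%nat * z i))%C.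

Lemma scl_DH z : DP n v h s z -> DH (scl z).
Proof.
 intros (H1 & H2 & H3). apply DH_iff. unfold scl. split; [|split]; intros i Hi.
 - destruct (Nat.ltb_spec i n); [|lia]. rewrite Cmod_mult, Cmod_R, Rabs_right by lra. specialize (H1 i Hi). nra.
 - cmp; auto.
 - cmp; auto.
Qed.
Lemma scl_blk o z : (n <= o)%nat -> blk n o (scl z) = blk n o z.
Proof. intros Ho. apply blk_eq. intros i Hi. unfold scl. cmp; easy. Qed.

Hypothesis Heh : Defs.holo1 (fun w => Defs.vnorm_lt (Defs.vsub w (Defs.vC w0)) h) e.
Let De (z : vec) := Defs.vnorm_lt (Defs.vsub (blk n 0 z) (Defs.vC w0)) h.
Lemma opn_De : opn n De.
Proof.
 apply (opn_ext _ (fun z => forall i, (i < n)%nat -> Cmod (z i - RtoC (v i)) < h)).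
 - intros z. split.
  + intros G [i Hi]. specialize (G i Hi). unfold v in G. rewrite (ext_lt _ _ _ _ Hi) in G. easy.
  + intros G i Hi. specialize (G (exist _ i Hi)). unfold v. rewrite (ext_lt _ _ _ _ Hi). easy.
 - apply opn_all. intros i Hi. apply opn_disc; easy.
Qed.
Let ee (z : vec) : C := e (blk n 0 z).
Let An_ee : An n De ee.
Proof. apply (holo1_An n _ e Heh opn_De). Qed.
Let De_om z : DP n v h s z -> De (fun i => z (2 * n + i)%nat).
Proof. intros (_ & _ & H3) [i Hi]. assert (G := H3 i Hi). unfold v in G. rewrite (ext_lt _ _ _ _ Hi) in G. easy. Qed.

Let An1 : An (3 * n) (DP n v h s) (fun z => HH (scl z)).
Proof.
 apply (An_comp (3 * n) (3 * n) DH (DP n v h s) HH (fun i z => scl z i)); [apply An_HH| |apply scl_DH].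
 intros i Hi. unfold scl. destruct (Nat.ltb i n); [apply An_mult; [apply An_const|apply An_coord; easy]|apply An_coord; easy].
Qed.
Let An2 : An (3 * n) (DP n v h s) (fun z => e (blk n (2 * n) z)).
Proof.
 apply (An_comp n (3 * n) De (DP n v h s) ee (fun i z => z (2 * n + i)%nat)); [easy| |easy]. intros i Hi. apply An_coord; lia.
Qed.
Let An3 : An (3 * n) (DP n v h s) (fun z => csum n (fun i => z (2 * n + i)%nat * z i)%C).
Proof. apply (An_csum (3 * n) (DP n v h s) n (fun i z => z (2 * n + i)%nat * z i)%C). intros i Hi. apply An_mult; apply An_coord; lia. Qed.

Lemma An_Pz : An (3 * n) (DP n v h s) Pz.
Proof. apply An_minus; [|easy]. apply An_mult; [apply An_const|apply An_minus; [easy|easy]]. Qed.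

(** In an action direction the factors r and 1 / r cancel, in an angular one 1 / r survives; the
    latter is compensated when the action component of the torus is multiplied by r. *)
Lemma pd_Pz z k : DP n v h s z -> (k < 2 * n)%nat ->
 pd (3 * n) k Pz z = if Nat.ltb k n then (pd (3 * n) k HH (scl z) - z (2 * n + k)%nat)%C else (RtoC (/ r) * pd (3 * n) k HH (scl z))%C.
Proof.
 intros Hz Hk. unfold Pz.
 rewrite (pd_minus (3 * n) (DP n v h s)); [|apply An_mult; [apply An_const|apply An_minus; [easy|easy]]|easy|easy|lia].
 rewrite (pd_mult (3 * n) (DP n v h s)); [|apply An_const|apply An_minus; [easy|easy]|easy|lia].
 rewrite pd_const by lia. rewrite (pd_minus (3 * n) (DP n v h s)); [|easy|easy|easy|lia].
 assert (E1 : pd (3 * n) k (fun z => HH (scl z)) z = (pd (3 * n) k HH (scl z) * (if Nat.ltb k n then RtoC r else 1))%C).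
 { assert (E := pd_comp (3 * n) (3 * n) DH (DP n v h s) HH (fun i z => scl z i) k z An_HH). etransitivity; [apply E|].
  - intros i Hi. unfold scl. destruct (Nat.ltb i n); [apply An_mult; [apply An_const|apply An_coord; easy]|apply An_coord; easy].
  - apply scl_DH.
  - easy.
  - lia.
  - rewrite (csum_ext (3 * n) _ (fun i => if Nat.eqb i k then (pd (3 * n) i HH (scl z) * (if Nat.ltb i n then RtoC r else 1))%C else 0%C)); [apply csum_delta; lia|].
   intros i Hi. change (fun i0 => scl z i0) with (scl z). unfold scl at 2. destruct (Nat.ltb i n).
   + rewrite (pd_mult (3 * n) (DP n v h s)); [|apply An_const|apply An_coord; lia|easy|lia]. rewrite pd_const, pd_coord by lia. cmp; ring.
   + rewrite pd_coord by lia. cmp; ring. }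
 assert (E2 : pd (3 * n) k (fun z => e (blk n (2 * n) z)) z = 0%C).
 { assert (E := pd_comp n (3 * n) De (DP n v h s) ee (fun i z => z (2 * n + i)%nat) k z An_ee). etransitivity; [apply E|].
  - intros i Hi. apply An_coord; lia.
  - easy.
  - easy.
  - lia.
  - apply csum_0. intros i Hi. rewrite pd_coord by lia. cmp; ring. }
 assert (E3 : pd (3 * n) k (fun z => csum n (fun i => z (2 * n + i)%nat * z i)%C) z = if Nat.ltb k n then z (2 * n + k)%nat else 0%C).
 { rewrite (pd_csum (3 * n) (DP n v h s) n (fun i z => z (2 * n + i)%nat * z i)%C); [|intros i Hi; apply An_mult; apply An_coord; lia|easy|lia].
  rewrite (csum_ext n _ (fun i => if Nat.eqb i k then z (2 * n + i)%nat else 0%C)).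
  - destruct (Nat.ltb_spec k n); [apply (csum_delta n k (fun i => z (2 * n + i)%nat)); lia|]. apply csum_0. intros i Hi. cmp; easy.
  - intros i Hi. rewrite (pd_mult (3 * n) (DP n v h s)); [|apply An_coord; lia|apply An_coord; lia|easy|lia]. rewrite !pd_coord by lia.
   cmp; ring. }
 rewrite E1, E2, E3. destruct (Nat.ltb k n); [|ring]. replace (RtoC (/ r)) with (/ RtoC r)%C by (symmetry; apply RtoC_inv; lra). field. intros E. apply RtoC_inj in E. lra.
Qed.

Lemma cdot_csum (u x : Defs.CV n) : Defs.cdot u x = csum n (fun i => Defs.ext (RtoC 0) u i * Defs.ext (RtoC 0) x i)%C.
Proof. unfold Defs.cdot. rewrite csum_n_csum. apply csum_ext. intros i Hi. rewrite !(ext_lt _ _ _ _ Hi). easy. Qed.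

Lemma Pz_bound eps : (forall I th w, Defs.Dom r s h w0 I th w -> Defs.Cmod (Defs.Csub (H I th w) (Defs.Cadd (e w) (Defs.cdot w I))) <= eps) ->
 forall z, DP n v h s z -> Cmod (Pz z) <= eps / r.
Proof.
 intros HB z Hz. assert (G := HB _ _ _ (scl_DH z Hz)). rewrite cdot_csum in G.
 replace (Pz z) with (RtoC (/ r) * (HH (scl z) - (e (blk n (2 * n) (scl z)) + csum n (fun i => Defs.ext (RtoC 0) (blk n (2 * n) (scl z)) i * Defs.ext (RtoC 0) (blk n 0 (scl z)) i))))%C.
 - rewrite Cmod_mult, Cmod_R, Rabs_right by pos. rewrite Rmult_comm. apply Rmult_le_compat_r; [pos|]. easy.
 - unfold Pz. rewrite scl_blk by lia.
  rewrite (csum_ext n (fun i => Defs.ext (RtoC 0) (blk n (2 * n) z) i * Defs.ext (RtoC 0) (blk n 0 (scl z)) i)%C (fun i => RtoC r * (z (2 * n + i)%nat * z i))%C).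
  + rewrite csum_scal. replace (RtoC (/ r)) with (/ RtoC r)%C by (symmetry; apply RtoC_inv; lra). field. intros E. apply RtoC_inj in E. lra.
  + intros i Hi. rewrite !(ext_lt _ _ _ _ Hi). unfold blk, scl. cbn [proj1_sig]. cmp; ring.
Qed.

Hypothesis Hper : forall I th w j, Defs.Dom r s h w0 I th w -> H I (Defs.vadd th (Defs.unitv j)) w = H I th w.
Hypothesis HreH : forall I th w, Defs.Dom r s h w0 I th w -> Defs.realvec I -> Defs.realvec th -> Defs.realvec w -> Defs.Im (H I th w) = 0.
Hypothesis Hree : forall w, Defs.vnorm_lt (Defs.vsub w (Defs.vC w0)) h -> Defs.realvec w -> Defs.Im (e w) = 0.

Lemma PF_Pz : PF n v h s Pz.
Proof.
 split; [apply An_Pz|]. split.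
 - intros z Hz j Hj. unfold Pz. f_equal; [|].
  + f_equal. f_equal.
   * unfold HH. set (j' := exist _ j Hj : Defs.Idx n). rewrite <- (Hper (blk n 0 (scl z)) (blk n n (scl z)) (blk n (2 * n) (scl z)) j' (scl_DH z Hz)). rewrite !(scl_blk n), !(scl_blk (2 * n)) by lia. f_equal.
    -- apply blk_eq. intros i Hi. unfold scl. unfold updv; cmp; auto.
    -- apply functional_extensionality; intros [i Hi]. unfold blk, Defs.vadd, Defs.unitv, updv. cbn [proj1_sig j']. destruct (Nat.eqb_spec (n + i) (n + j)), (Nat.eq_dec i j); try lia.
      ++ subst i. easy.
      ++ symmetry. change (z (n + i)%nat + RtoC 0 = z (n + i)%nat)%C. ring.
    -- apply blk_upd_out; lia.
   * f_equal. apply blk_upd_out; lia.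
  + apply csum_ext. intros i Hi. unfold updv; cmp; auto.
 - intros z Hz Hre.
  assert (R1 : snd (HH (scl z)) = 0).
  { apply HreH; [apply scl_DH; easy| | |]; intros [i Hi]; unfold blk, scl, Defs.Im; cbn [proj1_sig].
   - destruct (Nat.ltb_spec (0 + i) n); [|lia]. simpl. rewrite (Hre i) by lia. ring.
   - destruct (Nat.ltb_spec (n + i) n); [lia|intuition].
   - destruct (Nat.ltb_spec (2 * n + i) n); [lia|]. intuition. }
  assert (R2 : snd (e (blk n (2 * n) z)) = 0).
  { apply Hree; [apply (De_om z Hz)|]. intros [i Hi]. apply Hre. cmp; easy. }
  assert (R3 : snd (csum n (fun i => z (2 * n + i)%nat * z i)%C) = 0).
  { apply im_csum0. intros i Hi. apply im_mult0; apply Hre; lia. }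
   apply im_minus0; [|easy]. apply im_mult0; [easy|]. apply im_minus0; easy.
Qed.
End Ham.

Lemma is_grad_cont N f z L : is_grad N f z L -> forall eps, 0 < eps -> exists d, 0 < d /\ forall z', near N z z' d -> Cmod (f z' - f z) < eps.
Proof.
 intros HL eps He. destruct (is_grad_lip N f z L HL) as (rho & B & Hr & HB & Hl).
 assert (HNB : 0 <= INR N * B) by (apply Rmult_le_pos; [pos|easy]).
 set (d := Rmin rho (eps / (INR N * B + 1))). assert (Hd : 0 < d) by (apply Rmin_pos; [easy|pos]).
 exists d. split; [easy|]. intros z' Hz'. eapply Rle_lt_trans; [apply Hl; eapply near_le; [apply Rmin_l|eauto]|].
 assert (HV := vdist_near N z z' d Hd Hz').
 assert (d <= eps / (INR N * B + 1)) by apply Rmin_r. apply Rle_lt_trans with ((INR N * B) * (eps / (INR N * B + 1))).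
 - pos.
 - apply (Rmult_lt_reg_r (INR N * B + 1)); [lra|]. unfold Rdiv. rewrite <- Rmult_assoc, Rmult_assoc, Rinv_l by lra. nra.
Qed.

Lemma is_grad_ddir N f z L v : is_grad N f z L -> forall eps, 0 < eps -> exists d, 0 < d /\ forall t : R, t <> 0 -> Rabs t < d ->
 Cmod ((f (shiftv v z t) - f z) / RtoC t - csum N (fun i => L i * RtoC (v i))%C) < eps.
Proof.
 intros (rho & K & Hr & HK & HL) eps He. set (V := rsum N (fun i => Rabs (v i))). assert (HV : 0 <= V) by (apply rsum_pos; intros; apply Rabs_pos).
 assert (HKV : 0 <= K * (V * V)) by (apply Rmult_le_pos; [easy|pos]).
 exists (Rmin (rho / (V + 1)) (eps / (K * (V * V) + 1))). split; [pos|].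
 intros t Ht0 Ht. assert (Hp := Rabs_pos_lt t Ht0). assert (Ht1 : Rabs t < rho / (V + 1)) by (eapply Rlt_le_trans; [eauto|apply Rmin_l]).
 assert (Ht2 : Rabs t < eps / (K * (V * V) + 1)) by (eapply Rlt_le_trans; [apply Ht|apply Rmin_r]).
 assert (Hn : RtoC t <> RtoC 0) by (intros E; apply RtoC_inj in E; easy).
 assert (Ev : vdist N z (shiftv v z t) = Rabs t * V).
 { unfold vdist, V. rewrite <- rsum_scal. apply rsum_ext. intros i Hi. unfold shiftv. replace (z i + RtoC (t * v i) - z i)%C with (RtoC (t * v i)) by ring. rewrite Cmod_R, Rabs_mult. easy. }
 assert (Hnear : near N z (shiftv v z t) rho).
 { apply vdist_lt_near. apply (Rmult_lt_compat_r (V + 1)) in Ht1; [|lra]. unfold Rdiv in Ht1. rewrite Rmult_assoc, Rinv_l, Rmult_1_r in Ht1 by lra. nra. }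
 specialize (HL _ Hnear).
 rewrite (csum_ext N (fun i => L i * (shiftv v z t i - z i))%C (fun i => RtoC t * (L i * RtoC (v i)))%C) in HL by (intros i Hi; unfold shiftv; rewrite RtoC_mult; ring).
 rewrite csum_scal in HL. set (D := csum N (fun i => L i * RtoC (v i))%C) in *.
 replace ((f (shiftv v z t) - f z) / RtoC t - D)%C with ((f (shiftv v z t) - f z - RtoC t * D) / RtoC t)%C by (field; pos).
 rewrite Cmod_div, Cmod_R by easy. apply (Rmult_lt_reg_r (Rabs t)); [easy|]. unfold Rdiv. rewrite Rmult_assoc, Rinv_l, Rmult_1_r by lra.
 apply (Rmult_lt_compat_r (K * (V * V) + 1)) in Ht2; [|lra]. unfold Rdiv in Ht2. rewrite (Rmult_assoc eps), Rinv_l, Rmult_1_r in Ht2 by lra. nra.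
Qed.

Lemma per_nat n S c hh f j (m : nat) : KF n S c hh f -> (j < n)%nat -> forall z, Dm n S c hh z -> f (updv z j (z j + RtoC (INR m))%C) = f z /\ Dm n S c hh (updv z j (z j + RtoC (INR m))%C).
Proof.
 intros HF Hj. induction m as [|m IH]; intros z Hz.
 - simpl INR. replace (z j + RtoC 0)%C with (z j) by ring. rewrite updv_id. easy.
 - destruct (IH z Hz) as [E D]. set (z1 := updv z j (z j + RtoC (INR m))%C) in *. replace (updv z j (z j + RtoC (INR (Datatypes.S m)))%C) with (updv z1 j (z1 j + 1)%C).
  + split; [rewrite (proj1 (proj2 HF)) by easy; easy|apply Dm_per; easy].
  + unfold z1. rewrite updv_updv, updv_eq. f_equal. rewrite S_INR, RtoC_plus. ring.
Qed.
Lemma per_Z n S c hh f j (m : Z) z : KF n S c hh f -> (j < n)%nat -> Dm n S c hh z -> f (updv z j (z j + RtoC (IZR m))%C) = f z.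
Proof.
 intros HF Hj Hz. destruct (Z.abs_or_opp_abs m) as [E|E].
 - rewrite E. rewrite <- (Zabs2Nat.id_abs m), <- INR_IZR_INZ. apply (per_nat n S c hh); easy.
 - set (k := Z.abs_nat m). assert (Em : IZR m = - INR k). { rewrite E, opp_IZR, <- Zabs2Nat.id_abs, <- INR_IZR_INZ. easy. }
  set (z1 := updv z j (z j + RtoC (IZR m))%C).
  assert (Hz1 : Dm n S c hh z1).
  { destruct Hz as [H1 H2]. split; intros i Hi; unfold z1, updv.
   - destruct (Nat.eqb_spec i j) as [->|]; [|auto]. simpl. rewrite Rplus_0_r. auto.
   - cmp; auto. }
  destruct (per_nat n S c hh f j k HF Hj z1 Hz1) as [E1 _]. rewrite <- E1. unfold z1. rewrite updv_updv, updv_eq, Em.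
  replace (z j + RtoC (- INR k) + RtoC (INR k))%C with (z j); [rewrite updv_id; easy|]. rewrite RtoC_opp. ring.
Qed.
Lemma per_vec n S c hh f (k : nat -> Z) z : KF n S c hh f -> Dm n S c hh z -> f (fun i => if Nat.ltb i n then (z i + RtoC (IZR (k i)))%C else z i) = f z.
Proof.
 intros HF Hz. set (zz p := fun i => if Nat.ltb i p then (z i + RtoC (IZR (k i)))%C else z i).
 assert (G : forall p, (p <= n)%nat -> f (zz p) = f z /\ Dm n S c hh (zz p)); [|apply (G n); lia].
 assert (D : forall p, (p <= n)%nat -> Dm n S c hh (zz p)).
 { destruct Hz as [H1 H2]. split; intros i Hi; unfold zz.
  - destruct (Nat.ltb_spec i p); [simpl; rewrite Rplus_0_r|]; auto.
  - cmp; auto. }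
 induction p as [|p IH]; intros Hp; [cmp; easy|].
 split; [|auto]. destruct (IH ltac:(lia)) as [E _]. rewrite <- E. rewrite <- (per_Z n S c hh f p (k p) (zz p)) by (try easy; apply D; lia). f_equal.
 ext i. unfold zz, updv. cmp; subst; auto.
Qed.

(* Far apart points are separated by the sup bound on [VV], close ones by its Lipschitz constant. *)
Lemma id_plus_small_inj n S c hh (VV : nat -> vec -> C) T e z z' : (1 <= n)%nat -> (forall i, (i < n)%nat -> KF n S c hh (VV i)) ->
 (forall i y, (i < n)%nat -> Dm n S c hh y -> Cmod (VV i y) <= 12 * T * e) -> 0 < e -> 0 <= T -> INR n * (INR n * T) <= / 4096 ->
 Dm n (S - e) c hh z -> Dm n (S - e) c hh z' -> (forall i, (n <= i)%nat -> z i = z' i) -> (forall i, (i < n)%nat -> (z i + VV i z)%C = (z' i + VV i z')%C) ->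
 forall i, (i < n)%nat -> z i = z' i.
Proof.
 intros Hn HK HM He HT HNT Hz Hz' Ht Heq. set (N := INR n) in *. assert (HN : 1 <= N) by (apply (le_INR 1); easy).
 set (Sx := rsum n (fun i => Cmod (z' i - z i))). assert (HS0 : 0 <= Sx) by (apply rsum_pos; intros; apply Cmod_ge_0).
 assert (Hle : forall i, (i < n)%nat -> Cmod (z' i - z i) <= Sx) by (intros i Hi; apply (rsum_term_le n (fun i => Cmod (z' i - z i))); [pos|easy]).
 assert (Hdif : forall i, (i < n)%nat -> (z' i - z i)%C = (VV i z - VV i z')%C).
 { intros i Hi. assert (E := Heq i Hi). replace (z' i) with (z i + VV i z - VV i z')%C; [ring|]. rewrite E. ring. }
 assert (Hzz : z' = thadd n (fun i _ => (z' i - z i)%C) z).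
 { ext i. unfold thadd. destruct (Nat.ltb_spec i n); [ring|symmetry; apply Ht; easy]. }
 assert (HS : Sx = 0).
 { destruct (Rlt_or_le Sx (e / 2)) as [Hs|Hs].
  - assert (H1 : forall i, (i < n)%nat -> Cmod (z' i - z i) <= 36 * (N * T) * Sx).
   { intros i Hi. rewrite Hdif by easy. rewrite Cmod_sub_sym. rewrite Hzz at 1. replace (36 * (N * T) * Sx) with (3 * (12 * T * e) * N * (Sx / e)) by (field; lra).
    apply (KF_lip n S c hh (VV i) (12 * T * e) e (Sx / e) z); auto.
    - replace (Sx / e * e) with Sx by (field; lra). auto.
    - apply (Rmult_lt_reg_r e); [easy|]. unfold Rdiv. rewrite Rmult_assoc, Rinv_l by lra. lra. }
   assert (H2 : Sx <= N * (36 * (N * T) * Sx)) by (apply rsum_le_const; easy). pos.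
  - assert (H1 : Sx <= N * (24 * T * e)).
   { apply rsum_le_const. intros i Hi. rewrite Hdif by easy. via Cmod_sub_le.
    assert (h1 := HM i z Hi (Dm_le n S (S - e) c hh z ltac:(lra) Hz)). assert (h2 := HM i z' Hi (Dm_le n S (S - e) c hh z' ltac:(lra) Hz')). lra. }
   pos. }
 intros i Hi. assert (H := Hle i Hi). assert (E : Cmod (z' i - z i) = 0) by (generalize (Cmod_ge_0 (z' i - z i)%C); lra). apply Cmod_eq_0 in E.
 replace (z' i) with (z' i - z i + z i)%C by ring. rewrite E. ring.
Qed.

Section Emb.
Variables (n : nat) (wt : nat -> R).
(** Angles completed by the limit frequency [wt]: the passage from vectors of the statement to
    points of [Dm]. *)
Definition emb (th : Defs.CV n) : vec := fun i => if Nat.ltb i n then Defs.ext (RtoC 0) th i else RtoC (wt (i - n)%nat).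
Lemma emb_lt th (i : Defs.Idx n) : emb th (proj1_sig i) = th i.
Proof. unfold emb. destruct i as [i Hi]. simpl. destruct (Nat.ltb_spec i n); [apply ext_lt|lia]. Qed.
Lemma emb_lt' th i (Hi : (i < n)%nat) : emb th i = th (exist _ i Hi).
Proof. apply (emb_lt th (exist _ i Hi)). Qed.
Lemma emb_ge th i : (n <= i)%nat -> emb th i = RtoC (wt (i - n)%nat).
Proof. intros H. unfold emb. cmp; easy. Qed.
Lemma emb_ext th z : (forall i : Defs.Idx n, z (proj1_sig i) = th i) -> (forall i, (n <= i)%nat -> z i = RtoC (wt (i - n)%nat)) -> emb th = z.
Proof.
 intros H1 H2. ext i. destruct (Nat.lt_ge_cases i n) as [Hi|Hi].
 - rewrite (emb_lt' th i Hi), <- H1. easy.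
 - rewrite emb_ge, H2; easy.
Qed.
Lemma emb_upd th (j : Defs.Idx n) t : emb (Defs.upd th j t) = updv (emb th) (proj1_sig j) t.
Proof.
 apply emb_ext.
 - intros i. unfold updv, Defs.upd. destruct (Nat.eqb_spec (proj1_sig i) (proj1_sig j)), (Nat.eq_dec (proj1_sig i) (proj1_sig j)); try lia; [easy|apply emb_lt].
 - intros i Hi. rewrite updv_neq by (destruct j; simpl; lia). apply emb_ge; easy.
Qed.
Lemma emb_unit th (j : Defs.Idx n) : emb (Defs.vadd th (Defs.unitv j)) = updv (emb th) (proj1_sig j) (emb th (proj1_sig j) + 1)%C.
Proof.
 apply emb_ext.
 - intros i. unfold updv, Defs.vadd, Defs.unitv. destruct (Nat.eqb_spec (proj1_sig i) (proj1_sig j)) as [E|], (Nat.eq_dec (proj1_sig i) (proj1_sig j)); try lia.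
  + rewrite <- E, emb_lt. easy.
  + rewrite emb_lt. symmetry. apply Cplus_0_r.
 - intros i Hi. rewrite updv_neq by (destruct j; simpl; lia). apply emb_ge; easy.
Qed.
Lemma emb_shift th (w : Defs.RV n) t : emb (Defs.vadd th (Defs.vscal (Defs.RtoC t) (Defs.vC w))) = shiftv (Defs.ext 0 w) (emb th) t.
Proof.
 apply emb_ext.
 - intros i. unfold shiftv, Defs.vadd, Defs.vscal, Defs.vC. rewrite emb_lt, ext_idx, RtoC_mult. easy.
 - intros i Hi. unfold shiftv. rewrite ext_ge, Rmult_0_r, emb_ge by easy. ring.
Qed.
Lemma emb_Dm S hh th : 0 < hh -> Defs.strip S th -> Dm n S wt hh (emb th).
Proof.
 intros Hh H. split; intros i Hi; [rewrite (emb_lt' th i Hi); apply (H (exist _ i Hi))|]. rewrite emb_ge by lia. replace (n + i - n)%nat with i by lia.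
 replace (RtoC (wt i) - RtoC (wt i))%C with (RtoC 0) by ring. rewrite Cmod_0; easy.
Qed.
Lemma emb_real th : Defs.realvec th -> realv n (emb th).
Proof.
 intros H i Hi. destruct (Nat.lt_ge_cases i n) as [Hi'|Hi']; [rewrite (emb_lt' th i Hi'); apply H|rewrite emb_ge by easy; easy].
Qed.
Lemma emb_frz th : frz n wt (emb th) = emb th.
Proof. ext i. unfold frz, emb. cmp; easy. Qed.
Lemma real_strip S (th : Defs.CV n) : 0 < S -> Defs.realvec th -> Defs.strip S th.
Proof. intros HS H i. rewrite H, Rabs_R0. easy. Qed.

Lemma emb_holo S hh f : 0 < hh -> An (2 * n) (Dm n S wt hh) f -> Defs.holo1 (Defs.strip S) (fun th => f (emb th)).
Proof.
 intros Hh Hf. split.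
 - intros th Hth eps He. destruct (Hf (emb th) (emb_Dm S hh th Hh Hth)) as [L HL]. destruct (is_grad_cont _ _ _ _ HL eps He) as (d & Hd & G).
  exists d. split; [easy|]. intros th' _ Hc. apply (G (emb th')). intros i Hi. destruct (Nat.lt_ge_cases i n) as [Hi'|Hi'].
  + rewrite !(emb_lt' _ i Hi'), Cmod_sub_sym. easy.
  + rewrite !emb_ge by easy. replace (RtoC (wt (i - n)%nat) - RtoC (wt (i - n)%nat))%C with (RtoC 0) by ring. rewrite Cmod_0; easy.
 - intros th Hth j. assert (G := is_grad_cd (2 * n) f (emb th) _ (proj1_sig j) (An_grad _ _ _ _ Hf (emb_Dm S hh th Hh Hth)) ltac:(destruct j; simpl; lia)).
  apply cdiff_of_cd in G. rewrite emb_lt in G. replace (fun t => f (emb (Defs.upd th j t))) with (fun t => f (updv (emb th) (proj1_sig j) t)); [easy|].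
  ext t. rewrite emb_upd. easy.
Qed.

Lemma emb_ddir S hh f th (w : Defs.RV n) : 0 < hh -> An (2 * n) (Dm n S wt hh) f -> Defs.strip S th ->
 Defs.has_ddir (fun th => f (emb th)) th (Defs.vC w) (csum n (fun i => pd (2 * n) i f (emb th) * RtoC (Defs.ext 0 w i))%C).
Proof.
 intros Hh Hf Hth eps He. destruct (is_grad_ddir (2 * n) f (emb th) _ (Defs.ext 0 w) (An_grad _ _ _ _ Hf (emb_Dm S hh th Hh Hth)) eps He) as (d & Hd & G).
 exists d. split; [easy|]. intros t Ht0 Ht. rewrite emb_shift. specialize (G t Ht0 Ht).
 rewrite (csum_2n n) in G; [easy|]. intros i Hi. rewrite ext_ge by lia. ring.
Qed.
End Emb.

Lemma HH_ddir n r s h w0 H Z (i : Defs.Idx n) : Defs.holo3 (Defs.Dom r s h w0) H -> DH n r s h w0 Z ->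
 Defs.has_ddir (fun th => H (blk n 0 Z) th (blk n (2 * n) Z)) (blk n n Z) (Defs.unitv i) (pd (3 * n) (n + proj1_sig i) (HH n H) Z) /\
 Defs.has_ddir (fun I => H I (blk n n Z) (blk n (2 * n) Z)) (blk n 0 Z) (Defs.unitv i) (pd (3 * n) (proj1_sig i) (HH n H) Z).
Proof.
 intros HHolo HZ. assert (Hi : (proj1_sig i < n)%nat) by (destruct i; easy). assert (G := An_grad _ _ _ _ (An_HH n r s h w0 H HHolo) HZ).
 assert (Hsh : forall o (t : R), blk n o (updv Z (o + proj1_sig i) (Z (o + proj1_sig i)%nat + RtoC t)%C) = Defs.vadd (blk n o Z) (Defs.vscal (Defs.RtoC t) (Defs.unitv i))).
 { intros o t. ext j. unfold blk, updv, Defs.vadd, Defs.vscal, Defs.unitv.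
  destruct (Nat.eqb_spec (o + proj1_sig j) (o + proj1_sig i)) as [E|], (Nat.eq_dec (proj1_sig j) (proj1_sig i)); try lia.
  - rewrite E. change (Z (o + proj1_sig i)%nat + RtoC t = Z (o + proj1_sig i)%nat + RtoC t * RtoC 1)%C. ring.
  - change (Z (o + proj1_sig j)%nat = Z (o + proj1_sig j)%nat + RtoC t * RtoC 0)%C. ring. }
 split; intros eps He.
 - destruct (cd_quot _ _ _ (is_grad_cd (3 * n) _ Z _ (n + proj1_sig i) G ltac:(lia)) eps He) as (d & Hd & K). exists d. split; [easy|]. intros t Ht0 Ht.
  specialize (K (RtoC t)). rewrite Cmod_R in K. specialize (K (conj (Rabs_pos_lt t Ht0) Ht)). rewrite updv_id in K. unfold HH in K at 1.
  rewrite Hsh, (blk_upd_out n 0), (blk_upd_out n (2 * n)) in K by lia. easy.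
 - destruct (cd_quot _ _ _ (is_grad_cd (3 * n) _ Z _ (proj1_sig i) G ltac:(lia)) eps He) as (d & Hd & K). exists d. split; [easy|]. intros t Ht0 Ht.
  specialize (K (RtoC t)). rewrite Cmod_R in K. specialize (K (conj (Rabs_pos_lt t Ht0) Ht)). rewrite updv_id in K. unfold HH in K at 1.
  assert (E := Hsh O t). rewrite Nat.add_0_l in E. rewrite E, (blk_upd_out n n), (blk_upd_out n (2 * n)) in K by lia. easy.
Qed.

Lemma ln2_le1 : 0 < ln 2 <= 1.
Proof.
 split; [generalize ln_lt_2; lra|]. rewrite <- (ln_exp 1). apply ln_le; [lra|]. generalize (exp_ineq1 1). lra.
Qed.

(** The two conditions on eps and h give h Delta(Q_0) <= 1 / (4096 N^3). Multiplied by mu / h, this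
    converts bounds proportional to mu Delta(Q_0) into bounds proportional to mu / h = eps / (r h),
    which is the last conclusion. *)
Lemma kam_constants (N h mu D0 : R) : 1 <= N -> 0 < h -> 0 <= mu -> 0 < D0 -> mu <= / (384 * N) * h -> / (384 * N) * h <= / (384 * N) * / (4096 * (N * N * N)) * / D0 ->
 N * N * N * (mu * D0) <= / 4096 /\ N * (h * D0) <= / 4096 /\ 384 * N * mu <= h /\ 4096 * (N * (mu * D0)) <= mu / h.
Proof.
 intros HN Hh Hm HD H1 H2. assert (HN3 : N <= N * N * N) by nra.
 assert (Hc : 0 < / (384 * N)) by pos.
 assert (H3 : h * D0 <= / (4096 * (N * N * N))).
 { rewrite Rmult_assoc in H2. apply Rmult_le_reg_l in H2; [|easy]. apply (Rmult_le_compat_r D0) in H2; [|lra]. rewrite Rmult_assoc, Rinv_l in H2 by lra. lra. }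
 assert (H4 : N * N * N * (h * D0) <= / 4096).
 { apply (Rmult_le_compat_l (N * N * N)) in H3; [|lra]. replace (N * N * N * / (4096 * (N * N * N))) with (/ 4096) in H3 by (field; lra). easy. }
 assert (H5 : N * (h * D0) <= / 4096) by pos.
 assert (H6 : 384 * N * mu <= h). { apply (Rmult_le_compat_l (384 * N)) in H1; [|lra]. rewrite <- Rmult_assoc, Rinv_r, Rmult_1_l in H1 by lra. easy. }
 split; [|split; [easy|split; [easy|]]].
 - pos.
 - apply (Rmult_le_reg_r h); [easy|]. unfold Rdiv. rewrite (Rmult_assoc mu), Rinv_l, Rmult_1_r by lra. pos.
Qed.

Import Defs.

Theorem theorem2 : forall n : nat, (2 <= n)%nat ->
  exists c1 c2 c3 c4 c5 : R,
    0 < c1 <= 1 /\ 0 < c2 <= 1 /\ 0 < c3 <= 1 /\ 1 <= c4 /\ 1 <= c5 /\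
    forall (w0 : RV n) (r s h eps : R)
           (H : CV n -> CV n -> CV n -> Cpx) (e : CV n -> Cpx) (Q0 : R),
      (* omega_0 = (1, bar omega_0), bar omega_0 in [-1,1]^(n-1), non-resonant *)
      (forall i : Idx n, proj1_sig i = 0%nat -> w0 i = 1) ->
      (forall i : Idx n, proj1_sig i <> 0%nat -> -1 <= w0 i <= 1) ->
      nonresonant w0 ->
      (exists L, improper_int (fun x => / (x * DeltaStar w0 x)) (DeltaQ w0 1) L) ->
      0 < r < 1 -> 0 < s < 1 -> 0 < h < 1 -> 0 <= eps ->
      (* H bounded and real-analytic on D_{r,s} x O_h, 1-periodic in theta *)
      holo3 (Dom r s h w0) H ->
      (forall I th w, Dom r s h w0 I th w -> realvec I -> realvec th -> realvec w ->
         Im (H I th w) = 0) ->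
      (exists M, forall I th w, Dom r s h w0 I th w -> Cmod (H I th w) <= M) ->
      (forall I th w j, Dom r s h w0 I th w -> H I (vadd th (unitv j)) w = H I th w) ->
      (* H = N + P, N = e(omega) + omega.I, |P|_{r,s,h} <= eps, e real-analytic *)
      holo1 (fun w => vnorm_lt (vsub w (vC w0)) h) e ->
      (forall w, vnorm_lt (vsub w (vC w0)) h -> realvec w -> Im (e w) = 0) ->
      (forall I th w, Dom r s h w0 I th w ->
         Cmod (Csub (H I th w) (Cadd (e w) (cdot w I))) <= eps) ->
      (* Q0 *)
      1 <= Q0 ->
      (exists L0, improper_int (fun x => / (x * DeltaStar w0 x)) (DeltaQ w0 Q0) L0 /\
                  / Q0 + / ln 2 * L0 <= c3 * s) ->
      eps / r <= c1 * h -> c1 * h <= c2 * / (Q0 * PsiQ w0 Q0) ->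
      (* Phi_{omega_0}(theta) = (U theta, theta + V theta), lifted; omega tilde = wt *)
      exists (U V : CV n -> CV n) (wt : RV n),
        (* real-analytic extension to T^n_{s/2} *)
        (forall i, holo1 (strip (s / 2)) (fun th => U th i)) /\
        (forall i, holo1 (strip (s / 2)) (fun th => V th i)) /\
        (forall th j, strip (s / 2) th ->
           U (vadd th (unitv j)) = U th /\ V (vadd th (unitv j)) = V th) /\
        (forall th, realvec th -> realvec (U th) /\ realvec (V th)) /\
        (* maps T^n into B x T^n *)
        (forall th, realvec th -> vnorm_lt (U th) r) /\
        (* embedding: injective on T^n ... *)
        (forall th th', realvec th -> realvec th' -> U th = U th' ->
           (exists k : Idx n -> Z, forall i,
               Re (th i) + Re (V th i) - (Re (th' i) + Re (V th' i)) = IZR (k i)) ->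
           exists k : Idx n -> Z, forall i, Re (th i) - Re (th' i) = IZR (k i)) /\
        (* ... and an immersion *)
        (forall th (v : RV n), realvec th -> (exists i, v i <> 0) ->
           exists i L,
             (has_ddir (fun z => U z i) th (vC v) L /\ L <> RtoC 0) \/
             (has_ddir (fun z => V z i) th (vC v) L /\ Cadd L (RtoC (v i)) <> RtoC 0)) /\
        (* omega tilde in O_h *)
        (forall i, Rabs (wt i - w0 i) < h) /\
        (* X_{H_wt} o Phi = DPhi . omega_0 on T^n *)
        (forall th, realvec th -> forall i, exists a b,
           has_ddir (fun z => U z i) th (vC w0) a /\
           has_ddir (fun th' => H (U th) th' (vC wt)) (vadd th (V th)) (unitv i) (Copp a) /\
           has_ddir (fun z => V z i) th (vC w0) b /\
           has_ddir (fun I' => H I' (vadd th (V th)) (vC wt)) (U th) (unitv i)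
                    (Cadd (RtoC (w0 i)) b)) /\
        (* estimates *)
        (forall th, strip (s / 2) th -> forall i,
           Cmod (U th i) / r <= c4 * eps / (r * h) /\
           Cmod (V th i) / Q0 <= c4 * eps / (r * h)) /\
        (forall i, Rabs (wt i - w0 i) <= c5 * eps / r).
Proof.
 intros n Hn. set (N := INR n). set (Ce := Cerg n (/ 1024)).
 assert (HN : 1 <= N) by (apply (le_INR 1); lia). assert (HC : 4 <= Ce) by apply Cerg_pos.
 assert (HN3 : 1 <= N * N * N) by pos.
 assert (Hi1 : 0 < / (384 * N) <= 1) by (split; [pos|rewrite <- Rinv_1; apply Rinv_le_contravar; lra]).
 assert (Hi2 : 0 < / (4096 * (N * N * N)) <= 1) by (split; [pos|rewrite <- Rinv_1; apply Rinv_le_contravar; lra]).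
 assert (Hi3 : 0 < / (48 * Ce) <= 1) by (split; [pos|rewrite <- Rinv_1; apply Rinv_le_contravar; lra]).
 (* The first constant makes [384 * N * mu <= h], the second [4096 * (N * N * N) * (h * D0) <= 1],
    and the third keeps the total loss of strip below s / 4. The fourth can be 1 because the bounds
    7 T and 12 T meet a T of at most (mu / h) / 4096; the 5 is the bound on the total motion of the
    centres. *)
 exists (/ (384 * N)), (/ (384 * N) * / (4096 * (N * N * N))), (/ (48 * Ce)), 1, 5.
 split; [easy|]. split; [split; pos|]. split; [easy|]. split; [lra|]. split; [lra|].
 intros w0 r s h eps H e Q0 Hw1 _ Hnr _ Hr Hs Hh Heps HHolo HreH _ Hper Heh Hree HB HQ0 (L0 & HL0 & HQs) Hc1 Hc2.
 assert (Hn1 : (1 <= n)%nat) by lia.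
 destruct (q_seq n w0 Hn1 Hw1 Hnr Q0 L0 HQ0 HL0) as (Qs & Ps & Hdio & HDj & HQp & HL0p & HSum).
 set (D0 := DeltaQ w0 Q0) in *. assert (HD0 : 1 <= D0) by (eapply Rle_trans; [apply HQ0|apply DeltaQ_ge; easy]).
 set (mu := eps / r) in *. assert (Hmu : 0 <= mu) by (apply Rmult_le_pos; [easy|pos]).
 destruct (kam_constants N h mu D0 HN ltac:(lra) Hmu ltac:(lra) Hc1 Hc2) as (Ht & Hq & Hmuh & HT).
 (* As ln 2 <= 1, the sum of the 1 / Q_j is at most four times the left-hand side of the condition
    on [Q0], hence at most s / (12 Ce); each step loses 3 Ce / Q_j. *)
 assert (Hsum : forall J, 3 * rsum J (fun j => Ce / Qs j) <= s / 4).
 { intros J. unfold Rdiv. rewrite rsum_scal. specialize (HSum J). destruct ln2_le1 as [l1 l2].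
  assert (1 <= / ln 2) by (rewrite <- Rinv_1; apply Rinv_le_contravar; lra). assert (0 < / Q0) by pos.
  assert (h1 : rsum J (fun j => / Qs j) <= 4 * (/ (48 * Ce) * s)) by nra. apply (Rmult_le_compat_l Ce) in h1; [|lra].
  replace (Ce * (4 * (/ (48 * Ce) * s))) with (s / 12) in h1 by (field; lra). lra. }
 assert (Hdl0 : forall j, 0 < Ce / Qs j) by pos.
 assert (Hdl : forall j, Ce / Qs j <= s / 4).
 { intros j. assert (h1 := Hsum (S j)). simpl rsum in h1. assert (0 <= rsum j (fun j => Ce / Qs j)) by (apply rsum_pos; intros; left; auto). lra. }
 set (v := ext 0 w0). assert (Hv0 : forall i, (n <= i)%nat -> v i = 0) by (intros; apply ext_ge; easy).
 assert (HPF := PF_Pz n r s h w0 H e Hr HHolo Heh Hper HreH Hree).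
 assert (HPb := Pz_bound n r s h w0 H e Hr eps HB).
 (* The iteration starts on the strip 3 s / 4, so that a displacement V of size up to s / 4 stays in
    the domain of [H], and ends on s / 2. The remaining quarter allows one more Cauchy estimate
    around real angles. *)
 destruct (kam_limit n v h s mu (Pz n r H e) Hn1 Hv0 Hmu ltac:(lra) HPF HPb D0 (s / 4) ltac:(lra) ltac:(lra) Ht Hq Hmuh Qs Ps (3 * s / 4) (s / 2) Hdio HDj Hdl ltac:(lra)) as (UU & VV & wt & HK & Hfz & Hbd & Hwv & HDP & Heq).
 { intros J. generalize (Hsum J). fold Ce. lra. } { lra. }
 fold N in Hbd. set (T := N * (mu * D0)) in *.
 assert (HT0 : 0 <= T) by (unfold T; apply Rmult_le_pos; [lra|pos]).
 assert (HNT : N * T <= / 4096). { assert (E : N * N * N * (mu * D0) = N * (N * T)) by (unfold T; ring). pos. }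
 assert (HT1 : T <= / 4096) by nra.
 assert (Hh2 : 0 < h / 2) by lra. assert (Hs2 : 0 < s / 2) by lra.
 assert (HmuN : 5 * mu < h). { pos. }
 set (em := emb n wt). set (U := fun (th : CV n) (i : Idx n) => Cmul (RtoC r) (UU (proj1_sig i) (em th))). set (V := fun (th : CV n) (i : Idx n) => VV (proj1_sig i) (em th)).
 assert (Hlt : forall i : Idx n, (proj1_sig i < n)%nat) by (intros [i Hi]; easy).
 assert (HDm : forall th, strip (s / 2) th -> Dm n (s / 2) wt (h / 2) (em th)) by (intros; apply emb_Dm; easy).
 assert (HDr : forall S th, 0 < S -> realvec th -> Dm n S wt (h / 2) (em th)) by (intros; apply emb_Dm; [easy|apply real_strip; easy]).
 assert (AU : forall i : Idx n, An (2 * n) (Dm n (s / 2) wt (h / 2)) (fun z => Cmul (RtoC r) (UU (proj1_sig i) z))).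
 { intros i. apply An_mult; [apply An_const|apply (HK _ (Hlt i))]. }
 assert (AV : forall i : Idx n, An (2 * n) (Dm n (s / 2) wt (h / 2)) (VV (proj1_sig i))) by (intros i; apply (HK _ (Hlt i))).
 assert (HpV : forall th k l, realvec th -> (k < n)%nat -> (l < n)%nat -> Complex.Cmod (pd (2 * n) l (VV k) (em th)) <= 12 * T).
 { intros th k l Hre Hk Hl. replace (12 * T) with (12 * T * (s / 4) / (s / 4)) by (field; lra). apply (KF_cauchy n (s / 2) wt (h / 2)); [apply HK; easy|intros; apply Hbd; easy|lra|easy|apply HDr; [lra|easy]]. }
 exists U, V, (fun i => wt (proj1_sig i)).
 split; [|split; [|split; [|split; [|split; [|split; [|split; [|split; [|split; [|split]]]]]]]]].
 - intros i. apply (emb_holo n wt (s / 2) (h / 2) (fun z => Cmul (RtoC r) (UU (proj1_sig i) z)) Hh2 (AU i)).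
 - intros i. apply (emb_holo n wt (s / 2) (h / 2) (VV (proj1_sig i)) Hh2 (AV i)).
 - unfold U, V. split; ext i; unfold em; rewrite emb_unit.
  + f_equal. apply (HK _ (Hlt i)); [auto|easy].
  + apply (HK _ (Hlt i)); [auto|easy].
 - intros th Hre. assert (Hr' := emb_real n wt th Hre). split; intros i; unfold U, V, Im.
  + apply im_mult0; [easy|]. apply (HK _ (Hlt i)); [auto|easy].
  + apply (HK _ (Hlt i)); [auto|easy].
 - intros th Hre i. assert (h1 := proj1 (Hbd _ (em th) (Hlt i) (HDr _ th Hs2 Hre))). unfold U.
   rewrite Cmod_mult, Cmod_R, Rabs_right by lra. nra.
 - intros th th' Hre Hre' _ (k & Hk). exists k. intros i.
  (* Translating [th'] by [k] makes the lifted angular images equal, V being periodic, and theta + V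
     is injective on a strip by [id_plus_small_inj]. *)
  set (kk := ext 0%Z k). set (z := em th). set (z1 := em th'). set (z' := fun i => if Nat.ltb i n then (z1 i + Complex.RtoC (IZR (kk i)))%C else z1 i).
  assert (Hz' : forall S, 0 < S -> Dm n S wt (h / 2) z').
  { intros S HS. destruct (HDr S th' HS Hre') as [D1 D2]. split; intros l Hl; unfold z'.
   - destruct (Nat.ltb_spec l n); [|lia]. simpl. rewrite Rplus_0_r. auto.
   - cmp; auto. }
  assert (HV' : forall l, (l < n)%nat -> VV l z' = VV l z1) by (intros l Hl; apply (per_vec n (s / 2) wt (h / 2) (VV l) kk z1); [apply HK; easy|eauto]).
  assert (E : z (proj1_sig i) = z' (proj1_sig i)).
  { apply (id_plus_small_inj n (s / 2) wt (h / 2) VV T (s / 4) z z'); auto; try lra.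
   - apply HK; easy.
   - apply Hbd; easy.
   - apply (Rle_trans _ (N * N * N * (mu * D0))); [|easy]. right. unfold T. fold N. ring.
   - apply HDr; [lra|easy].
   - apply Hz'. lra.
   - intros l Hl. unfold z', z, z1, em. destruct (Nat.ltb_spec l n); [lia|]. rewrite !emb_ge by easy. easy.
   - intros l Hl. rewrite HV' by easy. specialize (Hk (exist _ l Hl)). unfold V in Hk. cbn [proj1_sig] in Hk. unfold z' at 1. destruct (Nat.ltb_spec l n); [|lia].
    unfold z, z1, em in *. rewrite !(emb_lt' n wt _ l Hl). unfold kk. rewrite (ext_lt _ _ _ _ Hl).
    assert (r1 : snd (th (exist _ l Hl)) = 0) by apply Hre. assert (r2 : snd (th' (exist _ l Hl)) = 0) by apply Hre'.
    assert (r3 : snd (VV l (emb n wt th)) = 0) by (apply (HK l Hl); [auto|apply emb_real; easy]).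
    assert (r4 : snd (VV l (emb n wt th')) = 0) by (apply (HK l Hl); [auto|apply emb_real; easy]).
    apply injective_projections; unfold Complex.Cplus, Complex.RtoC; cbn [fst snd]; [unfold Re in Hk; lra|lra]. }
  unfold z', z, z1, em in E. destruct (Nat.ltb_spec (proj1_sig i) n) as [_|Hc]; [|generalize (Hlt i); lia]. rewrite !emb_lt in E. unfold kk in E. rewrite ext_idx in E. rewrite E. unfold Re, Complex.Cplus, Complex.RtoC. cmp; ring.
 (* If the angular derivatives in the direction [x] all vanished, (Id + DV) x would be zero with DV
    small, and [x] itself would be zero. *)
 - intros th x Hre (i0 & Hi0). apply NNPP. intros Hno.
  assert (Hy : forall k, (k < n)%nat -> Complex.RtoC (ext 0 x k) = Complex.RtoC 0).
  { apply (near_id_inj n (fun l k => pd (2 * n) l (VV k) (em th)) (fun l => Complex.RtoC (ext 0 x l)) (12 * T)).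
   - auto.
   - fold N. lra.
   - intros k Hk. apply NNPP. intros Hne. apply Hno. exists (exist _ k Hk : Idx n). eexists. right. split.
    + apply (emb_ddir n wt (s / 2) (h / 2) (VV k) th x Hh2); [apply (HK k Hk)|apply real_strip; easy].
    + intros E. apply Hne.
     rewrite (csum_ext n _ (fun l => kd k l * Complex.RtoC (ext 0 x l) + pd (2 * n) l (VV k) (em th) * Complex.RtoC (ext 0 x l))%C) by (intros l _; rewrite (kd_sym k); ring).
     rewrite csum_plus, (csum_kd_l n k (fun l => Complex.RtoC (ext 0 x l))) by easy. rewrite (ext_lt _ _ _ _ Hk), Cplus_comm. easy. }
   specialize (Hy _ (Hlt i0)). rewrite ext_idx in Hy. apply RtoC_inj in Hy. easy.
 - intros i. assert (h1 := Hwv _ (Hlt i)). unfold v in h1. rewrite ext_idx in h1. lra.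
 (* The equations of the normalized torus are translated back: the action equation is multiplied by
    r, whereas in the angular one omega cancels against the term subtracted in [Pz]. *)
 - intros th Hre i. assert (Hz := HDr (s / 2) th Hs2 Hre). assert (Hze := HDr (s / 2 - s / 4) th ltac:(lra) Hre).
  set (Y := Th n UU VV (em th)). set (Z := scl n r Y).
  assert (HY : DP n v h s Y) by eauto. assert (HZ : DH n r s h w0 Z) by (apply scl_DH; easy).
  assert (B0 : blk n 0 Z = U th).
  { ext j. unfold blk, Z, scl. rewrite Nat.add_0_l. assert (Hj := Hlt j). destruct (Nat.ltb_spec (proj1_sig j) n); [|lia]. unfold Y. rewrite Th_I by easy. easy. }
  assert (B1 : blk n n Z = vadd th (V th)).
  { unfold Z. rewrite (scl_blk n r n) by lia. ext j. unfold blk, Y. rewrite Th_th by apply Hlt. unfold em. rewrite emb_lt. easy. }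
  assert (B2 : blk n (2 * n) Z = vC (fun i : Idx n => wt (proj1_sig i))).
  { unfold Z. rewrite (scl_blk n r (2 * n)) by lia. ext j. unfold blk, Y. rewrite Th_om. unfold em. rewrite emb_ge by lia. unfold vC, RtoC, Complex.RtoC. do 2 f_equal. lia. }
  destruct (HH_ddir n r s h w0 H Z i HHolo HZ) as [K1 K2]. rewrite B0, B1, B2 in K1, K2.
  destruct (Heq (em th) (proj1_sig i) Hze (emb_frz n wt th) (Hlt i)) as [Q1 Q2]. fold Y in Q1, Q2.
  assert (P1 := pd_Pz n r s h w0 H e Hr HHolo Heh Y (n + proj1_sig i) HY ltac:(generalize (Hlt i); lia)). assert (P2 := pd_Pz n r s h w0 H e Hr HHolo Heh Y (proj1_sig i) HY ltac:(generalize (Hlt i); lia)).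
  destruct (Nat.ltb_spec (n + proj1_sig i) n); [lia|]. destruct (Nat.ltb_spec (proj1_sig i) n) as [_|Hc]; [|generalize (Hlt i); lia]. fold Z in P1, P2.
  assert (EY : Y (2 * n + proj1_sig i)%nat = Complex.RtoC (wt (proj1_sig i))). { unfold Y. rewrite Th_om. unfold em. rewrite emb_ge by lia. intuition. }
  assert (Hst : strip (s / 2) th) by (apply real_strip; easy).
  eexists. eexists. split; [apply (emb_ddir n wt (s / 2) (h / 2) (fun z => Cmul (RtoC r) (UU (proj1_sig i) z)) th w0 Hh2 (AU i) Hst)|].
  split; [|split; [apply (emb_ddir n wt (s / 2) (h / 2) (VV (proj1_sig i)) th w0 Hh2 (AV i) Hst)|]]; fold em v.
  + replace (Copp _) with (pd (3 * n) (n + proj1_sig i) (HH n H) Z); [easy|]. symmetry.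
   rewrite (csum_ext n _ (fun j => Complex.RtoC r * (pd (2 * n) j (UU (proj1_sig i)) (em th) * Complex.RtoC (v j)))%C).
   * rewrite csum_scal. change (- (Complex.RtoC r * csum n (fun j => pd (2 * n) j (UU (proj1_sig i)) (em th) * Complex.RtoC (v j))) = pd (3 * n) (n + proj1_sig i) (HH n H) Z)%C. rewrite Q1, P1, RtoC_inv by lra.
    field. intros E. apply RtoC_inj in E. lra.
   * intros j Hj. change (Cmul (RtoC r)) with (Complex.Cmult (Complex.RtoC r)). rewrite (pd_mult (2 * n) (Dm n (s / 2) wt (h / 2))); [|apply An_const|apply (HK _ (Hlt i))|easy|lia]. rewrite pd_const by lia. ring.
  + replace (Cadd _ _) with (pd (3 * n) (proj1_sig i) (HH n H) Z); [easy|]. symmetry.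
   change (Complex.RtoC (w0 i) + csum n (fun j => pd (2 * n) j (VV (proj1_sig i)) (em th) * Complex.RtoC (v j)) = pd (3 * n) (proj1_sig i) (HH n H) Z)%C.
   assert (Ev : v (proj1_sig i) = w0 i) by apply ext_idx. rewrite Ev in Q2. rewrite Q2, P2, EY. ring.
 - intros th Hth i. destruct (Hbd _ (em th) (Hlt i) (HDm th Hth)) as [b1 b2].
  assert (Em : 1 * eps / (r * h) = mu / h) by (unfold mu; field; lra). rewrite Em.
  split.
  + unfold U. rewrite Cmod_mult, Cmod_R, Rabs_right by lra.
   replace (r * Complex.Cmod (UU (proj1_sig i) (em th)) / r) with (Complex.Cmod (UU (proj1_sig i) (em th))) by (field; lra). lra.
  + change (Complex.Cmod (VV (proj1_sig i) (em th)) / Q0 <= mu / h). apply (Rmult_le_reg_r Q0); [lra|]. unfold Rdiv at 1. rewrite Rmult_assoc, Rinv_l, Rmult_1_r by lra.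
   pos.
 - intros i. assert (h1 := Hwv _ (Hlt i)). unfold v in h1. rewrite ext_idx in h1. unfold mu in h1. lra.
Qed.
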